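(* Let $N\in[1,\infty)$, let $(X,d,m)$ be an infinitesimally Hilbertian $CD(0,N)$ space, $\bar\gamma:\mathbb R\to\operatorname{supp}(m)$ a line, $b:=b^+$ the corresponding Busemann function and $\bar F:\operatorname{supp}(m)\times\mathbb R\to\operatorname{supp}(m)$ the continuous gradient flow of $b$. Let $X':=\operatorname{supp}(m)/\!\sim$, where $x\sim y$ if $x=\bar F_t(y)$ for some $t\in\mathbb R$, let $\pi:\operatorname{supp}(m)\to X'$ be the projection, and $$d'(\pi(x),\pi(y)):=\inf_{t\in\mathbb R}d(x,\bar F_t(y)),\qquad x,y\in\operatorname{supp}(m).$$ Let $\iota:X'\to X$ be defined by $\iota(x')=x$ provided $\pi(x)=x'$ and $b(x)=0$. Then $\iota$ is an isometric embedding of $(X',d')$ into $(X,d)$.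
   Context: A metric measure space $(X,d,m)$ is a complete separable metric space with a non-negative Radon measure. $e_t(\gamma):=\gamma_t$. For absolutely continuous curves $|\dot\gamma_t|:=\lim_{h\to0}d(\gamma_{t+h},\gamma_t)/|h|$; $\int|\dot\gamma_t|^2dt:=+\infty$ on intervals where $\gamma$ is not absolutely continuous. Optimal transport and $CD(0,N)$: $\mathscr P_2(X)$ denotes Borel probability measures with finite second moment, $W_2$ the quadratic transportation distance; $\mathrm{OptGeo}(\mu,\nu)$ is the set of $\pi\in\mathscr P(C([0,1],X))$ with $(e_0)_\sharp\pi=\mu$, $(e_1)_\sharp\pi=\nu$, $\iint_0^1|\dot\gamma_t|^2dt\,d\pi=W_2^2(\mu,\nu)$. For $\mu=\rho m+\mu^s$, $\mu^s\perp m$: $\mathcal U_N(\mu):=-\int\rho^{1-1/N}dm$ ($N>1$), $\mathcal U_1(\mu):=-m(\{\rho>0\})$. $CD(0,N)$: for all $\mu_0,\mu_1\in\mathscr P_2(X)$ with supports in $\operatorname{supp}(m)$ there is $\pi\in\mathrm{OptGeo}(\mu_0,\mu_1)$ with $\mathcal U_{N'}((e_t)_\sharp\pi)\le(1-t)\mathcal U_{N'}(\mu_0)+t\,\mathcal U_{N'}(\mu_1)$ for all $t\in[0,1]$, $N'\ge N$. Sobolev functions: a test plan is $\pi\in\mathscr P(C([0,1],X))$ with $(e_t)_\sharp\pi\le Cm$ for all $t$ and some $C>0$, and $\iint_0^1|\dot\gamma_t|^2dt\,d\pi<\infty$. $S^2(X)$ is the space of Borel $f:X\to\mathbb R$ for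 which there is a non-negative $G\in L^2(X,m)$ with $\int|f(\gamma_1)-f(\gamma_0)|d\pi\le\iint_0^1G(\gamma_t)|\dot\gamma_t|dt\,d\pi$ for all test plans; $|Df|$ is the $m$-a.e. minimal such $G$. $W^{1,2}(X):=L^2\cap S^2$ with $\|f\|^2:=\|f\|_{L^2}^2+\||Df|\|_{L^2}^2$. Infinitesimally Hilbertian: $W^{1,2}(X)$ is a Hilbert space. A line is $\bar\gamma:\mathbb R\to\operatorname{supp}(m)$ with $d(\bar\gamma_t,\bar\gamma_s)=|t-s|$ for all $t,s$; $b^+(x):=\lim_{t\to+\infty}(t-d(x,\bar\gamma_t))$. Gradient flow trajectories are understood in $(\operatorname{supp}(m),d)$: $\gamma:I\to\operatorname{supp}(m)$ is a gradient flow trajectory of a Lipschitz $f$ if for all $t<s$ in $I$: $f(\gamma_t)=f(\gamma_s)+\frac12\int_t^s|\dot\gamma_r|^2dr+\frac12\int_t^s\operatorname{lip}(f)^2(\gamma_r)dr$, with $\operatorname{lip}(f)(x):=\limsup_{y\to x}\frac{|f(y)-f(x)|}{d(x,y)}$. Continuous gradient flow: $\bar F:\operatorname{supp}(m)\times\mathbb R\to\operatorname{supp}(m)$ is the unique continuous map such that for $m$-a.e. $x$ the curve $t\mapsto\bar F_t(x)$ is a gradient flow trajectory of $b$ with $\bar F_0(x)=x$, and $(\bar F_t)_\sharp m=m$ for all $t\in\mathbb R$. It exists, each $\bar F_t$ is an isometry of $(\operatorname{supp}(m),d)$, and $\bar F_t\circ\bar F_s=\bar F_{t+s}$; in particular $d'$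 and $\iota$ are well defined. *)

(* Defs.v *)
From HB Require Import structures.
From mathcomp Require Import all_boot all_order all_algebra.
From mathcomp Require Import all_classical all_reals all_analysis.
Import numFieldNormedType.Exports.

Set Implicit Arguments.
Unset Strict Implicit.
Unset Printing Implicit Defensive.

Import Order.TTheory GRing.Theory Num.Theory.

Local Open Scope classical_set_scope.
Local Open Scope ring_scope.

#[short(type="completeMetricType")]
HB.structure Definition CompleteMetric (R : numDomainType) :=
  {T of CompletePseudoMetric R T & Metric R T}.

Definition borel (T : ptopologicalType) : Type := g_sigma_algebraType (@open T).
HB.instance Definition _ (T : ptopologicalType) :=
  Measurable.copy (borel T) (g_sigma_algebraType (@open T)).

(* `C([0,1], X)`, with the topology of uniform convergence. *)
Definition curves (R : realType) (X : completeMetricType R) : Type :=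
  continuousType (set_type (`[0, 1]%classic : set R)) X.

Section curves_instances.
Context (R : realType) (X : completeMetricType R).

Local Notation I01 := (set_type (`[0, 1]%classic : set R)).

HB.instance Definition _ := Choice.copy (curves X) (continuousType I01 X).
HB.instance Definition _ := isPointed.Build (curves X)
  (mkcts (@cst_continuous I01 X (point : X)) : continuousType I01 X).
HB.instance Definition _ := Topological.copy (curves X)
  (initial_topology
    (fun (g : continuousType I01 X) => (g : I01 -> X) : {uniform I01 -> X})).

(* `curve_at g t` is `g t` for `t` in `[0,1]` and a fixed point of `X` outside
   `[0,1]`. *)
Definition curve_at (g : curves X) : R -> X :=
  valL ((g : continuousType I01 X) : I01 -> X).

Definition eval_at (t : R) (g : borel (curves X)) : borel X := curve_at g t.

End curves_instances.

Section metric_measure_spaces.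
Context (R : realType) (X : completeMetricType R).
Local Open Scope ereal_scope.

Local Notation leb := (@lebesgue_measure R).

Definition separable := exists2 D : set X, countable D & dense D.

Definition radon (m : {measure set (borel X) -> \bar R}) :=
  (forall x : X, exists2 U : set X, open_nbhs x U & m U < +oo) /\
  (forall A : set (borel X), measurable A ->
    m A = ereal_sup [set m K | K in [set K : set X | compact K /\ K `<=` A]]).

Definition supp (m : set (borel X) -> \bar R) : set X :=
  [set x | forall U : set X, open_nbhs x U -> 0 < m U].

(* Where the limit does not exist (a null set of times if `g` is absolutely
   continuous) `lim` returns a default value. *)
Definition speed (g : R -> X) (t : R) : R :=
  lim ((mdist (g (t + h)) (g t) / `|h|)%R @[h --> 0%R^']).

Definition abs_continuous (g : R -> X) (a b : R) :=
  exists2 k : R -> R, leb.-integrable `[a, b] (EFin \o k) &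
    forall s t : R, (a <= s)%R -> (s <= t)%R -> (t <= b)%R ->
      (mdist (g s) (g t))%:E <= \int[leb]_(r in `[s, t]) (k r)%:E.

Definition energy (g : R -> X) (a b : R) : \bar R :=
  if `[< abs_continuous g a b >]
  then \int[leb]_(t in `[a, b]) ((speed g t) ^+ 2)%:E else +oo.

Definition P2 (mu : probability (borel X) R) :=
  exists x0 : X, \int[mu]_x ((mdist (x : X) x0) ^+ 2)%:E < +oo.

Definition coupling (mu nu : probability (borel X) R)
    (P : probability (borel X * borel X)%type R) :=
  forall A : set (borel X), measurable A ->
    pushforward P fst A = mu A /\ pushforward P snd A = nu A.

(* The square of the quadratic transportation distance. *)
Definition W2sq (mu nu : probability (borel X) R) : \bar R :=
  ereal_inf [set \int[P]_z ((mdist (z.1 : X) (z.2 : X)) ^+ 2)%:E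
            | P in coupling mu nu].

Definition optgeo (mu nu : probability (borel X) R)
    (P : probability (borel (curves X)) R) :=
  [/\ forall A, measurable A -> pushforward P (eval_at 0%R) A = mu A,
      forall A, measurable A -> pushforward P (eval_at 1%R) A = nu A
    & \int[P]_g energy (curve_at g) 0 1 = W2sq mu nu].

(* `rho` is the density of the absolutely continuous part of `mu` in its
   Lebesgue decomposition with respect to `m`. *)
Definition is_density (m : {measure set (borel X) -> \bar R})
    (mu : set (borel X) -> \bar R) (rho : borel X -> R) :=
  [/\ measurable_fun setT rho, forall x, (0 <= rho x)%R
    & exists2 mus : {measure set (borel X) -> \bar R},
        exists S, [/\ measurable S, m S = 0 & mus (~` S) = 0]
      & forall A, measurable A ->
          mu A = \int[m]_(x in A) (rho x)%:E + mus A].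

Definition density m mu : borel X -> R := xget (cst 0%R) (is_density m mu).

(* `N = 1` is separate because `0 `^ 0 = 1`. *)
Definition renyi (N : R) (m : {measure set (borel X) -> \bar R})
    (mu : set (borel X) -> \bar R) : \bar R :=
  if N == 1%R then - m [set x | (0 < density m mu x)%R]
  else - \int[m]_x ((density m mu x) `^ (1 - N^-1))%:E.

Definition CD0 (N : R) (m : {measure set (borel X) -> \bar R}) :=
  forall mu0 mu1 : probability (borel X) R, P2 mu0 -> P2 mu1 ->
    supp mu0 `<=` supp m -> supp mu1 `<=` supp m ->
  exists2 P : probability (borel (curves X)) R, optgeo mu0 mu1 P &
    forall t N' : R, (0 <= t <= 1)%R -> (N <= N')%R ->
      renyi N' m (pushforward P (eval_at t)) <=
        (1 - t)%:E * renyi N' m mu0 + t%:E * renyi N' m mu1.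

Definition test_plan (m : {measure set (borel X) -> \bar R})
    (P : probability (borel (curves X)) R) :=
  (exists2 C : R, (0 < C)%R & forall t A, (0 <= t <= 1)%R -> measurable A ->
     pushforward P (eval_at t) A <= C%:E * m A) /\
  \int[P]_g energy (curve_at g) 0 1 < +oo.

Definition weak_upper_gradient (m : {measure set (borel X) -> \bar R})
    (f G : borel X -> R) :=
  [/\ G \in Lfun m 2%:E, forall x, (0 <= G x)%R
    & forall P : probability (borel (curves X)) R, test_plan m P ->
      \int[P]_g (`|f (curve_at g 1) - f (curve_at g 0)|%R)%:E <=
      \int[P]_g \int[leb]_(t in `[0%R, 1%R])
                  (G (curve_at g t) * speed (curve_at g) t)%:E].

Definition S2 (m : {measure set (borel X) -> \bar R}) (f : borel X -> R) :=
  measurable_fun setT f /\ exists G, weak_upper_gradient m f G.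

(* The function `|Df|`, defined up to `m`-a.e. equality. *)
Definition minimal_gradient (m : {measure set (borel X) -> \bar R})
    (f : borel X -> R) : borel X -> R :=
  xget (cst 0%R) [set G | weak_upper_gradient m f G /\
    forall H, weak_upper_gradient m f H -> {ae m, forall x, (G x <= H x)%R}].

Definition W12 (m : {measure set (borel X) -> \bar R}) : set (borel X -> R) :=
  [set f | f \in Lfun m 2%:E /\ S2 m f].

(* The square of the norm of `W^{1,2}(X)`. *)
Definition W12norm2 (m : {measure set (borel X) -> \bar R}) (f : borel X -> R) :
    \bar R :=
  'N[m]_2%:E [EFin \o f] ^+ 2 +
  'N[m]_2%:E [EFin \o minimal_gradient m f] ^+ 2.

(* `W^{1,2}(X)` is a Hilbert space: its norm is complete and comes from an
   inner product. Functions are not quotiented by `m`-a.e. equality. *)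
Definition infinitesimally_hilbertian
    (m : {measure set (borel X) -> \bar R}) :=
  (exists B : (borel X -> R) -> (borel X -> R) -> R,
    [/\ {in W12 m &, forall f g, B f g = B g f},
        forall (a : R) f g h, W12 m f -> W12 m g -> W12 m h ->
          B (fun x => a * f x + g x)%R h = (a * B f h + B g h)%R
      & forall f, W12 m f -> W12norm2 m f = (B f f)%:E]) /\
  (forall u : nat -> (borel X -> R), (forall n, W12 m (u n)) ->
    (forall e : R, (0 < e)%R ->
      \forall n & k \near \oo, W12norm2 m (u n \- u k)%R < e%:E) ->
    exists2 f, W12 m f & W12norm2 m (u n \- f)%R @[n --> \oo] --> 0).

Definition is_line (m : {measure set (borel X) -> \bar R}) (l : R -> X) :=
  (forall t, supp m (l t)) /\ forall t s, mdist (l t) (l s) = `|t - s|%R.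

Definition busemann (l : R -> X) (x : X) : R :=
  lim ((t - mdist x (l t))%R @[t --> +oo%R]).

(* The local Lipschitz constant in the metric space `supp m`, `0` at isolated
   points. *)
Definition lip (m : {measure set (borel X) -> \bar R}) (f : X -> R) (x : X) :
    \bar R :=
  maxe 0 (limf_esup (fun y => (`|f y - f x| / mdist x y)%:E)
                    (within (supp m) x^')).

Definition gradient_flow_trajectory (m : {measure set (borel X) -> \bar R})
    (f : X -> R) (I : set R) (g : R -> X) :=
  (forall t, I t -> supp m (g t)) /\
  forall t s : R, I t -> I s -> (t < s)%R ->
    (f (g t))%:E = (f (g s))%:E + (2^-1)%:E * energy g t s
      + (2^-1)%:E * \int[leb]_(r in `[t, s]) (lip m f (g r)) ^+ 2.

(* A flow on `supp m` is represented by a function `F` on `X`, of which only the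
   values on `supp m` matter. *)
Definition continuous_gradient_flow (m : {measure set (borel X) -> \bar R})
    (b : X -> R) (F : R -> X -> X) :=
  [/\ forall t x, supp m x -> supp m (F t x),
      {within supp m `*` setT, continuous (fun p : X * R => F p.2 p.1)},
      {ae m, forall x : X, supp m x ->
        gradient_flow_trajectory m b setT (F ^~ x) /\ F 0%R x = x}
    & forall t A, measurable (A : set (borel X)) ->
        m (supp m `&` F t @^-1` A) = m A].

Definition isometric_action (m : {measure set (borel X) -> \bar R})
    (F : R -> X -> X) :=
  (forall t x y, supp m x -> supp m y ->
    mdist (F t x) (F t y) = mdist x y) /\
  (forall t s x, supp m x -> F t (F s x) = F (t + s)%R x).

(* The equivalence class of `x`, i.e. its projection `pi(x)` in `X'`. *)
Definition orbit_class (m : {measure set (borel X) -> \bar R})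
    (F : R -> X -> X) (x : X) : set X :=
  [set y | supp m y /\ exists t, x = F t y].

Definition orbit_space (m : {measure set (borel X) -> \bar R})
    (F : R -> X -> X) : set (set X) :=
  orbit_class m F @` supp m.

Definition orbit_repr (m : {measure set (borel X) -> \bar R})
    (F : R -> X -> X) (u : set X) : X :=
  xget point [set x | supp m x /\ orbit_class m F x = u].

(* `d'`; it does not depend on the representatives by `orbit_distE` below. *)
Definition orbit_dist (m : {measure set (borel X) -> \bar R})
    (F : R -> X -> X) (u v : set X) : R :=
  inf [set mdist (orbit_repr m F u) (F t (orbit_repr m F v)) | t in setT].

Lemma isometric_action0 (m : {measure set (borel X) -> \bar R})
    (F : R -> X -> X) : (forall t x, supp m x -> supp m (F t x)) ->
  isometric_action m F -> forall x, supp m x -> F 0%R x = x.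
Proof.
move=> Fsupp [Fiso Fadd] x mx; apply: mdist_positivity.
rewrite -(Fiso 0%R _ _ (Fsupp 0%R _ mx) mx).
by rewrite Fadd// addr0 mdistxx.
Qed.

Lemma orbit_reprP (m : {measure set (borel X) -> \bar R})
    (F : R -> X -> X) : (forall t x, supp m x -> supp m (F t x)) ->
  isometric_action m F -> forall x, supp m x ->
  supp m (orbit_repr m F (orbit_class m F x)) /\
  exists t, orbit_repr m F (orbit_class m F x) = F t x.
Proof.
move=> Fsupp Fact x mx.
have [mz zx] : [set z | supp m z /\ orbit_class m F z = orbit_class m F x]
    (orbit_repr m F (orbit_class m F x)).
  by apply: xgetPex; exists x.
split=> //; have : orbit_class m F x x.
  by split=> //; exists 0%R; rewrite (isometric_action0 Fsupp Fact).
by rewrite -{1}zx => -[].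
Qed.

Lemma orbit_distE (m : {measure set (borel X) -> \bar R})
    (F : R -> X -> X) : (forall t x, supp m x -> supp m (F t x)) ->
  isometric_action m F -> forall x y, supp m x -> supp m y ->
  orbit_dist m F (orbit_class m F x) (orbit_class m F y) =
  inf [set mdist x (F t y) | t in setT].
Proof.
move=> Fsupp Fact x y mx my; have [Fiso Fadd] := Fact.
have [_ [a xa]] := orbit_reprP Fsupp Fact mx.
have [_ [c yc]] := orbit_reprP Fsupp Fact my.
have shift t : mdist (F a x) (F t (F c y)) = mdist x (F (t + c - a)%R y).
  rewrite -(Fiso a x)//; last exact: Fsupp.
  by rewrite !Fadd// addrCA subrr addr0.
rewrite /orbit_dist xa yc; congr inf; apply/seteqP; split=> _ [t _ <-].
  by exists (t + c - a)%R => //; rewrite shift.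
by exists (t - c + a)%R => //; rewrite shift (addrAC (t - c)%R) subrK addrK.
Qed.

Definition zero_section (m : {measure set (borel X) -> \bar R}) (b : X -> R)
    (F : R -> X -> X) (u : set X) : X :=
  xget point [set x | [/\ supp m x, orbit_class m F x = u & b x = 0%R]].

Definition isometric_embedding (T : Type) (A : set T) (d : T -> T -> R)
    (i : T -> X) :=
  forall u v, A u -> A v -> mdist (i u) (i v) = d u v.

End metric_measure_spaces.

(* Main.v *)
From HB Require Import structures.
Require Import Defs.
From mathcomp Require Import all_boot all_order all_algebra.
From mathcomp Require Import all_classical all_reals all_analysis.
From mathcomp Require Import measurable_realfun.
From mathcomp Require Import lra ring finmap.
Import numFieldNormedType.Exports.

Set Implicit Arguments.
Unset Strict Implicit.
Unset Printing Implicit Defensive.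

Import Order.TTheory GRing.Theory Num.Theory.

Local Open Scope classical_set_scope.
Local Open Scope ring_scope.

(** Let [S] be the support of [m] and [b] the Busemann function, so that the flow
    [F] translates [b]: [b (F t x) = b x - t], and orbits are lines
    ([flow_line]). For a point [q] of [S] let [f] be the distance to its orbit,
    a [1]-Lipschitz function which is constant along the flow. The theorem says
    that two points [p] and [q] with [b p = b q] satisfy [d (p, q) <= f p], the
    other inequality being trivial.

    The core is that [b + mu f] is Lipschitz on [S] with constant
    [sqrt (1 + mu ^ 2)], for all real [mu] ([lipschitz_combination]). Taken between
    [p] and a point [F s q] of the orbit, with [mu = f p / s], this is Pythagoras'
    inequality [s ^ 2 + f p ^ 2 <= d (p, F s q) ^ 2]. Hence a point of the orbit
    that is almost nearest to [p] has almost the same value of [b] as [p]; being at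
    distance [|s|] from [q], it is close to [q] ([level_set_distance]).

    For the core, [b] and [f] have gradients of norm at most [1] that should be
    orthogonal, since [f] is constant along the flow of [b]. Let [psi] be Lipschitz
    with bounded support. The flow preserves [m] and has unit speed, so it carries
    test plans ([flow_plan]), and along them [b + a psi] changes at least at rate
    [1 - |a| c], where [c] bounds the derivative of [psi] along the orbits
    ([flow_lower_bound]). So the energy of [b + a psi] is at least that of [b] up to
    an error linear in [a] with a coefficient proportional to [c]. As Sobolev
    functions form a Hilbert space, the energy is quadratic in [a], and its linear
    coefficient is small too ([energy_step]). This is applied to the product [psi]
    of a cutoff and a small bump of [f] ([bump]), with slope [1] in a thin window of
    levels and a small slope elsewhere: its size, hence [c], is small. In the window
    the gradient of [b + mu psi] is that of [b + mu f], by locality; elsewhere it is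
    at least [1 - |mu| c]. Summation over the windows bounds the integral of
    [|D (b + mu f)| ^ 2] over a set by [1 + mu ^ 2] times its measure
    ([energy_bound], [gradient_bound]).

    It remains to pass from a bound on the weak gradient to a Lipschitz bound, which
    takes test plans concentrated near the geodesics between two given points [a]
    and [w] ([geodesic_plan]). Transport to a Dirac mass and the curvature-dimension
    condition give the Brunn-Minkowski inequality towards [w] ([brunn_minkowski]),
    hence the compactness of balls and the existence of intermediate points. Dynamic
    programming along finitely many times then shows that for finitely many
    nonnegative functions of position at given times some curve close to a geodesic
    from [a] to [w] has cost at most a constant times the sum of the integrals of
    these functions ([value_function], [cheap_curve]). A Hahn-Banach argument turns this
    into a finitely additive mean on near-geodesics with bounded marginals
    ([mean_of_inequalities]), and coding near-geodesics by nested finite partitions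
    realizes this mean by a random curve ([sample_codes], [random_curve]).

    The Sobolev calculus rests on one characterization: [H] is a weak upper gradient
    of a Lipschitz function [w] if and only if along almost every curve of each test
    plan the slope of [w] is at almost every time at most [H] times the speed
    ([wug_slope], [slope_wug]). It gives the existence of minimal gradients
    ([minimal_gradientP]) and their locality ([wug_splice]). *)

(** * Conditioned measures and laws *)

Lemma uniform_probability d (T : measurableType d) (R : realType) (mu : {measure set T -> \bar R}) (A : set T) :
  measurable A -> (0 < mu A)%E -> (mu A < +oo)%E -> exists P : probability T R,
    forall D, measurable D -> P D = (mu (D `&` A) * ((fine (mu A))^-1)%:E)%E.
Proof.
move=> mA A0 Aoo; have [x0 _] : exists x, A x.
  by apply: contrapT => nA; move: A0; rewrite (_ : A = set0) ?measure0 ?ltxx// -subset0 => x Ax; apply: nA; exists x.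
pose P0 := mnormalize (mrestr mu mA) (\d_x0).
have P0E D : P0 D = (mu (D `&` A) * ((fine (mu A))^-1)%:E)%E.
  have ev : mrestr mu mA setT = mu A by rewrite /mrestr setTI.
  rewrite /P0 /mnormalize; set e0 := (X in X == 0); rewrite -!/e0 (_ : e0 = mu A) => [|]; last exact: ev.
  by rewrite (gt_eqF A0) (lt_eqF Aoo).
by exists (mnormalize (mrestr mu mA) (\d_x0)) => D mD; exact: P0E.
Qed.

Lemma push_law d d' (T : measurableType d) (T' : measurableType d') (R : realType) (P : probability T R)
    (h : T -> T') : measurable_fun setT h ->
  exists Q : probability T' R, forall D, Q D = P (h @^-1` D).
Proof.
move=> mh; pose h' : {mfun T >-> T'} := mfun_Sub (mem_set mh).
by exists (distribution P h').
Qed.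

(** * Lower integrals and densities of absolutely continuous functions *)

(** Generic lemmas introduce instances of the operations that agree with those of
    user-written terms only up to conversion, which linear arithmetic does not
    see through; [slra] first rebuilds the (in)equalities with one instance. *)
Section retyping.
Context (R : realType).
Implicit Types x y : R.
Definition radd x y : R := x + y.
Definition ropp x : R := - x.
Definition rmul x y : R := x * y.
Definition rinv x : R := x^-1.
Definition rabs x : R := `|x|.
Definition rexp x n : R := x ^+ n.
Definition rle x y : bool := x <= y.
Definition rlt x y : bool := x < y.
End retyping.

Ltac retype R t := lazymatch t with
  | @Algebra.add _ ?x ?y => let x := retype R x in let y := retype R y in
      constr:(@radd R x y)
  | @Algebra.opp _ ?x => let x := retype R x in constr:(@ropp R x)
  | @GRing.mul _ ?x ?y => let x := retype R x in let y := retype R y in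
      constr:(@rmul R x y)
  | @GRing.inv _ ?x => let x := retype R x in constr:(@rinv R x)
  | @Num.norm _ _ ?x => let x := retype R x in constr:(@rabs R x)
  | @GRing.exp _ ?x ?n => let x := retype R x in constr:(@rexp R x n)
  | _ => t
  end.

Ltac retype_goal R := lazymatch goal with
  | |- is_true (@Order.le _ _ ?x ?y) => let x := retype R x in
      let y := retype R y in change (is_true (@rle R x y))
  | |- is_true (@Order.lt _ _ ?x ?y) => let x := retype R x in
      let y := retype R y in change (is_true (@rlt R x y))
  | |- @eq _ ?x ?y => let x := retype R x in
      let y := retype R y in change (@eq (Real.sort R) x y)
  | _ => idtac
  end; cbv beta delta [radd ropp rmul rinv rabs rexp rle rlt].

Ltac retype_hyps R := repeat match goal with
  | H : is_true (@Order.le _ _ ?x ?y) |- _ => let x := retype R x in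
      let y := retype R y in change (is_true (@rle R x y)) in H
  | H : is_true (@Order.lt _ _ ?x ?y) |- _ => let x := retype R x in
      let y := retype R y in change (is_true (@rlt R x y)) in H
  end; cbv beta delta [radd ropp rmul rinv rabs rexp rle rlt] in *.

Ltac slra := intros; first [lra | match goal with R : Real.type |- _ =>
  retype_hyps R; retype_goal R; lra end].

Section integrals.
Context d (T : measurableType d) (R : realType) (mu : {measure set T -> \bar R}).
Local Open Scope ereal_scope.

Lemma lower_integral_le (D : set T) (f g : T -> \bar R) :
  (forall x, D x -> 0 <= f x) -> (forall x, D x -> f x <= g x) ->
  \int[mu]_(x in D) f x <= \int[mu]_(x in D) g x.
Proof.
move=> f0 fg; rewrite integral_mkcond [leRHS]integral_mkcond.
have fg' x : (f \_ D) x <= (g \_ D) x.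
  by rewrite !patchE; case: ifPn => // /set_mem; exact: fg.
have f0' x : 0 <= (f \_ D) x.
  by rewrite patchE; case: ifPn => // /set_mem; exact: f0.
have g0' x : 0 <= (g \_ D) x by exact: le_trans (fg' x).
rewrite !ge0_integralTE//; apply: ub_ereal_sup => _ [h /= hf <-].
by apply: ereal_sup_ubound; exists h => //= x; exact: le_trans (fg' x).
Qed.

Lemma ae_lower_integral_le (D : set T) (f g : T -> \bar R) :
  measurable D -> measurable_fun D f ->
  (forall x, D x -> 0 <= f x) -> (forall x, D x -> 0 <= g x) ->
  {ae mu, forall x, D x -> f x <= g x} ->
  \int[mu]_(x in D) f x <= \int[mu]_(x in D) g x.
Proof.
move=> mD mf f0 g0 [N [mN N0 fgN]].
rewrite (ge0_negligible_integral mN)//.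
rewrite integral_mkcond [leRHS]integral_mkcond.
apply: lower_integral_le => x _.
  by rewrite patchE; case: ifPn => // /set_mem[/f0].
rewrite !patchE; case: ifPn => [/set_mem[Dx Nx]|_]; last first.
  by case: ifPn => // /set_mem/g0.
by rewrite mem_set//; move: Dx; apply: contrapT => fg; apply/Nx/fgN.
Qed.

End integrals.

Section almost_everywhere.
Context d (T : measurableType d) (R : realType) (mu : {measure set T -> \bar R}).
Implicit Types P Q : T -> Prop.

Lemma aeS P Q : (forall x, P x -> Q x) ->
  {ae mu, forall x, P x} -> {ae mu, forall x, Q x}.
Proof. exact: (@filterS _ _ (ae_filter_ringOfSetsType mu)). Qed.

Lemma aeS2 P1 P2 Q : (forall x, P1 x -> P2 x -> Q x) ->
  {ae mu, forall x, P1 x} -> {ae mu, forall x, P2 x} -> {ae mu, forall x, Q x}.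
Proof. exact: (@filterS2 _ _ (ae_filter_ringOfSetsType mu)). Qed.

Lemma aeS3 P1 P2 P3 Q : (forall x, P1 x -> P2 x -> P3 x -> Q x) ->
  {ae mu, forall x, P1 x} -> {ae mu, forall x, P2 x} ->
  {ae mu, forall x, P3 x} -> {ae mu, forall x, Q x}.
Proof. exact: (@filterS3 _ _ (ae_filter_ringOfSetsType mu)). Qed.

Lemma ae_all P : (forall x, P x) -> {ae mu, forall x, P x}.
Proof. by move=> H; exact: (@nearW _ _ _ (ae_filter_ringOfSetsType mu)). Qed.

End almost_everywhere.

Section density_measure.
Context d (T : measurableType d) (R : realType) (mu : {measure set T -> \bar R}).
Variables (f : T -> \bar R) (mf : measurable_fun setT f).
Variable (f0 : forall x, (0 <= f x)%E).

Definition density_measure of measurable_fun setT f & (forall x, (0 <= f x)%E)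
  := fun A => (\int[mu]_(x in A) f x)%E.

Let nu := density_measure mf f0.
Let nu_set0 : nu set0 = 0%E. Proof. exact: integral_set0. Qed.
Let nu_ge0 A : (0 <= nu A)%E. Proof. exact: integral_ge0. Qed.
Let nu_sigma : semi_sigma_additive nu.
Proof. exact: semi_sigma_additive_nng_induced. Qed.
HB.instance Definition _ := isMeasure.Build _ _ _ nu nu_set0 nu_ge0 nu_sigma.
End density_measure.

Section absolutely_continuous.
Context (R : realType).
Local Notation leb := (@lebesgue_measure R).
Implicit Types (a k : R -> R) (x y s t : R).

Lemma stieltjes_oc (f : cumulative R R) s t : s <= t ->
  lebesgue_stieltjes_measure f `]s, t] = (f t - f s)%:E.
Proof.
move=> st; rewrite /lebesgue_stieltjes_measure /measure_extension.
by rewrite measurable_mu_extE/=; [rewrite wlength_itv_bnd|exact: is_ocitv].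
Qed.

Lemma continuous_nondecreasing_stieltjes (g : R -> R) :
  {homo g : x y / x <= y} -> continuous g ->
  exists f : cumulative R R, f = g :> (R -> R).
Proof.
move=> ndg cg.
pose m := isCumulative.Build _ _ _ g ndg (right_continuousW cg).
by exists (HB.pack_for (cumulative R R) g m).
Qed.

(** The increments of [a] are dominated by those of the indefinite integral
    [K] of [k], so that both [K + a] and [K - a] are nondecreasing; the Stieltjes
    measure of the first is at most twice the measure of density [k], and its
    Radon-Nikodym derivative gives the derivative of [a]. *)
Lemma ac_density a k x y :
  leb.-integrable `[x, y] (EFin \o k) ->
  (forall s t, x <= s -> s <= t -> t <= y ->
    ((`|a t - a s|)%:E <= \int[leb]_(r in `[s, t]) (k r)%:E)%E) ->
  exists2 al : R -> R, leb.-integrable setT (EFin \o al) &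
    forall s t, x <= s -> s <= t -> t <= y ->
      (a t - a s)%:E = (\int[leb]_(r in `[s, t]) (al r)%:E)%E.
Proof.
move=> ik ak.
have [yx|xy] := ltP y x.
  exists (cst 0) => [|s t xs st ty]; first exact: integrable0.
  by move: (le_trans xs (le_trans st ty)); rewrite leNgt yx.
pose kap := (fun r => `|k r|) \_ `[x, y].
have kap0 r : 0 <= kap r by rewrite /kap patchE; case: ifP.
have ikap : leb.-integrable setT (EFin \o kap).
  rewrite /kap (_ : EFin \o _ = (abse \o (EFin \o k)) \_ `[x, y]); last first.
    by apply/funext => r /=; rewrite !patchE /=; case: ifP.
  apply/integrable_restrict => //; rewrite setTI; exact: integrable_abse.
have mkap : measurable_fun setT kap.
  by apply/measurable_EFinP; case/integrableP: ikap.
pose K t := (\int[leb]_(r in `]-oo, t]) kap r)%R.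
have KE s t : s <= t -> (K t - K s)%:E = (\int[leb]_(r in `]s, t]) (kap r)%:E)%E.
  move=> st; rewrite /K Rintegral_itvB ?bnd_simp//; last first.
    exact: integrableS ikap.
  by rewrite /Rintegral fineK// integrable_fin_num//; exact: integrableS ikap.
have K_nd : {homo K : s t / s <= t}.
  move=> s t st; rewrite -subr_ge0 -lee_fin KE// integral_ge0// => r _.
  by rewrite lee_fin.
have cK : continuous K.
  move=> s; apply/cvgrPdist_lt => e e0.
  have [del [del0 Hdel]] := @integral_normr_continuous _ _ _ leb _ ikap _ e0.
  have aux u v : u <= v -> v - u < del -> `|K v - K u| < e.
    move=> uv uvd; rewrite ger0_norm ?subr_ge0 ?K_nd//.
    have : leb `]u, v] = (v - u)%:E.
      rewrite lebesgue_measure_itv/= lte_fin; case: ltP => [_|vu]; first by rewrite EFinB.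
      by rewrite (@le_anti _ _ u v) ?subrr// uv vu.
    move=> luv; have luvd : (leb `]u, v] < del%:E)%E by rewrite luv lte_fin.
    apply: le_lt_trans (Hdel _ (measurable_itv `]u, v]) luvd).
    rewrite -lee_fin KE// /Rintegral fineK.
      by apply: lower_integral_le => r _; rewrite ?lee_fin// ler_norm.
    apply: integrable_fin_num => //; apply: (integrableS measurableT) => //.
    exact: (integrable_abse ikap).
  near=> t; have [st|ts] := leP s t.
    rewrite distrC; apply: aux => //.
    rewrite -[ltLHS](ger0_norm); last by rewrite subr_ge0.
    rewrite distrC; near: t; apply/nbhs_ballP; exists del => //.
  apply: aux; first exact: ltW.
  rewrite -[ltLHS](ger0_norm); last by rewrite subr_ge0 ltW.
  near: t; apply/nbhs_ballP; exists del => //.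
pose c t := Num.max x (Num.min y t).
have cxy t : x <= c t <= y.
  by rewrite /c le_max lexx/= ge_max xy/= ge_min lexx.
have cid t : x <= t <= y -> c t = t.
  by move=> /andP[xt ty]; rewrite /c min_r// max_r.
have c_nd : {homo c : s t / s <= t}.
  by move=> s t st; rewrite /c le_max2// le_min2.
have aK s t : s <= t -> `|a (c t) - a (c s)| <= K t - K s.
  move=> st; rewrite -lee_fin KE//.
  have /andP[xs sy] := cxy s; have /andP[xt ty] := cxy t.
  apply: (le_trans (ak _ _ xs (c_nd _ _ st) ty)).
  rewrite -integral_itv_obnd_cbnd//; last first.
    apply: measurable_funS (measurable_int _ ik) => // r/=.
    by rewrite !in_itv/= => /andP[/(le_lt_trans xs)/ltW-> /le_trans->].
  have mk : measurable_fun `]c s, c t] (EFin \o k).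
    apply: measurable_funS (measurable_int _ ik) => // r/=.
    by rewrite !in_itv/= => /andP[/(le_lt_trans xs)/ltW-> /le_trans->].
  apply: (le_trans (lee_abs _)); apply: (le_trans (le_abse_integral leb (measurable_itv _) mk)).
  rewrite [leLHS]integral_mkcond [leRHS]integral_mkcond.
  apply: lower_integral_le => r _; first by rewrite patchE; case: ifP.
  rewrite !patchE; case: ifPn => [/set_mem/=|_]; last first.
    by case: ifP => // _; rewrite lee_fin.
  rewrite in_itv/= => /andP[csr rct].
  have [xr ry] : x < r /\ r <= y by rewrite (le_lt_trans xs csr) (le_trans rct ty).
  have sr : s < r.
    by move: csr; rewrite /c gt_max gt_min (ltNge y r) ry/= => /andP[].
  have rt : r <= t.
    by move: rct; rewrite /c le_max (leNgt r x) xr/= le_min => /andP[].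
  by rewrite mem_set/= ?in_itv/= ?sr// /kap patchE mem_set//= in_itv/= (ltW xr).
have cca : continuous (a \o c).
  move=> s; apply/cvgrPdist_lt => e e0.
  have /cvgrPdist_lt/(_ e e0) := cK s; apply: filterS => t; apply: le_lt_trans.
  rewrite /=; have [st|/ltW ts] := leP s t.
    by rewrite distrC (distrC (K s)) (le_trans (aK _ _ st))// ler_norm.
  by rewrite (le_trans (aK _ _ ts))// ler_norm.
have [g gE] : exists g : cumulative R R, g = K \+ (a \o c) :> (R -> R).
  apply: continuous_nondecreasing_stieltjes => [s t st|s]; last first.
    by apply: continuousD; [exact: cK|exact: cca].
  have := aK _ _ st; rewrite ler_norml => /andP[+ _] /=; slra.
have [h hE] : exists h : cumulative R R, h = K \- (a \o c) :> (R -> R).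
  apply: continuous_nondecreasing_stieltjes => [s t st|s]; last first.
    by apply: continuousB; [exact: cK|exact: cca].
  have := aK _ _ st; rewrite ler_norml => /andP[_ +] /=; slra.
have [K2 K2E] : exists f : cumulative R R, f = K \+ K :> (R -> R).
  apply: continuous_nondecreasing_stieltjes => [s t st|s].
    by rewrite lerD// K_nd.
  by apply: continuousD; exact: cK.
pose nug := lebesgue_stieltjes_measure g.
have mkap2 : measurable_fun setT (fun r => (kap r + kap r)%:E).
  by apply/measurable_EFinP; exact: measurable_funD.
have kap20 r : (0 <= (kap r + kap r)%:E)%E by rewrite lee_fin addr_ge0.
pose M := density_measure leb mkap2 kap20.
have gh A : measurable A -> (nug A + lebesgue_stieltjes_measure h A = M A)%E.
  move=> mA.
  rewrite /nug -measure_addE.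
  transitivity (lebesgue_stieltjes_measure K2 A).
    apply/esym; apply: lebesgue_stieltjes_measure_unique => //.
    move=> _ [[s t] _ <-]/=; have [st|ts] := leP s t; last first.
      by rewrite set_itv_ge ?measure0// bnd_simp -leNgt ltW.
    apply: (eq_trans _ (esym (measure_addE _ _ _))).
    transitivity ((g t - g s)%:E + (h t - h s)%:E)%E; last first.
      by congr (_ + _)%E; apply/esym; exact: stieltjes_oc.
    by rewrite stieltjes_oc// gE hE K2E -EFinD/=; congr EFin; ring.
  apply: lebesgue_stieltjes_measure_unique => //.
  move=> _ [[s t] _ <-]/=; have [st|ts] := leP s t; last first.
    by rewrite set_itv_ge ?measure0// bnd_simp -leNgt ltW.
  rewrite stieltjes_oc// /M /density_measure K2E/=.
  under eq_integral do rewrite EFinD.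
  rewrite ge0_integralD//=; [|by move=> *; rewrite lee_fin|exact/measurable_EFinP/measurable_funTS|by move=> *; rewrite lee_fin|exact/measurable_EFinP/measurable_funTS].
  by rewrite -KE// -EFinD; congr EFin; ring.
have nugT : (nug setT < +oo)%E.
  apply: (@le_lt_trans _ _ (M setT)).
    by rewrite -gh// leeDl// measure_ge0.
  rewrite /M /density_measure; under eq_integral do rewrite EFinD.
  rewrite ge0_integralD//=; [|by move=> *; rewrite lee_fin|exact/measurable_EFinP/measurable_funTS|by move=> *; rewrite lee_fin|exact/measurable_EFinP/measurable_funTS].
  have : (\int[leb]_x (kap x)%:E < +oo)%E.
    case/integrableP: ikap => _; under eq_integral do rewrite /= ger0_norm//.
    by [].
  by move=> ?; exact: lte_add_pinfty.
pose nu : {finite_measure set _ -> \bar R} := mfrestr (f := nug) measurableT nugT.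
have nuE A : nu A = nug A by rewrite /nu/= /mfrestr /mrestr setIT.
have nuleb : nu `<< leb.
  apply/null_content_dominatesP => A mA lA0; apply/eqP.
  rewrite eq_le measure_ge0 andbT nuE.
  apply: (@le_trans _ _ (M A)); first by rewrite -gh// leeDl// measure_ge0.
  rewrite /M /density_measure (ge0_negligible_integral mA mA _ _ lA0)//.
    by rewrite setDv integral_set0.
  exact: measurable_funTS.
have [f [f0 ffin fi fE]] := radon_nikodym_sigma_finite nuleb.
exists (fun r => fine (f r) - kap r).
  rewrite (_ : _ \o _ = f \- (EFin \o kap))%E; first exact: integrableB.
  by apply/funext => r /=; rewrite EFinB fineK.
move=> s t xs st ty; rewrite -integral_itv_obnd_cbnd; last first.
  apply: measurable_funTS; apply/measurable_EFinP; apply: measurable_funB => //.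
  by apply: measurableT_comp => //; case/integrableP: fi.
under eq_integral do rewrite EFinB fineK//.
rewrite integralB//; [|exact: integrableS fi|exact: integrableS ikap].
rewrite -fE// nuE (_ : nug _ = (g t - g s)%:E); last exact: stieltjes_oc.
rewrite -KE// gE -EFinB/= !cid ?xs ?(le_trans st)// ?(le_trans xs)//.
by congr EFin; ring.
Unshelve. all: by end_near.
Qed.
End absolutely_continuous.

(** * Differentiation almost everywhere and metric derivatives *)

Section lower_integral_ae.
Context d (T : measurableType d) (R : realType) (mu : {measure set T -> \bar R}).
Local Open Scope ereal_scope.
Import HBNNSimple.

Lemma ae_lower_integral_le_gen (D : set T) (f g : T -> \bar R) :
  measurable D ->
  (forall x, D x -> 0 <= f x) -> (forall x, D x -> 0 <= g x) ->
  {ae mu, forall x, D x -> f x <= g x} ->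
  \int[mu]_(x in D) f x <= \int[mu]_(x in D) g x.
Proof.
move=> mD f0 g0 fg; rewrite integral_mkcond [leRHS]integral_mkcond.
have f0' x : 0 <= (f \_ D) x.
  by rewrite patchE; case: ifPn => // /set_mem; exact: f0.
have g0' x : 0 <= (g \_ D) x.
  by rewrite patchE; case: ifPn => // /set_mem; exact: g0.
rewrite ge0_integralTE//; apply: ub_ereal_sup => _ [h /= hf <-].
rewrite -integralT_nnsfun; apply: ae_lower_integral_le => //.
- exact/measurable_EFinP.
- by move=> x _; rewrite lee_fin.
- move: fg; apply: filterS => x fgx _.
  apply: (le_trans (hf x)); rewrite !patchE; case: ifPn => // /set_mem.
  exact: fgx.
Qed.

Lemma ae_eq_lower_integral (D : set T) (f g : T -> \bar R) :
  measurable D ->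
  (forall x, D x -> 0 <= f x) -> (forall x, D x -> 0 <= g x) ->
  {ae mu, forall x, D x -> f x = g x} ->
  \int[mu]_(x in D) f x = \int[mu]_(x in D) g x.
Proof.
move=> mD f0 g0 fg; apply/eqP; rewrite eq_le !ae_lower_integral_le_gen//.
  by move: fg; apply: filterS => x fgx /fgx ->.
by move: fg; apply: filterS => x fgx /fgx ->.
Qed.

End lower_integral_ae.

Section derivatives.
Context (R : realType).
Local Notation leb := (@lebesgue_measure R).
Implicit Types (a f : R -> R) (s t x y : R).

Definition deriv_at a t (l : R) := forall e : R, 0 < e -> exists2 d : R, 0 < d &
  forall h : R, `|h| < d -> `|a (t + h) - a t - l * h| <= e * `|h|.

Definition slope_le a t (K : R) := forall e : R, 0 < e -> exists2 d : R, 0 < d &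
  forall h : R, `|h| < d -> `|a (t + h) - a t| <= (K + e) * `|h|.

Lemma deriv_slope a t l : deriv_at a t l -> slope_le a t `|l|.
Proof.
move=> al e /al[d d0 ad]; exists d => // h /ad H.
by have := ler_normD (a (t + h) - a t - l * h) (l * h); rewrite subrK normrM; slra.
Qed.

Lemma deriv_two_sided a t l D E u w :
  (forall h : R, `|h| < D -> `|a (t + h) - a t - l * h| <= E * `|h|) ->
  u <= t -> t <= w -> w - u < D -> `|a w - a u - l * (w - u)| <= E * (w - u).
Proof.
move=> al ut tw wuD.
have H1 : `|a u - a t - l * (u - t)| <= E * (t - u).
  have := al (u - t); rewrite (_ : t + (u - t) = u); last by ring.
  by rewrite distrC ger0_norm ?subr_ge0//; apply; slra.
have H2 : `|a w - a t - l * (w - t)| <= E * (w - t).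
  have := al (w - t); rewrite (_ : t + (w - t) = w); last by ring.
  by rewrite ger0_norm ?subr_ge0//; apply; slra.
move: H1 H2; rewrite !ler_norml => /andP[? ?] /andP[? ?].
by apply/andP; split; slra.
Qed.

Lemma deriv_slope_le a t l K : deriv_at a t l -> slope_le a t K -> `|l| <= K.
Proof.
move=> al aK; apply/ler_addgt0Pr => e e0.
have e20 : 0 < e / 2 by slra.
have [d d0 ad] := al _ e20; have [d' d'0 ad'] := aK _ e20.
pose h := Num.min d d' / 2; have h0 : 0 < h by rewrite divr_gt0// lt_min d0.
have m0 : 0 < Num.min d d' by rewrite lt_min d0.
have hd : h < Num.min d d' by rewrite /h; slra.
move: hd; rewrite lt_min => /andP[hd hd'].
have := ad h; rewrite (ger0_norm (ltW h0)) => /(_ hd) H.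
have := ad' h; rewrite (ger0_norm (ltW h0)) => /(_ hd') H'.
have : `|l * h| <= (K + e) * h.
  have := ler_normB (a (t + h) - a t) (a (t + h) - a t - l * h).
  rewrite opprB addrC subrK => H2; apply: (le_trans H2).
  have -> : (K + e) * h = (K + e / 2) * h + e / 2 * h by field.
  exact: lerD.
by rewrite normrM (gtr0_norm h0) ler_pM2r.
Qed.

Lemma integral_deriv_at f : leb.-integrable setT (EFin \o f) ->
  {ae leb, forall t, deriv_at (fun u => (\int[leb]_(r in `]-oo, u]) f r)%R) t (f t)}.
Proof.
move=> fi; have fi' y : leb.-integrable `]-oo, y] (EFin \o f).
  exact: integrableS fi.
have := FTC1Ny fi' (open_integrable_locally openT fi).
apply: aeS => t [/cvg_ex[/= l Hl] dl] e e0.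
have lE : l = f t.
  rewrite -dl; apply/esym/cvg_lim => //; apply: cvg_trans Hl.
  by apply: near_eq_cvg; apply: nearW => h; rewrite /= [h *: 1]mulr1.
move/cvgrPdist_lt : Hl => /(_ _ e0)[d /= d0 Hd]; exists d => // h hd.
have [->|h0] := eqVneq h 0; first by rewrite !addr0 subrr mulr0 subrr normr0 mulr0.
have /Hd : `|0 - h| < d by rewrite sub0r normrN.
move=> /(_ h0); rewrite /= [h *: 1]mulr1 lE distrC => H.
pose F (u : R) := (\int[leb]_(r in `]-oo, u]) f r)%R.
change (`|F (t + h) - F t - f t * h| <= e * `|h|).
have {}H : `|h^-1 * (F (h + t) - F t) - f t| < e by exact: H.
rewrite -ler_pdivrMr ?normr_gt0// -normfV -normrM mulrC mulrBr (addrC t h).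
by rewrite mulrCA mulVf// mulr1 ltW.
Qed.

Lemma integral_small f e : leb.-integrable setT (EFin \o f) -> 0 < e ->
  exists2 d : R, 0 < d & forall s t, t - s < d ->
    (\int[leb]_(r in `[s, t]) (`|f r|)%:E <= e%:E)%E.
Proof.
move=> fi e0; have [d [d0 Hd]] := @integral_normr_continuous _ _ _ leb _ fi _ e0.
exists d => // s t std.
have lst : (leb `[s, t] < d%:E)%E.
  by rewrite lebesgue_measure_itv/= lte_fin; case: ifP; rewrite -?EFinD lte_fin.
have := Hd _ (measurable_itv `[s, t]) lst; rewrite -lte_fin /Rintegral fineK; first exact: ltW.
apply: integrable_fin_num => //; apply: (integrableS measurableT) => //.
exact: (integrable_abse fi).
Qed.

Lemma ac_deriv_at a f x y : leb.-integrable setT (EFin \o f) ->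
  (forall s t, x <= s -> s <= t -> t <= y ->
      (a t - a s)%:E = (\int[leb]_(r in `[s, t]) (f r)%:E)%E) ->
  {ae leb, forall t, x < t < y -> deriv_at a t (f t)}.
Proof.
move=> fi af; have := integral_deriv_at fi; apply: aeS => t Ht /andP[xt ty].
move=> e /Ht[d d0 Hd].
exists (Num.min d (Num.min (t - x) (y - t))) => [|h].
  by rewrite !lt_min d0 !subr_gt0 xt ty.
rewrite !lt_min => /and3P[hd hx hy].
have xh : x <= t + h by move: hx; rewrite ltr_norml; slra.
have hy' : t + h <= y by move: hy; rewrite ltr_norml; slra.
suff -> : a (t + h) - a t =
    (\int[leb]_(r in `]-oo, (t + h)%R]) f r)%R - (\int[leb]_(r in `]-oo, t]) f r)%R.
  exact: Hd.
have aux u v : x <= u -> u <= v -> v <= y -> a v - a u =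
    (\int[leb]_(r in `]-oo, v]) f r)%R - (\int[leb]_(r in `]-oo, u]) f r)%R.
  move=> xu uv vy; apply: EFin_inj; rewrite af//.
  rewrite Rintegral_itvB ?bnd_simp//; last exact: integrableS fi.
  rewrite -integral_itv_obnd_cbnd; last first.
    by apply: measurable_funTS; case/integrableP: fi.
  by rewrite /Rintegral fineK// integrable_fin_num//; exact: integrableS fi.
have [h0|h0] := leP 0 h; first by apply: aux => //; slra.
by rewrite -[LHS]opprB -[RHS]opprB; congr (- _); apply: aux => //; slra.
Qed.

End derivatives.

Lemma ae_neq (R : realType) (s : R) : {ae (@lebesgue_measure R), forall t, t != s}.
Proof.
exists [set s]; split; first exact: measurable_set1.
  exact: lebesgue_measure_set1.
by move=> t /= /negP; rewrite negbK => /eqP.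
Qed.

Section metric_derivative.
Context (R : realType) (X : completeMetricType R).
Local Notation leb := (@lebesgue_measure R).
Implicit Types (g : R -> X) (s t x y : R).

(** The two-sided form of the metric derivative: it also compares difference
    quotients over dyadic cells that contain [t] with the speed at [t]. *)
Definition mslope g t (v : R) := forall e : R, 0 < e -> exists2 d : R, 0 < d &
  forall u w : R, u <= t -> t <= w -> w - u < d ->
    `|mdist (g u) (g w) - v * (w - u)| <= e * (w - u).

Lemma mslope_speed g t v : mslope g t v -> speed g t = v.
Proof.
move=> gv; apply/cvg_lim => //; apply/cvgrPdist_le => e /gv[d d0 H].
exists d => // h; rewrite /ball_ /= sub0r normrN => hd h0.
rewrite distrC -[leRHS](@mulfK _ `|h|) ?normr_eq0// ler_pdivlMr ?normr_gt0//.
rewrite -[X in _ * X]normr_id -normrM mulrBl divfK ?normr_eq0//.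
have [h0'|h0'] := leP 0 h.
  have E : t + h - t = h by ring.
  have := H t (t + h); rewrite E (ger0_norm h0') metric_sym => -> //.
    by rewrite lerDl.
  by move: hd; rewrite ger0_norm.
have E : t - (t + h) = - h by ring.
have := H (t + h) t; rewrite E (ltr0_norm h0') => -> //.
  by rewrite gerDl ltW.
by move: hd; rewrite ltr0_norm.
Qed.

Lemma mdist_lip (p q r : X) : `|mdist p r - mdist q r| <= mdist p q.
Proof.
rewrite ler_norml; apply/andP; split.
  by have := metric_triangle q p r; rewrite (metric_sym q p); slra.
by have := metric_triangle p q r; slra.
Qed.

Lemma abs_continuousP g x y : abs_continuous g x y ->
  exists v : R -> R, [/\ leb.-integrable setT (EFin \o v), forall t, 0 <= v t,
    forall s t, x <= s -> s <= t -> t <= y ->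
      ((mdist (g s) (g t))%:E <= \int[leb]_(r in `[s, t]) (v r)%:E)%E &
    {ae leb, forall t, t \in `[x, y] -> mslope g t (v t)}].
Proof.
move=> [k ik gk].
have [yx|xy] := leP y x.
  exists (cst 0); split => //; first exact: integrable0.
    move=> s t xs st ty; have <- : s = t by apply/le_anti; rewrite st (le_trans ty (le_trans yx xs)).
    by rewrite mdistxx integral_ge0.
  apply: aeS2 (ae_neq x) (ae_neq y) => t tx ty; rewrite in_itv/= => /andP[xt ty'].
  move: (le_trans xt ty') yx; rewrite le_eqVlt => /predU1P[xy|]; last by rewrite ltNge => /negbTE->.
  by move=> _; case/negP: tx; rewrite eq_le xt xy ty'.
pose kap := (fun r => `|k r|) \_ `[x, y].
have kap0 r : 0 <= kap r by rewrite /kap patchE; case: ifP.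
have ikap : leb.-integrable setT (EFin \o kap).
  rewrite /kap (_ : EFin \o _ = (abse \o (EFin \o k)) \_ `[x, y]); last first.
    by apply/funext => r /=; rewrite !patchE /=; case: ifP.
  apply/integrable_restrict => //; rewrite setTI; exact: integrable_abse.
have gkap s t : x <= s -> s <= t -> t <= y ->
    ((mdist (g s) (g t))%:E <= \int[leb]_(r in `[s, t]) (kap r)%:E)%E.
  move=> xs st ty; apply: (le_trans (gk _ _ xs st ty)).
  apply: (le_trans (lee_abs _)); apply: (le_trans (le_abse_integral leb (measurable_itv _) _)).
    apply: measurable_funS (measurable_int _ ik) => // r/=.
    by rewrite !in_itv/= => /andP[/(le_trans xs)-> /le_trans->].
  apply: lower_integral_le => // r/=; rewrite in_itv/= => /andP[sr rt].
  by rewrite /kap patchE mem_set//= in_itv/= (le_trans xs sr) (le_trans rt ty).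
pose rt n : R := ratr (odflt 0%Q (choice.unpickle n)).
pose r_ n := Num.max x (Num.min y (rt n)).
have rxy n : x <= r_ n <= y.
  by rewrite /r_ le_max lexx/= ge_max (ltW xy)/= ge_min lexx.
pose a_ n t := mdist (g t) (g (r_ n)).
have a_lip n s t : `|a_ n t - a_ n s| <= mdist (g s) (g t).
  by rewrite (metric_sym (g s)); exact: mdist_lip.
have /choice[al Hal] : forall n, exists al : R -> R, leb.-integrable setT (EFin \o al) /\
    forall s t, x <= s -> s <= t -> t <= y ->
      (a_ n t - a_ n s)%:E = (\int[leb]_(r in `[s, t]) (al r)%:E)%E.
  move=> n; have [|s t xs st ty|al ? ?] := @ac_density R (a_ n) kap x y.
  - exact: integrableS ikap.
  - by apply: le_trans (gkap _ _ xs st ty); rewrite lee_fin.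
  - by exists al.
pose be n := (fun r => Num.min `|al n r| (kap r)) \_ `[x, y].
pose v r := sups (be ^~ r) 0%N.
have mkap : measurable_fun setT kap by apply/measurable_EFinP; case/integrableP: ikap.
have mbe n : measurable_fun setT (be n).
  apply/measurable_restrict => //; apply: measurable_minr; last exact: measurable_funTS.
  apply: measurableT_comp => //; apply: measurable_funTS.
  by apply/measurable_EFinP; case/integrableP: (Hal n).1.
have be_kap n r : be n r <= kap r.
  by rewrite /be patchE; case: ifP => // _; rewrite ge_min lexx orbT.
have be0 n r : 0 <= be n r.
  by rewrite /be patchE; case: ifP => // _; rewrite le_min normr_ge0 kap0.
have ubbe r : has_ubound (range (be ^~ r)).
  by exists (kap r) => _ [n _ <-].
have supE r : v r = sup (range (be ^~ r)).
  rewrite /v /sups; congr sup; apply/seteqP; split => _ [n _ <-]; first by exists n.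
  by exists n.
have bev n r : be n r <= v r.
  by rewrite supE; apply: ub_le_sup => //; exists n.
have v_kap r : v r <= kap r.
  by rewrite supE; apply: ge_sup; [exists (be 0%N r); exists 0%N|move=> _ [n _ <-]].
have v0 r : 0 <= v r by exact: le_trans (bev 0%N r).
have mv : measurable_fun setT v.
  by apply: measurable_fun_sups => // t _.
have iv : leb.-integrable setT (EFin \o v).
  apply: (le_integrable _ _ _ ikap) => //; first exact/measurable_EFinP.
  by move=> r _ /=; rewrite !ger0_norm// lee_fin.
(* outside a null set, [|al n|] is bounded by [kap], so the truncation is harmless *)
have alkap : {ae leb, forall t n, x < t < y -> deriv_at (a_ n) t (al n t) /\ `|al n t| <= kap t}.
  have [K HK] : exists K : R -> R, forall s t, s <= t ->
      (K t - K s)%:E = (\int[leb]_(r in `[s, t]) (kap r)%:E)%E.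
    exists (fun u => (\int[leb]_(r in `]-oo, u]) kap r)%R) => s t st.
    rewrite Rintegral_itvB ?bnd_simp//; last exact: integrableS ikap.
    rewrite -integral_itv_obnd_cbnd; last by apply: measurable_funTS; apply/measurable_EFinP.
    by rewrite /Rintegral fineK// integrable_fin_num//; exact: integrableS ikap.
  have := ae_foralln (fun n => ac_deriv_at (Hal n).1 (Hal n).2).
  have := @ac_deriv_at R K kap x y ikap (fun s t _ st _ => HK s t st).
  apply: aeS2 => t Kt at_ n txy; split; first exact: at_.
  apply: deriv_slope_le (at_ n txy) _ => e e0.
  have [d d0 Hd] := deriv_slope (Kt txy) e0.
  move/andP: txy => [xt ty].
  exists (Num.min d (Num.min (t - x) (y - t))) => [|h].
    by rewrite !lt_min d0 !subr_gt0 xt ty.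
  rewrite !lt_min => /and3P[hd hx hy].
  have xh : x <= t + h by move: hx; rewrite ltr_norml; slra.
  have hy' : t + h <= y by move: hy; rewrite ltr_norml; slra.
  have := Hd _ hd; rewrite (ger0_norm (kap0 _)); apply: le_trans.
  have aux p q : x <= p -> p <= q -> q <= y -> `|a_ n q - a_ n p| <= `|K q - K p|.
    move=> xp pq qy; rewrite (le_trans (a_lip _ _ _))//.
    rewrite (le_trans _ (ler_norm _))// -lee_fin HK//; exact: gkap.
  have [h0|h0] := leP 0 h; first by apply: aux => //; slra.
  by rewrite distrC (distrC (K _)); apply: aux => //; slra.
have alv : {ae leb, forall t n, x < t < y -> `|al n t| <= v t}.
  move: alkap; apply: aeS => t H n txy; apply: le_trans (bev n t).
  rewrite /be patchE mem_set/= ?in_itv/=; last by case/andP: txy => /ltW-> /ltW.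
  by rewrite le_min lexx/= (H n txy).2.
have gv s t : x <= s -> s <= t -> t <= y ->
    ((mdist (g s) (g t))%:E <= \int[leb]_(r in `[s, t]) (v r)%:E)%E.
  move=> xs st ty; apply/lee_addgt0Pr => e e0.
  have [n Hn] : exists n, mdist (g s) (g (r_ n)) <= e / 2.
    have e20 : 0 < e / 2 by slra.
    have [d d0 Hd] := integral_small ikap e20.
    have [q] := @rat_in_itvoo R (s - d) (s + d) ltac:(slra).
    rewrite in_itv/= => /andP[rd1 rd2].
    exists (choice.pickle q); rewrite -lee_fin.
    have -> : r_ (choice.pickle q) = Num.max x (Num.min y (ratr q)).
      by rewrite /r_ /rt choice.pickleK.
    have sy : s <= y by exact: le_trans ty.
    have [csr|rcs] := leP s (Num.max x (Num.min y (ratr q))).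
      have H := Hd s (Num.max x (Num.min y (ratr q))).
      rewrite (le_trans (gkap _ _ xs csr _))//; first by rewrite ge_max (ltW xy) ge_min lexx.
      apply: le_trans (H _); last first.
        by rewrite ltrBlDl gt_max gt_min rd2 orbT andbT (le_lt_trans xs)// ltrDl.
      by apply: lower_integral_le => r _; rewrite lee_fin// ler_norm.
    rewrite metric_sym (le_trans (gkap _ _ _ (ltW rcs) _))//; first by rewrite le_max lexx.
    have H := Hd (Num.max x (Num.min y (ratr q))) s.
    apply: le_trans (H _); last first.
      by rewrite ltrBlDl -ltrBlDr lt_max lt_min rd1 andbT (lt_le_trans _ sy) ?orbT// gtrBl.
    by apply: lower_integral_le => r _; rewrite lee_fin// ler_norm.
  have : (`|a_ n t - a_ n s|%:E <= \int[leb]_(r in `[s, t]) (v r)%:E)%E.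
    have mal : measurable_fun setT (al n) by apply/measurable_EFinP; case/integrableP: (Hal n).1.
    rewrite -[X in (X <= _)%E]/(`|(a_ n t - a_ n s)%:E|)%E (Hal n).2//.
    apply: (le_trans (le_abse_integral leb (measurable_itv _) _)).
      by apply: measurable_funTS; exact/measurable_EFinP.
    apply: ae_lower_integral_le_gen => //; first by move=> r _; rewrite lee_fin.
    move: alv (ae_neq s) (ae_neq t); apply: aeS3 => r Hr rs rt' /=.
    rewrite in_itv/= => /andP[sr rt'']; rewrite lee_fin Hr//.
    have sr' : s < r by rewrite lt_neqAle eq_sym rs.
    have rt3 : r < t by rewrite lt_neqAle rt'.
    by rewrite (le_lt_trans xs sr') (lt_le_trans rt3 ty).
  move=> H; apply: (@le_trans _ _ (`|a_ n t - a_ n s|%:E + e%:E)%E); last by rewrite leeD2r.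
  rewrite -EFinD lee_fin /a_; have := metric_triangle (g t) (g (r_ n)) (g s).
  rewrite (metric_sym (g t) (g s)) (metric_sym (g (r_ n))).
  have := ler_norm (mdist (g t) (g (r_ n)) - mdist (g s) (g (r_ n))); slra.
exists v; split => //.
suff : {ae leb, forall t, x < t < y -> mslope g t (v t)}.
  apply: aeS3 (ae_neq x) (ae_neq y) => t tx ty H; rewrite in_itv/= => /andP[xt ty'].
  by apply: H; rewrite !lt_neqAle xt ty' ty eq_sym tx.
have [V HV] : exists V : R -> R, forall s t, s <= t ->
      (V t - V s)%:E = (\int[leb]_(r in `[s, t]) (v r)%:E)%E.
  exists (fun u => (\int[leb]_(r in `]-oo, u]) v r)%R) => s t st.
  rewrite Rintegral_itvB ?bnd_simp//; last exact: integrableS iv.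
  rewrite -integral_itv_obnd_cbnd; last by apply: measurable_funTS; apply/measurable_EFinP.
  by rewrite /Rintegral fineK// integrable_fin_num//; exact: integrableS iv.
have := @ac_deriv_at R V v x y iv (fun s t _ st _ => HV s t st).
apply: aeS3 alkap alv => t akt alvt Vt txy e e0.
have e20 : 0 < e / 2 by slra.
have [d d0 Hd] := Vt txy _ e0.
have [n Hn] : exists n, v t - e / 2 < be n t.
  have : v t - e / 2 < v t by slra.
  rewrite {2}supE => /sup_gt[|_ [n _ <-] H]; first by exists (be 0%N t); exists 0%N.
  by exists n.
have [d' d'0 Hd'] := (akt n txy).1 _ e20.
case/andP: (txy) => xt ty.
exists (Num.min (Num.min d d') (Num.min (t - x) (y - t))) => [|u w ut tw].
  by rewrite !lt_min d0 d'0 !subr_gt0 xt ty.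
rewrite !lt_min => /andP[/andP[hd hd'] /andP[hx hy]].
have xu : x <= u by slra.
have wy : w <= y by slra.
have wu0 : 0 <= w - u by rewrite subr_ge0 (le_trans ut).
rewrite ler_norml; apply/andP; split.
  have alt : v t - e / 2 <= `|al n t|.
    rewrite (le_trans (ltW Hn))// /be patchE; case: ifP => _; last exact: normr_ge0.
    by rewrite ge_min lexx.
  have H1 := deriv_two_sided Hd' ut tw hd'.
  have H2 : (v t - e / 2) * (w - u) <= `|al n t| * (w - u) by exact: (ler_wpM2r wu0 alt).
  have := ler_normB (a_ n w - a_ n u) (a_ n w - a_ n u - al n t * (w - u)).
  rewrite opprB addrC subrK normrM (ger0_norm wu0) => H3.
  have {}H3 := le_trans (le_trans H2 H3) (lerD (a_lip n u w) H1).
  clear - H3; slra.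
rewrite lerBlDr; have := deriv_two_sided Hd ut tw hd.
rewrite ler_norml => /andP[_ H1].
have H2 : mdist (g u) (g w) <= V w - V u.
  by rewrite -lee_fin HV ?(le_trans ut)//; exact: gv (le_trans ut tw) _.
by apply: (le_trans H2); clear - H1; slra.
Qed.

End metric_derivative.

(** * The energy of a curve and its dyadic sums *)

Section step_functions.
Context (R : realType).
Local Notation leb := (@lebesgue_measure R).
Implicit Types (c : nat -> R) (K L : nat) (t : R).

Lemma integral_cst_itv (c s t : R) : s <= t ->
  (\int[leb]_(r in `[s, t]) c%:E = (c * (t - s))%:E)%E.
Proof.
move=> st; rewrite integral_cst//.
have lst : leb `[s, t] = (t - s)%:E.
  rewrite lebesgue_measure_itv/= lte_fin lt_neqAle st andbT.
  by case: eqVneq => [->|_]; rewrite ?subrr// -EFinD.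
by rewrite [RHS]EFinM; apply: (eq_trans (congr1 (mule c%:E) lst)).
Qed.

Definition step K c t : R := if 0 <= t < 1 then c (Num.truncn (K%:R * t)) else 0.

Definition cell K i : set R := `[i%:R / K%:R, i.+1%:R / K%:R[%classic.

Lemma measurable_cell K i : measurable (cell K i).
Proof. exact: measurable_itv. Qed.

Lemma lebesgue_cell K i : (0 < K)%N -> leb (cell K i) = (K%:R^-1)%:E.
Proof.
move=> K0; have K0' : 0 < K%:R :> R by rewrite ltr0n.
rewrite /cell lebesgue_measure_itv/= lte_fin ltr_pM2r ?invr_gt0// ltr_nat ltnSn.
by rewrite -EFinD -mulrBl -natrB// subSnn mul1r.
Qed.

Lemma cellP K i t : (0 < K)%N -> 0 <= t -> cell K i t <-> Num.truncn (K%:R * t) = i.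
Proof.
move=> K0 t0; have K0' : 0 < K%:R :> R by rewrite ltr0n.
rewrite /cell/= in_itv/= ler_pdivrMr// ltr_pdivlMr// (mulrC t).
split=> [/truncn_def//|<-]; exact: (truncn_itv (mulr_ge0 (ltW K0') t0)).
Qed.

Lemma cell01 K i t : (i < K)%N -> cell K i t -> 0 <= t < 1.
Proof.
move=> iK; have K0 : 0 < K%:R :> R by rewrite ltr0n (leq_ltn_trans _ iK).
rewrite /cell/= in_itv/= => /andP[it ti]; apply/andP; split.
  by apply: le_trans it; rewrite divr_ge0// ltW.
by apply: (lt_le_trans ti); rewrite ler_pdivrMr// mul1r ler_nat.
Qed.

Lemma trunc_lt K t : 0 <= t < 1 -> (0 < K)%N -> (Num.truncn (K%:R * t) < K)%N.
Proof.
move=> /andP[t0 t1] K0; rewrite truncn_lt_nat ?mulr_ge0//.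
by rewrite gtr_pMr// ltr0n.
Qed.

Lemma stepE K c t : (0 < K)%N ->
  step K c t = \sum_(i < K) c i * \1_(cell K i) t.
Proof.
move=> K0; rewrite /step; case: ifPn => [t01|t01]; last first.
  rewrite big1// => i _; rewrite indicE memNset ?mulr0// => /(cell01 (ltn_ord i)).
  exact/negP.
rewrite (bigD1 (Ordinal (trunc_lt t01 K0)))//= big1 ?addr0 => [|i ineq].
  rewrite indicE mem_set ?mulr1//; apply/cellP => //.
  by case/andP: (t01).
rewrite indicE memNset ?mulr0//.
case/andP: (t01) => t0 t1 /(cellP _ K0 t0) E.
by move: ineq; rewrite -val_eqE/= E eqxx.
Qed.

Lemma measurable_step K c : (0 < K)%N -> measurable_fun setT (step K c).
Proof.
move=> K0; rewrite (_ : step K c = fun t => \sum_(i < K) c i * \1_(cell K i) t); last first.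
  by apply/funext => t; exact: stepE.
apply: measurable_sum => i; apply: measurable_funM => //.
by apply: measurable_indic; exact: measurable_cell.
Qed.

Lemma integral_step K c : (0 < K)%N -> (forall i, 0 <= c i) ->
  (\int[leb]_t (step K c t)%:E = (K%:R^-1 * \sum_(i < K) c i)%:E)%E.
Proof.
move=> K0 c0; have K0' : 0 < K%:R :> R by rewrite ltr0n.
under eq_integral do rewrite stepE// -sumEFin.
rewrite ge0_integral_sum//; last 2 first.
- move=> i; apply/measurable_EFinP; apply: measurable_funM => //.
  by apply: measurable_indic; exact: measurable_cell.
- by move=> i t _; rewrite lee_fin mulr_ge0.
rewrite mulr_sumr -sumEFin; apply: eq_bigr => i _.
under eq_integral do rewrite EFinM.
rewrite ge0_integralZl_EFin//; last first.
  by apply/measurable_EFinP; by apply: measurable_indic; exact: measurable_cell.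
rewrite integral_indic//; last exact: measurable_cell.
rewrite setIT; apply: (eq_trans (congr1 (mule (c i)%:E) (lebesgue_cell i K0))).
by rewrite -EFinM mulrC.
Qed.

Lemma step_refine K L c t : (0 < K)%N -> (0 < L)%N ->
  step K c t = step (K * L) (fun j => c (j %/ L)%N) t.
Proof.
move=> K0 L0; rewrite /step; case: ifPn => // /andP[t0 t1]; congr c.
have L0' : 0 < L%:R :> R by rewrite ltr0n.
have /andP[] := @truncn_itv R ((K * L)%:R * t) ltac:(by rewrite mulr_ge0).
set j := Num.truncn _ => jl jr; apply: truncn_def; apply/andP; split.
  rewrite -(ler_pM2r L0') -natrM mulrAC -natrM (le_trans _ jl)// ler_nat.
  exact: leq_trunc_div.
rewrite -(ltr_pM2r L0') -natrM mulrAC -natrM (lt_le_trans jr)// ler_nat.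
by rewrite ltn_ceil.
Qed.

End step_functions.

Lemma sum_blocks (V : nmodType) N K L (F : nat -> V) : N = (K * L)%N ->
  \sum_(j < N) F j = \sum_(i < K) \sum_(l < L) F (i * L + l)%N.
Proof.
move=> ->; elim: K => [|K IH]; first by rewrite !big_ord0.
by rewrite big_ord_recr/= -IH mulSn addnC big_split_ord.
Qed.

Section energy.
Context (R : realType) (X : completeMetricType R).
Local Notation leb := (@lebesgue_measure R).
Implicit Types (g : R -> X) (s t x y z : R).

Lemma speed_ge0 g t : 0 <= speed g t.
Proof.
rewrite /speed; set f := (X in lim (X @ _)).
have [cf|/dvgP->] := pselect (cvg (f @ 0^')); last by [].
by apply: limr_ge => //; apply: nearW => h; rewrite divr_ge0// mdist_ge0.
Qed.

Lemma abs_continuousW g x y s t : x <= s -> t <= y ->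
  abs_continuous g x y -> abs_continuous g s t.
Proof.
move=> xs ty [k ik gk]; exists k => [|u v su uv vt].
  apply: integrableS ik => // r/=; rewrite !in_itv/= => /andP[/(le_trans xs)-> /le_trans->//].
by apply: gk; [exact: le_trans su|by []|exact: le_trans ty].
Qed.

Lemma energy_ge0 g x y : (0 <= energy g x y)%E.
Proof.
rewrite /energy; case: ifP => // _; apply: integral_ge0 => t _.
by rewrite lee_fin sqr_ge0.
Qed.

Lemma energyE g x y : abs_continuous g x y ->
  energy g x y = (\int[leb]_(t in `[x, y]) ((speed g t) ^+ 2)%:E)%E.
Proof. by move=> ac; rewrite /energy asboolT. Qed.

(** The Cauchy-Schwarz inequality, integrated from
    [2 c v <= c ^+ 2 + v ^+ 2] with [c] the average speed. *)
Lemma energy_ge g s t : s < t ->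
  ((mdist (g s) (g t) ^+ 2 / (t - s))%:E <= energy g s t)%E.
Proof.
move=> st; rewrite /energy; case: ifPn => [/asboolP ac|_]; last by rewrite leey.
have [v [iv v0 gv sv]] := abs_continuousP ac.
have ts0 : 0 < t - s by rewrite subr_gt0.
have mv : measurable_fun setT v by apply/measurable_EFinP; case/integrableP: iv.
pose D := mdist (g s) (g t); pose c := D / (t - s).
have c0 : 0 <= c by rewrite divr_ge0 ?mdist_ge0// ltW.
have -> : (\int[leb]_(r in `[s, t]) ((speed g r) ^+ 2)%:E =
           \int[leb]_(r in `[s, t]) ((v r) ^+ 2)%:E)%E.
  apply: ae_eq_lower_integral => //.
  - by move=> r _; rewrite lee_fin sqr_ge0.
  - by move=> r _; rewrite lee_fin sqr_ge0.
  by move: sv; apply: aeS => r H /= /H/mslope_speed ->.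
have H : ((2 * c)%:E * (\int[leb]_(r in `[s, t]) (v r)%:E) <=
   (c ^+ 2 * (t - s))%:E + \int[leb]_(r in `[s, t]) ((v r) ^+ 2)%:E)%E.
  have -> : (c ^+ 2 * (t - s))%:E = (\int[leb]_(r in `[s, t]) (c ^+ 2)%:E)%E.
    by rewrite integral_cst_itv// ltW.
  rewrite -ge0_integralZl_EFin//; last 3 first.
  - by move=> r _; rewrite lee_fin.
  - by apply/measurable_funTS/measurable_EFinP.
  - by rewrite mulr_ge0.
  rewrite -ge0_integralD//; last 3 first.
  - by move=> r _; rewrite lee_fin sqr_ge0.
  - by move=> r _; rewrite lee_fin sqr_ge0.
  - by apply/measurable_funTS/measurable_EFinP; exact: measurable_funX.
  apply: lower_integral_le => r _.
    by rewrite -EFinM lee_fin (mulr_ge0 (mulr_ge0 _ c0))// v0.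
  rewrite -EFinM -EFinD lee_fin.
  by have := sqr_ge0 (c - v r); rewrite sqrrB mulr_natl; slra.
have := gv s t (lexx _) (ltW st) (lexx _); rewrite -/D => DI.
have : ((2 * c * D)%:E <= (c ^+ 2 * (t - s))%:E + \int[leb]_(r in `[s, t]) ((v r) ^+ 2)%:E)%E.
  apply: le_trans H; rewrite (EFinM (2 * c)); apply: lee_wpmul2l => //.
  by rewrite lee_fin mulr_ge0.
have E1 : c ^+ 2 * (t - s) = c * D by rewrite /c; field; rewrite gt_eqF.
have E2 : D ^+ 2 / (t - s) = c * D by rewrite /c; field; rewrite gt_eqF.
rewrite E1 E2 -leeBlDl// -EFinB; apply: le_trans; rewrite lee_fin; slra.
Qed.

Lemma energy_split g x z y : x <= z -> z <= y ->
  (energy g x z + energy g z y <= energy g x y)%E.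
Proof.
move=> xz zy; rewrite {3}/energy; case: ifPn => [/asboolP ac|_]; last by rewrite leey.
rewrite !energyE; [|exact: abs_continuousW ac|exact: abs_continuousW ac].
have [v [iv v0 gv sv]] := abs_continuousP ac.
have mv : measurable_fun setT v by apply/measurable_EFinP; case/integrableP: iv.
have vE a b : x <= a -> b <= y ->
  (\int[leb]_(t in `[a, b]) ((speed g t) ^+ 2)%:E = \int[leb]_(t in `[a, b]) ((v t) ^+ 2)%:E)%E.
  move=> xa yb; apply: ae_eq_lower_integral => //.
  - by move=> r _; rewrite lee_fin sqr_ge0.
  - by move=> r _; rewrite lee_fin sqr_ge0.
  move: sv; apply: aeS => r H /=; rewrite in_itv/= => /andP[ar rb].
  by rewrite (mslope_speed (H _))// in_itv/= (le_trans xa ar) (le_trans rb yb).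
have mv2 A : measurable_fun A (fun t => (v t ^+ 2)%:E).
  by apply: measurable_funTS; apply/measurable_EFinP; exact: measurable_funX.
rewrite !vE// (_ : `[x, y]%classic = `[x, z]%classic `|` `]z, y]%classic); last first.
  by rewrite -itv_bndbnd_setU// bnd_simp.
rewrite ge0_integral_setU//=; last 3 first.
- exact: mv2.
- by move=> r _; rewrite lee_fin sqr_ge0.
- apply/disj_setPS => r []/=; rewrite !in_itv/= => /andP[_ rz] /andP[zr _].
  by move: zr; rewrite ltNge rz.
by rewrite integral_itv_obnd_cbnd.
Qed.

Definition denergy g n : R := \sum_(i < 2 ^ n)
  (2 ^ n)%:R * mdist (g (i%:R / (2 ^ n)%:R)) (g (i.+1%:R / (2 ^ n)%:R)) ^+ 2.

Lemma denergy_le g n : ((denergy g n)%:E <= energy g 0 1)%E.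
Proof.
set K := (2 ^ n)%N; have K0 : 0 < K%:R :> R by rewrite ltr0n expn_gt0.
have step_ (j : nat) : ((\sum_(i < j) K%:R *
    mdist (g (i%:R / K%:R)) (g (i.+1%:R / K%:R)) ^+ 2)%:E <=
    energy g 0 (j%:R / K%:R))%E.
  elim: j => [|j IH]; first by rewrite big_ord0 energy_ge0.
  rewrite big_ord_recr/= EFinD.
  apply: le_trans (energy_split g (z := j%:R / K%:R) _ _); last 2 first.
  - by rewrite divr_ge0// ltW.
  - by rewrite ler_pM2r ?invr_gt0// ler_nat.
  apply: leeD => //; have := @energy_ge g (j%:R / K%:R) (j.+1%:R / K%:R).
  rewrite ltr_pM2r ?invr_gt0// ltr_nat ltnSn => /(_ isT); apply: le_trans.
  by rewrite -mulrBl -natrB// subSnn mul1r invrK mulrC.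
by have := step_ K; rewrite divff ?gt_eqF.
Qed.

Lemma mdist_chain (p : nat -> X) m n : (m <= n)%N ->
  mdist (p m) (p n) <= \sum_(m <= i < n) mdist (p i) (p i.+1).
Proof.
elim: n => [|n IH]; first by rewrite leqn0 => /eqP->; rewrite mdistxx big_nil.
rewrite leq_eqVlt => /predU1P[->|]; first by rewrite mdistxx big_geq.
rewrite ltnS => mn; rewrite big_nat_recr//=.
by rewrite (le_trans (metric_triangle _ (p n) _))// lerD2r IH.
Qed.

Lemma variance_le (L : nat) (x : nat -> R) a : (0 < L)%N -> 0 <= a ->
  a <= L%:R^-1 * \sum_(l < L) x l ->
  \sum_(l < L) (x l - a) ^+ 2 <= \sum_(l < L) x l ^+ 2 - L%:R * a ^+ 2.
Proof.
move=> L0 a0 ax; have L0' : 0 < L%:R :> R by rewrite ltr0n.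
have aS : L%:R * a <= \sum_(l < L) x l.
  by move: ax; rewrite mulrC ler_pdivlMr// mulrC.
have -> : \sum_(l < L) (x l - a) ^+ 2 =
    \sum_(l < L) x l ^+ 2 - 2 * a * (\sum_(l < L) x l) + L%:R * a ^+ 2.
  have -> : L%:R * a ^+ 2 = \sum_(l < L) a ^+ 2.
    by rewrite sumr_const card_ord mulr_natl.
  rewrite mulr_sumr -sumrB -big_split/=; apply: eq_bigr => l _; ring.
have := ler_wpM2l a0 aS; move: (\sum_(l < L) x l) (\sum_(l < L) x l ^+ 2) => S1 S2.
have -> : a * (L%:R * a) = L%:R * a ^+ 2 by ring.
slra.
Qed.

End energy.

Section finite_energy.
Context (R : realType) (X : completeMetricType R).
Local Notation leb := (@lebesgue_measure R).
Variables (g : R -> X) (M : R).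
Implicit Types (s t : R) (n i j : nat).

Definition continuous01 := forall t : R, 0 <= t <= 1 -> forall e : R, 0 < e ->
  exists2 d : R, 0 < d & forall s : R, 0 <= s <= 1 -> `|s - t| < d ->
    mdist (g s) (g t) <= e.

Let K n := (2 ^ n)%N.
Let K0 n : (0 < K n)%N. Proof. by rewrite expn_gt0. Qed.
Let K0' n : 0 < (K n)%:R :> R. Proof. by rewrite ltr0n. Qed.

Let pt n i := g (i%:R / (K n)%:R).
Let c n i : R := (K n)%:R * mdist (pt n i) (pt n i.+1).
Let c0 n i : 0 <= c n i. Proof. by rewrite mulr_ge0 ?mdist_ge0. Qed.

Let f n := step (K n) (c n).

Let f0 n t : 0 <= f n t. Proof. by rewrite /f /step; case: ifP. Qed.

Let denergyE n : denergy g n = (K n)%:R^-1 * \sum_(i < K n) c n i ^+ 2.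
Proof.
rewrite /denergy mulr_sumr; apply: eq_bigr => i _.
rewrite /c -/(K n) -/(pt n i) -/(pt n i.+1); field.
by rewrite gt_eqF.
Qed.

(* The distance in L2 between two levels of the dyadic difference quotients. *)
Let c_variance m n : (m <= n)%N ->
  (K n)%:R^-1 * \sum_(i < K n) (c n i - c m (i %/ K (n - m))) ^+ 2 <=
  denergy g n - denergy g m.
Proof.
move=> mn; set L := K (n - m); have KL : K n = (K m * L)%N.
  by rewrite /K /L /K -expnD subnKC.
have L0 : (0 < L)%N := K0 _.
have -> : denergy g n - denergy g m = (K n)%:R^-1 *
    (\sum_(i < K m) (\sum_(l < L) c n (i * L + l)%N ^+ 2 - L%:R * c m i ^+ 2)).
  rewrite !denergyE sumrB mulrBr -mulr_sumr; congr (_ - _).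
    by congr (_ * _); exact: (sum_blocks (fun i => c n i ^+ 2) KL).
  by rewrite mulrA KL natrM invfM -(mulrA _ L%:R^-1) mulVf ?mulr1// pnatr_eq0 -lt0n.
rewrite ler_wpM2l ?invr_ge0//.
rewrite (sum_blocks (fun i => (c n i - c m (i %/ L)) ^+ 2) KL).
apply: ler_sum => i _.
have -> : \sum_(l < L) (c n (i * L + l) - c m ((i * L + l) %/ L)) ^+ 2 =
          \sum_(l < L) (c n (i * L + l) - c m i) ^+ 2.
  by apply: eq_bigr => l _; rewrite divnMDl// divn_small// addn0.
apply: (@variance_le R L (fun l => c n (i * L + l)%N)) => //.
rewrite /c -mulr_sumr KL natrM -mulrA mulrA (mulrC L%:R^-1) -!mulrA.
rewrite ler_pM2l// [leRHS]mulrC divfK ?pnatr_eq0 -?lt0n//.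
have -> : pt m i = pt n (i * L + 0)%N.
  rewrite /pt addn0; congr g; rewrite KL !natrM; field.
  by rewrite !pnatr_eq0 -!lt0n L0 K0.
have -> : pt m i.+1 = pt n (i * L + L)%N.
  rewrite /pt; congr g; rewrite KL -mulSnr !natrM; field.
  by rewrite !pnatr_eq0 -!lt0n L0 K0.
have := mdist_chain (fun l => pt n (i * L + l)) (leq0n L).
by rewrite big_mkord => H; apply: (le_trans H); apply: ler_sum => l _; rewrite addnS.
Qed.

Hypothesis g_cont : continuous01.
Hypothesis g_fin : forall n, denergy g n <= M.

Let nd_denergy m n : (m <= n)%N -> denergy g m <= denergy g n.
Proof.
move=> mn; rewrite -subr_ge0 (le_trans _ (c_variance mn))// mulr_ge0 ?invr_ge0//.
by apply: sumr_ge0 => i _; rewrite sqr_ge0.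
Qed.

(* Levels along which the difference quotients converge fast in L1. *)
Let levels : exists n_ : nat -> nat, [/\ forall j, (j <= n_ j)%N,
  forall j, (n_ j <= n_ j.+1)%N &
  forall j, denergy g (n_ j.+1) - denergy g (n_ j) <= ((2 ^+ j)^-1) ^+ 2].
Proof.
pose E := range (denergy g).
have supE : has_sup E by split; [exists (denergy g 0); exists 0%N|exists M => _ [n _ <-]].
have /choice[N HN] j : exists n, sup E - (((2 ^+ j)^-1) ^+ 2 : R) < denergy g n.
  have : sup E - ((2 ^+ j)^-1) ^+ 2 < sup E by rewrite gtrBl exprn_gt0// invr_gt0 exprn_gt0.
  by move=> /(sup_gt supE.1)[_ [n _ <-]]; exists n.
exists (fun j => \sum_(i < j.+1) (N i).+1)%N; split => j.
- elim: j => // j IH; rewrite big_ord_recr/=.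
  by apply: (leq_trans _ (leq_add IH (leqnn _))); rewrite addnS ltnS leq_addr.
- by rewrite [leqRHS]big_ord_recr/= leq_addr.
have := HN j; set a := (\sum_(i < j.+1) _)%N; set b := (\sum_(i < j.+2) _)%N.
have : denergy g (N j) <= denergy g a.
  by apply: nd_denergy; rewrite /a big_ord_recr/= addnS ltnW// ltnS leq_addl.
have : denergy g b <= sup E by apply: ub_le_sup; [exact: supE.2|exists b].
slra.
Qed.

Let pt_sum (m n p : nat) : (m <= n <= K p)%N ->
  ((mdist (pt p m) (pt p n))%:E <= \int[leb]_(r in `[(m%:R / (K p)%:R)%R, (n%:R / (K p)%:R)%R]) (f p r)%:E)%E.
Proof.
move=> /andP[mn nK].
pose c' i : R := if (m <= i < n)%N then c p i else 0.
have c'0 i : 0 <= c' i by rewrite /c'; case: ifP.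
apply: (@le_trans _ _ (\int[leb]_r (step (K p) c' r)%:E)%E).
  rewrite integral_step// lee_fin (le_trans (mdist_chain _ mn))//.
  rewrite big_geq_mkord (big_ord_widen_cond (K p) _ (fun i => mdist (pt p i) (pt p i.+1)))//.
  rewrite mulr_sumr big_mkcond/=; apply: ler_sum => i _; rewrite /c' /c.
  by case: ifP; rewrite ?mulr0// mulKf// gt_eqF.
rewrite [leRHS]integral_mkcond; apply: lower_integral_le => r _.
  by rewrite lee_fin /step; case: ifP.
rewrite /step patchE; case: ifPn => [/andP[r0 r1]|_]; last first.
  by case: ifP => //; rewrite lee_fin f0.
rewrite /c'; case: ifPn => [/andP[mi ni]|_]; last by case: ifP => //; rewrite lee_fin f0.
rewrite mem_set/=; last first.
  have := (cellP _ (K0 p) r0).2 erefl; rewrite /cell/= !in_itv/= => /andP[ir ri].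
  rewrite (le_trans _ ir) ?ler_pM2r ?invr_gt0 ?ler_nat//=.
  by rewrite (le_trans (ltW ri))// ler_pM2r ?invr_gt0// ler_nat.
by rewrite lee_fin /f /step r0 r1.
Qed.

Lemma finite_energy_ac : abs_continuous g 0 1.
Proof.
have [n_ [n_ge n_nd n_fast]] := levels.
pose D j t := `|f (n_ j.+1) t - f (n_ j) t|.
pose dc j i : R := `|c (n_ j.+1) i - c (n_ j) (i %/ K (n_ j.+1 - n_ j))|.
have DE j t : D j t = step (K (n_ j.+1)) (dc j) t.
  rewrite /D /f (@step_refine R (K (n_ j)) (K (n_ j.+1 - n_ j)))//.
  rewrite (_ : (K (n_ j) * K (n_ j.+1 - n_ j))%N = K (n_ j.+1)).
    by rewrite /step; case: ifP => // _; rewrite subrr normr0.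
  by rewrite /K -expnD subnKC.
have mf n : measurable_fun setT (f n) by exact: measurable_step.
have mD j : measurable_fun setT (D j).
  by apply: measurableT_comp => //; exact: measurable_funB.
have intD j : (\int[leb]_t (D j t)%:E <= ((2 ^+ j)^-1)%:E)%E.
  under eq_integral do rewrite DE.
  rewrite integral_step//= ?lee_fin; last by move=> i; exact: normr_ge0.
  set eta := (2 ^+ j)^-1; have eta0 : 0 < eta by rewrite invr_gt0 exprn_gt0.
  set k := (K (n_ j.+1))%:R^-1; have k0 : 0 <= k by rewrite invr_ge0.
  have kS : k * \sum_(i < K (n_ j.+1)) (dc j i) ^+ 2 <= eta ^+ 2.
    apply: le_trans (n_fast j); apply: le_trans (c_variance (n_nd j)).
    rewrite le_eqVlt; apply/orP; left; apply/eqP; congr (_ * _).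
    by apply: eq_bigr => i _; rewrite /dc real_normK ?num_real.
  have H : k * \sum_(i < K (n_ j.+1)) dc j i <=
      k * \sum_(i < K (n_ j.+1)) (2^-1 * (eta + eta^-1 * dc j i ^+ 2)).
    rewrite ler_wpM2l//; apply: ler_sum => i _.
    rewrite -subr_ge0 (_ : _ - _ = 2^-1 * eta^-1 * (eta - dc j i) ^+ 2); last first.
      by field; rewrite gt_eqF.
    by rewrite mulr_ge0 ?sqr_ge0// mulr_ge0// invr_ge0 ltW.
  apply: (le_trans H); rewrite -mulr_sumr big_split/= -mulr_sumr sumr_const card_ord.
  rewrite -[eta *+ _]mulr_natr.
  have -> : k * (2^-1 * (eta * (K (n_ j.+1))%:R + eta^-1 * \sum_(i < K (n_ j.+1)) dc j i ^+ 2)) =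
      2^-1 * (eta + eta^-1 * (k * \sum_(i < K (n_ j.+1)) dc j i ^+ 2)).
    by rewrite /k; field; rewrite !gt_eqF.
  have : eta^-1 * (k * \sum_(i < K (n_ j.+1)) dc j i ^+ 2) <= eta.
    by rewrite ler_pdivrMl// -expr2.
  slra.
pose G t : \bar R := ((f (n_ 0%N) t)%:E + \sum_(0 <= j <oo) (D j t)%:E)%E.
have G0 t : (0 <= G t)%E.
  by rewrite adde_ge0 ?lee_fin ?f0// nneseries_ge0// => j _ _; rewrite lee_fin normr_ge0.
have fG J t : ((f (n_ J) t)%:E <= G t)%E.
  apply: (@le_trans _ _ ((f (n_ 0%N) t)%:E + (\sum_(0 <= j < J) D j t)%:E)%E).
    rewrite -EFinD lee_fin; elim: J => [|J IH]; first by rewrite big_geq ?addr0.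
    rewrite big_nat_recr//= addrA; have := ler_norm (f (n_ J.+1) t - f (n_ J) t).
    by rewrite -/(D J t); slra.
  rewrite /G leeD2l// -sumEFin; apply: nneseries_lim_ge => j _ _.
  by rewrite lee_fin normr_ge0.
have mG : measurable_fun setT G.
  apply: emeasurable_funD; first exact/measurable_EFinP.
  apply: ge0_emeasurable_sum => //= j; first by move=> t _ _; rewrite lee_fin normr_ge0.
  by move=> _; apply/measurable_EFinP; exact: mD.
have iG : leb.-integrable setT G.
  apply/integrableP; split => //; under eq_integral do rewrite gee0_abs//.
  rewrite ge0_integralD//; last 4 first.
  - by move=> t _; rewrite lee_fin f0.
  - by apply/measurable_EFinP; exact: mf.
  - by move=> t _; apply: nneseries_ge0 => j _ _; rewrite lee_fin normr_ge0.
  - apply: ge0_emeasurable_sum => //= j; first by move=> t _ _; rewrite lee_fin normr_ge0.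
    by move=> _; apply/measurable_EFinP; exact: mD.
  rewrite integral_step// integral_nneseries//; last 2 first.
  - by move=> j; apply/measurable_EFinP; exact: mD.
  - by move=> j t _; rewrite lee_fin normr_ge0.
  apply: lte_add_pinfty; first by rewrite ltry.
  apply: (@le_lt_trans _ _ 2%:E); last by rewrite ltry.
  apply: lime_le; first by apply: is_cvg_nneseries => j _ _; apply: integral_ge0 => t _; rewrite lee_fin normr_ge0.
  apply: nearW => J; apply: (@le_trans _ _ (\sum_(0 <= j < J) (2 ^+ j)^-1)%:E).
    by rewrite -sumEFin; apply: lee_sum => j _; exact: intD.
  rewrite lee_fin; suff : \sum_(0 <= j < J) (2 ^+ j)^-1 = 2 - 2 * (2 ^+ J)^-1 :> R.
    by move=> ->; rewrite gerBl mulr_ge0// invr_ge0 exprn_ge0.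
  elim: J => [|J IH]; first by rewrite big_geq// expr0 invr1 mulr1 subrr.
  rewrite big_nat_recr//= IH exprS; field.
  by rewrite expf_neq0.
have ptG s t e : 0 <= s -> s < t -> t <= 1 -> 0 < e ->
    ((mdist (g s) (g t))%:E <= \int[leb]_(r in `[s, t]) G r + e%:E)%E.
  move=> s0 st t1 e0; have e20 : 0 < e / 2 by slra.
  have s01 : 0 <= s <= 1 by rewrite s0 (le_trans (ltW st)).
  have t01 : 0 <= t <= 1 by rewrite t1 (le_trans s0 (ltW st)).
  have [d d0 Hd] := g_cont s01 e20; have [d' d'0 Hd'] := g_cont t01 e20.
  pose eps := Num.min ((t - s) / 2) (Num.min d d').
  have eps0 : 0 < eps by rewrite !lt_min divr_gt0 ?subr_gt0// d0 d'0.
  have [J HJ] : exists J, ((K (n_ J))%:R)^-1 < eps.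
    exists (Num.truncn eps^-1).+1; set J := _.+1.
    rewrite invf_plt ?posrE//; have := truncnS_gt eps^-1; rewrite -/J => /lt_le_trans; apply.
    by rewrite ler_nat (leq_trans (n_ge J))// ltnW// ltn_expl.
  move: HJ; set k := (K (n_ J))%:R^-1; rewrite !lt_min => /and3P[k1 k2 k3].
  have k0 : 0 < k by rewrite invr_gt0.
  pose p := (Num.truncn ((K (n_ J))%:R * s)).+1; pose q := Num.truncn ((K (n_ J))%:R * t).
  have ps : s < p%:R * k by rewrite /k ltr_pdivlMr// mulrC /p truncnS_gt.
  have ps' : p%:R * k <= s + k.
    rewrite /p -natr1 mulrDl mul1r lerD2r /k ler_pdivrMr// mulrC truncn_le.
    by rewrite mulr_ge0.
  have qt : q%:R * k <= t.
    by rewrite /k ler_pdivrMr// mulrC truncn_le mulr_ge0// (le_trans s0 (ltW st)).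
  have qt' : t - k < q%:R * k.
    by rewrite ltrBlDr -[X in _ + X]mul1r -mulrDl natr1 /k ltr_pdivlMr// mulrC truncnS_gt.
  have pq : p%:R * k <= q%:R * k by slra.
  have qK : (q <= K (n_ J))%N.
    by rewrite -(ler_nat R) -(ler_pM2r k0) mulfV ?gt_eqF// (le_trans qt).
  have := @pt_sum p q (n_ J); rewrite qK andbT -(ler_nat R) -(ler_pM2r k0) pq => /(_ isT) H.
  have {}H : ((mdist (pt (n_ J) p) (pt (n_ J) q))%:E <= \int[leb]_(r in `[s, t]) G r)%E.
    apply: (le_trans H); rewrite [leLHS]integral_mkcond [leRHS]integral_mkcond.
    apply: lower_integral_le => r _; first by rewrite patchE; case: ifP => // _; rewrite lee_fin f0.
    rewrite !patchE; case: ifPn => [/set_mem/=|_]; last by case: ifP.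
    rewrite in_itv/= => /andP[pr rq]; rewrite mem_set/= ?fG// in_itv/=.
    by rewrite (le_trans (ltW ps) pr) (le_trans rq qt).
  have H1 : mdist (pt (n_ J) p) (g s) <= e / 2.
    apply: (Hd (p%:R * k)); first by apply/andP; split; slra.
    by rewrite ger0_norm ?subr_ge0; slra.
  have H2 : mdist (pt (n_ J) q) (g t) <= e / 2.
    apply: (Hd' (q%:R * k)); first by apply/andP; split; slra.
    by rewrite ler0_norm ?subr_le0; slra.
  apply: (@le_trans _ _ (mdist (pt (n_ J) p) (pt (n_ J) q) + e)%:E).
    rewrite lee_fin; have := metric_triangle (g s) (pt (n_ J) p) (g t).
    have := metric_triangle (pt (n_ J) p) (pt (n_ J) q) (g t).
    rewrite (metric_sym (g s) (pt _ _)); lra.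
  by rewrite EFinD leeD2r.
exists (fine \o G).
  have iG01 : leb.-integrable `[0, 1] G by exact: integrableS iG.
  apply: le_integrable iG01 => //.
    by apply/measurable_EFinP; apply: measurableT_comp => //; exact: measurable_funTS.
  by move=> t _ /=; case: (G t) (G0 t) => [r||]//= _; exact: leey.
move=> s t s0 st t1.
have [<-|st'] := eqVneq s t; first by rewrite mdistxx integral_ge0// => r _; rewrite lee_fin fine_ge0.
have {}st : s < t by rewrite lt_neqAle st' st.
apply: (@le_trans _ _ (\int[leb]_(r in `[s, t]) G r)%E).
  by apply/lee_addgt0Pr => e e0; exact: ptG.
apply: ae_lower_integral_le_gen => //; first by move=> r _; rewrite lee_fin fine_ge0.
have := integrable_ae measurableT iG; apply: aeS => r /(_ I) Gfin _ /=.
by rewrite fineK.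
Qed.

Lemma finite_energy : (energy g 0 1 <= M%:E)%E.
Proof.
have ac := finite_energy_ac; have [v [iv v0 gv sv]] := abs_continuousP ac.
have mf n : measurable_fun setT (f n) by exact: measurable_step.
have fv : {ae leb, forall t, t \in `[0, 1] -> f n t @[n --> \oo] --> v t}.
  apply: aeS2 sv (ae_neq 1) => t H t1 t01; have {}H := H t01.
  move: t01; rewrite in_itv/= => /andP[t0]; rewrite le_eqVlt (negbTE t1)/= => {}t1.
  apply/cvgrPdist_le => /= e e0; have [d d0 Hd] := H e e0.
  exists (Num.truncn d^-1).+1 => // n /= nd.
  have Kd : (K n)%:R^-1 < d.
    rewrite invf_plt ?posrE//; have := truncnS_gt d^-1 => /lt_le_trans; apply.
    by rewrite ler_nat (leq_trans nd)// ltnW// ltn_expl.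
  have := (cellP _ (K0 n) t0).2 erefl; rewrite /cell/= in_itv/= => /andP[ut tw].
  have E : (Num.truncn ((K n)%:R * t)).+1%:R / (K n)%:R -
     (Num.truncn ((K n)%:R * t))%:R / (K n)%:R = (K n)%:R^-1 :> R.
    by rewrite -mulrBl -natrB// subSnn mul1r.
  have := Hd _ _ ut (ltW tw); rewrite E => /(_ Kd).
  rewrite /f /step t0 t1/= /c /pt distrC => HK.
  rewrite -(ler_pM2r (_ : 0 < (K n)%:R^-1)) ?invr_gt0//; apply: le_trans HK.
  rewrite -[X in _ * X](@ger0_norm _ (K n)%:R^-1) ?invr_ge0// -normrM mulrBl.
  by rewrite [(K n)%:R * mdist _ _]mulrC mulfK ?gt_eqF.
rewrite energyE//.
apply: (@le_trans _ _ (\int[leb]_(t in `[0%R, 1%R]) limn_einf (fun n => (f n t ^+ 2)%:E))%E).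
  apply: ae_lower_integral_le_gen => //.
  - by move=> t _; rewrite lee_fin sqr_ge0.
  - move=> t _; rewrite limn_einf_lim; apply: lime_ge; first exact: is_cvg_einfs.
    apply: nearW => n; apply: le_ereal_inf_tmp => _ [k _ <-].
    by rewrite lee_fin sqr_ge0.
  apply: aeS2 sv fv => t sv_ fv_ /= t01; rewrite (mslope_speed (sv_ t01)).
  have H : (f n t ^+ 2)%:E @[n --> \oo] --> (v t ^+ 2)%:E.
    by apply/cvg_EFin; [exact: nearW|apply: cvgM; exact: fv_].
  by rewrite (cvg_limn_einf_sup H).
have mf2 n : measurable_fun setT (fun t => (f n t ^+ 2)%:E).
  by apply/measurable_EFinP; exact: measurable_funX.
apply: (le_trans (fatou leb (measurable_itv _) (fun n => measurable_funTS (mf2 n)) _)).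
  by move=> n t _; rewrite lee_fin sqr_ge0.
rewrite limn_einf_lim; apply: lime_le; first exact: is_cvg_einfs.
apply: nearW => n; apply: (@le_trans _ _ (denergy g n)%:E); last by rewrite lee_fin.
apply: (@le_trans _ _ (\int[leb]_(t in `[0%R, 1%R]) (f n t ^+ 2)%:E)%E).
  by apply: ereal_inf_lbound; exists n => /=.
have cn2 i : 0 <= c n i ^+ 2 by exact: sqr_ge0.
rewrite denergyE -(integral_step (K0 n) cn2).
rewrite integral_mkcond; apply: lower_integral_le => t _.
  by rewrite patchE; case: ifP => // _; rewrite lee_fin sqr_ge0.
rewrite patchE /f /step; case: ifP => _; first by case: ifP; rewrite ?expr0n.
by case: ifP => //; rewrite lee_fin ?sqr_ge0.
Qed.

End finite_energy.

(** * Measurability in the space of curves *)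

Section borel_sets.
Context (R : realType) (X : completeMetricType R).
Implicit Types (x y : X) (U A : set X).

Lemma open_borel (Y : ptopologicalType) (U : set Y) : open U -> measurable (U : set (borel Y)).
Proof. exact: sub_sigma_algebra. Qed.

Lemma closed_borel (Y : ptopologicalType) (U : set Y) : closed U -> measurable (U : set (borel Y)).
Proof.
by move=> cU; rewrite -(setCK U); apply: measurableC; apply: open_borel; exact: closed_openC.
Qed.

Lemma measurable_fun_borel d (T : measurableType d) (Y : ptopologicalType)
    (h : T -> borel Y) : (forall O : set Y, open O -> measurable (h @^-1` O)) ->
  measurable_fun setT h.
Proof.
move=> mh; apply: (@measurability _ _ _ (borel Y) _ _ (@open Y)) => // _ [V oV <-].
by rewrite setTI; exact: mh.
Qed.

Lemma continuous_borel (Y : ptopologicalType) (f : Y -> R) :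
  continuous f -> measurable_fun setT (f : borel Y -> R).
Proof.
move=> cf; apply: (measurability (@RGenOInfty.G R)); first exact: RGenOInfty.measurableE.
move=> _ [_ [a ->] <-]; rewrite setTI; apply: open_borel.
by move/continuousP : cf; apply; exact: interval_open.
Qed.

Lemma near_continuous_borel (Y : ptopologicalType) (f : Y -> R) :
  (forall (y : Y) (e : R), 0 < e -> nbhs y [set z | `|f y - f z| < e]) ->
  measurable_fun setT (f : borel Y -> R).
Proof.
by move=> H; apply: continuous_borel => y; apply/cvgrPdist_lt => e /(H y).
Qed.

Lemma nbhs_mdistE x U : nbhs x U <-> exists2 e : R, 0 < e &
  forall y, mdist x y < e -> U y.
Proof.
rewrite -nbhs_ballE; split=> -[e e0 H]; exists e => // y.
  by move=> xy; apply: H; rewrite ballEmdist.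
by rewrite ballEmdist; exact: H.
Qed.

Lemma lip_continuous (f : X -> R) (L : R) :
  (forall x y, `|f x - f y| <= L * mdist x y) -> continuous f.
Proof.
move=> fL x; apply/cvgrPdist_lt => e e0; apply/nbhs_mdistE.
exists (e / (`|L| + 1)); first by rewrite divr_gt0// ltr_wpDl.
move=> y xy; apply: (le_lt_trans (fL x y)).
apply: (@le_lt_trans _ _ ((`|L| + 1) * mdist x y)).
  rewrite ler_wpM2r ?mdist_ge0// (le_trans (ler_norm L))// lerDl//.
by rewrite mulrC -ltr_pdivlMr// ltr_wpDl.
Qed.

Lemma mdist_continuous w : continuous (fun x => mdist x w).
Proof. by apply: (@lip_continuous _ 1) => x y; rewrite mul1r; exact: mdist_lip. Qed.

Lemma closed_mdist_le w (r : R) : closed [set x : X | mdist x w <= r].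
Proof.
rewrite (_ : mkset _ = (fun x => mdist x w) @^-1` [set s | s <= r])//.
by apply: closed_comp => [x _|]; [exact: mdist_continuous|exact: closed_le].
Qed.

Lemma open_mdist_lt w (r : R) : open [set x : X | mdist x w < r].
Proof.
rewrite (_ : mkset _ = (fun x => mdist x w) @^-1` [set s | s < r])//.
by apply: open_comp => [x _|]; [exact: mdist_continuous|exact: open_lt].
Qed.

End borel_sets.

Section curve_space.
Context (R : realType) (X : completeMetricType R).
Local Notation I01 := (set_type (`[0, 1]%classic : set R)).
Implicit Types (g : curves X) (s t : R).

Lemma in01P t : t \in (`[0, 1]%classic : set R) = (0 <= t <= 1).
Proof. by apply/idP/idP => [/set_mem/=|t01]; rewrite ?mem_set//= in_itv. Qed.

Definition time01 t (t01 : 0 <= t <= 1) : I01 :=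
  exist _ t (eq_ind_r is_true t01 (in01P t)).

Lemma curve_atE g t (t01 : 0 <= t <= 1) :
  curve_at g t = (g : continuousType I01 X) (time01 t01).
Proof.
rewrite /curve_at; set h := (g : continuousType I01 X) : I01 -> X.
have e := congr1 (fun k : I01 -> X => k (time01 t01)) (@valLK _ _ (point : X) _ h).
by rewrite -[RHS]e.
Qed.

Lemma curves_nbhsP g (U : set (curves X)) : nbhs g U <-> exists2 e : R, 0 < e &
  forall g', (forall t, 0 <= t <= 1 -> mdist (curve_at g t) (curve_at g' t) < e) -> U g'.
Proof.
pose i (g : curves X) : {uniform I01 -> X} := (g : continuousType I01 X) : I01 -> X.
have ic : continuous i by exact: initial_continuous.
split=> [|[e e0 HU]].
  rewrite nbhsE => -[B [[W oW WB] Bg] BU].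
  have : nbhs (i g) W by apply: open_nbhs_nbhs; split => //; move: Bg; rewrite -WB.
  move/uniform_nbhs => [E []]; rewrite -entourage_ballE => -[e /= e0 eE] EW.
  exists e => // g' H; apply: BU; rewrite -WB; apply: EW => -[t t01] _.
  have t01' : 0 <= t <= 1 by rewrite -in01P.
  apply: eE; rewrite /= ballEmdist /=.
  have := H t t01'; rewrite !(curve_atE _ t01') /i.
  by rewrite (_ : time01 t01' = exist _ t t01)//; apply: val_inj.
have : nbhs (i g) [set h | forall y, True -> (fun xy => ball xy.1 e xy.2) (i g y, h y)].
  apply/uniform_nbhs; exists [set xy | ball xy.1 e xy.2]; split => //.
  by rewrite -entourage_ballE; exists e.
move=> H0; have H1 : nbhs g (i @^-1` _) := ic g _ H0.
apply: (@filterS _ _ (nbhs_filter g) _ _ _ H1) => g' H; apply: HU => t t01.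
by have := H (time01 t01) I; rewrite /= ballEmdist/= !(curve_atE _ t01).
Qed.

Lemma curve_at_continuous t : 0 <= t <= 1 ->
  continuous (fun g : curves X => curve_at g t).
Proof.
move=> t01 g U /nbhs_mdistE[e e0 eU]; apply/curves_nbhsP; exists e => // g' H.
by apply: eU; exact: H.
Qed.

Lemma curve_continuous01 g : continuous01 (curve_at g).
Proof.
move=> t t01 e e0.
have /= := @cts_fun _ _ (g : continuousType I01 X) (time01 t01).
move=> /(_ [set y | mdist ((g : continuousType I01 X) (time01 t01)) y < e]).
case; first by apply/nbhs_mdistE; exists e.
move=> _ [[W oW <-] Wt WB].
have : nbhs t W by apply: open_nbhs_nbhs; split.
move/nbhs_ballP => [d d0 dW]; exists d => // s s01 std.
rewrite (curve_atE _ s01) (curve_atE _ t01) metric_sym ltW//.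
by apply: (WB (time01 s01)); apply: dW; rewrite /ball/= distrC.
Qed.

Lemma mk_curve (g : R -> X) : continuous01 g ->
  exists c : curves X, forall t, 0 <= t <= 1 -> curve_at c t = g t.
Proof.
move=> gc; pose h (u : I01) : X := g (set_val u).
have hc : continuous h.
  move=> [t t01] U /nbhs_mdistE[e e0 eU].
  have t01' : 0 <= t <= 1 by rewrite -in01P.
  have e20 : 0 < e / 2 by rewrite divr_gt0.
  have [d d0 Hd] := gc t t01' _ e20.
  exists (set_val @^-1` (ball t d)^°); split.
  - by exists (ball t d)^° => //; exact: open_interior.
  - by apply: nbhsx_ballx.
  - move=> [s s01] /= /interior_subset std; apply: eU; rewrite /h/= metric_sym.
    apply: (@le_lt_trans _ _ (e / 2)); last by rewrite ltr_pdivrMr// ltr_pMr// ltr1n.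
    by apply: Hd; [rewrite -in01P|rewrite distrC; exact: std].
pose c : continuousType I01 X := mkcts hc.
by exists c => t t01; rewrite curve_atE.
Qed.

Lemma measurable_mdist_curve s t : 0 <= s <= 1 -> 0 <= t <= 1 ->
  measurable_fun setT (fun g : borel (curves X) => mdist (curve_at g s) (curve_at g t)).
Proof.
move=> s01 t01; apply: near_continuous_borel => g e e0.
apply/curves_nbhsP; exists (e / 2) => [|g' H]; first by rewrite divr_gt0.
have h1 := H s s01; have h2 := H t t01.
have h3 := metric_triangle (curve_at g s) (curve_at g' s) (curve_at g t).
have h4 := metric_triangle (curve_at g' s) (curve_at g' t) (curve_at g t).
have h5 := metric_triangle (curve_at g' s) (curve_at g s) (curve_at g' t).
have h6 := metric_triangle (curve_at g s) (curve_at g t) (curve_at g' t).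
rewrite (metric_sym (curve_at g' t) (curve_at g t)) in h4.
rewrite (metric_sym (curve_at g' s) (curve_at g s)) in h5.
by rewrite /= ltr_norml; apply/andP; split; slra.
Qed.

Lemma measurable_eval t : 0 <= t <= 1 -> measurable_fun setT (@eval_at R X t).
Proof.
move=> t01; apply: measurable_fun_borel => O oO; apply: open_borel.
by move/continuousP : (curve_at_continuous t01); exact.
Qed.

Lemma measurable_denergy n :
  measurable_fun setT (fun g : borel (curves X) => denergy (curve_at g) n).
Proof.
have K0 : 0 < (2 ^ n)%:R :> R by rewrite ltr0n expn_gt0.
have in01 (j : nat) : (j <= 2 ^ n)%N -> 0 <= (j%:R / (2 ^ n)%:R : R) <= 1.
  by move=> jn; rewrite divr_ge0// ler_pdivrMr// mul1r ler_nat.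
rewrite /denergy; apply: measurable_sum => i.
have m1 : measurable_fun setT (fun g : borel (curves X) =>
    mdist (curve_at g (i%:R / (2 ^ n)%:R)) (curve_at g (i.+1%:R / (2 ^ n)%:R))).
  by apply: measurable_mdist_curve; apply: in01; rewrite // ltnW.
exact: (measurable_funM (measurable_cst _) (measurable_funX 2 m1)).
Qed.

(** The dyadic sums increase to the energy; in particular the energy is a
    measurable function of the curve. *)
Lemma energy_sup (g : curves X) :
  energy (curve_at g) 0 1 = ereal_sup (range (fun n => (denergy (curve_at g) n)%:E)).
Proof.
apply/eqP; rewrite eq_le; apply/andP; split; last first.
  by apply: ge_ereal_sup => _ [n _ <-]; exact: denergy_le.
have ub n : ((denergy (curve_at g) n)%:E <=
    ereal_sup (range (fun n => (denergy (curve_at g) n)%:E)))%E.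
  by apply: ereal_sup_ubound; exists n.
case: (ereal_sup _) ub => [M ub|_|ub]; last by have := ub 0; rewrite leNgt ltNyr.
  by apply: finite_energy => [|n]; [exact: curve_continuous01|have := ub n; rewrite lee_fin].
exact: leey.
Qed.

Lemma measurable_energy :
  measurable_fun setT (fun g : borel (curves X) => energy (curve_at g) 0 1).
Proof.
rewrite (_ : (fun _ => _) = fun g => esups (fun n => (denergy (curve_at g) n)%:E) 0).
  apply: (@measurable_fun_esups _ _ _ setT
    (fun n (g : borel (curves X)) => (denergy (curve_at g) n)%:E) _ 0) => n.
  by apply/measurable_EFinP; exact: measurable_denergy.
apply/funext => g; rewrite energy_sup /esups/=; congr ereal_sup.
by apply/seteqP; split=> _ [n _ <-]; exists n.
Qed.

End curve_space.

Lemma natSinv_lt (R : realType) (e : R) : 0 < e -> \forall n \near \oo, n.+1%:R^-1 < e.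
Proof. by move=> e0; exact: (near_infty_natSinv_lt (PosNum e0)). Qed.

Section pointwise_limits.
Context (R : realType) d (T : measurableType d) (Y : ptopologicalType).
Variable near_ : R -> Y -> Y -> Prop.
Hypothesis near_nbhs : forall y (U : set Y), nbhs y U <->
  exists2 e : R, 0 < e & forall z, near_ e y z -> U z.
Hypothesis near_sym : forall e y z, near_ e y z -> near_ e z y.
Hypothesis near_trans : forall e e' x y z, near_ e x y -> near_ e' y z ->
  near_ (e + e') x z.
Hypothesis near_mono : forall e e' x y, e <= e' -> near_ e x y -> near_ e' x y.

(** Over an open set [O], the points whose [e]-neighbourhood lies in [O] may not
    form an open set, but their interiors exhaust [O]. *)
Lemma measurable_lim (h : nat -> T -> borel Y) (h' : T -> borel Y) :
  (forall n, measurable_fun setT (h n)) ->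
  (forall x (e : R), 0 < e -> \forall n \near \oo, near_ e (h n x) (h' x)) ->
  measurable_fun setT h'.
Proof.
move=> mh hh; apply: measurable_fun_borel => O oO.
pose P (k : nat) : set Y := interior [set y | forall z, near_ k.+1%:R^-1 y z -> O z].
rewrite (_ : _ @^-1` _ = \bigcup_k \bigcup_N \bigcap_(n in [set n | (N <= n)%N]) (h n @^-1` P k)).
  apply: bigcup_measurable => k _; apply: bigcup_measurable => N _.
  apply: bigcap_measurable => [|n _]; first by exists N => /=.
  rewrite -[_ @^-1` _]setTI; apply: mh => //; apply: open_borel; exact: open_interior.
apply/seteqP; split => x /=; last first.
  move=> [k _ [N _ H]]; have k0 : 0 < k.+1%:R^-1 :> R by rewrite invr_gt0.
  have [N' _ H'] := hh x _ k0.
  have := interior_subset (H (maxn N N') (leq_maxl _ _)).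
  by move=> /(_ (h' x)); apply; apply: H'; rewrite /= leq_maxr.
move=> Ox; have /near_nbhs[e e0 He] : nbhs (h' x) O by exact: open_nbhs_nbhs.
have e30 : 0 < e / 3 by rewrite divr_gt0.
have [N _ H] := hh x _ e30.
have [k ke] : exists k : nat, k.+1%:R^-1 < e / 3.
  by have [k _ Hk] := natSinv_lt e30; exists k; apply: Hk => /=.
exists k => //; exists N => // n /= Nn; apply/near_nbhs; exists (e / 3) => // y ny z nz.
apply: He.
have e3 : e = e / 3 + (e / 3 + e / 3) by field.
rewrite {}e3; apply: (@near_mono (e / 3 + (e / 3 + k.+1%:R^-1))).
  by rewrite !lerD2l ltW.
apply: near_trans (near_trans ny nz); apply: near_sym; exact: H.
Qed.

End pointwise_limits.

Section joint_measurability.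
Context (R : realType) (X : completeMetricType R).

Lemma measurable_lim_mdist d (T : measurableType d) (h : nat -> T -> borel X)
    (h' : T -> borel X) : (forall n, measurable_fun setT (h n)) ->
  (forall x (e : R), 0 < e -> \forall n \near \oo, mdist (h n x : X) (h' x) < e) ->
  measurable_fun setT h'.
Proof.
apply: (@measurable_lim R d T X (fun e (x y : X) => mdist x y < e)).
- exact: nbhs_mdistE.
- by move=> e y z; rewrite metric_sym.
- by move=> e e' x y z H1 H2; have := metric_triangle x y z; slra.
- by move=> e e' x y ee H; exact: lt_le_trans ee.
Qed.

Lemma measurable_lim_curves d (T : measurableType d) (h : nat -> T -> borel (curves X))
    (h' : T -> borel (curves X)) : (forall n, measurable_fun setT (h n)) ->
  (forall x (e : R), 0 < e -> \forall n \near \oo, forall t, 0 <= t <= 1 ->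
    mdist (curve_at (h n x) t) (curve_at (h' x) t) < e) ->
  measurable_fun setT h'.
Proof.
apply: (@measurable_lim R d T (curves X) (fun e (g g' : curves X) => forall t, 0 <= t <= 1 ->
    mdist (curve_at g t) (curve_at g' t) < e)).
- by move=> g U; exact: curves_nbhsP.
- by move=> e y z H t t01; rewrite metric_sym; exact: H.
- move=> e e' x y z H1 H2 t t01.
  by have := metric_triangle (curve_at x t) (curve_at y t) (curve_at z t);
    have := H1 _ t01; have := H2 _ t01; slra.
- by move=> e e' x y ee H t t01; exact: lt_le_trans (H _ t01) ee.
Qed.

Definition clamp (s t r : R) := Num.max s (Num.min t r).

Lemma clamp01 (s t r : R) : s <= t -> s <= clamp s t r <= t.
Proof.
by rewrite /clamp => st; rewrite le_max lexx/= ge_max st ge_min lexx.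
Qed.

Lemma clamp_id (s t r : R) : s <= r <= t -> clamp s t r = r.
Proof. by move=> /andP[sr rt]; rewrite /clamp min_r// max_r. Qed.

Lemma clamp_lip (s t r r' : R) : `|clamp s t r - clamp s t r'| <= `|r - r'|.
Proof.
have n1 := ler_norm (r - r'); have n2 := ler_norm (r' - r).
rewrite distrC in n2; rewrite /clamp !minEle !maxEle.
by do !case: ifPn; rewrite -?ltNge; intros; rewrite ler_norml; apply/andP; split; slra.
Qed.

Lemma measurable_clamp (s t : R) : measurable_fun setT (clamp s t).
Proof. by apply: measurable_maxr => //; apply: measurable_minr. Qed.

(** Evaluation is jointly measurable: curves are continuous, so evaluation at [r]
    is the limit of evaluations at multiples of [n^-1]. *)
Lemma measurable_eval_joint :
  measurable_fun setT (fun p : borel (curves X) * R => eval_at (clamp 0 1 p.2) p.1).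
Proof.
pose q n (r : R) : R := (Num.truncn (n.+1%:R * clamp 0 1 r))%:R / n.+1%:R.
have c01 (r : R) : 0 <= clamp 0 1 r <= 1 by exact: clamp01.
have qle n r : 0 <= q n r /\ q n r <= clamp 0 1 r /\ clamp 0 1 r < q n r + n.+1%:R^-1.
  have /andP[c0 _] := c01 r.
  have n0 : 0 < n.+1%:R :> R by rewrite ltr0n.
  have /andP[] := truncn_itv (mulr_ge0 (ltW n0) c0) => H1 H2; rewrite /q; split.
    by rewrite divr_ge0.
  split; first by rewrite ler_pdivrMr// (mulrC _ n.+1%:R).
  by rewrite -[X in _ + X]mul1r -mulrDl ltr_pdivlMr// (mulrC _ n.+1%:R) natr1.
have q01 n r : 0 <= q n r <= 1.
  by have [-> [+ _]] := qle n r; have /andP[_ c1] := c01 r => /le_trans->.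
apply: (@measurable_lim_mdist _ _ (fun n p => eval_at (q n p.2) p.1)) => [n|[g r] e e0 /=].
  apply: measurable_fun_borel => O oO.
  rewrite (_ : _ @^-1` O = \bigcup_(i in [set i | (i <= n.+1)%N])
    ((eval_at (i%:R / n.+1%:R) @^-1` O) `*`
     [set r | (i%:R <= n.+1%:R * clamp 0 1 r < i.+1%:R)])).
    apply: bigcup_measurable => i /= iN; apply: measurableX.
      rewrite -[X in measurable X]setTI; apply: measurable_eval => //.
        by rewrite divr_ge0// ler_pdivrMr ?ltr0n// mul1r ler_nat.
      exact: open_borel.
    rewrite (_ : mkset _ = (fun r => n.+1%:R * clamp 0 1 r) @^-1` `[i%:R, i.+1%:R[).
      rewrite -[X in measurable X]setTI; apply: measurable_funM => //.
      exact: measurable_clamp.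
    by apply/seteqP; split => r /=; rewrite in_itv.
  apply/seteqP; split => [[g r]/= H|[g r] [i /= iN [/= H H2]]].
    exists (Num.truncn (n.+1%:R * clamp 0 1 r)).
      rewrite /= -(ler_nat R); have := q01 n r; rewrite /q => /andP[_].
      by rewrite ler_pdivrMr ?ltr0n// mul1r.
    by split => //=; apply: truncn_itv; rewrite mulr_ge0//; have /andP[] := c01 r.
  by rewrite /q (truncn_def H2).
have [d d0 Hd] := @curve_continuous01 _ _ g _ (c01 r) _ (divr_gt0 e0 (ltr0Sn R 1)).
have := natSinv_lt d0; apply: filterS => n nd.
rewrite /eval_at (le_lt_trans (Hd _ _ _))//; last first.
- by rewrite ltr_pdivrMr// ltr_pMr// ltr1n.
- have [_ [H1 H2]] := qle n r; rewrite distrC ger0_norm ?subr_ge0// ltrBlDl.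
  by apply: (lt_trans H2); rewrite ltrD2l.
Unshelve. all: by end_near. Qed.

End joint_measurability.

(** * The support, and the Jensen inequality of the Renyi entropy *)

Section integrals2.
Context d (T : measurableType d) (R : realType) (mu : {measure set T -> \bar R}).
Local Open Scope ereal_scope.
Import HBNNSimple.

Lemma ae_eq_of_integral_le (D : set T) (f : T -> R) (g : T -> \bar R) :
  measurable D -> measurable_fun D f -> measurable_fun D g ->
  (forall x, D x -> (0 <= f x)%R) -> (forall x, D x -> (f x)%:E <= g x) ->
  \int[mu]_(x in D) g x <= \int[mu]_(x in D) (f x)%:E ->
  \int[mu]_(x in D) (f x)%:E < +oo ->
  {ae mu, forall x, D x -> g x = (f x)%:E}.
Proof.
move=> mD mf mg f0 fg gf foo.
pose h x := g x - (f x)%:E.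
have mf' : measurable_fun D (EFin \o f) by exact/measurable_EFinP.
have mh : measurable_fun D h by apply: emeasurable_funB.
have h0 x : D x -> 0 <= h x by move=> Dx; rewrite /h sube_ge0//; exact: fg.
have gE : \int[mu]_(x in D) g x = \int[mu]_(x in D) (f x)%:E + \int[mu]_(x in D) h x.
  rewrite -ge0_integralD//.
  by apply: eq_integral => x _; rewrite /h addeC subeK.
have ff : \int[mu]_(x in D) (f x)%:E \is a fin_num.
  by rewrite ge0_fin_numE// integral_ge0// => x Dx; rewrite lee_fin f0.
have hi0 : \int[mu]_(x in D) `|h x| = 0.
  apply/eqP; rewrite eq_le integral_ge0 ?andbT//.
  rewrite (eq_integral h); last by move=> x /set_mem Dx; rewrite gee0_abs ?h0.
  by move: gf; rewrite gE -[leRHS]adde0 leeD2lE.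
have /(ae_eq_integral_abs _ mD mh) := hi0.
apply: filterS => x /[swap] Dx /(_ Dx) /= hx0.
by rewrite -[LHS](@subeK _ _ (f x)%:E)// -/(h x) hx0 add0e.
Qed.

Lemma lower_integral_pushforward d' (T' : measurableType d') (P : {measure set T' -> \bar R})
    (h : T' -> T) (f : T -> \bar R) : measurable_fun setT h ->
  (forall A, measurable A -> mu A = P (h @^-1` A)) ->
  (forall x, 0 <= f x) -> \int[mu]_x f x <= \int[P]_y f (h y).
Proof.
move=> mh muP f0; rewrite ge0_integralTE//; apply: ub_ereal_sup => _ [s /= sf <-].
rewrite -integralT_nnsfun.
rewrite (eq_measure_integral (pushforward P h)); last by move=> A mA _; exact: muP.
rewrite ge0_integral_pushforward//; last 2 first.
- exact/measurable_EFinP.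
- by move=> x _; rewrite lee_fin.
by rewrite preimage_setT; apply: lower_integral_le => y _ /=; rewrite ?lee_fin.
Qed.

Lemma integral_law d' (T' : measurableType d') (P : {measure set T' -> \bar R})
    (h : T' -> T) (f : T -> \bar R) : measurable_fun setT h ->
  (forall A, measurable A -> mu A = P (h @^-1` A)) ->
  measurable_fun setT f -> (forall x, 0 <= f x) -> \int[mu]_x f x = \int[P]_y f (h y).
Proof.
move=> mh muP mf f0.
rewrite (eq_measure_integral (pushforward P h)); last by move=> A mA _; exact: muP.
by rewrite ge0_integral_pushforward ?preimage_setT.
Qed.

End integrals2.

Lemma closed_nbhs (Y : topologicalType) (A : set Y) :
  (forall x, ~ A x -> nbhs x (~` A)) -> closed A.
Proof. by move=> H; rewrite -(setCK A); apply: open_closedC; rewrite openE => x /H. Qed.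

Section support.
Context (R : realType) (X : completeMetricType R) (m : {measure set (borel X) -> \bar R}).
Hypothesis radonm : radon m.
Local Open Scope ereal_scope.

Lemma closed_supp : closed (supp m).
Proof.
apply: closed_nbhs => x /existsNP[U /not_implyP[[oU Ux] /negP]].
rewrite -leNgt => mU; rewrite nbhsE; exists U => // y Uy; apply/existsNP; exists U.
by apply/not_implyP; split => //; apply/negP; rewrite -leNgt.
Qed.

Lemma measurable_supp : measurable (supp m : set (borel X)).
Proof. by apply: closed_borel; exact: closed_supp. Qed.

(** A property of measures that is local passes to compact sets; it serves both
    for being null, on the complement of the support, and for being finite. *)
Lemma compact_measure (P : \bar R -> Prop) (K : set X) : P 0 ->
  (forall a b, P a -> P b -> P (a + b)) ->
  (forall a b, 0 <= a -> a <= b -> P b -> P a) -> compact K ->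
  (forall x, K x -> exists2 U : set X, open_nbhs x U & P (m U)) -> P (m K).
Proof.
move=> P0 PD Ple cK KU.
pose U x := if pselect (K x) is left Kx then projT1 (cid2 (KU x Kx)) else set0.
have UK x : K x -> [/\ open (U x), U x x & P (m (U x))].
  by rewrite /U => Kx; case: pselect => // Kx'; case: cid2 => /= V [].
have := cK; rewrite compact_cover => /(_ X K U).
case=> [x Kx|x Kx|D DK KD]; first by have [] := UK x Kx.
  by exists x => //; have [] := UK x Kx.
have mK : measurable (K : set (borel X)).
  by apply: closed_borel; apply: compact_closed => //; exact: metric_hausdorff.
have fD : finite_set [set` D] by exact: finite_fset.
have mU x : [set` D] x -> measurable (U x : set (borel X)).
  by move=> xD; apply: open_borel; have [] := UK x (set_mem (DK _ xD)).
have le := content_sub_fsum m fD mU mK KD.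
refine (Ple _ _ (measure_ge0 _ _) le _).
rewrite fsbig_finite//.
rewrite big_seq; elim/big_rec : _ => // x a; rewrite in_fset_set// => /set_mem xD Pa.
by apply: PD => //; have [] := UK x (set_mem (DK _ xD)).
Qed.

Lemma supp_conull : m (~` supp m) = 0.
Proof.
rewrite radonm.2; last exact: measurableC measurable_supp.
apply/eqP; rewrite eq_le; apply/andP; split; last first.
  by apply: ereal_sup_ubound; exists set0; rewrite ?measure0//; split => //; exact: compact0.
apply: ub_ereal_sup => _ [K [cK KS] <-].
have P0 a b : a = 0 :> \bar R -> b = 0 -> a + b = 0 by move=> -> ->; rewrite adde0.
suff -> : m K = 0 by [].
apply: (@compact_measure (fun a => a = 0)) => // [a b a0 ab b0|x /KS/existsNP[U]].
  by apply/eqP; rewrite eq_le a0 andbT -b0.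
move=> /not_implyP[oU /negP]; rewrite -leNgt => mU; exists U => //.
by apply/eqP; rewrite eq_le mU measure_ge0.
Qed.

Lemma compact_finite (K : set X) : compact K -> m K < +oo.
Proof.
move=> cK; apply: (@compact_measure (fun a => a < +oo)) => // [a b|a b _|x _].
- exact: lte_add_pinfty.
- exact: le_lt_trans.
- exact: radonm.1.
Qed.

Lemma ae_supp (P : X -> Prop) : (forall x, supp m x -> P x) -> {ae m, forall x, P x}.
Proof.
move=> SP; exists (~` supp m); split; [exact: measurableC measurable_supp|exact: supp_conull|].
by move=> x /= nP Sx; apply: nP; exact: SP.
Qed.

End support.

(** The tangent line at [e^-1] of the concave function [s |-> s `^ (1 - K^-1)]. *)
Lemma powR_tangent (R : realType) (K e s : R) : (1 < K) -> (0 < e) -> (0 <= s) ->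
  (s `^ (1 - K^-1) <= (1 - K^-1) * e `^ K^-1 * s + K^-1 * (e `^ K^-1 / e)).
Proof.
move=> K1 e0 s0; have K0 : (0 < K) by apply: lt_trans K1.
set r := (1 - K^-1); have r0 : (0 < r) by rewrite subr_gt0 invf_lt1.
have ip : (0 < r^-1) by rewrite invr_gt0.
set b := ((e `^ K^-1 / e) `^ K^-1).
have a0 : (0 < e `^ K^-1 / e) by rewrite divr_gt0// powR_gt0.
have b0 : (0 < b) by rewrite powR_gt0.
have := @conjugate_powR R (s `^ r / b) b r^-1 K _ (ltW b0) ip K0.
rewrite divr_ge0 ?powR_ge0 ?(ltW b0)// invrK /r subrK => /(_ isT erefl).
rewrite -/r divfK ?gt_eqF// => /le_trans; apply; rewrite lerD//; last first.
  by rewrite mulrC ler_wpM2l ?invr_ge0 ?(ltW K0)// /b -powRrM mulVf ?gt_eqF// powRr1// ltW.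
rewrite mulrC -mulrA ler_wpM2l ?(ltW r0)//.
rewrite powRM ?invr_ge0 ?powR_ge0 ?(ltW b0)// -powRrM mulfV ?gt_eqF// powRr1// mulrC.
rewrite ler_wpM2r//.
(* b is a power of e whose exponent cancels *)
have ee : (e `^ K^-1 / e = e `^ (- r)).
  have en : e != 0 by rewrite gt_eqF.
  by rewrite /r opprB powRB ?powRr1 ?(ltW e0)// en implybT.
rewrite -powR_inv1 ?(ltW b0)// /b ee -!powRrM.
rewrite (_ : - r * (K^-1 * (-1 / r)) = K^-1)//.
by field; rewrite !gt_eqF.
Qed.

Section jensen.
Context d (T : measurableType d) (R : realType) (m : {measure set T -> \bar R}).
Local Open Scope ereal_scope.

Lemma jensen_powR (K e : R) (rho : T -> R) (E : set T) : (1 < K)%R -> (0 < e)%R ->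
  measurable E -> m E = e%:E -> measurable_fun setT rho ->
  (forall x, (0 <= rho x)%R) -> \int[m]_(x in E) (rho x)%:E <= 1 ->
  \int[m]_(x in E) ((rho x) `^ (1 - K^-1))%:E <= (e `^ K^-1)%:E.
Proof.
move=> K1 e0 mE mEe mrho rho0 rho1.
have K0 : (0 < K)%R by apply: lt_trans K1.
have r0 : (0 < 1 - K^-1)%R by rewrite subr_gt0 invf_lt1.
set a := ((1 - K^-1) * e `^ K^-1)%R; set b := (K^-1 * (e `^ K^-1 / e))%R.
have a0 : (0 <= a)%R by rewrite mulr_ge0 ?powR_ge0 ?ltW.
have b0 : (0 <= b)%R.
  by apply: mulr_ge0; [rewrite invr_ge0 ltW|rewrite divr_ge0 ?powR_ge0// ltW].
have mrho' : measurable_fun E rho by exact: measurable_funTS.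
apply: (@le_trans _ _ (\int[m]_(x in E) (a%:E * (rho x)%:E + b%:E))).
  apply: lower_integral_le => x _; first by rewrite lee_fin powR_ge0.
  by rewrite -EFinM -EFinD lee_fin powR_tangent.
rewrite ge0_integralD//; last 2 first.
- by move=> x _; rewrite -EFinM lee_fin mulr_ge0.
- by apply: emeasurable_funM => //; exact/measurable_EFinP.
rewrite ge0_integralZl ?integral_cst ?mEe//.
apply: (@le_trans _ _ (a%:E + (b * e)%:E)).
  by rewrite EFinM leeD2r// -[leRHS]mule1 lee_wpmul2l.
  by rewrite -EFinD lee_fin /a /b -mulrA divfK ?gt_eqF// -mulrDl subrK mul1r.
  exact/measurable_EFinP.
by move=> x _; rewrite lee_fin.
Qed.

End jensen.

(** * The Brunn-Minkowski inequality towards a point *)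

Lemma intermediate_eq (R : realType) (a b D th : R) : 0 < th < 1 -> 0 <= a -> 0 <= b ->
  0 <= D -> D <= a + b -> a ^+ 2 / th + b ^+ 2 / (1 - th) <= D ^+ 2 ->
  a = th * D /\ b = (1 - th) * D.
Proof.
move=> /andP[t0 t1] a0 b0 D0 Dab H; have u0 : 0 < 1 - th by slra.
have H1 : (1 - th) * a ^+ 2 + th * b ^+ 2 <= th * (1 - th) * D ^+ 2.
  have -> : (1 - th) * a ^+ 2 + th * b ^+ 2 =
      th * (1 - th) * (a ^+ 2 / th + b ^+ 2 / (1 - th)).
    by field; rewrite !gt_eqF.
  by rewrite ler_wpM2l// mulr_ge0// ltW.
have H2 : D ^+ 2 <= (a + b) ^+ 2 by rewrite ler_sqr// nnegrE addr_ge0.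
have H3 : (1 - th) * a - th * b = 0.
  apply/eqP; rewrite -sqrf_eq0 eq_le sqr_ge0 andbT.
  have : th * (1 - th) * D ^+ 2 <= th * (1 - th) * (a + b) ^+ 2.
    by rewrite ler_wpM2l// mulr_ge0// ltW.
  by move: H1; rewrite !expr2; slra.
have aE : a = th * (a + b) by slra.
have bE : b = (1 - th) * (a + b) by slra.
have sE : (a + b) ^+ 2 <= D ^+ 2.
  apply: le_trans H; rewrite le_eqVlt; apply/orP; left; apply/eqP.
  by set s := a + b in aE bE *; rewrite aE bE; field; rewrite !gt_eqF.
have DE : D = a + b.
  by apply/eqP; rewrite eq_le Dab/= -ler_sqr// nnegrE addr_ge0.
by rewrite DE.
Qed.

Lemma compact_seq_limit (T : topologicalType) (K : set T) (q : nat -> T) :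
  compact K -> (forall n, K (q n)) ->
  exists2 x, K x & forall C : set T, closed C -> (\forall n \near \oo, C (q n)) -> C x.
Proof.
move=> cK Kq; have [|x [Kx clx]] := cK (q @ \oo) _.
  by exists 0 => // n _; exact: Kq.
exists x => // C cC Cq; apply: contrapT => nCx.
have oC : nbhs x (~` C) by apply: open_nbhs_nbhs; split => //; exact: closed_openC.
by have [y [Cy /(_ Cy)]] := clx _ _ Cq oC.
Qed.

Section dirac.
Context d (T : measurableType d) (R : realType).

Lemma dirac_in (x : T) (A : set T) : A x -> (\d_x : {measure set T -> \bar R}) A = 1%E.
Proof. by move=> Ax; rewrite /= diracE mem_set. Qed.

Lemma dirac_out (x : T) (A : set T) : ~ A x -> (\d_x : {measure set T -> \bar R}) A = 0%E.
Proof. by move=> Ax; rewrite /= diracE memNset. Qed.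

End dirac.

Section brunn_minkowski.
Context (R : realType) (X : completeMetricType R) (m : {measure set (borel X) -> \bar R}).
Hypothesis radonm : radon m.
Local Open Scope ereal_scope.

(** The energy of almost every curve is the least possible one, so that the
    curve has constant speed. *)
Lemma optgeo_dirac_geodesic (mu : probability (borel X) R) (w : X)
    (P : probability (borel (curves X)) R) (th : R) : optgeo mu (\d_(w : borel X))%R P ->
  \int[mu]_x ((mdist (x : X) w) ^+ 2)%:E < +oo -> (0 < th < 1)%R ->
  {ae P, forall g, mdist (curve_at g 0) (curve_at g th) = (th * mdist (curve_at g 0) w)%R /\
    mdist (curve_at g th) w = ((1 - th) * mdist (curve_at g 0) w)%R}.
Proof.
move=> [P0 P1 PE] foo th01; have /andP[th0 th1] := th01.
have i0 : (0 <= (0 : R) <= 1)%R by rewrite lexx ler01.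
have i1 : (0 <= (1 : R) <= 1)%R by rewrite lexx ler01.
have g1 : {ae P, forall g, curve_at g 1 = w}.
  exists (eval_at 1 @^-1` (~` [set w])); split.
  - rewrite -[X in measurable X]setTI; apply: measurable_eval => //.
    by apply: measurableC; apply: closed_borel; apply: accessible_closed_set1;
      exact/hausdorff_accessible/metric_hausdorff.
  - rewrite -[LHS]/(pushforward P (eval_at 1) _) P1//; last first.
      by apply: measurableC; apply: closed_borel; apply: accessible_closed_set1;
        exact/hausdorff_accessible/metric_hausdorff.
    by rewrite dirac_out// => /(_ erefl).
  - by move=> g /= H E; apply: H.
have mh : measurable_fun setT (fun x : borel X => (x, w : borel X)).
  exact: measurable_fun_pair.
pose h : {mfun borel X >-> (borel X * borel X)%type} := mfun_Sub (mem_set mh).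
have mw : measurable_fun setT (fun x : borel X => (mdist (x : X) w ^+ 2)%R).
  by apply: measurable_funX; apply: continuous_borel; exact: mdist_continuous.
have W2le : W2sq mu (\d_(w : borel X))%R <= \int[mu]_x ((mdist (x : X) w) ^+ 2)%:E.
  apply: (@le_trans _ _ (\int[distribution mu h]_z ((mdist (z.1 : X) (z.2 : X)) ^+ 2)%:E)).
    apply: ereal_inf_lbound; exists (distribution mu h) => // A mA; split => //.
    apply: (@eq_trans _ _ (mu (h @^-1` (snd @^-1` A)))); first by [].
    have [Aw|Aw] := pselect (A w).
      rewrite dirac_in// (_ : h @^-1` (snd @^-1` A) = setT) ?probability_setT//.
      by apply/seteqP; split => // x _; exact: Aw.
    rewrite dirac_out// (_ : h @^-1` (snd @^-1` A) = set0) ?measure0//.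
    by apply/seteqP; split.
  apply: (@lower_integral_pushforward _ _ _ (distribution mu h) _ _ mu h) => // z.
  by rewrite lee_fin sqr_ge0.
pose D (g : borel (curves X)) : R := (mdist (curve_at g 0) (curve_at g 1) ^+ 2)%R.
have mD : measurable_fun setT D by apply: measurable_funX; exact: measurable_mdist_curve.
have D0 g : setT g -> (0 <= D g)%R by move=> _; rewrite sqr_ge0.
have DE : \int[P]_g (D g)%:E = \int[mu]_x ((mdist (x : X) w) ^+ 2)%:E.
  rewrite (@ae_eq_lower_integral _ _ _ P setT _
    (fun g => ((mdist (eval_at 0 g : X) w) ^+ 2)%:E))//; last 2 first.
  - by move=> g _; rewrite lee_fin sqr_ge0.
  - by apply: aeS g1 => g E _; rewrite /D E.
  apply/esym; apply: (@integral_law _ _ _ mu _ _ P (@eval_at R X 0)) => //.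
  - exact: measurable_eval.
  - by move=> A mA; exact: (esym (P0 A mA)).
  - exact/measurable_EFinP.
  - by move=> x; rewrite lee_fin sqr_ge0.
have Eg : {ae P, forall g, setT g -> energy (curve_at g) 0 1 = (D g)%:E}.
  apply: ae_eq_of_integral_le => //.
  - exact: measurable_energy.
  - move=> g _; apply: le_trans (energy_ge (curve_at g) ltr01).
    by rewrite lee_fin /D subr0 divr1.
  - by rewrite PE DE.
  - by rewrite DE.
apply: aeS2 Eg g1 => g /(_ I) Eg g1.
rewrite -g1; apply: intermediate_eq => //; [exact: mdist_ge0..|exact: metric_triangle|].
rewrite -lee_fin -Eg; apply: le_trans (energy_split (curve_at g) (ltW th0) (ltW th1)).
rewrite EFinD leeD//; first by have := energy_ge (curve_at g) th0; rewrite subr0.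
exact: energy_ge.
Qed.

Variables (N : R) (K : nat).
Hypothesis cdX : CD0 N m.
Hypothesis K2 : (2 <= K)%N.
Hypothesis NK : (N <= K%:R)%R.

Let K1 : (1 < K%:R :> R)%R. Proof. by rewrite ltr1n. Qed.

Let renyiE mu : renyi K%:R m mu = - \int[m]_x ((density m mu x) `^ (1 - K%:R^-1))%:E.
Proof. by rewrite /renyi gt_eqF. Qed.

Let r0 : (0 < 1 - K%:R^-1 :> R)%R.
Proof. by rewrite subr_gt0 invf_lt1// (lt_trans ltr01). Qed.

Lemma renyi_uniform (A : set (borel X)) (mu : set (borel X) -> \bar R) (c : R) :
  (0 < c)%R -> measurable A -> m A = c%:E ->
  (forall B, measurable B -> mu B = m (B `&` A) * (c^-1)%:E) ->
  renyi K%:R m mu <= - (c `^ K%:R^-1)%:E.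
Proof.
move=> c0 mA mAc muE; have ic : (0 < c^-1)%R by rewrite invr_gt0.
have [mrho rho0 [mus [S [mS S0 musS]] rhoE]] : is_density m mu (density m mu).
  apply: xgetPex; exists (fun x => c^-1 * \1_A x)%R; split.
  - by apply: measurable_funM => //; exact: measurable_indic.
  - by move=> x; rewrite mulr_ge0// ltW.
  exists mzero; first by exists set0; split => //; rewrite measure0.
  move=> B mB; rewrite muE// /mzero adde0; under eq_integral do rewrite EFinM.
  rewrite ge0_integralZl//; last 2 first.
  - by apply/measurable_EFinP; exact: measurable_indic.
  - by rewrite lee_fin ltW.
  by rewrite integral_indic// setIC muleC.
set rho := density m mu in mrho rho0 rhoE *.
rewrite renyiE leeN2.
pose B := A `&` ~` S `&` [set x | rho x < c^-1]%R.
have mB : measurable B.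
  apply: measurableI; first by apply: measurableI => //; exact: measurableC.
  have := mrho measurableT _ (measurable_itv `]-oo, c^-1[%R); rewrite setTI.
  by congr measurable; apply/seteqP; split => x /=; rewrite in_itv.
have mBoo : m B < +oo.
  rewrite (le_lt_trans _ (ltry c))// -mAc.
  by apply: le_measure => [||x [[]]//]; exact: mem_set.
have rhoB : \int[m]_(x in B) (rho x)%:E = (c^-1)%:E * m B.
  have := rhoE B mB; rewrite muE// (_ : B `&` A = B); last first.
    by apply/seteqP; split => x; [case|move=> Bx; split => //; case: Bx => -[]].
  rewrite (_ : mus B = 0) ?adde0 => [<-|]; first by rewrite muleC.
  apply/eqP; rewrite eq_le measure_ge0 andbT -musS; apply: le_measure.
  - exact: mem_set.
  - by apply: mem_set; exact: measurableC.
  - by move=> x [[]].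
have Bnull : {ae m, forall x, ~ B x}.
  have : {ae m, forall x, B x -> (c^-1)%:E = (rho x)%:E}.
    apply: ae_eq_of_integral_le => //.
    - exact: measurable_funTS.
    - by move=> x [_ /ltW]; rewrite lee_fin.
    - by rewrite rhoB integral_cst.
    - by rewrite rhoB lte_mul_pinfty// lee_fin ltW.
  by apply: aeS => x H Bx; have [] := H Bx; case: Bx => _ /= /[swap] <-; rewrite ltxx.
have Snull : {ae m, forall x, ~ S x}.
  by exists S; split => // x /= /contrapT.
apply: (@le_trans _ _ (\int[m]_(x in A) (c^-1 `^ (1 - K%:R^-1))%:E)).
  rewrite integral_cst// mAc -EFinM lee_fin -(powR_inv1 (ltW c0)) -powRrM.
  rewrite -[X in (_ <= _ * X)%R](powRr1 (ltW c0)) -powRD; last first.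
    by rewrite (gt_eqF c0) implybT.
  by rewrite (_ : (-1 * (1 - K%:R^-1) + 1 = K%:R^-1)%R)//; ring.
rewrite [leRHS](_ : _ = \int[m]_(x in setT) ((rho x) `^ (1 - K%:R^-1))%:E)//.
apply: (@le_trans _ _ (\int[m]_(x in A) ((rho x) `^ (1 - K%:R^-1))%:E)).
  apply: ae_lower_integral_le_gen => //.
  - by move=> x _; rewrite lee_fin powR_ge0.
  - by move=> x _; rewrite lee_fin powR_ge0.
  apply: aeS2 Bnull Snull => x nB nS Ax; rewrite lee_fin ge0_ler_powR ?nnegrE ?(ltW r0) ?(ltW ic)//.
  by rewrite leNgt; apply/negP => H; apply: nB.
apply: ge0_subset_integral => //.
- apply/measurable_EFinP; exact: (measurableT_comp (measurable_powR _)).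
- by move=> x _; rewrite lee_fin powR_ge0.
Qed.

Lemma brunn_minkowski (A E : set X) (w : X) (r th : R) :
  measurable (A : set (borel X)) -> measurable (E : set (borel X)) ->
  A `<=` supp m -> (forall x, A x -> (mdist x w <= r)%R) -> m A < +oo ->
  supp m w -> (0 < th < 1)%R ->
  (forall p q, A p -> supp m q -> mdist p q = (th * mdist p w)%R ->
    mdist q w = ((1 - th) * mdist p w)%R -> E q) ->
  ((1 - th) ^+ K)%:E * m A <= m E.
Proof.
move=> mA mE AS Ar Aoo Sw th01 HE; have /andP[th0 th1] := th01.
have th1' : (0 < 1 - th)%R by rewrite subr_gt0.
have [A0|A0] := eqVneq (m A) 0; first by rewrite A0 mule0.
have mAc : m A = (fine (m A))%:E by rewrite fineK// ge0_fin_numE.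
set c := fine (m A) in mAc.
have c0 : (0 < c)%R by rewrite -lte_fin -mAc lt_neqAle eq_sym A0/=.
pose mu := mnormalize (mrestr m mA) (\d_(w : borel X)%R).
have muE B : measurable B -> mu B = m (B `&` A) * (c^-1)%:E.
  move=> mB; have ev : mrestr m mA setT = c%:E by rewrite /mrestr setTI.
  rewrite /mu /mnormalize; set e0 := (X in X == 0); rewrite -!/e0 (_ : e0 = c%:E) => [|]; last exact: ev.
  by rewrite /= eqe (gt_eqF c0).
have muA : mu (~` A) = 0 by rewrite muE ?setICl ?measure0 ?mul0e//; exact: measurableC.
have aeA : {ae mu, forall x, A x} by exists (~` A); split => //; exact: measurableC.
have fin2 : \int[mu]_x ((mdist (x : X) w) ^+ 2)%:E < +oo.
  apply: (@le_lt_trans _ _ (\int[mu]_x (r ^+ 2)%:E)).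
    apply: ae_lower_integral_le_gen => //; [by move=> x _; rewrite lee_fin sqr_ge0..|].
    apply: aeS aeA => x Ax _; rewrite lee_fin.
    by rewrite ler_sqr ?nnegrE ?mdist_ge0 ?(le_trans _ (Ar _ Ax)) ?mdist_ge0 ?Ar.
  rewrite integral_cst//; apply: (@le_lt_trans _ _ ((r ^+ 2)%:E * 1)); last by rewrite mule1 ltry.
  apply: lee_wpmul2l; first by rewrite lee_fin sqr_ge0.
  exact: probability_le1.
have smu : supp mu `<=` supp m.
  move=> x Sx U oU; have := Sx U oU; apply: contraTT; rewrite -!leNgt => mU.
  rewrite muE; last by case: oU => + _; exact: open_borel.
  rewrite (_ : m _ = 0) ?mul0e//; apply/eqP; rewrite eq_le measure_ge0 andbT.
  apply: le_trans mU; apply: le_measure => //; apply: mem_set.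
  - by apply: measurableI => //; case: oU => + _; exact: open_borel.
  - by case: oU => + _; exact: open_borel.
have sd : supp (\d_(w : borel X))%R `<=` supp m.
  move=> x Sx; apply: contrapT => nSx.
  have oS : open_nbhs x (~` supp m) by split => //; exact/closed_openC/closed_supp.
  by have := Sx _ oS; rewrite dirac_out ?ltxx// => /(_ Sw).
have P2d : P2 (\d_(w : borel X))%R.
  exists w; rewrite integral_dirac//; last first.
    apply/measurable_EFinP; apply: measurable_funX; apply: continuous_borel.
    exact: mdist_continuous.
  by rewrite mdistxx expr0n/= mule0 ltry.
have [P Pg PR] := cdX (ex_intro _ w fin2 : P2 mu) P2d smu sd.
have := PR th K%:R; rewrite (ltW th0) (ltW th1) => /(_ isT NK).
set nu := pushforward P (eval_at th); set rho := density m nu.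
have Igeo : \int[m]_x ((rho x) `^ (1 - K%:R^-1))%:E >= ((1 - th) * c `^ K%:R^-1)%:E ->
    ((1 - th) ^+ K)%:E * m A <= m E.
  move=> Irho.
  have I0 : 0 < \int[m]_x ((rho x) `^ (1 - K%:R^-1))%:E.
    by apply: lt_le_trans Irho; rewrite lte_fin mulr_gt0// powR_gt0.
  have [mrho rho0 [mus [S [mS S0 musS]] rhoE]] : is_density m nu rho.
    have [[r' Hr']|/forallNP nex] := pselect (exists r', is_density m nu r').
      by apply: xgetPex; exists r'.
    have E0 : rho = cst (0 : R)%R by exact: xgetPN.
    move: I0; rewrite E0 integral0_eq ?ltxx// => x _ /=.
    by rewrite powR0// gt_eqF.
  have Eth : {ae P, forall g, (E `|` ~` supp m) (curve_at g th)}.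
    have g0A : {ae P, forall g, A (curve_at g 0)}.
      exists (eval_at 0 @^-1` (~` A)); split => //.
      - rewrite -[X in measurable X]setTI; apply: measurable_eval => //.
          by rewrite lexx ler01.
        exact: measurableC.
      - by have [P0 _ _] := Pg; rewrite -[LHS]/(pushforward P (eval_at 0) _) P0//; exact: measurableC.
    apply: aeS2 (optgeo_dirac_geodesic Pg fin2 th01) g0A => g [H1 H2] g0A.
    by have [Sg|Sg] := pselect (supp m (curve_at g th)); [left; exact: HE H1 H2|right].
  have mES : measurable (E `|` ~` supp m : set (borel X)).
    by apply: measurableU => //; apply: measurableC; exact: measurable_supp.
  have nuE : nu (~` (E `|` ~` supp m)) = 0.
    have /negligibleP : P.-negligible (eval_at th @^-1` (~` (E `|` ~` supp m))).
      by apply: negligibleS Eth => g.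
    apply; rewrite -[X in measurable X]setTI; apply: measurable_eval => //.
      by rewrite !ltW.
    exact: measurableC.
  have rhoN : {ae m, forall x, ~ E x -> rho x = 0%R}.
    have mC : measurable (~` (E `|` ~` supp m) : set (borel X)) by exact: measurableC.
    have I : \int[m]_(x in ~` (E `|` ~` supp m)) `|(rho x)%:E| = 0.
      apply/eqP; rewrite eq_le integral_ge0 ?andbT//.
      rewrite (eq_integral (EFin \o rho)); last by move=> x _ /=; rewrite ger0_norm.
      by rewrite -nuE rhoE// leeDl.
    have /ae_eq_integral_abs := I.
    move=> /(_ mC); have mr : measurable_fun (~` (E `|` ~` supp m) : set (borel X)) (EFin \o rho).
      by apply/measurable_EFinP; exact: measurable_funTS.
    move=> /(_ mr); have := @ae_supp _ _ _ radonm (supp m) (fun x Sx => Sx).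
    apply: aeS2 => x Sx /= H nE; have [] // : (rho x)%:E = 0.
    by apply: H => -[].
  have rho1 : \int[m]_(x in E) (rho x)%:E <= 1.
    apply: (@le_trans _ _ (nu E)); first by rewrite rhoE// leeDl.
    by apply: probability_le1; rewrite -[X in measurable X]setTI; apply: measurable_eval => //; rewrite !ltW.
  have [Eoo|Eoo] := leP +oo (m E); first by apply: le_trans Eoo; exact: leey.
  have IE : \int[m]_x ((rho x) `^ (1 - K%:R^-1))%:E <=
      \int[m]_(x in E) ((rho x) `^ (1 - K%:R^-1))%:E.
    rewrite [leRHS]integral_mkcond; apply: ae_lower_integral_le_gen => //.
    - by move=> x _; rewrite lee_fin powR_ge0.
    - by move=> x _; rewrite patchE; case: ifP => // _; rewrite lee_fin powR_ge0.
    apply: aeS rhoN => x H _; rewrite patchE; case: ifPn => // /negP xE.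
    by rewrite H ?powR0 ?gt_eqF// => Ex; apply: xE; exact: mem_set.
  have mEe : m E = (fine (m E))%:E by rewrite fineK// ge0_fin_numE.
  set e := fine (m E) in mEe.
  have e0 : (0 < e)%R.
    rewrite -lte_fin -mEe lt_neqAle measure_ge0 andbT; apply/eqP => mE0.
    move: I0; rewrite ltNge => /negP; apply; apply: (le_trans IE).
    apply: (@le_trans _ _ (\int[m]_(x in E) 0)); last by rewrite integral0.
    apply: ae_lower_integral_le_gen => //; first by move=> x _; rewrite lee_fin powR_ge0.
    by exists E; split => // x /= H; apply: contrapT => nEx; apply: H => /nEx.
  have := le_trans Irho (le_trans IE (jensen_powR K1 e0 mE mEe mrho rho0 rho1)).
  rewrite lee_fin mAc mEe -EFinM lee_fin => H.
  have rootK (a : R) : (0 <= a)%R -> ((a `^ K%:R^-1) ^+ K = a)%R.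
    move=> a0; rewrite -powR_mulrn ?powR_ge0// -powRrM mulVf ?powRr1//.
    by rewrite pnatr_eq0 -lt0n ltnW.
  rewrite -[leRHS](rootK e (ltW e0)) -[c](rootK c (ltW c0)) -exprMn.
  by rewrite lerXn2r// nnegrE ?powR_ge0// mulr_ge0 ?powR_ge0// ltW.
move=> Hr; apply: Igeo; move: Hr; rewrite renyiE -/rho => Hr.
rewrite -leeN2; apply: (le_trans Hr).
apply: (@le_trans _ _ ((1 - th)%:E * - (c `^ K%:R^-1)%:E + th%:E * 0)); last first.
  by rewrite mule0 adde0 muleN -EFinM.
apply: leeD; apply: lee_wpmul2l; rewrite ?lee_fin ?(ltW th0) ?(ltW th1')//.
  exact: renyi_uniform muE.
by rewrite renyiE oppe_le0 integral_ge0// => x _; rewrite lee_fin powR_ge0.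
Qed.

End brunn_minkowski.

(** * Compact balls, intermediate points and layer cakes *)

Lemma totally_bounded_compact (R : realType) (X : completeMetricType R) (A : set X) :
  closed A -> (forall e : R, 0 < e -> exists t : seq X,
    forall x, A x -> exists2 y, y \in t & mdist y x < e) -> compact A.
Proof.
move=> cA tbA; rewrite compact_ultra => F UF FA.
have cF : cauchy F.
  apply: cauchy_exP => e e0; have [t ht] := tbA e e0.
  have Ft : F (\bigcup_(y in [set` t]) ball y e).
    apply: filterS FA => x Ax; have [y yt yx] := ht x Ax.
    by exists y => //; rewrite ballEmdist.
  elim: t Ft {ht} => [|y t IH] Ft.
    by have [x [z]] := filter_ex Ft.
  have [Fy|nFy] := in_ultra_setVsetC (ball y e) UF; first by exists y.
  apply: IH; apply: filterS2 Ft nFy => x [z]; rewrite /= inE => /predU1P[->//|zt] zx _.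
  by exists z.
have Fl : F --> lim F by apply/cauchy_cvgP.
exists (lim F); split => //; apply: cA => B /Fl FB.
exact: filter_ex (filterI FA FB).
Qed.

Lemma closed_mdist_near (R : realType) (X : completeMetricType R) (p : X) (a e : R) :
  closed [set z : X | `|mdist z p - a| <= e].
Proof.
rewrite (_ : mkset _ = (fun z : X => `|mdist z p - a|) @^-1` [set s | s <= e])//.
apply: closed_comp => [y _|]; last exact: closed_le.
apply: (@lip_continuous _ _ _ 1) => x z; rewrite mul1r.
apply: (le_trans (ler_dist_dist _ _)).
by rewrite opprB addrA subrK; exact: mdist_lip.
Qed.

Section geometry.
Context (R : realType) (X : completeMetricType R) (m : {measure set (borel X) -> \bar R}).
Variables (N : R) (K : nat).
Hypothesis radonm : radon m.
Hypothesis cdX : CD0 N m.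
Hypothesis K2 : (2 <= K)%N.
Hypothesis NK : N <= K%:R.
Local Open Scope ereal_scope.

Definition sball (w : X) (r : R) : set X := [set x | supp m x /\ (mdist x w <= r)%R].

Lemma closed_sball w r : closed (sball w r).
Proof. by apply: closedI; [exact: closed_supp|exact: closed_mdist_le]. Qed.

Lemma measurable_sball w r : measurable (sball w r : set (borel X)).
Proof. by apply: closed_borel; exact: closed_sball. Qed.

Let q (R0 s : R) : R := (s / (2 * (`|R0| + s)))%R.

Let q_bounds (R0 s : R) : (0 < s)%R -> (0 < q R0 s < 1)%R /\ (q R0 s * R0 <= s)%R.
Proof.
move=> s0; have D0 : (0 < 2 * (`|R0| + s))%R by rewrite mulr_gt0// ltr_wpDl.
split.
  rewrite /q divr_gt0//= ltr_pdivrMr// mul1r.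
  by have := normr_ge0 R0; slra.
rewrite /q mulrAC ler_pdivrMr//; have := ler_norm R0; have := normr_ge0 R0 => h1 h2.
have : (s * R0 <= s * `|R0|)%R by rewrite ler_wpM2l// ltW.
have : (0 <= s * `|R0|)%R by rewrite mulr_ge0// ltW.
have : (0 < s * s)%R by rewrite mulr_gt0.
by rewrite [(2 * _)%R]mulrC mulrA mulrDr; slra.
Qed.

(** Moving [A] towards [w] until it lies in the ball of radius [s] contracts it by
    the ratio [q R0 s], which costs a factor bounded below by Brunn-Minkowski. *)
Lemma contract_measure (A : set X) w (R0 s : R) : (0 < s)%R -> supp m w ->
  measurable (A : set (borel X)) -> A `<=` sball w R0 -> m A < +oo ->
  ((q R0 s) ^+ K)%:E * m A <= m (sball w s).
Proof.
move=> s0 Sw mA AS Aoo; have [/andP[q0 q1] qR] := q_bounds R0 s0.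
have th01 : (0 < 1 - q R0 s < 1)%R by rewrite subr_gt0 q1/= ltrBlDr ltrDl.
rewrite -[q R0 s](subKr 1%R).
apply: (brunn_minkowski (r := R0) radonm cdX K2 NK mA _ _ _ _ Sw th01) => //.
- exact: measurable_sball.
- by move=> x /AS[].
- by move=> x /AS[].
move=> p z Ap Sz _ zw; split => //; rewrite zw subKr.
have [_ pw] := AS _ Ap; apply: le_trans qR.
by rewrite ler_wpM2l// ltW.
Qed.

Lemma sball_finite w r : supp m w -> m (sball w r) < +oo.
Proof.
move=> Sw; have [U [oU Uw] mU] := radonm.1 w.
have /nbhs_mdistE[e e0 eU] : nbhs w U by exact: open_nbhs_nbhs.
have e20 : (0 < e / 2)%R by rewrite divr_gt0.
have [/andP[q0 q1] _] := q_bounds r e20; set c := (q r (e / 2) ^+ K)%R.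
have c0 : (0 < c)%R by rewrite exprn_gt0.
apply: (@le_lt_trans _ _ ((c^-1)%:E * m U)); last first.
  by rewrite lte_mul_pinfty// lee_fin invr_ge0 ltW.
rewrite radonm.2; last exact: measurable_sball.
apply: ub_ereal_sup => _ [C [cC CS] <-].
have mC : measurable (C : set (borel X)).
  by apply: closed_borel; apply: compact_closed => //; exact: metric_hausdorff.
rewrite lee_pdivlMl//; apply: (le_trans (contract_measure e20 Sw mC CS _)).
  exact: compact_finite.
apply: le_measure.
- by apply: mem_set; exact: measurable_sball.
- by apply: mem_set; exact: open_borel.
move=> x [_ xw]; apply: eU; rewrite metric_sym (le_lt_trans xw)//.
by rewrite ltr_pdivrMr// ltr_pMr// ltr1n.
Qed.

Lemma sball_gt0 w r : supp m w -> (0 < r)%R -> 0 < m (sball w r).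
Proof.
move=> Sw r0; have oB : open_nbhs w [set x : X | mdist x w < r]%R.
  by split; [exact: open_mdist_lt|rewrite /= mdistxx].
apply: (lt_le_trans (Sw _ oB)).
apply: (@le_trans _ _ (m (sball w r `|` ~` supp m))).
  apply: le_measure; [|apply: mem_set; apply: measurableU|].
  - by apply: mem_set; apply: open_borel; exact: open_mdist_lt.
  - exact: measurable_sball.
  - by apply: measurableC; exact: measurable_supp.
  by move=> x /= /ltW xw; have [Sx|Sx] := pselect (supp m x); [left|right].
apply: (le_trans (measureU2 _ _ _)) => //.
- exact: measurable_sball.
- by apply: measurableC; exact: measurable_supp.
have S0 : m (~` (supp m : set (borel X))) = 0 by exact: supp_conull.
rewrite -[leRHS]adde0 leeD2l//.
by have /eqP := S0; rewrite eq_le => /andP[].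
Qed.

(** A maximal separated set is finite: the disjoint balls around its points have
    measures bounded below, by contraction of one large ball. *)
Lemma sball_net w (r e : R) : supp m w -> (0 < r)%R -> (0 < e)%R -> exists t : seq X,
  forall x, sball w r x -> exists2 y, y \in t & (mdist y x < e)%R.
Proof.
move=> Sw r0 e0; apply: contrapT => /forallNP nt.
have e20 : (0 < e / 2)%R by rewrite divr_gt0.
have e40 : (0 < e / 2 / 2)%R by rewrite divr_gt0.
have [/andP[q0 _] _] := q_bounds (r + r) e40.
set c := (q (r + r) (e / 2 / 2) ^+ K * fine (m (sball w r)))%R.
have fB : m (sball w r) = (fine (m (sball w r)))%:E.
  by rewrite fineK// ge0_fin_numE// sball_finite.
have c0 : (0 < c)%R.
  by rewrite mulr_gt0 ?exprn_gt0// -lte_fin -fB sball_gt0.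
have cE x : sball w r x -> c%:E <= m (sball x (e / 2 / 2)).
  move=> [Sx xw]; rewrite EFinM -fB; apply: contract_measure => //.
  - exact: measurable_sball.
  - move=> y [Sy yw]; split => //; apply: (le_trans (metric_triangle _ w _)).
    by rewrite lerD// metric_sym.
  - exact: sball_finite.
pose U (t : seq X) : set (borel X) := \bigcup_(x in [set` t]) sball x (e / 2 / 2).
have mU t : measurable (U t).
  by apply: fin_bigcup_measurable => // x _; exact: measurable_sball.
have key n : exists t : seq X, (forall x, x \in t -> sball w r x) /\
    (n%:R * c)%:E <= m (U t).
  elim: n => [|n [t [tB tm]]]; first by exists [::]; rewrite mul0r measure_ge0.
  have /existsNP[x /not_implyP[Bx /forall2NP xt]] := nt t.
  exists (x :: t); split => [y|]; first by rewrite inE => /predU1P[->//|/tB].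
  have -> : U (x :: t) = sball x (e / 2 / 2) `|` U t.
    apply/seteqP; split => [z [y /=]|z [xz|[y /= yt yz]]].
    - by rewrite inE => /predU1P[->|yt] yz; [left|right; exists y].
    - by exists x => //=; rewrite inE eqxx.
    - by exists y => //=; rewrite inE yt orbT.
  rewrite measureU//; first last.
  - apply/seteqP; split => // z [[_ zx] [y /= yt [_ zy]]].
    have [//|] := xt y; apply; apply: (le_lt_trans (metric_triangle _ z _)).
    rewrite metric_sym (@le_lt_trans _ _ (e / 2)%R)// ?ltr_pdivrMr ?ltr_pMr ?ltr1n//.
    by rewrite [leRHS]splitr lerD.
  - exact: measurable_sball.
  by rewrite -addn1 natrD mulrDl mul1r addrC EFinD leeD// cE.
have Ub t : (forall x, x \in t -> sball w r x) -> m (U t) <= m (sball w (r + e / 2)).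
  move=> tB; apply: le_measure; [exact: mem_set|by apply: mem_set; exact: measurable_sball|].
  move=> z [x /= /tB [Sx xw] [Sz zx]]; split => //.
  apply: (le_trans (metric_triangle _ x _)); rewrite addrC lerD//.
  by apply: (le_trans zx); rewrite ler_pdivrMr// ler_peMr ?ler1n// ltW.
have fM : m (sball w (r + e / 2)) = (fine (m (sball w (r + e / 2))))%:E.
  by rewrite fineK// ge0_fin_numE// sball_finite.
set M := fine _ in fM; pose n := (Num.truncn (`|M| / c)).+1.
have [t [tB tm]] := key n; have := le_trans tm (Ub t tB); rewrite fM lee_fin leNgt.
move=> /negP; apply; apply: (le_lt_trans (ler_norm M)); rewrite -ltr_pdivrMr//.
exact: truncnS_gt.
Qed.

Lemma compact_sball w r : supp m w -> compact (sball w r).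
Proof.
move=> Sw; apply: (@subclosed_compact _ _ (sball w (`|r| + 1))).
- exact: closed_sball.
- apply: totally_bounded_compact; first exact: closed_sball.
  by move=> e e0; apply: sball_net => //; rewrite ltr_wpDl.
- move=> x [Sx xr]; split => //; apply: (le_trans xr).
  by rewrite (le_trans (ler_norm r))// lerDl.
Qed.

Lemma intermediate_point (p w : X) (th : R) : supp m p -> supp m w -> (0 < th < 1)%R ->
  exists2 z, supp m z & mdist p z = (th * mdist p w)%R /\ mdist z w = ((1 - th) * mdist p w)%R.
Proof.
move=> Sp Sw th01; have /andP[th0 th1] := th01.
pose D := mdist p w; have D0 : (0 <= D)%R by exact: mdist_ge0.
pose Q (n : nat) x z := [/\ sball p n.+1%:R^-1 x, supp m z, mdist x z = (th * mdist x w)%R &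
  mdist z w = ((1 - th) * mdist x w)%R].
have ex n : exists xz, Q n xz.1 xz.2.
  apply: contrapT => /forallNP H.
  have n0 : (0 < n.+1%:R^-1 :> R)%R by rewrite invr_gt0.
  have := @brunn_minkowski _ _ _ radonm N K cdX K2 NK (sball p n.+1%:R^-1) set0 w
    (n.+1%:R^-1 + D) th (measurable_sball _ _) measurable0 _ _ (sball_finite _ Sp) Sw th01.
  rewrite measure0 => H2; have : ((1 - th) ^+ K)%:E * m (sball p n.+1%:R^-1) <= 0.
    apply: H2 => [x []//|x [_ xp]|x z Bx Sz xz zw]; last by apply: (H (x, z)).
    by rewrite (le_trans (metric_triangle _ p _))// lerD2r.
  by rewrite leNgt mule_gt0// ?lte_fin ?exprn_gt0 ?subr_gt0// sball_gt0.
have [xz xzQ] := choice ex.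
have [|z [Sz _] zC] := @compact_seq_limit _ _ (fun n => (xz n).2) (@compact_sball w (D + 1)%R Sw).
  move=> n; have [[_ xp] Sz _ zw] := xzQ n; split => //; rewrite zw.
  have xw : (mdist (xz n).1 w <= D + 1)%R.
    rewrite (le_trans (metric_triangle _ p _))// addrC lerD2l (le_trans xp)//.
    by rewrite invf_le1// ler1n.
  apply: le_trans xw; rewrite ler_piMl ?mdist_ge0//; slra.
exists z => //.
have close (e : R) : (0 < e)%R -> (`|mdist p z - th * D| <= e /\ `|mdist z w - (1 - th) * D| <= e)%R.
  move=> e0; have e20 : (0 < e / 2)%R by rewrite divr_gt0.
  split.
    rewrite (metric_sym p); have := zC _ (@closed_mdist_near R X p (th * D)%R e); apply.
    have := natSinv_lt e20; apply: filterS => n ne /=; rewrite metric_sym.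
    have [[_ xp] Sz' xz' _] := xzQ n.
    have h1 := mdist_lip p (xz n).1 (xz n).2; have h2 := mdist_lip (xz n).1 p w.
    rewrite xz' in h1; rewrite -/D in h2; rewrite (metric_sym p (xz n).1) in h1.
    have h3 : (`|th * mdist (xz n).1 w - th * D| <= mdist (xz n).1 p)%R.
      rewrite -mulrBr normrM gtr0_norm//; apply: le_trans h2.
      by rewrite ler_piMl// ltW.
    have := ler_normD (mdist p (xz n).2 - th * mdist (xz n).1 w)%R (th * mdist (xz n).1 w - th * D)%R.
    rewrite addrA subrK => /le_trans; apply; rewrite [leRHS]splitr.
    by apply: lerD; [apply: (le_trans h1)|apply: (le_trans h3)]; apply: (le_trans xp); exact: ltW.
  have := zC _ (@closed_mdist_near R X w ((1 - th) * D)%R e); apply.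
  have := natSinv_lt e0; apply: filterS => n ne /=.
  have [[_ xp] Sz' _ ->] := xzQ n; rewrite -mulrBr normrM (@ger0_norm _ (1 - th)%R); last by rewrite subr_ge0 ltW.
  apply: (@le_trans _ _ (mdist (xz n).1 p)); last by rewrite (le_trans xp)// ltW.
  by apply: le_trans (mdist_lip _ _ w); rewrite ler_piMl// lerBlDr lerDl ltW.
split; apply/eqP; rewrite -subr_eq0 -normr_le0; apply/ler_addgt0Pr => e e0;
  by rewrite add0r; have [] := close e e0.
Qed.

End geometry.

Section layer_cake.
Context d (T : measurableType d) (R : realType) (m : {measure set T -> \bar R}).
Implicit Types (V W : T -> R) (B : set T).

Let cnt (dl x : R) J : R := \sum_(j < J) ((j.+1%:R * dl < x)%R : nat)%:R.

Let cnt_le (dl x : R) J : 0 < dl -> 0 <= x -> dl * cnt dl x J <= x.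
Proof.
move=> d0 x0; rewrite /cnt; elim: J => [|J IH]; first by rewrite big_ord0 mulr0.
rewrite big_ord_recr/=; case: ltP => H; last by rewrite addr0.
rewrite mulrDr mulr1; apply: le_trans (ltW H); rewrite -natr1 mulrDl mul1r lerD2r mulrC.
rewrite ler_pM2r//; apply: (@le_trans _ _ (\sum_(j < J) (1 : R))).
  by apply: ler_sum => j _; case: (_ < _).
by rewrite sumr_const card_ord.
Qed.

Let cnt_ge (dl x : R) J : 0 < dl -> x <= J.+1%:R * dl -> x <= dl + dl * cnt dl x J.
Proof.
move=> d0; rewrite /cnt; elim: J => [|J IH] xJ.
  by rewrite big_ord0 mulr0 addr0 -[dl]mul1r.
have [H|H] := leP x (J.+1%:R * dl).
  apply: (le_trans (IH H)); rewrite big_ord_recr/= lerD2l ler_pM2l// lerDl.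
  by case: (_ < _).
rewrite (eq_bigr (fun=> 1)); last first.
  move=> j _; rewrite (le_lt_trans _ H)// ler_pM2r// ler_nat.
  exact: ltn_ord.
apply: (le_trans xJ); rewrite sumr_const card_ord -[X in X + _]mulr1 -mulrDr mulrC.
by rewrite nat1r.
Qed.

(** Both integrals are integrals over [a] of the measures of superlevel sets. *)
Lemma layer_cake V W B (M c : R) : measurable B -> (m B < +oo)%E -> 0 <= c ->
  measurable_fun setT V -> measurable_fun setT W ->
  (forall x, 0 <= V x <= M) -> (forall x, 0 <= W x) ->
  (forall a : R, 0 <= a -> (c%:E * m (B `&` [set x | (a < V x)%R]) <= m (B `&` [set x | (a < W x)%R]))%E) ->
  (c%:E * \int[m]_(x in B) (V x)%:E <= \int[m]_(x in B) (W x)%:E)%E.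
Proof.
move=> mB Boo c0 mV mW V0 W0 H.
have mlt (U : T -> R) a : measurable_fun setT U -> measurable [set x | a < U x].
  move=> mU; have := mU measurableT _ (measurable_itv `]a, +oo[); rewrite setTI.
  by congr measurable; apply/seteqP; split => x /=; rewrite in_itv/= andbT.
have cntE (U : T -> R) dl J : 0 < dl -> measurable_fun setT U ->
    (\int[m]_(x in B) (dl * cnt dl (U x) J)%:E =
     \sum_(j < J) dl%:E * m (B `&` [set x | (j.+1%:R * dl < U x)%R]))%E.
  move=> d0 mU.
  have mi (j : nat) : measurable_fun B (fun x => \1_[set x | (j.+1%:R * dl < U x)%R] x : R).
    by apply: measurable_funTS; apply: measurable_indic; exact: mlt.
  have -> : (\int[m]_(x in B) (dl * cnt dl (U x) J)%:E = \int[m]_(x in B)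
      \sum_(j < J) (dl%:E * (\1_[set x | (j.+1%:R * dl < U x)%R] x)%:E))%E.
    apply: eq_integral => x _; rewrite /cnt mulr_sumr -sumEFin; apply: eq_bigr => j _.
    rewrite -EFinM indicE; congr ((_ * _%:R)%:E).
    by case: ltP => h; [rewrite mem_set|rewrite memNset//= ltNge h].
  rewrite ge0_integral_sum//; last 2 first.
  - move=> j; apply: emeasurable_funM => //; apply/measurable_EFinP; exact: mi.
  - by move=> j x _; rewrite -EFinM lee_fin mulr_ge0// ltW.
  apply: eq_bigr => j _; rewrite ge0_integralZl//; last 2 first.
  - by apply/measurable_EFinP; exact: mi.
  - by rewrite lee_fin ltW.
  by rewrite integral_indic//; [rewrite setIC|exact: mlt].
have mBE : m B = (fine (m B))%:E by rewrite fineK// ge0_fin_numE.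
apply/lee_addgt0Pr => e e0.
pose dl := e / (c * (fine (m B) + 1) + 1).
have fB0 : 0 <= fine (m B) by rewrite fine_ge0.
have den0 : 0 < c * (fine (m B) + 1) + 1 by rewrite ltr_wpDl// mulr_ge0// addr_ge0.
have d0 : 0 < dl by rewrite divr_gt0.
pose J := Num.truncn (M / dl).
have VJ x : V x <= J.+1%:R * dl.
  have /andP[_ VM] := V0 x; apply: (le_trans VM); rewrite -ler_pdivrMr// ltW//.
  exact: truncnS_gt.
have cm (U : T -> R) : measurable_fun setT U -> measurable_fun B (fun x => dl * cnt dl (U x) J).
  move=> mU; apply: measurable_funM => //; apply: measurable_sum => j.
  rewrite (_ : (fun _ => _) = (fun x => \1_[set x | (j.+1%:R * dl < U x)%R] x : R)); last first.
    apply/funext => x; rewrite indicE; congr (_%:R).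
    by case: ltP => h; [rewrite mem_set|rewrite memNset//= ltNge h].
  by apply: measurable_funTS; apply: measurable_indic; exact: mlt.
have cnt0 x y : 0 <= dl * cnt dl x y by apply: mulr_ge0; [exact: ltW|exact: sumr_ge0].
apply: (@le_trans _ _ (c%:E * (dl%:E * m B + \int[m]_(x in B) (dl * cnt dl (V x) J)%:E))%E).
  apply: lee_wpmul2l; first by rewrite lee_fin.
  rewrite -integral_cst// -ge0_integralD//.
  - apply: lower_integral_le => x _; first by have /andP[] := V0 x.
    by rewrite -EFinD lee_fin cnt_ge.
  - by move=> x _; rewrite lee_fin ltW.
  - by move=> x _; rewrite lee_fin.
  - by apply/measurable_EFinP; exact: cm.
rewrite ge0_muleDr ?mule_ge0 ?lee_fin ?(ltW d0)//; last first.
  by apply: integral_ge0 => x _; rewrite lee_fin.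
rewrite addeC; apply: leeD; last first.
  rewrite mBE -!EFinM lee_fin; apply: (@le_trans _ _ (dl * (c * (fine (m B) + 1) + 1))).
    by rewrite mulrCA (ler_pM2l d0) mulrDr mulr1 -addrA lerDl addr_ge0.
  by rewrite /dl divfK ?gt_eqF.
apply: (@le_trans _ _ (\int[m]_(x in B) (dl * cnt dl (W x) J)%:E)%E); last first.
  apply: lower_integral_le => x _; rewrite lee_fin//; exact: cnt_le.
rewrite !cntE// ge0_sume_distrr; last by move=> j _; rewrite mule_ge0// lee_fin ltW.
apply: lee_sum => j _; rewrite muleCA; apply: lee_wpmul2l; first by rewrite lee_fin ltW.
by apply: H; rewrite mulr_ge0// ltW.
Qed.

End layer_cake.

(** * Finitely additive means and sampling *)

Section hahn_banach.
Context (R : realType) (V : lmodType R) (B : set V).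
Hypothesis BD : forall u v, B u -> B v -> B (u + v).
Hypothesis BZ : forall (a : R) u, B u -> B (a *: u).
Implicit Types (p q : V -> R) (u v : V).

Definition sublinear q := (forall u v, B u -> B v -> q (u + v) <= q u + q v) /\
  (forall (a : R) u, 0 < a -> B u -> q (a *: u) <= a * q u).

Let B0 u : B u -> B 0. Proof. by move=> /(BZ 0); rewrite scale0r. Qed.

Let BN u : B u -> B (- u). Proof. by move=> /(BZ (-1)); rewrite scaleN1r. Qed.

Lemma sublinear0 q u : B u -> sublinear q -> q 0 = 0.
Proof.
move=> /B0 b0 [_ qZ]; have h20 : 0 < 2^-1 :> R by rewrite invr_gt0.
have h2 : 0 < 2 :> R by [].
have := qZ _ _ h20 b0; have := qZ _ _ h2 b0; rewrite !scaler0 => H1 H2.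
by apply/eqP; rewrite eq_le; apply/andP; split; slra.
Qed.

Lemma sublinear_geN q u : B u -> sublinear q -> - q (- u) <= q u.
Proof.
move=> Bu sq; have := sq.1 u (- u) Bu (BN Bu).
by rewrite subrr (sublinear0 Bu sq); slra.
Qed.

Lemma sublinearZ q (a : R) u : 0 < a -> B u -> sublinear q -> q (a *: u) = a * q u.
Proof.
move=> a0 Bu [_ qZ]; apply/eqP; rewrite eq_le qZ//=.
have ia : 0 < a^-1 by rewrite invr_gt0.
have := qZ _ _ ia (BZ a Bu); rewrite scalerA mulVf ?gt_eqF// scale1r.
by rewrite -(ler_pM2l a0) mulrA mulfV ?gt_eqF// mul1r.
Qed.

(** The infimum of a chain of sublinear functionals below [p] is sublinear, so
    Zorn's lemma applies. *)
Lemma minimal_sublinear p : sublinear p -> exists q, [/\ sublinear q,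
  forall u, B u -> q u <= p u &
  forall q', sublinear q' -> (forall u, B u -> q' u <= q u) ->
    forall u, B u -> q u <= q' u].
Proof.
move=> sp.
pose W := {q : V -> R | sublinear q /\ forall u, B u -> q u <= p u}.
pose le (x y : W) := `[< forall u, B u -> projT1 y u <= projT1 x u >].
pose w0 : W := exist _ p (conj sp (fun u _ => lexx (p u))).
have [|||x xmax] := @ZL_preorder W w0 le.
- by move=> x; apply/asboolP.
- by move=> y x z /asboolP xy /asboolP yz; apply/asboolP => u Bu; exact: le_trans (yz _ Bu) (xy _ Bu).
- move=> A Atot; have [->|/set0P[x0 Ax0]] := eqVneq A set0.
    by exists w0 => y.
  pose E u := [set projT1 x u | x in A].
  have Enz u : E u !=set0 by exists (projT1 x0 u); exists x0.
  have Elb u : B u -> has_lbound (E u).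
    move=> Bu; exists (- p (- u)) => _ [x Ax <-].
    apply: le_trans (sublinear_geN Bu (projT2 x).1).
    by rewrite lerN2; exact: (projT2 x).2 (BN Bu).
  pose q u := inf (E u).
  have qle x u : B u -> A x -> q u <= projT1 x u.
    by move=> Bu Ax; apply: ge_inf; [exact: Elb|exists x].
  have qlt u (e : R) : B u -> 0 < e -> exists2 x, A x & projT1 x u < q u + e.
    move=> Bu e0; have [] := @inf_adherent _ (E u) e e0 (conj (Enz u) (Elb u Bu)).
    by move=> _ [x Ax <-] H; exists x.
  have sq : sublinear q.
    split=> [u v Bu Bv|a u a0 Bu].
      apply/ler_addgt0Pr => e e0; have e20 : 0 < e / 2 by rewrite divr_gt0.
      have [x1 A1 H1] := qlt _ _ Bu e20; have [x2 A2 H2] := qlt _ _ Bv e20.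
      have [x [Ax xu xv]] : exists x, [/\ A x, projT1 x u <= projT1 x1 u &
          projT1 x v <= projT1 x2 v].
        have [/asboolP H|/asboolP H] := Atot _ _ A1 A2.
          by exists x2; split => //; exact: H.
        by exists x1; split => //; exact: H.
      have := (projT2 x).1.1 u v Bu Bv; have := qle x _ (BD Bu Bv) Ax.
      by move: H1 H2 xu xv; rewrite [e]splitr; slra.
    apply/ler_addgt0Pr => e e0; have ea0 : 0 < e / a by rewrite divr_gt0.
    have [x Ax H] := qlt _ _ Bu ea0.
    apply: (le_trans (qle x _ (BZ a Bu) Ax)); apply: (le_trans ((projT2 x).1.2 a u a0 Bu)).
    rewrite -ler_pdivlMl// mulrDr mulKf ?gt_eqF// mulrC.
    by rewrite mulrC (mulrC a^-1) ltW.
  exists (exist _ q (conj sq (fun u Bu => le_trans (qle x0 u Bu Ax0) ((projT2 x0).2 u Bu)))).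
  by move=> x Ax; apply/asboolP => u Bu /=; exact: qle.
- exists (projT1 x); split; [exact: (projT2 x).1|exact: (projT2 x).2|].
  move=> q' sq' q'x u Bu.
  pose y : W := exist _ q' (conj sq' (fun u Bu => le_trans (q'x u Bu) ((projT2 x).2 u Bu))).
  have : le x y by apply/asboolP.
  by move=> /xmax/asboolP; apply.
Qed.

Lemma hahn_banach p : sublinear p -> exists L : V -> R,
  [/\ forall u v, B u -> B v -> L (u + v) = L u + L v,
      forall (a : R) u, B u -> L (a *: u) = a * L u &
      forall u, B u -> L u <= p u].
Proof.
move=> /minimal_sublinear[q [sq qp qmin]].
have qN u : B u -> q (- u) = - q u.
  move=> Bu; apply/eqP; rewrite eq_le; apply/andP; split; last first.
    by have := sublinear_geN (BN Bu) sq; rewrite opprK; slra.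
  (* translating along u gives a smaller sublinear functional *)
  pose E v := [set q (v + a *: u) - a * q u | a in [set a : R | 0 <= a]].
  have Elb v : B v -> lbound (E v) (- q (- v)).
    move=> Bv _ [a /= a00 <-]; have [a0|a0] := leP a 0.
      have -> : a = 0 by apply/eqP; rewrite eq_le a0.
      by rewrite scale0r addr0 mul0r subr0; exact: sublinear_geN.
    have := sq.1 (v + a *: u) (- v) (BD Bv (BZ a Bu)) (BN Bv).
    by rewrite addrAC subrr add0r (sublinearZ a0 Bu sq); slra.
  have Enz v : E v !=set0 by exists (q (v + 0 *: u) - 0 * q u); exists 0 => /=.
  pose q' v := inf (E v).
  have q'le v (a : R) : B v -> 0 <= a -> q' v <= q (v + a *: u) - a * q u.
    by move=> Bv a0; apply: ge_inf; [exists (- q (- v)); exact: Elb|exists a].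
  have q'lt v (e : R) : B v -> 0 < e -> exists2 a : R, 0 <= a &
      q (v + a *: u) - a * q u < q' v + e.
    move=> Bv e0; have hi : has_inf (E v) by split=> //; exists (- q (- v)); exact: Elb.
    by have [_ [a a0 <-] H] := inf_adherent e0 hi; exists a.
  have q'q v : B v -> q' v <= q v.
    by move=> Bv; have := q'le v 0 Bv (lexx 0); rewrite scale0r addr0 mul0r subr0.
  have sq' : sublinear q'.
    split=> [v w Bv Bw|c v c0 Bv]; apply/ler_addgt0Pr => e e0.
      have e20 : 0 < e / 2 by rewrite divr_gt0.
      have [a1 a10 H1] := q'lt _ _ Bv e20; have [a2 a20 H2] := q'lt _ _ Bw e20.
      have := q'le (v + w) (a1 + a2) (BD Bv Bw) (addr_ge0 a10 a20).
      have := sq.1 _ _ (BD Bv (BZ a1 Bu)) (BD Bw (BZ a2 Bu)).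
      by rewrite scalerDl addrACA mulrDl; move: H1 H2; rewrite [e]splitr; slra.
    have ec0 : 0 < e / c by rewrite divr_gt0.
    have [a a0 H] := q'lt _ _ Bv ec0.
    have := q'le (c *: v) (c * a) (BZ c Bv) (mulr_ge0 (ltW c0) a0).
    rewrite -scalerA -scalerDr (sublinearZ c0 (BD Bv (BZ a Bu)) sq) -mulrA -mulrBr.
    move=> /le_trans; apply; rewrite -[e](mulfVK (lt0r_neq0 c0)) mulrC (mulrC c) -mulrDl.
    by rewrite ler_wpM2r// ltW.
  have := qmin q' sq' q'q _ (BN Bu); have := q'le (- u) 1 (BN Bu) ler01.
  by rewrite scale1r addNr (sublinear0 Bu sq) mul1r sub0r => /[swap]/le_trans; apply.
exists q; split=> // [u v Bu Bv|a u Bu].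
  apply/eqP; rewrite eq_le sq.1//=; have := sq.1 (u + v) (- v) (BD Bu Bv) (BN Bv).
  by rewrite addrK qN//; slra.
have [a0|a0|<-] := ltgtP 0 a.
- exact: sublinearZ.
- have Na0 : 0 < - a by rewrite oppr_gt0.
  rewrite -[a *: u]opprK -scaleNr qN; last exact: BZ.
  by rewrite (sublinearZ Na0 Bu sq) mulNr opprK.
- by rewrite scale0r mul0r (sublinear0 Bu sq).
Qed.

End hahn_banach.

Section positive_functionals.
Context (R : realType) (T : Type).
Implicit Types (f g : T -> R).

Definition bounded_on f := exists M : R, forall x, `|f x| <= M.

Lemma bounded_onD f g : bounded_on f -> bounded_on g -> bounded_on (f + g).
Proof.
move=> [M fM] [M' gM]; exists (M + M') => x.
by apply: (le_trans (ler_normD _ _)); rewrite lerD.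
Qed.

Lemma bounded_onZ (a : R) f : bounded_on f -> bounded_on (a *: f).
Proof.
by move=> [M fM]; exists (`|a| * M) => x; rewrite /= normrM ler_wpM2l.
Qed.

(** A set [K] of inequalities [f <= r] each of which holds approximately at some
    point holds on average: the functional that dominates [f] by a constant
    plus a combination of inequalities is sublinear, and any linear functional
    below it is such an average. *)
Lemma mean_of_inequalities (K : (T -> R) -> R -> Prop) :
  K 0 0 ->
  (forall f r g s, K f r -> K g s -> K (f + g) (r + s)) ->
  (forall (a : R) f r, 0 < a -> K f r -> K (a *: f) (a * r)) ->
  (forall f r, K f r -> bounded_on f) ->
  (forall f r (e : R), K f r -> 0 < e -> exists x, f x <= r + e) ->
  exists L : (T -> R) -> R,
  [/\ forall f g, bounded_on f -> bounded_on g -> L (f + g) = L f + L g,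
      forall (a : R) f, bounded_on f -> L (a *: f) = a * L f,
      forall f, bounded_on f -> (forall x, 0 <= f x) -> 0 <= L f,
      L (cst 1) = 1 & forall f r, K f r -> L f <= r].
Proof.
move=> K0 KD KZ Kb Kex.
pose E f := [set c | exists g r, K g r /\ forall x, f x <= c - r + g x].
have [x0 _] := Kex _ _ _ K0 ltr01.
have Enz f : bounded_on f -> E f !=set0.
  move=> [M fM]; exists M; exists 0, 0; split => // x.
  by rewrite subr0 addr0; exact: le_trans (ler_norm _) (fM x).
have Elb f (M : R) : (forall x, - M <= f x) -> lbound (E f) (- M).
  move=> fM c [g [r [Kg fc]]]; apply/ler_addgt0Pr => e e0.
  have [x gx] := Kex _ _ _ Kg e0; have := fM x; have := fc x; slra.
have Elb' f : bounded_on f -> has_lbound (E f).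
  move=> [M fM]; exists (- M); apply: Elb => x.
  by have := fM x; rewrite ler_norml => /andP[].
pose p f := inf (E f).
have ple f c : bounded_on f -> E f c -> p f <= c by move=> /Elb'/ge_inf; apply.
have plt f (e : R) : bounded_on f -> 0 < e -> exists2 c, E f c & c < p f + e.
  by move=> bf e0; have [c] := inf_adherent e0 (conj (Enz f bf) (Elb' f bf)); exists c.
have sp : sublinear bounded_on p.
  split=> [f g bf bg|a f a0 bf]; apply/ler_addgt0Pr => e e0.
    have e20 : 0 < e / 2 by rewrite divr_gt0.
    have [c1 [f1 [r1 [K1 H1]]] c1p] := plt _ _ bf e20.
    have [c2 [f2 [r2 [K2 H2]]] c2p] := plt _ _ bg e20.
    have : p (f + g) <= c1 + c2.
      apply: ple; first exact: bounded_onD.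
      exists (f1 + f2), (r1 + r2); split=> [|x]; first exact: KD.
      have := H1 x; have := H2 x; rewrite -[(f + g) x]/(f x + g x) -[(f1 + f2) x]/(f1 x + f2 x).
      by slra.
    by move: c1p c2p; rewrite [e]splitr; slra.
  have ea0 : 0 < e / a by rewrite divr_gt0.
  have [c [g [r [Kg H]]] cp] := plt _ _ bf ea0.
  apply: (@le_trans _ _ (a * c)).
    apply: ple; first exact: bounded_onZ.
    exists (a *: g), (a * r); split=> [|x]; first exact: KZ.
    by rewrite -mulrBr /= -mulrDr ler_wpM2l// ltW.
  by rewrite -[e](mulfVK (lt0r_neq0 a0)) mulrC (mulrC a) -mulrDl ler_wpM2r// ltW.
have [L [LD LZ Lp]] := hahn_banach bounded_onD bounded_onZ sp.
have b1 : bounded_on (cst 1) by exists 1 => x; rewrite /= normr1.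
have LN f : bounded_on f -> L (- f) = - L f.
  by move=> bf; rewrite -scaleN1r LZ// mulN1r.
have bN f : bounded_on f -> bounded_on (- f).
  by move=> bf; rewrite -scaleN1r; exact: bounded_onZ.
exists L; split=> //.
- move=> f bf f0; rewrite -oppr_le0 -LN//; apply: (le_trans (Lp _ (bN _ bf))).
  apply: ple (bN _ bf) _; exists 0, 0; split => // x.
  by rewrite subr0 addr0 oppr_le0.
- apply/eqP; rewrite eq_le; apply/andP; split.
    apply: (le_trans (Lp _ b1)); apply: ple => //; exists 0, 0; split => // x.
    by rewrite subr0 addr0.
  rewrite -lerN2 -LN//; apply: (le_trans (Lp _ (bN _ b1))).
  apply: ple (bN _ b1) _; exists 0, 0; split => // x.
  by rewrite subr0 addr0.
- move=> f r Kf; apply: (le_trans (Lp _ (Kb _ _ Kf))); apply: ple (Kb _ _ Kf) _.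
  by exists f, r; split => // x; rewrite subrr add0r.
Qed.

End positive_functionals.

Section codes.
Context (R : realType) (T : Type).
Local Notation leb := (@lebesgue_measure R).
Variables (L : (T -> R) -> R).
Hypothesis LD : forall f g, bounded_on f -> bounded_on g -> L (f + g) = L f + L g.
Hypothesis LZ : forall (a : R) f, bounded_on f -> L (a *: f) = a * L f.
Hypothesis L0 : forall f, bounded_on f -> (forall x, 0 <= f x) -> 0 <= L f.
Hypothesis L1 : L (cst 1) = 1.
Variables (n : nat -> nat) (c : nat -> T -> nat).
Hypothesis cn : forall k x, (c k x < n k)%N.

Fixpoint code k x : nat := if k is k'.+1 then code k' x * n k' + c k' x else 0.
Fixpoint ncode k : nat := if k is k'.+1 then ncode k' * n k' else 1.

Let n0 (x : T) k : (0 < n k)%N. Proof. exact: leq_ltn_trans (cn k x). Qed.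

Lemma code_lt k x : (code k x < ncode k)%N.
Proof.
elim: k => [//|k IH]/=; apply: (@leq_trans ((code k x).+1 * n k)%N).
  by rewrite mulSn addnC ltn_add2r.
by rewrite leq_mul2r IH orbT.
Qed.

Lemma code_div k x : (code k.+1 x %/ n k)%N = code k x.
Proof. by rewrite /= divnMDl ?(n0 x)// divn_small// addn0. Qed.

Lemma code_eq k l x y : (k < l)%N -> code l x = code l y -> c k x = c k y.
Proof.
elim: l => // l IH; rewrite ltnS leq_eqVlt => /predU1P[->|kl] E; last first.
  by apply: IH => //; rewrite -(code_div l x) E code_div.
have := congr1 (modn^~ (n l)) E; rewrite /= !modnMDl !modn_small//.
Qed.

Lemma L_mono f g : bounded_on f -> bounded_on g -> (forall x, f x <= g x) -> L f <= L g.
Proof.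
move=> bf bg fg; have bN : bounded_on (-1 *: f) by exact: bounded_onZ.
have := L0 (bounded_onD bg bN); rewrite LD// LZ// mulN1r subr_ge0; apply=> x.
by rewrite -[(g + _) x]/(g x + (-1 * f x)) mulN1r subr_ge0.
Qed.

Let scale0_cst : 0 *: cst 1 = (fun=> 0) :> (T -> R).
Proof. by apply/funext => x; exact: mul0r. Qed.

Let ind k i : T -> R := fun x => (code k x < i)%:R.

Let b01 (f : T -> R) : (forall x, 0 <= f x <= 1) -> bounded_on f.
Proof. by move=> H; exists 1 => x; have /andP[? ?] := H x; rewrite ger0_norm. Qed.

Let b_ind k i : bounded_on (ind k i).
Proof. by apply: b01 => x; rewrite /ind; case: (_ < _)%N; rewrite ?lexx ?ler01. Qed.

(** The distribution function of the code of a random point under [L]. *)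
Definition cdf k i : R := L (ind k i).

Lemma cdf_mono k i j : (i <= j)%N -> cdf k i <= cdf k j.
Proof.
move=> ij; apply: L_mono => // x; rewrite /ind ler_nat.
by case: (ltnP (code k x) i) => // /leq_trans ->.
Qed.

Lemma cdf0 k : cdf k 0 = 0.
Proof.
rewrite /cdf (_ : ind k 0 = 0 *: cst 1); last by rewrite scale0_cst.
by rewrite LZ ?mul0r//; apply: b01 => x; rewrite ler01 lexx.
Qed.

Lemma cdf1 k : cdf k (ncode k) = 1.
Proof. by rewrite -L1; congr L; apply/funext => x; rewrite /ind code_lt. Qed.

Lemma cdf_refine k i : cdf k.+1 (i * n k) = cdf k i.
Proof.
congr L; apply/funext => x; congr (_%:R); congr nat_of_bool.
by rewrite -(code_div k x) ltn_divLR ?(n0 x).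
Qed.

(** The quantile: the cell [cdf k i, cdf k i.+1) that contains [u]. *)
Definition quantile k (u : R) : nat := (\sum_(i < ncode k) (cdf k i.+1 <= u)%R)%N.

Lemma quantileP k u : 0 <= u < 1 -> forall i, (i < ncode k)%N ->
  (quantile k u == i) = (cdf k i <= u < cdf k i.+1).
Proof.
move=> /andP[u0 u1].
have H j : (j <= ncode k)%N -> forall i, (i < j)%N -> cdf k i <= u < cdf k i.+1 ->
    (\sum_(l < j) (cdf k l.+1 <= u)%R)%N = i.
  elim: j => // j IH jN i; rewrite ltnS => ij /andP[iu ui].
  rewrite big_ord_recr/=; move: ij; rewrite leq_eqVlt => /predU1P[ij|ij]; last first.
    rewrite (IH (ltnW jN) i ij) ?iu//.
    by rewrite leNgt (lt_le_trans ui (cdf_mono k _)) ?addn0// leqW.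
  subst i; rewrite [X in (_ + X)%N](_ : _ = 0)%N ?addn0; last by rewrite leNgt ui.
  rewrite (eq_bigr (fun=> 1%N)) ?sum1_card ?card_ord// => l _.
  by rewrite (le_trans (cdf_mono k (ltn_ord l)) iu).
move=> i iN; apply/eqP/idP => [qi|]; last by move=> /(H _ (leqnn _) i iN).
have [j jN ju] : exists2 j, (j < ncode k)%N & cdf k j <= u < cdf k j.+1.
  have ex : exists j, u < cdf k j by exists (ncode k); rewrite cdf1.
  case: (ex_minnP ex) => -[|j] uj jmin; first by rewrite cdf0 ltNge u0 in uj.
  exists j; first by apply: jmin; rewrite cdf1.
  by rewrite uj andbT leNgt; apply/negP => /jmin; rewrite ltnn.
by rewrite -qi /quantile (H _ (leqnn _) j jN ju).
Qed.

Lemma quantile_lt k u : 0 <= u < 1 -> (quantile k u < ncode k)%N.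
Proof.
move=> /andP[u0 u1].
have ex : exists j, u < cdf k j by exists (ncode k); rewrite cdf1.
case: (ex_minnP ex) => -[|j] uj jmin; first by rewrite cdf0 ltNge u0 in uj.
have jN : (j < ncode k)%N by apply: jmin; rewrite cdf1.
have /eqP-> // : quantile k u == j.
rewrite quantileP ?u0// uj andbT leNgt; apply/negP => /jmin; by rewrite ltnn.
Qed.

Lemma quantile_refine k u : 0 <= u < 1 -> (quantile k.+1 u %/ n k)%N = quantile k u.
Proof.
move=> u01; have jN := quantile_lt k.+1 u01; set j := quantile k.+1 u.
have /andP[_ nk] : (0 < ncode k)%N && (0 < n k)%N.
  by rewrite -muln_gt0; exact: leq_ltn_trans (leq0n _) jN.
have := quantileP u01 jN; rewrite eqxx => /esym/andP[H1 H2].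
apply/esym/eqP; rewrite quantileP//; last by rewrite ltn_divLR.
rewrite -(cdf_refine k (j %/ n k)) -(cdf_refine k (j %/ n k).+1) (le_trans _ H1) ?(lt_le_trans H2)//; apply: cdf_mono.
  by rewrite -ltn_divLR.
exact: leq_trunc_div.
Qed.

Lemma cell_quantile k i : (i < ncode k)%N ->
  [set u : R | 0 <= u < 1 /\ quantile k u = i] = `[cdf k i, cdf k i.+1[%classic.
Proof.
move=> iN; apply/seteqP; split=> u /=; rewrite in_itv/=.
  by move=> [u01 /eqP]; rewrite quantileP.
move=> ui; have u01 : 0 <= u < 1.
  move: ui => /andP[iu ui]; rewrite -(cdf0 k) -(cdf1 k) (le_trans _ iu) ?cdf_mono//.
  by rewrite (lt_le_trans ui)// cdf_mono.
by split => //; apply/eqP; rewrite quantileP.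
Qed.

Lemma cdfS k i : cdf k i.+1 - cdf k i = L (fun x => (code k x == i)%:R).
Proof.
rewrite -(addrK (cdf k i) (L _)); congr (_ - _).
rewrite /cdf -LD//; last by apply: b01 => x; case: (_ == _); rewrite ?lexx ?ler01.
congr L; apply/funext => x; rewrite /ind -[RHS]/(_ + _) -natrD ltnS leq_eqVlt.
by case: ltngtP => // ->; rewrite eqxx ltnn.
Qed.

Lemma L_code k (h : nat -> R) :
  L (fun x => h (code k x)) = \sum_(i < ncode k) h i * (cdf k i.+1 - cdf k i).
Proof.
pose F j : T -> R := fun x => \sum_(i < j) h i * (code k x == i)%:R.
have bi i : bounded_on (fun x => (code k x == i)%:R : R).
  by apply: b01 => x; case: (_ == _); rewrite ?lexx ?ler01.
have FS j : F j.+1 = F j + h j *: (fun x => (code k x == j)%:R : R).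
  by apply/funext => x; rewrite /F big_ord_recr.
have F0 : F 0 = 0 *: cst 1 by rewrite scale0_cst; apply/funext => x; rewrite /F big_ord0.
have b1 : bounded_on (cst 1 : T -> R) by apply: b01 => x; rewrite ler01 lexx.
have bF j : bounded_on (F j).
  elim: j => [|j IH]; first by rewrite F0; exact: bounded_onZ.
  by rewrite FS; apply: bounded_onD => //; exact: bounded_onZ.
have LF j : L (F j) = \sum_(i < j) h i * (cdf k i.+1 - cdf k i).
  elim: j => [|j IH]; first by rewrite F0 LZ// mul0r big_ord0.
  by rewrite FS LD//; [rewrite IH LZ// big_ord_recr/= cdfS|exact: bounded_onZ].
rewrite -LF; congr L; apply/funext => x; rewrite /F (bigD1 (Ordinal (code_lt k x)))//=.
rewrite eqxx mulr1 big1 ?addr0// => i ix; rewrite (_ : _ == _ = false) ?mulr0//.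
by apply/negbTE; apply: contra ix => /eqP E; apply/eqP/val_inj.
Qed.

Lemma cdf_code k i : cdf k i < cdf k i.+1 -> exists x, code k x = i.
Proof.
apply: contraPP => /forallNP H; apply/negP; rewrite -leNgt -subr_le0 cdfS.
rewrite (_ : (fun _ => _) = 0 *: cst 1) ?LZ ?mul0r//; last first.
  by rewrite scale0_cst; apply/funext => x; case: eqP => // /H.
by apply: b01 => x; rewrite ler01 lexx.
Qed.

(** A random point with law [L] cannot be sampled, as [L] is only finitely
    additive, but its codes can, consistently, from a single uniform variable. *)
Lemma sample_codes (x0 : T) : exists s : nat -> R -> T,
  [/\ forall k u, 0 <= u < 1 -> code k (s k u) = quantile k u,
      forall k l u, 0 <= u < 1 -> (k < l)%N -> c k (s l u) = c k (s k.+1 u),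
      forall k (Q : set T), measurable [set u : R | 0 <= u < 1 /\ Q (s k u)] &
      forall k f (e : R), bounded_on f -> (forall x, 0 <= f x) ->
        (forall x y, code k x = code k y -> f x <= f y + e) ->
        (\int[leb]_(u in `[0%R, 1%R[) (f (s k u))%:E <= (L f + e)%:E)%E].
Proof.
pose rep k i := if pselect (exists x, code k x = i) is left e then projT1 (cid e) else x0.
have repP k i x : code k x = i -> code k (rep k i) = i.
  by move=> xi; rewrite /rep; case: pselect => [e|[]]; [case: cid|exists x].
pose s k u := rep k (quantile k u).
have sE k u : 0 <= u < 1 -> code k (s k u) = quantile k u.
  move=> u01; have := quantileP u01 (quantile_lt k u01); rewrite eqxx => /esym/andP[H1 H2].
  have [x xq] := cdf_code (le_lt_trans H1 H2).
  exact: repP xq.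
have down k l u : 0 <= u < 1 -> (k <= l)%N -> code k (s l u) = code k (s k u).
  move=> u01 kl; rewrite (sE k)//; elim: l kl => [|l IH].
    by rewrite leqn0 => /eqP->; rewrite sE.
  rewrite leq_eqVlt => /predU1P[->|kl]; first by rewrite sE.
  have El : code l (s l.+1 u) = code l (s l u).
    by rewrite -(code_div l (s l.+1 u)) sE// quantile_refine// sE.
  rewrite -(IH kl); elim: l kl El {IH} => [|l IH]; first by rewrite ltnS leqn0 => /eqP->.
  rewrite ltnS leq_eqVlt => /predU1P[->//|kl] El.
  have El' : code l (s l.+2 u) = code l (s l.+1 u).
    by rewrite -(code_div l (s l.+2 u)) El code_div.
  have code_trans j x y : (k <= j)%N -> code j x = code j y -> code k x = code k y.
    elim: j => [|j IHj]; first by rewrite leqn0 => /eqP->.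
    rewrite leq_eqVlt => /predU1P[->//|kj] E.
    by apply: IHj => //; rewrite -(code_div j x) E code_div.
  exact: code_trans El'.
exists s; split=> //.
- move=> k l u u01 kl; apply: (@code_eq k k.+1) => //.
  by rewrite !down// sE.
- move=> k Q; rewrite (_ : mkset _ = \bigcup_(i in [set i | (i < ncode k)%N /\ Q (rep k i)])
      [set u : R | 0 <= u < 1 /\ quantile k u = i]).
    by apply: bigcup_measurable => i [iN _]; rewrite cell_quantile.
  apply/seteqP; split => u /=.
    by move=> [u01 Qu]; exists (quantile k u) => //; split => //; exact: quantile_lt.
  by move=> [i [iN Qi] [u01 qi]]; split => //; rewrite /s qi.
move=> k f e bf f0 fe.
have [M fM] := bf; have M0 : 0 <= M by exact: le_trans (normr_ge0 _) (fM x0).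
pose h i := f (rep k i).
have bh : bounded_on (fun x => h (code k x)) by exists M => x; exact: fM.
have e0 : 0 <= e by have := fe x0 x0 erefl; rewrite lerDl.
apply: (@le_trans _ _ (L (fun x => h (code k x)))%:E); last first.
  rewrite lee_fin; have be : bounded_on (e *: cst 1 : T -> R).
    by apply: bounded_onZ; apply: b01 => x; rewrite ler01 lexx.
  have -> : L f + e = L (f + e *: cst 1).
    rewrite LD// LZ ?L1 ?mulr1//; apply: b01 => x; by rewrite ler01 lexx.
  apply: L_mono => //; first exact: bounded_onD.
  move=> x; rewrite -[(f + _) x]/(f x + e * 1) mulr1; apply: fe.
  by rewrite (repP k _ x).
rewrite L_code.
have mcell i : measurable (`[cdf k i, cdf k i.+1[%classic : set R) by [].
have -> : (\int[leb]_(u in `[0%R, 1%R[) (f (s k u))%:E = \int[leb]_(u in `[0%R, 1%R[)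
    \sum_(i < ncode k) (h i * \1_(`[cdf k i, cdf k i.+1[%classic : set R) u)%:E)%E.
  apply: eq_integral => u /set_mem/=; rewrite in_itv/= => u01; rewrite sumEFin; congr (_%:E).
  rewrite (bigD1 (Ordinal (quantile_lt k u01)))//= big1 => [|i iq].
    by rewrite addr0 indicE mem_set ?mulr1//= in_itv/= -quantileP ?eqxx ?quantile_lt.
  rewrite indicE memNset ?mulr0//= in_itv/= -quantileP// => /eqP E.
  by move/negP : iq; apply; apply/eqP/val_inj.
rewrite ge0_integral_sum//; last 2 first.
- move=> i; apply/measurable_EFinP; exact: measurable_funM.
- by move=> i u _; rewrite lee_fin mulr_ge0// f0.
rewrite -sumEFin; apply: lee_sum => i _.
under eq_integral do rewrite EFinM.
rewrite ge0_integralZl//; last 2 first.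
- by apply/measurable_EFinP; exact: measurable_indic.
- by rewrite lee_fin f0.
rewrite EFinM lee_wpmul2l ?lee_fin ?f0//.
rewrite integral_indic//; apply: (@le_trans _ _ (leb `[cdf k i, cdf k i.+1[)).
  by apply: le_measure; [apply: mem_set; exact: measurableI|exact: mem_set|move=> x []].
rewrite lebesgue_measure_itv/= lte_fin; case: ltP => _; first by rewrite -EFinB.
by rewrite lee_fin subr_ge0 cdf_mono.
Qed.

End codes.

(** * Optimal chains by dynamic programming *)

Section optimal_chains.
Context (R : realType) (X : completeMetricType R) (m : {measure set (borel X) -> \bar R}).
Variables (N : R) (K : nat).
Hypothesis radonm : radon m.
Hypothesis cdX : CD0 N m.
Hypothesis K2 : (2 <= K)%N.
Hypothesis NK : N <= K%:R.
Variables (w : X) (R0 T : R).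
Hypothesis Sw : supp m w.
Hypothesis T01 : 0 < T < 1.

Let B := sball m w R0.
Let cB : compact B. Proof. exact: (compact_sball radonm cdX K2 NK). Qed.
Let mB : measurable (B : set (borel X)). Proof. exact: measurable_sball. Qed.
Let Boo : (m B < +oo)%E. Proof. exact: (sball_finite radonm cdX K2 NK). Qed.

(** [geo s p s' q]: a geodesic towards [w], parametrized so that it would reach
    [w] at time [1], can go through [p] at time [s] and [q] at time [s']. *)
Definition geo (s : R) (p : X) (s' : R) (q : X) :=
  mdist q w * (1 - s) = (1 - s') * mdist p w /\ mdist p q * (1 - s) = (s' - s) * mdist p w.

Fixpoint chain (s : R) (p : X) (L : seq (R * (X -> R))) (g : R -> X) : Prop :=
  if L is (s', _) :: L' then [/\ geo s p s' (g s'), B (g s') & chain s' (g s') L' g]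
  else True.

Definition cost (L : seq (R * (X -> R))) (g : R -> X) : R := \sum_(tp <- L) tp.2 (g tp.1).

Definition times (L : seq (R * (X -> R))) := [seq tp.1 | tp <- L].

Lemma chain_eq s p L g g' : (forall t, t \in times L -> g t = g' t) ->
  chain s p L g -> chain s p L g'.
Proof.
elim: L s p => // -[s' psi] L IH s p gg /= [H1 H2 H3].
have E : g s' = g' s' by apply: gg; rewrite /= inE eqxx.
rewrite -E; split => //; apply: IH H3 => t tL; apply: gg.
by rewrite /= inE tL orbT.
Qed.

Lemma cost_eq L g g' : (forall t, t \in times L -> g t = g' t) -> cost L g = cost L g'.
Proof.
rewrite /cost; elim: L => [|[s psi] L IH] gg; first by rewrite !big_nil.
rewrite !big_cons/= IH ?gg ?inE ?eqxx// => t tL; apply: gg.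
by rewrite /= inE tL orbT.
Qed.

Lemma geo_closed s s' p (q : nat -> X) (pn : nat -> X) z : 0 <= s -> s < s' -> s' < 1 ->
  (forall n, geo s (pn n) s' (q n)) -> (forall n, mdist (pn n) p <= n.+1%:R^-1) ->
  (forall C : set X, closed C -> (\forall n \near \oo, C (q n)) -> C z) -> geo s p s' z.
Proof.
move=> s0 ss' s'1 gq pnp zC.
have u0 : 0 < 1 - s by slra. have u0' : 0 < 1 - s' by slra.
have close (e : R) : 0 < e -> `|mdist z w - (1 - s') / (1 - s) * mdist p w| <= e /\
    `|mdist z p - (s' - s) / (1 - s) * mdist p w| <= e.
  move=> e0; have e20 : 0 < e / 2 by rewrite divr_gt0.
  split.
    have := zC _ (@closed_mdist_near R X w ((1 - s') / (1 - s) * mdist p w) e); apply.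
    have := natSinv_lt e0; apply: filterS => n ne /=; have [g1 _] := gq n.
    have -> : mdist (q n) w = (1 - s') / (1 - s) * mdist (pn n) w.
      by rewrite mulrAC -g1 mulfK ?gt_eqF.
    rewrite -mulrBr normrM ger0_norm ?divr_ge0 ?(ltW u0) ?(ltW u0')//.
    apply: (@le_trans _ _ (mdist (pn n) p)); last exact: le_trans (pnp n) (ltW ne).
    apply: le_trans (mdist_lip _ _ w); rewrite ler_piMl// ler_pdivrMr//; slra.
  have := zC _ (@closed_mdist_near R X p ((s' - s) / (1 - s) * mdist p w) e); apply.
  have := natSinv_lt e20; apply: filterS => n ne /=; have [_ g2] := gq n.
  have E : mdist (pn n) (q n) = (s' - s) / (1 - s) * mdist (pn n) w.
    by rewrite mulrAC -g2 mulfK ?gt_eqF.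
  have h1 := mdist_lip p (pn n) (q n); have h2 := mdist_lip (pn n) p w.
  rewrite E (metric_sym p (q n)) (metric_sym p (pn n)) in h1.
  have h3 : `|(s' - s) / (1 - s) * mdist (pn n) w - (s' - s) / (1 - s) * mdist p w| <= mdist (pn n) p.
    rewrite -mulrBr normrM ger0_norm ?divr_ge0 ?(ltW u0) ?subr_ge0 ?(ltW ss')//.
    by apply: le_trans h2; rewrite ler_piMl// ler_pdivrMr//; slra.
  have := ler_normD (mdist (q n) p - (s' - s) / (1 - s) * mdist (pn n) w)
    ((s' - s) / (1 - s) * mdist (pn n) w - (s' - s) / (1 - s) * mdist p w).
  rewrite addrA subrK => /le_trans; apply; rewrite [leRHS]splitr.
  by apply: lerD; [apply: (le_trans h1)|apply: (le_trans h3)]; apply: (le_trans (pnp n)); exact: ltW.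
have E1 : mdist z w = (1 - s') / (1 - s) * mdist p w.
  apply/eqP; rewrite -subr_eq0 -normr_le0; apply/ler_addgt0Pr => e e0.
  by rewrite add0r; have [] := close e e0.
have E2 : mdist z p = (s' - s) / (1 - s) * mdist p w.
  apply/eqP; rewrite -subr_eq0 -normr_le0; apply/ler_addgt0Pr => e e0.
  by rewrite add0r; have [] := close e e0.
by split; [rewrite E1|rewrite (metric_sym p z) E2]; rewrite mulrAC divfK ?gt_eqF.
Qed.

Lemma geo_exists s s' p : 0 <= s -> s < s' -> s' < 1 -> B p -> exists2 q, B q & geo s p s' q.
Proof.
move=> s0 ss' s'1 [Sp pw]; have u0 : 0 < 1 - s by slra.
have th01 : 0 < (s' - s) / (1 - s) < 1.
  by apply/andP; split; [rewrite divr_gt0// subr_gt0|rewrite ltr_pdivrMr// mul1r ltrD2r].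
have [q Sq [H1 H2]] := intermediate_point radonm cdX K2 NK Sp Sw th01.
have E : 1 - (s' - s) / (1 - s) = (1 - s') / (1 - s) by field; rewrite gt_eqF.
exists q; last by split; rewrite ?H1 ?H2 ?E mulrAC divfK ?gt_eqF.
split => //; rewrite H2; apply: le_trans pw.
by rewrite ler_piMl ?mdist_ge0//; have /andP[? ?] := th01; slra.
Qed.

Fixpoint admissible (s : R) (L : seq (R * (X -> R))) : Prop :=
  if L is (s', psi) :: L' then
    [/\ s < s' <= T, continuous psi, exists M : R, forall x, 0 <= psi x <= M & admissible s' L']
  else True.

Definition total_mass (L : seq (R * (X -> R))) : \bar R :=
  (\sum_(tp <- L) \int[m]_(x in B) (tp.2 x)%:E)%E.

Lemma total_mass_ge0 s L : admissible s L -> (0 <= total_mass L)%E.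
Proof.
rewrite /total_mass; elim: L s => [|[t f] L IH] s /=; first by rewrite big_nil.
move=> [_ _ [M fM] /IH H]; rewrite big_cons adde_ge0//.
by apply: integral_ge0 => x _; have /andP[] := fM x.
Qed.

Lemma admissible_lt s L t : admissible s L -> t \in times L -> s < t.
Proof.
elim: L s => // -[s' psi] L IH s /= [/andP[ss' _] _ _ aL]; rewrite inE => /predU1P[->//|tL].
exact: lt_trans ss' (IH _ aL tL).
Qed.

Lemma closed_seq (A : set X) : (forall p (q : nat -> X), (forall n, A (q n)) ->
  (forall n, mdist (q n) p <= n.+1%:R^-1) -> A p) -> closed A.
Proof.
move=> H p clp; have ex n : exists q, A q /\ mdist q p <= n.+1%:R^-1.
  have [|q [Aq pq]] := clp [set q | mdist p q < n.+1%:R^-1].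
    by apply/nbhs_mdistE; exists n.+1%:R^-1; rewrite ?invr_gt0.
  by exists q; split => //; rewrite metric_sym ltW.
by have [q Hq] := choice ex; apply: (H p q) => n; have [] := Hq n.
Qed.

Lemma lsc_measurable (V : X -> R) : (forall x, 0 <= V x) -> (forall x, ~ B x -> V x = 0) ->
  (forall c, closed (B `&` [set x | V x <= c])) -> measurable_fun setT (V : borel X -> R).
Proof.
move=> V0 VB cV; apply: (measurability (@RGenOInfty.G R)); first exact: RGenOInfty.measurableE.
move=> _ [_ [a ->] <-]; rewrite setTI.
have [a0|a0] := ltP a 0.
  rewrite (_ : _ @^-1` _ = setT)//; apply/seteqP; split => // x _ /=.
  by rewrite in_itv/= andbT (lt_le_trans a0).
rewrite (_ : _ @^-1` _ = B `\` (B `&` [set x | V x <= a])).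
  by apply: measurableD => //; apply: closed_borel.
apply/seteqP; split => x /=; rewrite in_itv/= andbT.
  move=> ax; split=> [|[_]]; last by rewrite leNgt ax.
  by apply: contrapT => /VB Vx; move: ax; rewrite Vx ltNge a0.
by move=> [Bx nV]; rewrite ltNge; apply/negP => H; apply: nV.
Qed.

(** Dynamic programming: the value function of the cheapest chain is lower
    semicontinuous, and contracting its superlevel sets towards [w] bounds its
    integral. *)
Lemma value_function L s : 0 <= s <= T -> admissible s L ->
  exists V : X -> R, [/\ exists M : R, forall x, 0 <= V x <= M,
    forall x, ~ B x -> V x = 0, forall c, closed (B `&` [set x | V x <= c]),
    forall p, B p -> exists g : R -> X, [/\ g s = p, chain s p L g & cost L g <= V p] &
    (((1 - T) ^+ K)%:E * \int[m]_(x in B) (V x)%:E <= ((1 - s) ^+ K)%:E * total_mass L)%E].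
Proof.
have /andP[T0 T1] := T01.
elim: L s => [|[s' psi] L IH] s /andP[s0 sT].
  move=> _; exists (cst 0); split => //.
  - by exists 0 => x; rewrite lexx.
  - move=> c; apply: closedI; first exact: closed_sball.
    have [c0|c0] := leP 0 c; [rewrite (_ : mkset _ = setT)|rewrite (_ : mkset _ = set0)].
    + exact: closedT.
    + by apply/seteqP; split.
    + exact: closed0.
    + by apply/seteqP; split => // x /=; rewrite leNgt c0.
  - by move=> p Bp; exists (cst p); split => //; rewrite /cost big_nil.
  - by rewrite integral0 mule0 /total_mass big_nil mule0.
move=> /= [/andP[ss' s'T] cpsi [Mp psiM] aL].
have s'1 : s' < 1 by slra. have s'0 : 0 <= s' <= T by apply/andP; split; slra.
have u0 : 0 < 1 - s by slra. have u0' : 0 < 1 - s' by slra.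
have [V' [[M' V'M] V'B cV' V'g V'i]] := IH s' s'0 aL.
pose W x := psi x + V' x.
have W0 x : 0 <= W x by have /andP[? _] := psiM x; have /andP[? _] := V'M x; rewrite addr_ge0.
have WM x : W x <= Mp + M' by have /andP[_ ?] := psiM x; have /andP[_ ?] := V'M x; rewrite lerD.
have cW c : closed (B `&` [set x | W x <= c]).
  apply: closed_nbhs => x nx; have [Bx|Bx] := pselect (B x); last first.
    have : nbhs x (~` B) by apply: open_nbhs_nbhs; split => //; exact/closed_openC/closed_sball.
    by apply: filterS => y nBy [By _].
  have cx : c < W x by rewrite ltNge; apply/negP => H; apply: nx.
  pose e := (W x - c) / 2; have e0 : 0 < e by rewrite divr_gt0// subr_gt0.
  have ee : e + e = W x - c by rewrite /e -splitr.
  have n1 : nbhs x [set y | psi x - e < psi y].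
    have /cvgrPdist_lt/(_ e e0) := cpsi x; apply: filterS => y /=.
    by rewrite ltr_norml => /andP[_]; slra.
  have n2 : nbhs x (~` (B `&` [set y | V' y <= V' x - e])).
    apply: open_nbhs_nbhs; split; first exact/closed_openC/cV'.
    by move=> [_ /=]; slra.
  apply: filterS2 n1 n2 => y /= h1 h2 [By]; rewrite /= => Wy; apply: h2; split => //=.
  by move: Wy ee; rewrite /W; slra.
pose Z p := B `&` [set q | geo s p s' q].
have Znz p : B p -> exists q, Z p q.
  by move=> Bp; have [q Bq gq] := geo_exists s0 ss' s'1 Bp; exists q.
pose V p := if `[< B p >] then inf [set W q | q in Z p] else 0.
have VE p : B p -> V p = inf [set W q | q in Z p] by move=> Bp; rewrite /V asboolT.
have Vle p q : B p -> Z p q -> V p <= W q.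
  by move=> Bp Zq; rewrite VE//; apply: ge_inf; [exists 0 => _ [y _ <-]|exists q].
have Vatt p : B p -> exists2 q, Z p q & W q <= V p.
  move=> Bp; have ex n : exists q, Z p q /\ W q <= V p + n.+1%:R^-1.
    have n0 : 0 < n.+1%:R^-1 :> R by rewrite invr_gt0.
    have hi : has_inf [set W q | q in Z p].
      split; first by have [q Zq] := Znz p Bp; exists (W q); exists q.
      by exists 0 => _ [y _ <-].
    by have [_ [q Zq <-] H] := inf_adherent n0 hi; exists q; split => //; rewrite VE// ltW.
  have [q Hq] := choice ex.
  have [|z Bz zC] := compact_seq_limit (q := q) cB; first by move=> n; have [[]] := Hq n.
  exists z; first split => //.
    apply: (@geo_closed s s' p q (fun=> p)) => //.
    - by move=> n; have [[]] := Hq n.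
    - by move=> n; rewrite mdistxx invr_ge0.
  apply/ler_addgt0Pr => e e0; have [] // : (B `&` [set x | W x <= V p + e]) z.
  apply: zC => //; have := natSinv_lt e0; apply: filterS => n ne; have [[Bq _] Wq] := Hq n.
  by split => //=; apply: (le_trans Wq); rewrite lerD2l ltW.
have V0 x : 0 <= V x.
  rewrite /V; case: asboolP => // Bx; apply: lb_le_inf => [|_ [y _ <-]//].
  by have [q Zq] := Znz x Bx; exists (W q); exists q.
have MM : 0 <= Mp + M' by apply: le_trans (WM w).
have VM x : V x <= Mp + M'.
  have [Bx|Bx] := pselect (B x); last by rewrite /V asboolF.
  by have [q Zq] := Znz x Bx; apply: (le_trans (Vle _ _ Bx Zq)).
have VB x : ~ B x -> V x = 0 by move=> Bx; rewrite /V asboolF.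
have cV c : closed (B `&` [set x | V x <= c]).
  apply: closed_seq => p pn Hp pnp.
  have Bp : B p.
    apply: closed_sball => U /nbhs_mdistE[e e0 eU]; have [n _ Hn] := natSinv_lt e0.
    exists (pn n); split; first by have [] := Hp n.
    by apply: eU; rewrite metric_sym (le_lt_trans (pnp n))//; apply: Hn => /=.
  have ex n : exists q, Z (pn n) q /\ W q <= c.
    have [Bn Vn] := Hp n; have [q Zq Wq] := Vatt _ Bn.
    by exists q; split => //; exact: le_trans Vn.
  have [q Hq] := choice ex.
  have [|z Bz zC] := compact_seq_limit (q := q) cB; first by move=> n; have [[]] := Hq n.
  split => //=; have [_ /= Wz] : (B `&` [set x | W x <= c]) z.
    by apply: zC => //; exists 0 => // n _; have [[Bq _] Wq] := Hq n.
  apply: le_trans Wz; apply: Vle => //; split => //=.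
  by apply: (@geo_closed s s' p q pn) => // n; have [[]] := Hq n.
have mV : measurable_fun setT (V : borel X -> R) by exact: lsc_measurable.
have mV' : measurable_fun setT (V' : borel X -> R).
  by apply: lsc_measurable => // x; have /andP[] := V'M x.
have mpsi : measurable_fun setT (psi : borel X -> R) by exact: continuous_borel.
exists V; split => //.
- by exists (Mp + M') => x; rewrite V0 VM.
- move=> p Bp; have [q [Bq gq] Wq] := Vatt p Bp; have [g [gs' gL gV]] := V'g q Bq.
  pose g' t := if t == s then p else g t.
  have gg' t : t \in s' :: times L -> g t = g' t.
    rewrite /g' inE => tL; case: eqP => // ts; have : s < t.
      move: tL => /predU1P[->//|tL]; exact: lt_trans ss' (admissible_lt aL tL).
    by rewrite ts ltxx.
  have g's' : g' s' = q by rewrite -gg' ?gs'// inE eqxx.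
  exists g'; split; first by rewrite /g' eqxx.
    split; rewrite ?g's'//; apply: chain_eq gL => t tL; apply: gg'.
    by rewrite inE tL orbT.
  rewrite /cost big_cons/= g's'; apply: le_trans Wq; rewrite /W lerD2l.
  rewrite -/(cost L g') -(@cost_eq L g g'); first exact: gV.
  by move=> t tL; apply: gg'; rewrite inE tL orbT.
have c1 : 0 < (1 - s) ^+ K by rewrite exprn_gt0.
have c2 : 0 < (1 - s') ^+ K by rewrite exprn_gt0.
have c3 : 0 < (1 - T) ^+ K by rewrite exprn_gt0// subr_gt0.
have step_ : (((1 - s') ^+ K / (1 - s) ^+ K)%:E * \int[m]_(x in B) (V x)%:E <=
    \int[m]_(x in B) (W x)%:E)%E.
  apply: (@layer_cake _ (borel X) R m V W B (Mp + M')) => //.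
  - by rewrite divr_ge0 ?ltW.
  - exact: measurable_funD.
  - by move=> x; rewrite V0 VM.
  move=> a a0.
  have mlt (U : X -> R) : measurable_fun setT (U : borel X -> R) ->
      measurable (B `&` [set x | a < U x] : set (borel X)).
    move=> mU; apply: measurableI => //.
    have := mU measurableT _ (measurable_itv `]a, +oo[); rewrite setTI.
    by congr measurable; apply/seteqP; split => x /=; rewrite in_itv/= andbT.
  have th01 : 0 < (s' - s) / (1 - s) < 1.
    by apply/andP; split; [rewrite divr_gt0// subr_gt0|rewrite ltr_pdivrMr// mul1r ltrD2r].
  have E : 1 - (s' - s) / (1 - s) = (1 - s') / (1 - s) by field; rewrite gt_eqF.
  rewrite -expr_div_n -E.
  apply: (brunn_minkowski (r := R0) radonm cdX K2 NK _ _ _ _ _ Sw th01).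
  - exact: mlt.
  - by apply: mlt; exact: measurable_funD.
  - by move=> x [[]].
  - by move=> x [[]].
  - apply: le_lt_trans Boo; apply: le_measure => [||x []//]; apply: mem_set => //; exact: mlt.
  move=> p z [Bp /= ap] Sz; rewrite E => pz zw; have Bz : B z.
    split => //; rewrite zw; have [_ pw] := Bp; apply: le_trans pw.
    by rewrite ler_piMl ?mdist_ge0// ler_pdivrMr// mul1r; slra.
  split => //=; apply: (lt_le_trans ap); apply: Vle => //; split => //.
  by split; rewrite ?pz ?zw mulrAC divfK ?gt_eqF.
have fin (U : X -> R) (M : R) : (forall x, 0 <= U x <= M) -> measurable_fun setT (U : borel X -> R) ->
    (\int[m]_(x in B) (U x)%:E)%E \is a fin_num.
  move=> UM mU; rewrite ge0_fin_numE; last first.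
    by apply: integral_ge0 => x _; have /andP[] := UM x.
  apply: (@le_lt_trans _ _ (\int[m]_(x in B) (`|M|)%:E)%E).
    apply: lower_integral_le => x _; have /andP[h1 h2] := UM x; rewrite lee_fin//.
    exact: le_trans (ler_norm M).
  by rewrite integral_cst// lte_mul_pinfty// lee_fin.
have WE : (\int[m]_(x in B) (W x)%:E = \int[m]_(x in B) (psi x)%:E + \int[m]_(x in B) (V' x)%:E)%E.
  rewrite -ge0_integralD//.
  - by move=> x _; have /andP[] := psiM x.
  - by apply/measurable_EFinP; exact: measurable_funTS.
  - by move=> x _; have /andP[] := V'M x.
  - by apply/measurable_EFinP; exact: measurable_funTS.
have VMb x : 0 <= V x <= Mp + M' by rewrite V0 VM.
move: step_ V'i; rewrite WE /total_mass big_cons /=.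
rewrite -(fineK (fin _ _ VMb mV)) -(fineK (fin _ _ psiM mpsi)) -(fineK (fin _ _ V'M mV')).
set iV := fine _; set ip := fine _; set iV' := fine _.
have := total_mass_ge0 aL; rewrite /total_mass.
case: (\sum_(_ <- L) _)%E => [tot|_ _ _|]; last 2 first.
- by rewrite addeC/= mulry gtr0_sg// mul1e leey.
- by rewrite leNgt ltNy0.
move=> _; rewrite -!EFinD -!EFinM !lee_fin => H1 H2.
have ip0 : 0 <= ip by apply: fine_ge0; apply: integral_ge0 => x _; have /andP[] := psiM x.
have H1' : (1 - s') ^+ K * iV <= (1 - s) ^+ K * (ip + iV').
  by rewrite -ler_pdivrMl// mulrA (mulrC (_ ^+ K)^-1).
have gb : (1 - T) ^+ K <= (1 - s') ^+ K.
  by rewrite lerXn2r// ?nnegrE ?lerD2l ?lerN2// subr_ge0 ltW.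
rewrite -(ler_pM2l c2) mulrCA; apply: (@le_trans _ _ ((1 - T) ^+ K * ((1 - s) ^+ K * (ip + iV')))).
  by rewrite ler_pM2l.
rewrite mulrCA [leRHS]mulrCA ler_pM2l// !mulrDr lerD//.
by rewrite ler_wpM2r.
Qed.

(** A chain from a given set of positive measure that is no more expensive
    than the average cost. *)
Lemma cheap_chain (A : set X) (L : seq (R * (X -> R))) (e : R) : A `<=` B ->
  measurable (A : set (borel X)) -> (0 < m A)%E -> admissible 0 L -> 0 < e ->
  exists g : R -> X, [/\ A (g 0), chain 0 (g 0) L g &
    ((cost L g)%:E <= ((1 - T) ^- K / fine (m A))%:E * total_mass L + e%:E)%E].
Proof.
move=> AB mA A0 aL e0; have /andP[T0 T1] := T01.
have [|V [[M VM] VB cV Vg Vi]] := value_function _ aL; first by rewrite lexx ltW.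
have mV : measurable_fun setT (V : borel X -> R).
  by apply: lsc_measurable => // x; have /andP[] := VM x.
have Aoo : (m A < +oo)%E.
  by apply: le_lt_trans Boo; apply: le_measure => //; exact: mem_set.
have mAE : m A = (fine (m A))%:E by rewrite fineK// ge0_fin_numE.
have a0 : 0 < fine (m A) by rewrite -lte_fin -mAE.
have g0 : 0 < (1 - T) ^+ K by rewrite exprn_gt0// subr_gt0.
set r := (((1 - T) ^- K / fine (m A))%:E * total_mass L)%E.
have [p Ap pr] : exists2 p, A p & ((V p)%:E <= r + e%:E)%E.
  apply: contrapT => /forall2NP H.
  have rV p : A p -> (r + e%:E <= (V p)%:E)%E.
    by move=> Ap; have [//|/negP] := H p; rewrite -ltNge => /ltW.
  have [p0 Ap0] : A !=set0.
    by apply/set0P/eqP => A00; move: A0; rewrite A00 measure0 ltxx.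
  have rfin : (r < +oo)%E.
    apply: (@le_lt_trans _ _ (V p0)%:E); last exact: ltry.
    by apply: le_trans (rV _ Ap0); rewrite leeDl// lee_fin ltW.
  have t0 := total_mass_ge0 aL.
  have iVB : (\int[m]_(x in A) (V x)%:E <= \int[m]_(x in B) (V x)%:E)%E.
    apply: ge0_subset_integral => //.
    - by apply/measurable_EFinP; exact: measurable_funTS.
    - by move=> x _; have /andP[] := VM x.
  have iVA : ((r + e%:E) * m A <= \int[m]_(x in A) (V x)%:E)%E.
    rewrite -integral_cst//; apply: lower_integral_le => x Ax; last exact: rV.
    by rewrite adde_ge0 ?lee_fin ?(ltW e0)// /r mule_ge0// lee_fin divr_ge0 ?invr_ge0 ?(ltW g0) ?(ltW a0).
  have := le_trans iVA iVB; rewrite leNgt => /negP; apply.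
  move: Vi; rewrite subr0 expr1n mul1e => Vi.
  apply: (@le_lt_trans _ _ (((1 - T) ^- K)%:E * total_mass L)%E).
    by rewrite lee_pdivlMl.
  rewrite mAE ge0_muleDl ?lee_fin ?(ltW e0)//; last first.
    by rewrite /r mule_ge0// lee_fin divr_ge0 ?invr_ge0 ?(ltW g0) ?(ltW a0).
  have -> : (r * (fine (m A))%:E = ((1 - T) ^- K)%:E * total_mass L)%E.
    by rewrite /r muleC muleA -EFinM mulrCA mulfV ?gt_eqF// mulr1.
  rewrite lteDl; first by rewrite -EFinM lte_fin mulr_gt0.
  rewrite ge0_fin_numE; last by rewrite mule_ge0// lee_fin invr_ge0 ltW.
  apply: lte_mul_pinfty; rewrite ?lee_fin ?invr_ge0 ?(ltW g0)//.
  move: rfin; rewrite /r; case: (total_mass L) t0 => [t _ _|_|//]; first exact: ltry.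
  by rewrite mulry gtr0_sg ?mul1e// divr_gt0// invr_gt0.
have [g [gp gL gV]] := Vg p (AB _ Ap).
exists g; split; rewrite ?gp//; apply: le_trans pr; by rewrite lee_fin.
Qed.

(** Each step of a chain stops a geodesic towards [w] and starts another one with
    the same speed, so the lengths of the steps add up. *)
Lemma chain_dist s p L g : 0 <= s -> admissible s L -> chain s p L g -> g s = p ->
  (forall t, t \in s :: times L -> t < 1 -> mdist (g t) w * (1 - s) = (1 - t) * mdist p w) /\
  (forall t t', t \in s :: times L -> t' \in s :: times L -> t <= t' ->
    mdist (g t) (g t') * (1 - s) <= (t' - t) * mdist p w).
Proof.
have /andP[T0 T1] := T01.
elim: L s p => [|[s' psi] L IH] s p s0 aL cL gs.
  split=> [t|t t']; rewrite !inE.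
    by move=> /eqP -> _; rewrite gs mulrC.
  by move=> /eqP-> /eqP-> _; rewrite mdistxx mul0r subrr mul0r.
move: aL cL => /= [/andP[ss' s'T] _ _ aL] [[z1 z2] Bs' cL].
have s'0 : 0 <= s' by slra. have [H1 H2] := IH s' (g s') s'0 aL cL erefl.
have u0 : 0 < 1 - s by slra. have u0' : 0 < 1 - s' by slra.
have up t : t \in s' :: times L -> s' <= t.
  by rewrite inE => /predU1P[->//|tL]; exact: ltW (admissible_lt aL tL).
have D2 t t' : t \in s' :: times L -> t' \in s' :: times L -> t <= t' ->
    mdist (g t) (g t') * (1 - s) <= (t' - t) * mdist p w.
  move=> tL t'L tt'; have := H2 t t' tL t'L tt'; rewrite -(ler_pM2l u0) => H.
  rewrite -(ler_pM2l u0') mulrCA [leLHS]mulrCA; apply: le_trans (_ : _ <= (t' - t) * ((1 - s') * mdist p w)) _.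
    by rewrite -z1; move: H; rewrite !mulrA [_ * (1 - s')]mulrC; rewrite (mulrC (1 - s)) -!mulrA (mulrC (1 - s)) !mulrA.
  by rewrite mulrCA.
split=> [t|t t'].
  rewrite inE => /predU1P[->|tL t1]; first by move=> _; rewrite gs mulrC.
  apply: (@mulfI _ (1 - s')); first by rewrite gt_eqF.
  by rewrite mulrA (mulrC (1 - s')) (H1 t tL t1) -mulrA z1 mulrCA.
rewrite inE => /predU1P[->|tL]; rewrite inE => /predU1P[->|t'L] tt'.
- by rewrite mdistxx mul0r subrr mul0r.
- have h := D2 s' t' (mem_head _ _) t'L (up _ t'L).
  apply: (@le_trans _ _ ((mdist (g s) (g s') + mdist (g s') (g t')) * (1 - s))).
    by rewrite ler_pM2r//; exact: metric_triangle.
  rewrite mulrDl {1}gs z2; apply: (le_trans (lerD (lexx _) h)); rewrite -mulrDl.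
  by rewrite addrC addrA subrK.
- by move: (up _ tL) => st; exfalso; slra.
- exact: D2.
Qed.

End optimal_chains.

(** * Cheap near-geodesics *)

Section filter_limits.
Context (R : realType) (X : completeMetricType R) (I : Type) (F : set_system I).
Context {FF : ProperFilter F}.

Lemma cvg_mdist_le (f g : I -> X) (x y : X) (r : R) : f @ F --> x -> g @ F --> y ->
  (\forall i \near F, mdist (f i) (g i) <= r) -> mdist x y <= r.
Proof.
move=> fx gy fg; apply/ler_addgt0Pr => e e0; have e20 : 0 < e / 2 by rewrite divr_gt0.
have nf : F (f @^-1` [set z | mdist x z < e / 2]) by apply: (fx [set z | _]); apply/nbhs_mdistE; exists (e / 2).
have ng : F (g @^-1` [set z | mdist y z < e / 2]) by apply: (gy [set z | _]); apply/nbhs_mdistE; exists (e / 2).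
have [i [[/= h1 h2] h3]] := filter_ex (filterI (filterI nf ng) fg).
apply: (le_trans (metric_triangle x (f i) y)).
have := metric_triangle (f i) (g i) y; rewrite (metric_sym (g i)).
by rewrite [e]splitr; slra.
Qed.

Lemma cvg_closed (f : I -> X) (x : X) (A : set X) : closed A -> f @ F --> x ->
  (\forall i \near F, A (f i)) -> A x.
Proof. by move=> cA fx fA; apply: cA => U /fx FU; have [i []] := filter_ex (filterI fA FU); exists (f i). Qed.

Lemma cvg_ler (f : I -> R) (x r : R) : f @ F --> x ->
  (\forall i \near F, f i <= r) -> x <= r.
Proof.
move=> fx fr; apply/ler_addgt0Pr => e e0.
have fx' := (@cvgrPdist_lt R R^o I F FF f x).1 fx e e0.
have [i [/= + h2]] := filter_ex (filterI fx' fr).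
by rewrite ltr_norml => /andP[_]; slra.
Qed.

End filter_limits.

Lemma big_group (V : nmodType) (I : Type) (T : eqType) (k : I -> T) (L : seq I) (F : seq T)
    (h : I -> T -> V) : uniq F -> {subset map k L <= F} ->
  \sum_(t <- F) \sum_(i <- L | k i == t) h i t = \sum_(i <- L) h i (k i).
Proof.
move=> uF; elim: L => [|i L IH] sLF.
  by rewrite big_nil big1// => t _; rewrite big_nil.
rewrite big_cons -IH; last by move=> t tL; apply: sLF; rewrite /= inE tL orbT.
have kF : k i \in F by apply: sLF; rewrite /= mem_head.
under eq_bigr do rewrite big_cons.
rewrite (eq_bigr (fun t => (if t == k i then h i t else 0) +
    \sum_(j <- L | k j == t) h j t)); last first.
  by move=> t _; rewrite eq_sym; case: eqP => _; rewrite ?add0r.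
by rewrite big_split/=; congr (_ + _); rewrite -big_mkcond -big_filter filter_pred1_uniq// big_seq1.
Qed.

Lemma ultra_fmap (I J : Type) (U : set_system I) (f : I -> J) :
  UltraFilter U -> UltraFilter (f @ U).
Proof.
move=> UU; split=> [|G PG fG]; first exact: fmap_proper_filter.
apply/seteqP; split; last exact: fG.
move=> A GA; have [//|nA] := in_ultra_setVsetC (f @^-1` A) UU.
by have [x []] := filter_ex (filterI GA (fG (~` A) nA)).
Qed.

Section cheap_curves.
Context (R : realType) (X : completeMetricType R) (m : {measure set (borel X) -> \bar R}).
Variables (N : R) (K : nat).
Hypothesis radonm : radon m.
Hypothesis cdX : CD0 N m.
Hypothesis K2 : (2 <= K)%N.
Hypothesis NK : N <= K%:R.
Variables (a w : X) (rho sg T : R).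
Hypothesis Sw : supp m w.
Hypothesis Sa : supp m a.
Hypothesis rho0 : 0 < rho.
Hypothesis sgT : 0 < sg < T.
Hypothesis T1 : T < 1.

Definition len : R := mdist a w + rho.

(** Near-geodesics from a ball around [a] to a point near [w]. The initial and
    final pieces are cut off, as mass cannot be controlled there. *)
Definition near_geodesic (c : R -> X) :=
  [/\ forall t, 0 <= t <= 1 -> sball m w len (c t),
      forall t t', 0 <= t <= 1 -> 0 <= t' <= 1 -> mdist (c t) (c t') <= len * `|t - t'|,
      mdist (c 0) a <= rho + sg * len & mdist (c 1) w <= (1 - T) * len].

Definition nice_test (tp : R * (X -> R)) := [/\ 0 <= tp.1 <= 1, continuous tp.2 &
  exists M : R, forall x, 0 <= tp.2 x <= M].

Definition mass_bound : R := (1 - T) ^- K / fine (m (sball m a rho)).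

Definition mean_cost (L : seq (R * (X -> R))) : R :=
  \sum_(tp <- L) mass_bound * fine (\int[m]_(x in sball m w len) (tp.2 x)%:E)%E.

Fixpoint all_nice (L : seq (R * (X -> R))) : Prop :=
  if L is tp :: L' then nice_test tp /\ all_nice L' else True.

Let par (t : R) : R := sg + t * (T - sg).

Let len0 : 0 < len. Proof. by rewrite /len ltr_wpDl// mdist_ge0. Qed.

Let par_mono t t' : t < t' -> par t < par t'.
Proof. by move=> tt; rewrite /par ltrD2l ltr_pM2r// subr_gt0; have /andP[] := sgT. Qed.

Let par_bounds t : 0 <= t <= 1 -> 0 < par t <= T.
Proof.
move=> /andP[t0 t1]; have /andP[s0 sT] := sgT; have u0 : 0 < T - sg by slra.
have h0 : 0 <= t * (T - sg) by rewrite mulr_ge0// ltW.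
have h1 : t * (T - sg) <= T - sg by rewrite ler_piMl// ltW.
by rewrite /par; apply/andP; split; slra.
Qed.

Lemma nice_fin tp : nice_test tp -> (\int[m]_(x in sball m w len) (tp.2 x)%:E)%E \is a fin_num.
Proof.
move=> [_ _ [M fM]]; rewrite ge0_fin_numE; last first.
  by apply: integral_ge0 => x _; have /andP[] := fM x.
apply: (@le_lt_trans _ _ (\int[m]_(x in sball m w len) (`|M|)%:E)%E).
  apply: lower_integral_le => x _; have /andP[h1 h2] := fM x; rewrite lee_fin//.
  exact: le_trans (ler_norm M).
rewrite integral_cst//; last exact: measurable_sball.
by rewrite lte_mul_pinfty// ?lee_fin//; exact: (sball_finite radonm cdX K2 NK).
Qed.

Lemma integral_nice_sum (P : pred (R * (X -> R))) L : all_nice L ->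
  (\int[m]_(x in sball m w len) (\sum_(tp <- L | P tp) tp.2 x)%R%:E =
   \sum_(tp <- L | P tp) \int[m]_(x in sball m w len) (tp.2 x)%:E)%E.
Proof.
elim: L => [_|tp L IH /= [[_ ctp [M fM]] nL]].
  by rewrite big_nil; under eq_integral do rewrite big_nil; rewrite integral0.
rewrite big_cons; under eq_integral do rewrite big_cons.
case: ifP => Ptp; last exact: IH.
have ms : measurable_fun setT (fun x : borel X => \sum_(tp <- L | P tp) tp.2 x).
  elim: L nL {IH} => [_|[t f] L IH /= [[_ cf _] nL]].
    under eq_fun do rewrite big_nil; exact: measurable_cst.
  under eq_fun do rewrite big_cons; case: (P (t, f)); last exact: IH.
  by apply: measurable_funD; [exact: continuous_borel|exact: IH].
have s0 x : 0 <= \sum_(tp <- L | P tp) tp.2 x.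
  elim: L nL {IH ms} => [_|[t f] L IH /= [[_ _ [M' fM']] nL]]; first by rewrite big_nil.
  by rewrite big_cons; case: ifP => _; rewrite ?addr_ge0 ?IH//; have /andP[] := fM' x.
under eq_integral do rewrite EFinD.
rewrite ge0_integralD ?IH//.
- exact: measurable_sball.
- by move=> x _; have /andP[] := fM x.
- by apply/measurable_EFinP; apply: measurable_funTS; exact: continuous_borel.
- by move=> x _; rewrite lee_fin.
- by apply/measurable_EFinP; exact: measurable_funTS.
Qed.

Lemma chain_mem s p L g t : chain m w len s p L g -> t \in times L -> sball m w len (g t).
Proof.
elim: L s p => // -[s' f] L IH s p /= [_ Bs cL]; rewrite inE => /predU1P[->//|].
exact: IH cL.
Qed.

Lemma nice_sum L t : all_nice L ->
  continuous (fun x => \sum_(tp <- L | tp.1 == t) tp.2 x) /\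
  exists M : R, forall x, 0 <= \sum_(tp <- L | tp.1 == t) tp.2 x <= M.
Proof.
elim: L => [_|[t' f] L IH /= [[_ cf [M fM]] nL]].
  split; first by under eq_fun do rewrite big_nil; move=> x; exact: cvg_cst.
  by exists 0 => x; rewrite big_nil lexx.
have [IH1 [M' IH2]] := IH nL; pose f' x := if t' == t then f x else 0.
have -> : (fun x => \sum_(tp <- (t', f) :: L | tp.1 == t) tp.2 x) =
    (fun x => f' x + \sum_(tp <- L | tp.1 == t) tp.2 x).
  by apply/funext => x; rewrite big_cons/= /f'; case: ifP => // _; rewrite add0r.
have f'M x : 0 <= f' x <= `|M|.
  rewrite /f'; case: ifP => _; last by rewrite lexx normr_ge0.
  by have /andP[/= -> h] := fM x; exact: le_trans (ler_norm M).
split.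
  move=> x; apply: cvgD; last exact: IH1.
  by rewrite /f'; case: (t' == t); [exact: cf|exact: cvg_cst].
exists (`|M| + M') => x; rewrite big_cons/=.
have h1 := f'M x; have /andP[h2 h3] := IH2 x.
case: ifP => tt; last by rewrite h2/= (le_trans h3)// lerDr.
by move: h1; rewrite /f' tt => /andP[h4 h5]; rewrite addr_ge0//= lerD.
Qed.

(** Only finitely many times at once: the tests at equal times are added up. *)
Lemma cheap_finite (L : seq (R * (X -> R))) (E : seq R) (e : R) : all_nice L ->
  (forall t, t \in E -> 0 <= t <= 1) -> 0 < e ->
  exists c : R -> X, [/\ forall t, t \in E -> sball m w len (c t),
    forall t t', t \in E -> t' \in E -> mdist (c t) (c t') <= len * `|t - t'|,
    0 \in E -> mdist (c 0) a <= rho + sg * len,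
    1 \in E -> mdist (c 1) w <= (1 - T) * len &
    \sum_(tp <- L) tp.2 (c tp.1) <= mean_cost L + e].
Proof.
move=> nL E01 e0; have /andP[s0 sT] := sgT.
have T01 : 0 < T < 1 by rewrite T1 andbT; slra.
pose F := sort <=%R (undup (E ++ map fst L)).
have uF : uniq F by rewrite sort_uniq undup_uniq.
have memF t : (t \in F) = (t \in E) || (t \in map fst L).
  by rewrite mem_sort mem_undup mem_cat.
have F01 t : t \in F -> 0 <= t <= 1.
  rewrite memF => /orP[/E01//|].
  elim: L nL {F uF memF} => // tp L IH /= [[t01 _ _] nL].
  by rewrite inE => /predU1P[->//|]; exact: IH.
pose psi t x := \sum_(tp <- L | tp.1 == t) tp.2 x.
pose Lc := [seq (par t, psi t) | t <- F].
have tLc : times Lc = map par F by rewrite /times -map_comp.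
have aL : admissible T 0 Lc.
  have sF : sorted <%R F by rewrite lt_sorted_uniq_le uF sort_le_sorted.
  have adm F' s : (forall t, t \in F' -> 0 <= t <= 1) -> sorted <%R F' ->
      (forall t, t \in F' -> s < par t) -> admissible T s [seq (par t, psi t) | t <- F'].
    elim: F' s => //= t F' IH s F'01 sF' sF0; have [c1 c2] := nice_sum t nL; split => //.
      by rewrite sF0 ?mem_head//; have /andP[] := par_bounds (F'01 _ (mem_head t F')).
    apply: IH => [t' t'F|| t' t'F].
    - by apply: F'01; rewrite inE t'F orbT.
    - exact: path_sorted sF'.
    - by apply: par_mono; have /allP := order_path_min lt_trans sF'; apply.
  by apply: adm => // t /F01/par_bounds/andP[].
have AB : sball m a rho `<=` sball m w len.
  move=> x [Sx xa]; split => //; apply: (le_trans (metric_triangle _ a _)).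
  by rewrite /len addrC lerD2l.
have A0 : (0 < m (sball m a rho))%E by exact: (sball_gt0 radonm).
have [g [Ag cg gcost]] := cheap_chain radonm cdX K2 NK Sw T01 AB (measurable_sball _ _ _) A0 aL e0.
have [d1 d2] := chain_dist T01 (lexx 0) aL cg erefl.
have D0 : mdist (g 0) w <= len by have [_] := AB _ Ag.
have in_t t : t \in E -> par t \in 0 :: times Lc.
  by move=> tE; rewrite inE tLc map_f ?orbT// memF tE.
exists (fun t => g (par t)); split.
- by move=> t tE; apply: (chain_mem cg); rewrite tLc map_f// memF tE.
- have wl t t' : t \in E -> t' \in E -> t <= t' ->
      mdist (g (par t)) (g (par t')) <= len * `|t - t'|.
    move=> tE t'E tt'; have pp : par t <= par t'.
      by move: tt'; rewrite le_eqVlt => /predU1P[->//|/par_mono/ltW].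
    have := d2 _ _ (in_t t tE) (in_t t' t'E) pp; rewrite subr0 mulr1 => /le_trans; apply.
    rewrite distrC ger0_norm ?subr_ge0// mulrC.
    have -> : par t' - par t = (T - sg) * (t' - t) by rewrite /par; ring.
    apply: (@le_trans _ _ (len * ((T - sg) * (t' - t)))).
      by rewrite ler_wpM2r// mulr_ge0 ?subr_ge0// ltW.
    by rewrite ler_wpM2l ?(ltW len0)// ler_piMl ?subr_ge0//; slra.
  move=> t t' tE t'E; case: (leP t t') => [|/ltW] tt'; first exact: wl.
  by rewrite metric_sym distrC; exact: wl.
- move=> E0; have p0 : par 0 = sg by rewrite /par mul0r addr0.
  have := d2 0 (par 0) (mem_head _ _) (in_t 0 E0); rewrite p0 !subr0 mulr1 => /(_ (ltW s0)) h.
  apply: (le_trans (metric_triangle _ (g 0) _)); rewrite addrC lerD//; first by have [] := Ag.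
  by rewrite metric_sym (le_trans h)// ler_wpM2l// ltW.
- move=> E1; have p1 : par 1 = T by rewrite /par mul1r addrC subrK.
  have := d1 (par 1) (in_t 1 E1); rewrite p1 subr0 mulr1 => ->//.
  by rewrite ler_wpM2l// subr_ge0 ltW.
have sub : {subset map fst L <= F} by move=> t tL; rewrite memF tL orbT.
have costE : cost Lc g = \sum_(tp <- L) tp.2 (g (par tp.1)).
  rewrite /cost big_map /psi/=.
  exact: (@big_group _ _ _ fst L F (fun tp t => tp.2 (g (par t)))).
rewrite -costE -lee_fin; apply: (le_trans gcost); rewrite le_eqVlt; apply/orP; left; apply/eqP.
rewrite EFinD; congr (_ + _)%E; rewrite /total_mass big_map /psi/=.
under eq_bigr do rewrite integral_nice_sum//.
rewrite (@big_group _ _ _ fst L F (fun tp t => \int[m]_(x in sball m w len) (tp.2 x)%:E)%E)//.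
rewrite -/mass_bound /mean_cost -mulr_sumr (EFinM mass_bound); congr (_ * _)%E.
elim: L nL {gcost costE sub aL tLc Lc psi F01 memF uF F cg d1 d2 in_t} => [_|tp L IH /= [ntp nL]].
  by rewrite !big_nil.
by rewrite !big_cons EFinD fineK ?nice_fin// IH.
Qed.

(** Compactness in the product topology: an ultrafilter on the finite sets of
    times provides one curve for all times. *)
Lemma cheap_curve (L : seq (R * (X -> R))) (e : R) : all_nice L -> 0 < e ->
  exists2 c, near_geodesic c & \sum_(tp <- L) tp.2 (c tp.1) <= mean_cost L + e.
Proof.
move=> nL e0.
pose F0 : set_system (seq R) := [set P | exists E0 : seq R, forall E : seq R, {subset E0 <= E} -> P E].
have F0F : ProperFilter F0.
  apply: Build_ProperFilter.
    by move=> [E0 H]; exact: (H E0).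
  split.
  - by exists [::].
  - move=> P Q [E1 H1] [E2 H2]; exists (E1 ++ E2) => E sE.
    by split; [apply: H1|apply: H2] => t tE; apply: sE; rewrite mem_cat tE ?orbT.
  - by move=> P Q PQ [E1 H1]; exists E1 => E /H1/PQ.
have [U [UU FU]] := ultraFilterLemma F0F.
pose cut E : seq R := [seq t <- E | 0 <= t <= 1].
have ex E : exists c : R -> X, [/\ forall t, t \in cut E -> sball m w len (c t),
    forall t t', t \in cut E -> t' \in cut E -> mdist (c t) (c t') <= len * `|t - t'|,
    0 \in cut E -> mdist (c 0) a <= rho + sg * len,
    1 \in cut E -> mdist (c 1) w <= (1 - T) * len &
    \sum_(tp <- L) tp.2 (c tp.1) <= mean_cost L + e].
  by apply: cheap_finite => // t; rewrite mem_filter => /andP[].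
have [C HC] := choice ex.
have ev t : 0 <= t <= 1 -> U [set E | t \in cut E].
  by move=> t01; apply: FU; exists [:: t] => E sE /=; rewrite mem_filter t01 sE ?mem_head.
have cB : compact (sball m w len) by exact: (compact_sball radonm cdX K2 NK).
have lim_ t : exists x : X, 0 <= t <= 1 -> (fun E => C E t) @ U --> x.
  have [t01|t01] := pselect (0 <= t <= 1); last by exists point.
  have := cB; rewrite compact_ultra => /(_ ((fun E => C E t) @ U) _)[].
  - exact: ultra_fmap.
  - have H0 : U ((fun E => C E t) @^-1` sball m w len).
      by apply: filterS (ev t t01) => E tE; have [H _ _ _ _] := HC E; exact: H.
    exact: H0.
  - by move=> x [_ Hx]; exists x.
have [c Hc] := choice lim_.
have i0 : 0 <= (0 : R) <= 1 by rewrite lexx ler01.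
have i1 : 0 <= (1 : R) <= 1 by rewrite ler01 lexx.
exists c; first split.
- move=> t t01; apply: (cvg_closed _ (Hc t t01)); first exact: closed_sball.
  by apply: filterS (ev t t01) => E tE; have [H _ _ _ _] := HC E; exact: H.
- move=> t t' t01 t01'; apply: (cvg_mdist_le (Hc t t01) (Hc t' t01')).
  by apply: filterS2 (ev t t01) (ev t' t01') => E tE tE'; have [_ H _ _ _] := HC E; exact: H.
- apply: (cvg_mdist_le (Hc 0 i0) (@cvg_cst _ a _ U _)).
  by apply: filterS (ev 0 i0) => E tE; have [_ _ H _ _] := HC E; exact: H.
- apply: (cvg_mdist_le (Hc 1 i1) (@cvg_cst _ w _ U _)).
  by apply: filterS (ev 1 i1) => E tE; have [_ _ _ H _] := HC E; exact: H.
apply: (@cvg_ler _ _ U _ (fun E => \sum_(tp <- L) tp.2 (C E tp.1))); last first.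
  by apply: nearW => E; have [] := HC E.
elim: L nL {ex HC} => [_|tp L IH /= [[t01 ctp _] nL]].
  by under eq_fun do rewrite big_nil; rewrite big_nil; exact: cvg_cst.
under eq_fun do rewrite big_cons; rewrite big_cons; apply: cvgD; last exact: IH.
by apply: (cvg_comp _ _ (Hc _ t01)); exact: ctp.
Qed.

End cheap_curves.

(** * Test plans concentrated near geodesics *)

Section set_distance.
Context (R : realType) (X : completeMetricType R).
Implicit Types (A : set X) (x y : X).

Definition setdist A x : R := inf [set mdist x y | y in A].

Lemma setdist_le A x y : A y -> setdist A x <= mdist x y.
Proof. by move=> Ay; apply: ge_inf; [exists 0 => _ [z _ <-]; exact: mdist_ge0|exists y]. Qed.

Lemma setdist_ge0 A x : A !=set0 -> 0 <= setdist A x.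
Proof.
by move=> [y Ay]; apply: lb_le_inf => [|_ [z _ <-]]; [exists (mdist x y); exists y|exact: mdist_ge0].
Qed.

Lemma setdist_lt A x (e : R) : A !=set0 -> 0 < e -> exists2 y, A y & mdist x y < setdist A x + e.
Proof.
move=> [z Az] e0; have hi : has_inf [set mdist x y | y in A].
  by split; [exists (mdist x z); exists z|exists 0 => _ [y _ <-]; exact: mdist_ge0].
by have [_ [y Ay <-] H] := inf_adherent e0 hi; exists y.
Qed.

Lemma setdist_lip A x y : A !=set0 -> `|setdist A x - setdist A y| <= mdist x y.
Proof.
move=> A0; have half u v : setdist A u <= setdist A v + mdist u v.
  apply/ler_addgt0Pr => e e0; have [z Az H] := setdist_lt v A0 e0.
  apply: (le_trans (setdist_le u Az)); apply: (le_trans (metric_triangle u v z)); slra.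
by rewrite ler_norml; have := half x y; have := half y x; rewrite (metric_sym y); slra.
Qed.

Lemma setdist_gt0 A x : closed A -> A !=set0 -> ~ A x -> 0 < setdist A x.
Proof.
move=> cA A0 nAx; have : nbhs x (~` A) by apply: open_nbhs_nbhs; split => //; exact: closed_openC.
move=> /nbhs_mdistE[e e0 He]; apply: (lt_le_trans e0).
apply: lb_le_inf => [|_ [y Ay <-]]; first by have [y Ay] := A0; exists (mdist x y); exists y.
by rewrite leNgt; apply/negP => /He; apply.
Qed.

End set_distance.

Section geodesic_plan.
Context (R : realType) (X : completeMetricType R) (m : {measure set (borel X) -> \bar R}).
Variables (N : R) (K : nat).
Hypothesis radonm : radon m.
Hypothesis cdX : CD0 N m.
Hypothesis K2 : (2 <= K)%N.
Hypothesis NK : N <= K%:R.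
Variables (a w : X) (rho sg T : R).
Hypothesis Sw : supp m w.
Hypothesis Sa : supp m a.
Hypothesis rho0 : 0 < rho.
Hypothesis sgT : 0 < sg < T.
Hypothesis T1 : T < 1.
Local Notation leb := (@lebesgue_measure R).
Local Notation len := (len a w rho).
Local Notation near_geodesic := (near_geodesic m a w rho sg T).
Local Notation mass_bound := (mass_bound m K a rho T).
Local Notation mean_cost := (mean_cost m K a w rho T).
Let TG := {c : R -> X | near_geodesic c}.
Let B := sball m w len.

Let len0 : 0 < len. Proof. by rewrite /len ltr_wpDl// mdist_ge0. Qed.

Let mb0 : 0 < mass_bound.
Proof.
rewrite /mass_bound divr_gt0//; first by rewrite invr_gt0 exprn_gt0// subr_gt0.
rewrite fine_gt0// (sball_gt0 radonm Sa rho0)/=.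
exact: (sball_finite radonm cdX K2 NK).
Qed.

Let at_ t (f : X -> R) : TG -> R := fun c => f (sval c t).

Lemma mean_curve : exists L : (TG -> R) -> R,
  [/\ forall f g, bounded_on f -> bounded_on g -> L (f + g) = L f + L g,
      forall (b : R) f, bounded_on f -> L (b *: f) = b * L f,
      forall f, bounded_on f -> (forall x, 0 <= f x) -> 0 <= L f,
      L (cst 1) = 1 &
      forall t f, nice_test (t, f) ->
        L (at_ t f) <= mass_bound * fine (\int[m]_(x in B) (f x)%:E)%E].
Proof.
pose ev (L : seq (R * (X -> R))) : TG -> R := fun c => \sum_(tp <- L) tp.2 (sval c tp.1).
pose Kq f r := exists L, [/\ all_nice L, f = ev L & r = mean_cost L].
have ev_b L : all_nice L -> bounded_on (ev L).
  elim: L => [_|tp L IH /= [[_ _ [M fM]] /IH[M' HM']]].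
    by exists 0 => c; rewrite /ev big_nil normr0.
  exists (M + M') => c; rewrite /ev big_cons; apply: (le_trans (ler_normD _ _)).
  by apply: lerD; [have /andP[? ?] := fM (sval c tp.1); rewrite ger0_norm|exact: HM'].
have [|||||L [LD LZ L0 L1 LK]] := @mean_of_inequalities R TG Kq.
- by exists [::]; split => //; [apply/funext => c; rewrite /ev big_nil|rewrite /mean_cost big_nil].
- move=> f r g s [L1 [n1 -> ->]] [L2 [n2 -> ->]]; exists (L1 ++ L2); split.
  + by elim: L1 n1 => //= tp L1 IH [? /IH].
  + by apply/funext => c; rewrite /ev big_cat.
  + by rewrite /mean_cost big_cat.
- move=> b f r b0 [L [nL -> ->]]; exists [seq (tp.1, fun x => b * tp.2 x) | tp <- L]; split.
  + elim: L nL => //= tp L IH [[t01 ctp [M fM]] /IH nL]; split => //; split => //=.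
      by move=> x; apply: cvgM; [exact: cvg_cst|exact: ctp].
    exists (b * M) => x; have /andP[h1 h2] := fM x.
    by rewrite mulr_ge0 ?(ltW b0)//= ler_wpM2l// ltW.
  + by apply/funext => c; rewrite /ev big_map/= -mulr_sumr.
  + rewrite /mean_cost big_map/= mulr_sumr.
    elim: L nL => [|tp L IH /= [ntp nL]]; first by rewrite !big_nil.
    rewrite !big_cons IH//; congr (_ + _); rewrite mulrCA; congr (_ * _).
    have [_ ctp [M fM]] := ntp.
    have -> : (\int[m]_(x in B) (b * tp.2 x)%:E = b%:E * \int[m]_(x in B) (tp.2 x)%:E)%E.
      under eq_integral do rewrite EFinM.
      rewrite ge0_integralZl//.
      * exact: measurable_sball.
      * by apply/measurable_EFinP; apply: measurable_funTS; exact: continuous_borel.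
      * by move=> x _; have /andP[] := fM x.
      * by rewrite lee_fin ltW.
    by rewrite fineM// (nice_fin radonm cdX K2 NK a rho Sw ntp).
- by move=> f r [L [nL -> _]]; exact: ev_b.
- move=> f r e [L [nL -> ->]] e0.
  have [c nc H] := cheap_curve radonm cdX K2 NK Sw Sa rho0 sgT T1 nL e0.
  by exists (exist _ c nc).
exists L; split => // t f nf; apply: LK; exists [:: (t, f)]; split => //.
  by apply/funext => c; rewrite /ev big_seq1.
by rewrite /mean_cost big_seq1.
Qed.

Let x0ex : exists x : TG, True.
Proof.
have [c nc _] := cheap_curve radonm cdX K2 NK Sw Sa rho0 sgT T1 (I : all_nice [::]) ltr01.
by exists (exist _ c nc).
Qed.

(** Each code number stands for a time and a scale; at that time a near-geodesic
    is approximated by a point of a finite net. *)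
Lemma curve_codes : exists (n : nat -> nat) (c : nat -> TG -> nat),
  (forall k x, (c k x < n k)%N) /\
  forall e : R, 0 < e -> exists L, forall x y, (forall k, (k < L)%N -> c k x = c k y) ->
    forall t, 0 <= t <= 1 -> mdist (sval x t) (sval y t) <= e.
Proof.
have exnet k : exists s : seq X, forall x, B x -> exists2 y, y \in s & mdist y x < k.+1%:R^-1.
  by apply: (sball_net radonm cdX K2 NK Sw len0); rewrite invr_gt0.
have [net Hnet] := choice exnet.
pose near_ k j (c : TG) y := mdist y (sval c (j%:R / k.+1%:R)) < k.+1%:R^-1.
pose cd i (c : TG) := if (choice.unpickle i : option (nat * nat)) is Some kj
  then find (near_ kj.1 kj.2 c) (net kj.1) else 0%N.
pose n i := (if (choice.unpickle i : option (nat * nat)) is Some kj then size (net kj.1) else 0%N).+1.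
exists n, cd; split => [i c|e e0].
  by rewrite /cd /n; case: choice.unpickle => // kj; rewrite ltnS find_size.
have d0 : 0 < e / (2 + 2 * len).
  by rewrite divr_gt0// addr_gt0// mulr_gt0.
have [k _ /(_ k (leqnn _)) ke] := natSinv_lt d0.
have k0 : 0 < k.+1%:R :> R by rewrite ltr0n.
exists (\max_(j < k.+2) (choice.pickle (k, nat_of_ord j)).+1)%N => x y xy t t01.
have /andP[t0 t1] := t01.
have tr := truncn_itv (mulr_ge0 (ltW k0) t0); set j := Num.truncn _ in tr.
have /andP[j1 j2] := tr.
have jk : (j <= k.+1)%N by rewrite -(ler_nat R) (le_trans j1)// ger_pMr.
have j01 : 0 <= (j%:R / k.+1%:R : R) <= 1.
  by rewrite divr_ge0//= ler_pdivrMr// mul1r ler_nat.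
have tj : `|t - j%:R / k.+1%:R| <= k.+1%:R^-1.
  rewrite ger0_norm; last by rewrite subr_ge0 ler_pdivrMr// mulrC.
  rewrite lerBlDr -[X in X + _]mul1r -mulrDl ler_pdivlMr// mulrC nat1r ltW//.
have := xy (choice.pickle (k, j)); rewrite /cd choice.pickleK/= => /(_ _) fE.
have {}fE : find (near_ k j x) (net k) = find (near_ k j y) (net k).
  by apply: fE; apply: (@leq_bigmax_cond _ _ (fun i : 'I_k.+2 => (choice.pickle (k, nat_of_ord i)).+1) (Ordinal (jk : (j < k.+2)%N))).
have hasx : has (near_ k j x) (net k).
  have [|z zn zx] := Hnet k (sval x (j%:R / k.+1%:R)); last by apply/hasP; exists z.
  by have [H _ _ _] := svalP x; exact: H.
have hasy : has (near_ k j y) (net k).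
  have [|z zn zx] := Hnet k (sval y (j%:R / k.+1%:R)); last by apply/hasP; exists z.
  by have [H _ _ _] := svalP y; exact: H.
have zx := nth_find a hasx; have zy := nth_find a hasy; rewrite -fE in zy.
set z := nth _ _ _ in zx zy; rewrite /near_ in zx zy.
have [_ lx _ _] := svalP x; have [_ ly _ _] := svalP y.
have h1 := lx t _ t01 j01; have h2 := ly _ t j01 t01; rewrite distrC in h2.
have h3 : len * `|t - j%:R / k.+1%:R| <= len * k.+1%:R^-1 by rewrite ler_wpM2l// ltW.
have h4 := metric_triangle (sval x t) (sval x (j%:R / k.+1%:R)) (sval y t).
have h5 := metric_triangle (sval x (j%:R / k.+1%:R)) z (sval y t).
have h6 := metric_triangle z (sval y (j%:R / k.+1%:R)) (sval y t).
have ke' : (2 + 2 * len) * k.+1%:R^-1 <= e.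
  by rewrite mulrC -ler_pdivlMr ?addr_gt0 ?mulr_gt0// ltW.
rewrite mulrDl -(mulrA 2) in ke'.
rewrite (metric_sym _ z) in h5; move: h1 h2 h3 h4 h5 h6 zx zy ke'.
set A1 := mdist _ _; set q := k.+1%:R^-1; set lq := len * q; set v := len * `|_|.
by move=> *; slra.
Qed.

Let to_curve (c : TG) : exists g : curves X, forall t, 0 <= t <= 1 -> curve_at g t = sval c t.
Proof.
apply: mk_curve => t t01 e e0; have [_ lc _ _] := svalP c.
exists (e / len); first by rewrite divr_gt0.
move=> s s01 st; apply: (le_trans (lc s t s01 t01)).
by rewrite mulrC -ler_pdivlMr// ltW.
Qed.

(** Random near-geodesics: a measurable family [g] on [0, 1) whose values at any
    time are distributed with density at most [mass_bound]. *)
Lemma random_curve : exists g : R -> curves X,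
  [/\ measurable_fun setT (g : R -> borel (curves X)),
    forall u, 0 <= u < 1 -> near_geodesic (curve_at (g u)) &
    forall t f (k : R), nice_test (t, f) -> (forall x y, `|f x - f y| <= k * mdist x y) ->
      (\int[leb]_(u in `[0%R, 1%R[) (f (curve_at (g u) t))%:E <=
       mass_bound%:E * \int[m]_(x in B) (f x)%:E)%E].
Proof.
have [x0 _] := x0ex; have [L [LD LZ L0 L1 LK]] := mean_curve.
have [n [c [cn cclose]]] := curve_codes.
have [s [_ s1 smeas sint]] := sample_codes LD LZ L0 L1 cn x0.
have scl (e : R) M : (forall x y, (forall k, (k < M)%N -> c k x = c k y) ->
    forall t, 0 <= t <= 1 -> mdist (sval x t) (sval y t) <= e) ->
  forall u, 0 <= u < 1 -> forall l l', (M <= l)%N -> (M <= l')%N -> forall t, 0 <= t <= 1 ->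
    mdist (sval (s l u) t) (sval (s l' u) t) <= e.
  move=> H u u01 l l' Ml Ml' t t01; apply: H => // k kM.
  by rewrite (s1 k l)// ?(leq_trans kM)// (s1 k l')// (leq_trans kM).
have lim1 u t : exists y : X, 0 <= u < 1 -> 0 <= t <= 1 -> (fun l => sval (s l u) t) @ \oo --> y.
  have [u01|u01] := pselect (0 <= u < 1); last by exists point.
  have [t01|t01] := pselect (0 <= t <= 1); last by exists point.
  exists (lim ((fun l => sval (s l u) t) @ \oo)) => _ _; apply/cauchy_cvgP.
  apply: cauchy_exP => e e0; have e20 : 0 < e / 2 by rewrite divr_gt0.
  have [M HM] := cclose _ e20; exists (sval (s M u) t).
  exists M => // l /= Ml; rewrite ballEmdist/= (le_lt_trans (scl _ _ HM u u01 _ _ _ Ml _ t01))//.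
  by rewrite ltr_pdivrMr// ltr_pMr// ltr1n.
pose y u t := projT1 (cid (lim1 u t)).
have Hy u t : 0 <= u < 1 -> 0 <= t <= 1 -> (fun l => sval (s l u) t) @ \oo --> y u t.
  exact: projT2 (cid (lim1 u t)).
have yG u : 0 <= u < 1 -> near_geodesic (y u).
  move=> u01; have i0 : 0 <= (0 : R) <= 1 by rewrite lexx ler01.
  have i1 : 0 <= (1 : R) <= 1 by rewrite ler01 lexx.
  split.
  - move=> t t01; apply: (cvg_closed _ (Hy u t u01 t01)); first exact: closed_sball.
    by apply: nearW => l; have [H _ _ _] := svalP (s l u); exact: H.
  - move=> t t' t01 t'01; apply: (cvg_mdist_le (Hy u t u01 t01) (Hy u t' u01 t'01)).
    by apply: nearW => l; have [_ H _ _] := svalP (s l u); exact: H.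
  - apply: (cvg_mdist_le (Hy u 0 u01 i0) (@cvg_cst _ a _ \oo _)).
    by apply: nearW => l; have [_ _ H _] := svalP (s l u).
  - apply: (cvg_mdist_le (Hy u 1 u01 i1) (@cvg_cst _ w _ \oo _)).
    by apply: nearW => l; have [_ _ _ H] := svalP (s l u).
have ycl (e : R) M : (forall x y, (forall k, (k < M)%N -> c k x = c k y) ->
    forall t, 0 <= t <= 1 -> mdist (sval x t) (sval y t) <= e) ->
  forall u, 0 <= u < 1 -> forall l, (M <= l)%N -> forall t, 0 <= t <= 1 ->
    mdist (sval (s l u) t) (y u t) <= e.
  move=> H u u01 l Ml t t01.
  apply: (cvg_mdist_le (@cvg_cst _ (sval (s l u) t) _ \oo _) (Hy u t u01 t01)).
  by exists M => // l' /= Ml'; exact: (scl _ _ H).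
have [C HC] := choice to_curve.
pose x1 := C x0.
pose gl u := if pselect (0 <= u < 1) is left u01 then C (exist _ (y u) (yG u u01)) else x1.
pose gk k u := if 0 <= u < 1 then C (s k u) else x1.
have glE u t : 0 <= u < 1 -> 0 <= t <= 1 -> curve_at (gl u) t = y u t.
  by move=> u01 t01; rewrite /gl; case: pselect => // u01'; rewrite HC.
exists gl; split.
- apply: (@measurable_lim_curves _ X _ _ (gk : nat -> R -> borel (curves X))) => [k|u e e0].
    apply: measurable_fun_borel => O oO.
    rewrite (_ : _ @^-1` O = [set u | 0 <= u < 1 /\ O (C (s k u))] `|`
        (~` `[0, 1[ `&` [set _ | O x1])).
      apply: measurableU; first exact: (smeas k (fun x => O (C x))).
      apply: measurableI; first exact: measurableC.
      have [Ox|Ox] := pselect (O x1); [rewrite (_ : mkset _ = setT)|rewrite (_ : mkset _ = set0)] => //.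
      + by apply/seteqP; split.
      + by apply/seteqP; split.
    apply/seteqP; split => u /=; rewrite /gk in_itv/=.
      by case: ifP => u01 Ou; [left|right; split => //; rewrite u01].
    by move=> [[-> //]|[/negP/negbTE -> //]].
  have [u01|u01] := pselect (0 <= u < 1); last first.
    apply: nearW => k t t01; rewrite /gk /gl; case: pselect => // _.
    by move/negP/negbTE : u01 => ->; rewrite mdistxx.
  have e20 : 0 < e / 2 by rewrite divr_gt0.
  have [M HM] := cclose _ e20; exists M => // k /= Mk t t01.
  rewrite glE// /gk u01 HC// (le_lt_trans (ycl _ _ HM u u01 k Mk t t01))//.
  by rewrite ltr_pdivrMr// ltr_pMr// ltr1n.
- move=> u u01; have [h1 h2 h3 h4] := yG u u01.
  have i0 : 0 <= (0 : R) <= 1 by rewrite lexx ler01.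
  have i1 : 0 <= (1 : R) <= 1 by rewrite ler01 lexx.
  split; rewrite ?glE//.
  + by move=> t t01; rewrite glE//; exact: h1.
  + by move=> t t' t01 t'01; rewrite !glE//; exact: h2.
move=> t f k nf flip; have [/= t01 cf [M fM]] := nf.
have bf : bounded_on (at_ t f).
  by exists M => x; have /andP[h1 h2] := fM (sval x t); rewrite ger0_norm.
have fin : (\int[m]_(x in B) (f x)%:E)%E \is a fin_num.
  exact: (nice_fin radonm cdX K2 NK a rho Sw nf).
rewrite -(fineK fin) -EFinM; apply/lee_addgt0Pr => e e0.
have k1 : 0 < `|k| + 1 by rewrite ltr_wpDl.
have d0 : 0 < e / 2 / (`|k| + 1) by rewrite divr_gt0// divr_gt0.
have [Lc HL] := cclose _ d0.
have kd (p q : X) : mdist p q <= e / 2 / (`|k| + 1) -> f p <= f q + e / 2.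
  move=> pq; have := flip p q; rewrite ler_norml => /andP[_]; rewrite lerBlDl => /le_trans; apply.
  rewrite lerD2l; apply: (@le_trans _ _ ((`|k| + 1) * mdist p q)).
    by rewrite ler_wpM2r ?mdist_ge0// (le_trans (ler_norm k))// lerDl.
  by rewrite mulrC -ler_pdivlMr.
apply: (@le_trans _ _ (\int[leb]_(u in `[0%R, 1%R[) ((at_ t f (s Lc u))%:E + (e / 2)%:E))%E).
  apply: lower_integral_le => u /=; rewrite in_itv/= => u01.
    by have /andP[] := fM (curve_at (gl u) t).
  rewrite glE// -EFinD lee_fin kd// metric_sym; exact: (ycl _ _ HL).
have l1 : leb `[0%R, 1%R[ = 1%E by rewrite lebesgue_measure_itv/= lte_fin ltr01 -EFinD subr0.
have ms : measurable_fun (`[0%R, 1%R[%classic : set R) (fun u => at_ t f (s Lc u)).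
  move=> mI Y mY; rewrite (_ : _ `&` _ = [set u | 0 <= u < 1 /\ Y (at_ t f (s Lc u))]).
    exact: (smeas Lc (fun x => Y (at_ t f x))).
  by apply/seteqP; split => u /=; rewrite in_itv.
rewrite ge0_integralD//; last 3 first.
- by move=> u _; have /andP[] := fM (sval (s Lc u) t).
- exact/measurable_EFinP.
- by move=> u _; rewrite lee_fin divr_ge0// ltW.
have -> : (\int[leb]_(u in `[0%R, 1%R[) (e / 2)%:E = (e / 2)%:E)%E.
  by rewrite integral_cst//; apply: (eq_trans (congr1 (mule _) l1)); rewrite mule1.
have := sint Lc (at_ t f) (e / 2) bf _ _; rewrite /at_ => /(_ _ _) H.
apply: (@le_trans _ _ ((L (at_ t f) + e / 2)%:E + (e / 2)%:E)%E).
  rewrite leeD2r//; apply: H => [x|x x' xx]; first by have /andP[] := fM (sval x t).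
  apply: kd; apply: HL => // j jL; exact: (code_eq cn jL xx).
by rewrite -!EFinD lee_fin -addrA -splitr lerD2r LK.
Qed.

Let B_fin : (m B < +oo)%E. Proof. exact: (sball_finite radonm cdX K2 NK). Qed.

Let mI : measurable (`[0%R, 1%R[%classic : set R). Proof. by []. Qed.

Lemma law_bound (g : R -> curves X) (t : R) (A : set X) : 0 <= t <= 1 ->
  measurable_fun setT (g : R -> borel (curves X)) ->
  (forall t f (k : R), nice_test (t, f) -> (forall x y, `|f x - f y| <= k * mdist x y) ->
      (\int[leb]_(u in `[0%R, 1%R[) (f (curve_at (g u) t))%:E <=
       mass_bound%:E * \int[m]_(x in B) (f x)%:E)%E) ->
  measurable (A : set (borel X)) ->
  (leb (`[0%R, 1%R[ `&` [set u | A (curve_at (g u) t)]) <= mass_bound%:E * m A)%E.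
Proof.
move=> t01 mg gint mA.
have mBX : measurable (B : set (borel X)) by exact: measurable_sball.
have mpre (Q : set X) : measurable (Q : set (borel X)) ->
    measurable (`[0%R, 1%R[ `&` [set u | Q (curve_at (g u) t)]).
  move=> mQ; apply: measurableI => //.
  have := measurableT_comp (measurable_eval t01) mg => /(_ measurableT Q mQ).
  by rewrite setTI.
(* the indicator of the complement of a compact set is a limit of Lipschitz tests *)
have open_case (C : set X) : compact C ->
    (leb (`[0%R, 1%R[ `&` [set u | (~` C) (curve_at (g u) t)]) <= mass_bound%:E * m (B `\` C))%E.
  move=> cC; have clC : closed C by apply: compact_closed => //; exact: metric_hausdorff.
  have mC : measurable (C : set (borel X)) by exact: closed_borel.
  have bound (Q : set X) (f : X -> R) (k : R) : measurable (Q : set (borel X)) ->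
      nice_test (t, f) -> (forall x y, `|f x - f y| <= k * mdist x y) ->
      (forall x, 0 <= f x <= 1) -> (forall x, C x -> f x = 0) -> (forall x, Q x -> 1 <= f x) ->
      (leb (`[0%R, 1%R[ `&` [set u | Q (curve_at (g u) t)]) <= mass_bound%:E * m (B `\` C))%E.
    move=> mQ nf fk f01 fC fQ; apply: (le_trans _ (le_trans (gint t f k nf fk) _)).
      rewrite setIC -integral_indic//; last first.
        by have := measurableT_comp (measurable_eval t01) mg => /(_ measurableT Q mQ); rewrite setTI.
      apply: lower_integral_le => u _; rewrite lee_fin ?indicE//.
      case: (boolP (u \in _)) => [/set_mem/fQ//|_]; by have /andP[] := f01 (curve_at (g u) t).
    apply: lee_wpmul2l; first by rewrite lee_fin ltW.
    apply: (@le_trans _ _ (\int[m]_(x in B) (\1_(~` C) x)%:E)%E).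
      apply: lower_integral_le => x _; rewrite lee_fin; first by have /andP[] := f01 x.
      rewrite indicE; have [Cx|Cx] := pselect (C x); first by rewrite fC// memNset// => /(_ Cx).
      by rewrite mem_set//; have /andP[] := f01 x.
    by rewrite integral_indic// ?setDE 1?setIC//; exact: measurableC.
  have [C0|/set0P C0] := eqVneq C set0.
    apply: (bound _ (cst 1) 0) => //.
    - exact: measurableC.
    - by split => //= [x|]; [exact: cvg_cst|exists 1 => x; rewrite ler01 lexx].
    - by move=> x y; rewrite subrr normr0 mul0r.
    - by move=> x; rewrite ler01 lexx.
    - by move=> x; rewrite C0.
  pose f n x : R := Num.min 1 (n.+1%:R * setdist C x).
  pose F n := [set x | 1 <= n.+1%:R * setdist C x].
  have f01 n x : 0 <= f n x <= 1.
    by rewrite /f le_min ler01 mulr_ge0 ?setdist_ge0//= ge_min lexx.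
  have flip n x y : `|f n x - f n y| <= n.+1%:R * mdist x y.
    have h0 : `|n.+1%:R * setdist C x - n.+1%:R * setdist C y| <= n.+1%:R * mdist x y.
      by rewrite -mulrBr normrM ger0_norm// ler_wpM2l//; exact: setdist_lip.
    apply: le_trans h0; rewrite /f.
    set p := n.+1%:R * _; set q := n.+1%:R * _.
    have n1 := ler_norm (p - q); have n2 := ler_norm (q - p); rewrite distrC in n2.
    rewrite !minEle; do !case: ifPn; rewrite -?ltNge => *; rewrite ler_norml; apply/andP; split; slra.
  have cF n : closed (F n).
    rewrite (_ : F n = (fun x => n.+1%:R * setdist C x) @^-1` [set s | 1 <= s])//.
    apply: closed_comp => [x _|]; last exact: closed_ge.
    apply: (@lip_continuous _ _ _ n.+1%:R) => y z.
    by rewrite -mulrBr normrM ger0_norm// ler_wpM2l//; exact: setdist_lip.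
  have FU : `[0%R, 1%R[ `&` [set u | (~` C) (curve_at (g u) t)] =
      \bigcup_n (`[0%R, 1%R[ `&` [set u | F n (curve_at (g u) t)]).
    apply/seteqP; split => u /=.
      move=> [u01 nC]; have d0 := setdist_gt0 clC C0 nC.
      have [n _ /(_ n (leqnn _)) nd] := natSinv_lt d0; exists n => //; split => //.
      by rewrite /F /= -ler_pdivrMl ?ltr0n// mulr1 ltW.
    move=> [n _ [u01 Fn]]; split => // Cu; move: Fn; rewrite /F /= leNgt => /negP; apply.
    rewrite (@le_lt_trans _ _ 0)//; rewrite mulr_ge0_le0// (le_trans (setdist_le _ Cu))//.
    by rewrite mdistxx.
  have cv := @nondecreasing_cvg_mu _ _ _ leb (fun n => `[0%R, 1%R[ `&` [set u | F n (curve_at (g u) t)]).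
  rewrite FU; have {}cv := cv (fun n => mpre _ (closed_borel (cF n))) _ _.
  have {}cv := cv (bigcup_measurable (fun n _ => mpre _ (closed_borel (cF n)))).
  rewrite -(cvg_lim _ (cv _))//; last first.
    move=> n n' nn'; apply/subsetPset => u /= [u01 Fn]; split => //.
    apply: (le_trans Fn); rewrite ler_wpM2r ?setdist_ge0// ler_nat ltnS//.
  apply: lime_le; first by apply/cvg_ex; eexists; apply: cv => n n' nn'; apply/subsetPset => u /= [u01 Fn]; split => //;
    apply: (le_trans Fn); rewrite ler_wpM2r ?setdist_ge0// ler_nat ltnS.
  apply: nearW => n; apply: (bound _ (f n) n.+1%:R) => //.
  - exact: closed_borel.
  - split => //=; last by exists 1 => x; exact: f01.
    by apply: lip_continuous => x y; exact: flip.
  - move=> x Cx; apply/eqP; rewrite eq_le; have /andP[-> _] := f01 n x; rewrite andbT.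
    rewrite /f ge_min; apply/orP; right; rewrite mulr_ge0_le0// (le_trans (setdist_le _ Cx))//.
    by rewrite mdistxx.
  - by move=> x; rewrite /F /f /= le_min lexx.
have BAoo : (m (B `\` A) < +oo)%E.
  apply: le_lt_trans B_fin; apply: le_measure => [||x []//]; apply: mem_set => //.
  exact: measurableD.
have BAE : m (B `\` A) = (fine (m (B `\` A)))%:E by rewrite fineK// ge0_fin_numE.
apply/lee_addgt0Pr => e e0.
have em : 0 < e / mass_bound by rewrite divr_gt0.
have mBA : measurable (B `\` A : set (borel X)) by exact: measurableD.
have rE := radonm.2 _ mBA.
have [C [cC CBA] mC] : exists2 C : set X, compact C /\ C `<=` B `\` A &
    (m (B `\` A) - (e / mass_bound)%:E < m C)%E.
  have fin : ereal_sup [set m C | C in [set C : set X | compact C /\ C `<=` B `\` A]] \is a fin_num.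
    by move: rE => <-; rewrite BAE.
  have [_ [C HC <-] H] := ub_ereal_sup_adherent em fin.
  by exists C => //; move: H; move: rE => <-.
have clC : closed C by apply: compact_closed => //; exact: metric_hausdorff.
apply: (@le_trans _ _ (leb (`[0%R, 1%R[ `&` [set u | (~` C) (curve_at (g u) t)]))).
  apply: le_measure.
  - by apply: mem_set; exact: mpre.
  - by apply: mem_set; apply: mpre; apply: measurableC; exact: closed_borel.
  - by move=> u /= [u01 Au]; split => // /CBA[].
apply: (le_trans (open_case C cC)).
have mBC : (m (B `\` C) <= m A + (e / mass_bound)%:E)%E.
  have mCb : measurable (C : set (borel X)) by exact: closed_borel.
  have split1 : (m (B `\` C) = m (B `&` A `\` C) + m ((B `\` A) `\` C))%E.
    rewrite -measureU//.
    - by congr (m _); apply/seteqP; split => x /=; [move=> [Bx Cx]; have [?|?] := pselect (A x); [left|right]|move=> [[[]]|[[]]]].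
    - by apply: measurableD => //; exact: measurableI.
    - by apply: measurableD.
    - by apply/seteqP; split => // x /= [[[_ Ax] _] [[_ /(_ Ax)]]].
  have split2 : (m (B `\` A) = m C + m ((B `\` A) `\` C))%E.
    rewrite -measureU//.
    - by congr (m _); apply/seteqP; split => x /=; [move=> BAx; have [?|?] := pselect (C x); [left|right]|move=> [/CBA//|[]]].
    - exact: measurableD.
    - by apply/seteqP; split => // x /= [Cx [_ /(_ Cx)]].
  rewrite split1; apply: leeD.
    apply: le_measure; [apply: mem_set; apply: measurableD => //; exact: measurableI|exact: mem_set|].
    by move=> x /= [[_ Ax]].
  have fC : m C \is a fin_num.
    rewrite ge0_fin_numE//; apply: le_lt_trans BAoo; apply: le_measure => //; exact: mem_set.
  have fD : m ((B `\` A) `\` C) \is a fin_num.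
    rewrite ge0_fin_numE//; apply: le_lt_trans BAoo; apply: le_measure => [||x []//]; apply: mem_set => //.
    exact: measurableD.
  move: mC; rewrite split2 -(fineK fC) -(fineK fD) -!EFinD lte_fin lee_fin.
  by move=> H; have := H; slra.
apply: (le_trans (lee_wpmul2l _ mBC)); first by rewrite lee_fin ltW.
rewrite ge0_muleDr// ?lee_fin ?(ltW em)// -EFinM mulrCA mulfV ?gt_eqF// mulr1//.
Qed.

Lemma closed_near_geodesic : closed [set g : curves X | near_geodesic (curve_at g)].
Proof.
move=> g clg.
have near_ (e : R) : 0 < e -> exists g' : curves X, near_geodesic (curve_at g') /\
    forall t, 0 <= t <= 1 -> mdist (curve_at g t) (curve_at g' t) < e.
  move=> e0; have [|g' [Hg' gg']] := clg [set g' | forall t, 0 <= t <= 1 ->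
    mdist (curve_at g t) (curve_at g' t) < e]; first by apply/curves_nbhsP; exists e.
  by exists g'.
have i0 : 0 <= (0 : R) <= 1 by rewrite lexx ler01.
have i1 : 0 <= (1 : R) <= 1 by rewrite ler01 lexx.
split.
- move=> t t01; apply: closed_sball => U /nbhs_mdistE[e e0 eU].
  have [g' [[H _ _ _] gg']] := near_ e e0; exists (curve_at g' t); split; first exact: H.
  by apply: eU; exact: gg'.
- move=> t t' t01 t'01; apply/ler_addgt0Pr => e e0; have e20 : 0 < e / 2 by rewrite divr_gt0.
  have [g' [[_ H _ _] gg']] := near_ _ e20.
  have h1 := gg' t t01; have h2 := gg' t' t'01; have h3 := H t t' t01 t'01.
  have h4 := metric_triangle (curve_at g t) (curve_at g' t) (curve_at g t').
  have h5 := metric_triangle (curve_at g' t) (curve_at g' t') (curve_at g t').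
  rewrite (metric_sym (curve_at g' t')) in h5.
  by rewrite [e]splitr; move: h1 h2 h3 h4 h5; set v := len * _; slra.
- apply/ler_addgt0Pr => e e0; have [g' [[_ _ H _] gg']] := near_ e e0.
  have h4 := metric_triangle (curve_at g 0) (curve_at g' 0) a; have h1 := gg' 0 i0.
  by move: h1 h4 H; set v := _ * len; slra.
- apply/ler_addgt0Pr => e e0; have [g' [[_ _ _ H] gg']] := near_ e e0.
  have h4 := metric_triangle (curve_at g 1) (curve_at g' 1) w; have h1 := gg' 1 i1.
  by move: h1 h4 H; set v := _ * len; slra.
Qed.

Lemma lipschitz_energy (g : curves X) (L : R) :
  (forall t t', 0 <= t <= 1 -> 0 <= t' <= 1 -> mdist (curve_at g t) (curve_at g t') <= L * `|t - t'|) ->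
  (energy (curve_at g) 0 1 <= (L ^+ 2)%:E)%E.
Proof.
move=> gL; apply: finite_energy => [|n]; first exact: curve_continuous01.
set k := (2 ^ n)%N; have k0 : 0 < k%:R :> R by rewrite ltr0n expn_gt0.
apply: (@le_trans _ _ (\sum_(i < k) k%:R * (L ^+ 2 / k%:R ^+ 2))).
  apply: ler_sum => i _; rewrite ler_pM2l//.
  have j01 (j : nat) : (j <= k)%N -> 0 <= (j%:R / k%:R : R) <= 1.
    by move=> jk; rewrite divr_ge0//= ler_pdivrMr// mul1r ler_nat.
  have := gL _ _ (j01 i (ltnW (ltn_ord i))) (j01 i.+1 (ltn_ord i)).
  rewrite -mulrBl -opprB -natrB// subSnn mulNr normrN mul1r ger0_norm ?invr_ge0// => h.
  rewrite -expr_div_n ler_sqr ?nnegrE ?mdist_ge0//.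
  exact: le_trans (mdist_ge0 _ _) h.
rewrite sumr_const card_ord -mulr_natl mulrA le_eqVlt; apply/orP; left; apply/eqP.
by field; rewrite gt_eqF.
Qed.

(** The [CD] condition only gives optimal plans without density bounds; the mean
    of cheap near-geodesics, sampled by its codes, has bounded marginals. *)
Theorem geodesic_plan : exists2 P : probability (borel (curves X)) R, test_plan m P &
  {ae P, forall g, near_geodesic (curve_at g)}.
Proof.
have [g [mg gnear gint]] := random_curve.
have l1 : leb `[0%R, 1%R[ = 1%E by rewrite lebesgue_measure_itv/= lte_fin ltr01 -EFinD subr0.
have l0 : (0 < leb `[0%R, 1%R[)%E by rewrite l1 lte01.
have loo : (leb `[0%R, 1%R[ < +oo)%E by rewrite l1 ltry.
have [P0 P0E] := @uniform_probability _ _ R leb _ mI l0 loo.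
have [P PE0] := @push_law _ _ _ (borel (curves X)) _ P0 g mg.
have PE D : measurable D -> P D = leb ([set u | D (g u)] `&` `[0%R, 1%R[).
  move=> mD; have mgD := mg measurableT D mD; rewrite setTI in mgD.
  have e1 : (fine (leb `[0%R, 1%R[))^-1 = 1 :> R by rewrite l1 invr1.
  rewrite PE0 (P0E _ mgD); apply: etrans (congr1 (fun z => _ * z%:E)%E e1) _.
  by rewrite mule1.
have ng : {ae P, forall g, near_geodesic (curve_at g)}.
  exists (~` [set g | near_geodesic (curve_at g)]); split => //.
    by apply: measurableC; apply: closed_borel; exact: closed_near_geodesic.
  rewrite PE; last by apply: measurableC; apply: closed_borel; exact: closed_near_geodesic.
  rewrite (_ : _ `&` _ = set0) ?measure0//; apply/seteqP; split => // u [/= H].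
  by rewrite in_itv/= => u01; apply: H; exact: gnear.
exists P => //; split.
  exists mass_bound => // t D t01 mD; have mE := measurable_eval t01 measurableT mD; rewrite setTI in mE.
  rewrite /pushforward PE// setIC; exact: (law_bound t01 mg gint mD).
apply: (@le_lt_trans _ _ (\int[P]_g (len ^+ 2)%:E)%E).
  apply: ae_lower_integral_le_gen => //.
  - by move=> g' _; exact: energy_ge0.
  - by move=> g' _; rewrite lee_fin sqr_ge0.
  by apply: aeS ng => g' [_ H _ _] _; exact: lipschitz_energy.
rewrite integral_cst//; apply: (@le_lt_trans _ _ ((len ^+ 2)%:E * 1)%E); last by rewrite mule1 ltry.
by apply: lee_wpmul2l; [rewrite lee_fin sqr_ge0|exact: probability_le1].
Qed.

End geodesic_plan.

(** * Localization of the upper gradient inequality *)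

Lemma nbhs_open (Y : topologicalType) (A : set Y) : (forall x, A x -> nbhs x A) -> open A.
Proof. by rewrite openE. Qed.

Section lower_comparison.
Context d (T : measurableType d) (R : realType) (mu : {measure set T -> \bar R}).
Local Open Scope ereal_scope.
Import HBNNSimple.

(** The integral of a function that may not be measurable is a supremum over the
    simple functions below it; a countable supremum of them attains it. *)
Lemma lower_envelope (J : T -> \bar R) : (forall x, 0 <= J x) -> \int[mu]_x J x < +oo ->
  exists J' : T -> \bar R, [/\ measurable_fun setT J', forall x, 0 <= J' x <= J x &
    \int[mu]_x J' x = \int[mu]_x J x].
Proof.
move=> J0 Joo.
have ex (n : nat) : exists h : {nnsfun T >-> R}, (forall x, (h x)%:E <= J x) /\
    \int[mu]_x J x <= \int[mu]_x (h x)%:E + (n.+1%:R^-1)%:E.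
  have n0 : (0 < n.+1%:R^-1 :> R)%R by rewrite invr_gt0.
  have fin : \int[mu]_x J x \is a fin_num by rewrite ge0_fin_numE// integral_ge0.
  move: (fin); rewrite {1}ge0_integralTE// => fin'; have [_ [h /= hJ <-]] := ub_ereal_sup_adherent n0 fin'.
  rewrite -ge0_integralTE// => H; exists h; split => //.
  rewrite -leeBlDr//; apply: ltW; by rewrite integralT_nnsfun.
have [h Hh] := choice ex.
pose J' x := ereal_sup (range (fun n => (h n x)%:E)).
have hJ' n x : (h n x)%:E <= J' x by apply: ereal_sup_ubound; exists n.
have mJ' : measurable_fun setT J'.
  rewrite (_ : J' = fun x => esups (fun n => (h n x)%:E) 0%N).
    apply: (@measurable_fun_esups _ _ _ setT (fun n x => (h n x)%:E) _ 0%N) => n.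
    exact/measurable_EFinP.
  apply/funext => x; rewrite /J' /esups/=; congr ereal_sup.
  by apply/seteqP; split=> _ [n _ <-]; exists n.
have J'b x : 0 <= J' x <= J x.
  apply/andP; split; first by apply: le_trans (hJ' 0%N x); rewrite lee_fin.
  by apply: ge_ereal_sup => _ [n _ <-]; have [] := Hh n.
exists J'; split => //; apply/eqP; rewrite eq_le; apply/andP; split.
  by apply: lower_integral_le => x _; have /andP[] := J'b x.
apply/lee_addgt0Pr => e e0; have [n _ /(_ n (leqnn _)) ne] := natSinv_lt e0.
have [_ Hn] := Hh n; apply: (le_trans Hn); apply: leeD; last by rewrite lee_fin ltW.
by apply: lower_integral_le => x _; rewrite ?lee_fin.
Qed.

Lemma integral_on (A : set T) (f g : T -> \bar R) : (forall x, A x -> f x = g x) ->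
  (forall x, ~ A x -> g x = 0) -> \int[mu]_(x in A) f x = \int[mu]_x g x.
Proof.
move=> fg g0; rewrite [LHS]integral_mkcond; apply: eq_integral => x _; rewrite patchE.
by have [Ax|Ax] := pselect (A x); [rewrite mem_set// fg|rewrite memNset// g0].
Qed.

Lemma ae_le_of_lower_integrals (D : T -> R) (J : T -> \bar R) : measurable_fun setT D ->
  (forall x, (0 <= D x)%R) -> (forall x, 0 <= J x) -> \int[mu]_x J x < +oo ->
  (forall A, measurable A -> \int[mu]_(x in A) (D x)%:E <= \int[mu]_(x in A) J x) ->
  {ae mu, forall x, (D x)%:E <= J x}.
Proof.
move=> mD D0 J0 Joo H; have [J' [mJ' J'b J'E]] := lower_envelope J0 Joo.
pose A := [set x | J' x < (D x)%:E].
have mA : measurable A.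
  rewrite -[A]setTI; apply: emeasurable_fun_lt => //; exact/measurable_EFinP.
have J'0 x : 0 <= J' x by have /andP[] := J'b x.
have J'oo : \int[mu]_x J' x < +oo by rewrite J'E.
(* off J', nothing more can be gained on A *)
have JA : \int[mu]_(x in A) J x <= \int[mu]_(x in A) J' x.
  have Jf : {ae mu, forall x, J' x \is a fin_num}.
    have iJ' : mu.-integrable setT J'.
      apply/integrableP; split => //; under eq_integral do rewrite gee0_abs//.
      exact: J'oo.
    by apply: aeS (integrable_ae measurableT iJ') => x /(_ I).
  rewrite integral_mkcond ge0_integralTE; last first.
    by move=> x; rewrite patchE; case: ifP.
  apply: ub_ereal_sup => _ [s /= sJ <-]; rewrite -integralT_nnsfun.
  have ms : measurable_fun setT (EFin \o s) by exact/measurable_EFinP.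
  pose M x := maxe (s x)%:E (J' x).
  have mM : measurable_fun setT M by exact: measurable_maxe.
  have sJ' x : (s x)%:E <= J x.
    by apply: (le_trans (sJ x)); rewrite patchE; case: ifP.
  have MJ : \int[mu]_x M x <= \int[mu]_x J' x.
    rewrite J'E; apply: lower_integral_le => x _; first by rewrite le_max J'0 orbT.
    by rewrite ge_max sJ'; have /andP[] := J'b x.
  have : {ae mu, forall x, M x = J' x}.
    pose Jr x := fine (J' x).
    have JrE : {ae mu, forall x, J' x = (Jr x)%:E} by apply: aeS Jf => x Jx; rewrite /Jr fineK.
    have mJr : measurable_fun setT Jr by exact: measurableT_comp mJ'.
    have iJr : \int[mu]_x J' x = \int[mu]_x (Jr x)%:E.
      apply: ae_eq_lower_integral => //; first by move=> x _; rewrite lee_fin fine_ge0.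
      by apply: aeS JrE => x E _.
    pose M' x := maxe (s x)%:E (Jr x)%:E.
    have MM' : \int[mu]_x M' x = \int[mu]_x M x.
      apply: ae_eq_lower_integral => //.
      - by move=> x _; rewrite le_max lee_fin fun_ge0.
      - by move=> x _; rewrite le_max lee_fin fun_ge0.
      - by apply: aeS JrE => x E _; rewrite /M' /M E.
    have : {ae mu, forall x, setT x -> M' x = (Jr x)%:E}.
      apply: ae_eq_of_integral_le => //.
      - by apply: measurable_maxe => //; exact/measurable_EFinP.
      - by move=> x _; rewrite fine_ge0.
      - by move=> x _; rewrite le_max lexx orbT.
      - by rewrite MM' -iJr.
      - by rewrite -iJr.
    by apply: aeS2 JrE => x E /(_ I); rewrite /M' /M E.
  move=> Mae; rewrite [leRHS]integral_mkcond; apply: ae_lower_integral_le_gen => //.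
  - by move=> x _; rewrite lee_fin.
  - by move=> x _; rewrite patchE; case: ifP.
  apply: aeS Mae => x Mx _; rewrite patchE; case: ifPn => xA.
    by rewrite -Mx /M le_max lexx.
  by have := sJ x; rewrite patchE (negbTE xA).
have : {ae mu, forall x, A x -> (D x)%:E = (fine (J' x))%:E}.
  have J'fin x : A x -> J' x \is a fin_num.
    by move=> Ax; rewrite ge0_fin_numE//; apply: lt_trans Ax _; exact: ltry.
  have E : \int[mu]_(x in A) J' x = \int[mu]_(x in A) (fine (J' x))%:E.
    by apply: eq_integral => x /set_mem Ax; rewrite fineK// J'fin.
  apply: ae_eq_of_integral_le => //.
  - by apply: measurable_funTS; exact: measurableT_comp mJ'.
  - by apply/measurable_EFinP; exact: measurable_funTS.
  - by move=> x _; rewrite fine_ge0.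
  - by move=> x Ax; rewrite fineK ?J'fin//; exact: ltW.
  - by rewrite -E (le_trans (H A mA)).
  - rewrite -E; apply: le_lt_trans J'oo; apply: ge0_subset_integral => //.
apply: aeS => x HA; rewrite leNgt; apply/negP => DJ.
have Ax : A x by apply: le_lt_trans DJ; have /andP[] := J'b x.
move: (Ax); rewrite /A /= HA// fineK ?ltxx//.
by rewrite ge0_fin_numE//; apply: lt_trans Ax _; exact: ltry.
Qed.

End lower_comparison.

Section test_plan_curves.
Context (R : realType) (X : completeMetricType R) (m : {measure set (borel X) -> \bar R}).
Local Notation leb := (@lebesgue_measure R).
Implicit Types (P : probability (borel (curves X)) R) (w H : borel X -> R).

Lemma ae_neq2 (s t : R) : {ae leb, forall r, r != s /\ r != t}.
Proof. by apply: aeS2 (ae_neq s) (ae_neq t). Qed.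

Lemma test_plan_ac P : test_plan m P ->
  {ae P, forall g, abs_continuous (curve_at g) 0 1 /\ (energy (curve_at g) 0 1 < +oo)%E}.
Proof.
move=> [_ Eoo]; have iE : P.-integrable setT (fun g : borel (curves X) => energy (curve_at g) 0 1).
  apply/integrableP; split; first exact: measurable_energy.
  by rewrite (eq_integral (fun g : borel (curves X) => energy (curve_at g) 0 1))// => g _; rewrite gee0_abs// energy_ge0.
apply: aeS (integrable_ae measurableT iE) => g /(_ I); rewrite ge0_fin_numE ?energy_ge0// => goo.
split => //; apply: contrapT => nac; move: goo; rewrite /energy asboolF//.
Qed.

Lemma test_plan_marginal P : test_plan m P -> exists2 C : R, 0 < C & forall t A,
  0 <= t <= 1 -> measurable A -> (P (eval_at t @^-1` A) <= C%:E * m A)%E.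
Proof. by case. Qed.

(** By Fubini, as at each time the marginal is absolutely continuous. *)
Lemma test_plan_ae P (Q : X -> Prop) : test_plan m P -> {ae m, forall x, Q x} ->
  {ae P, forall g, {ae leb, forall t, t \in `[0%R, 1%R] -> Q (curve_at g t)}}.
Proof.
move=> tpP [Nl [mN N0 NQ]]; have [C C0 PC] := test_plan_marginal tpP.
pose h (p : borel (curves X) * R) : \bar R := (\1_Nl (eval_at (clamp 0 1 p.2) p.1))%:E.
have mh : measurable_fun setT h.
  have mi : measurable_fun setT (\1_Nl : borel X -> R) by exact: measurable_indic.
  have := measurableT_comp mi (@measurable_eval_joint R X).
  by move=> mc; exact/measurable_EFinP.
have h0 p : (0 <= h p)%E by rewrite lee_fin indicE.
have c01 (t : R) : 0 <= clamp 0 1 t <= 1 by exact: clamp01.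
have I0 t : (\int[P]_g h (g, t) = 0)%E.
  apply/eqP; rewrite eq_le integral_ge0 ?andbT//.
  rewrite -[leLHS]/(\int[P]_g (\1_(eval_at (clamp 0 1 t) @^-1` Nl) g)%:E)%E.
  rewrite integral_indic// ?setIT; last first.
    by rewrite -[X in measurable X]setTI; apply: measurable_eval.
  by apply: (le_trans (PC _ _ (c01 t) mN)); rewrite N0 mule0.
have F0 : (\int[P]_g \int[leb]_t h (g, t) = 0)%E.
  by rewrite (@fubini_tonelli _ _ _ _ _ P leb h mh h0) integral0_eq.
have mF : measurable_fun setT (fun g => \int[leb]_t h (g, t))%E.
  exact: (@measurable_fun_fubini_tonelli_F _ _ _ _ _ leb h mh h0).
have : (\int[P]_g `|\int[leb]_t h (g, t)| = 0)%E.
  rewrite -[RHS]F0; apply: eq_integral => g _; rewrite gee0_abs//.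
  by apply: integral_ge0.
move=> /(ae_eq_integral_abs P measurableT mF); apply: aeS => g /(_ I) /= gN.
have mg : measurable_fun setT (fun t => h (g, t)).
  exact: (measurableT_comp mh (measurable_pair1 g)).
have : (\int[leb]_t `|h (g, t)| = 0)%E.
  by rewrite -[RHS]gN; apply: eq_integral => t _; rewrite gee0_abs.
move=> /(ae_eq_integral_abs leb measurableT mg); apply: aeS => t /(_ I) /= ht.
rewrite in_itv/= => t01; apply: contrapT => nQ.
have : Nl (curve_at g t) by apply: NQ.
by move: ht; rewrite /h /= clamp_id// => -[]; rewrite indicE => /eqP; rewrite pnatr_eq0 eqb0 => /negP + NN; apply; exact: mem_set.
Qed.

Lemma mslope_clamp (g : R -> X) (s t r v : R) : s < r < t -> mslope g r v ->
  mslope (g \o clamp s t) r v.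
Proof.
move=> /andP[sr rt] H e e0; have [d d0 Hd] := H e e0.
have [d' [d'0 d's d't]] : exists d' : R, [/\ 0 < d', d' <= r - s & d' <= t - r].
  exists (Num.min (r - s) (t - r)); rewrite lt_min !subr_gt0 sr rt.
  by split => //; rewrite ge_min lexx ?orbT.
exists (Num.min d d') => [|u u' ur ru']; first by rewrite lt_min d0.
rewrite lt_min => /andP[h1 h2].
have us : s <= u <= t by apply/andP; split; slra.
have u's : s <= u' <= t by apply/andP; split; slra.
by rewrite /= !clamp_id//; exact: Hd.
Qed.

Lemma mslope_clamp_out (g : R -> X) (s t r : R) : s <= t -> r < s \/ t < r ->
  mslope (g \o clamp s t) r 0.
Proof.
move=> st H e e0.
have [d d0 Hd] : exists2 d : R, 0 < d & forall u, `|u - r| < d -> clamp s t u = clamp s t r.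
  case: H => H; [exists (s - r)|exists (r - t)]; rewrite ?subr_gt0// => u; rewrite ltr_norml => /andP[h1 h2].
    have us : u <= s by slra.
    by rewrite /clamp !max_l// ge_min ?us ?orbT// (ltW H) orbT.
  have tu : t <= u by slra.
  by rewrite /clamp !min_l// ltW.
exists d => // u u' ur ru' uu'.
rewrite /= !Hd ?mdistxx ?mul0r ?subrr ?normr0 ?mulr_ge0 ?(ltW e0) ?subr_ge0 ?(le_trans ur)//.
  by rewrite ger0_norm ?subr_ge0//; slra.
by rewrite ler0_norm ?subr_le0//; slra.
Qed.

Lemma energy_clamp (g : R -> X) (s t : R) : 0 <= s -> s <= t -> t <= 1 ->
  (energy (g \o clamp s t) 0 1 <= energy g 0 1)%E.
Proof.
move=> s0 st t1; rewrite {2}/energy; case: ifPn => [/asboolP ac|_]; last by rewrite leey.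
have [v [iv v0 gv sv]] := abs_continuousP ac.
have acc : abs_continuous (g \o clamp s t) 0 1.
  exists v => [|x y x0 xy y1]; first exact: integrableS iv.
  rewrite /=; have cx := clamp01 x st; have cy := clamp01 y st.
  have [/andP[h1 h2] /andP[h3 h4]] := (cx, cy).
  have [cc|cc] := leP (clamp s t y) (clamp s t x).
    have -> : clamp s t x = clamp s t y.
      apply/eqP; rewrite eq_le cc andbT /clamp ge_max le_max lexx/= le_max.
      by apply/orP; right; rewrite le_min !ge_min lexx xy orbT.
    by rewrite mdistxx; apply: integral_ge0 => z _; rewrite lee_fin.
  have xc : x <= clamp s t x.
    rewrite leNgt; apply/negP => cx'; move: cc; apply/negP; rewrite -leNgt.
    have tx : t < x by move: cx'; rewrite /clamp gt_max gt_min ltxx orbF => /andP[].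
    rewrite (_ : clamp s t x = t) ?h4//; rewrite /clamp min_l ?(ltW tx)//; exact: max_r.
  have cy' : clamp s t y <= y.
    rewrite leNgt; apply/negP => yc; move: cc; apply/negP; rewrite -leNgt.
    have ys : y < s by move: yc; rewrite /clamp lt_max lt_min ltxx andbF orbF.
    rewrite (_ : clamp s t y = s) ?h1//; rewrite /clamp max_l// ge_min (ltW ys) orbT//.
  apply: (le_trans (gv _ _ _ (ltW cc) _)); rewrite ?(le_trans s0)// ?(le_trans _ t1)//.
  apply: ge0_subset_integral => //.
  - by apply/measurable_EFinP; apply: measurable_funTS; have /integrableP[/measurable_EFinP] := iv.
  - by move=> z _; rewrite lee_fin.
  - by move=> z /=; rewrite !in_itv/= => /andP[/(le_trans xc)-> /le_trans->].
rewrite energyE//; apply: ae_lower_integral_le_gen => //; try by move=> x _; rewrite lee_fin sqr_ge0.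
apply: aeS3 sv (ae_neq s) (ae_neq t) => r svr rs rt r01.
have svr' := svr r01; rewrite lee_fin (mslope_speed svr').
have [rs'|sr] := ltP r s.
  by rewrite (mslope_speed (mslope_clamp_out g st (or_introl rs'))) expr0n/= sqr_ge0.
have [tr|rt'] := ltP t r.
  by rewrite (mslope_speed (mslope_clamp_out g st (or_intror tr))) expr0n/= sqr_ge0.
have srt : s < r < t by rewrite !lt_neqAle sr rt' rt eq_sym rs.
by rewrite (mslope_speed (mslope_clamp srt svr')).
Qed.

(** Freezing the curves outside [[s, t]], and those off [A] for all times, turns a
    test plan into another one that only sees the increments over [[s, t]] of the
    curves in [A]. *)
Lemma freeze_map (s t : R) (A : set (curves X)) : 0 <= s -> s <= t -> t <= 1 ->
  measurable (A : set (borel (curves X))) ->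
  exists Phi : curves X -> curves X, [/\ measurable_fun setT (Phi : borel (curves X) -> borel (curves X)),
    forall g r, A g -> 0 <= r <= 1 -> curve_at (Phi g) r = curve_at g (clamp s t r) &
    forall g r, ~ A g -> 0 <= r <= 1 -> curve_at (Phi g) r = curve_at g s].
Proof.
move=> s0 st t1 mA.
have freeze (s' t' : R) : 0 <= s' -> s' <= t' -> t' <= 1 -> exists Phi : curves X -> curves X,
    measurable_fun setT (Phi : borel (curves X) -> borel (curves X)) /\
    forall g r, 0 <= r <= 1 -> curve_at (Phi g) r = curve_at g (clamp s' t' r).
  move=> s'0 s't' t'1.
  have c01 r : 0 <= clamp s' t' r <= 1.
    by have /andP[h1 h2] := clamp01 r s't'; rewrite (le_trans s'0 h1) (le_trans h2).
  have ex (g : curves X) : exists g' : curves X, forall r, 0 <= r <= 1 ->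
      curve_at g' r = curve_at g (clamp s' t' r).
    apply: mk_curve => r r01 e e0; have [d d0 Hd] := @curve_continuous01 _ _ g _ (c01 r) _ e0.
    exists d => // u u01 ur; apply: Hd => //; exact: le_lt_trans (clamp_lip _ _ _ _) ur.
  have [Phi HPhi] := choice ex; exists Phi; split=> [|g r r01]; last exact: HPhi.
  apply: measurable_fun_borel => W oW; apply: open_borel; apply: nbhs_open => g /= Wg.
  have /curves_nbhsP[e e0 eW] : nbhs (Phi g) W by exact: open_nbhs_nbhs.
  apply/curves_nbhsP; exists e => // g' gg'; apply: eW => r r01.
  by rewrite !HPhi//; exact: gg'.
have [P1 [m1 H1]] := freeze s t s0 st t1.
have [P2 [m2 H2]] := freeze s s s0 (lexx s) (le_trans st t1).
exists (fun g => if `[< A g >] then P1 g else P2 g); split.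
- apply: measurable_fun_borel => W oW.
  have mW : measurable (W : set (borel (curves X))) by exact: open_borel.
  rewrite (_ : _ @^-1` W = (A `&` (P1 @^-1` W)) `|` (~` A `&` (P2 @^-1` W))).
    apply: measurableU; apply: measurableI => //.
    - by rewrite -[X in measurable X]setTI; exact: m1.
    - exact: measurableC.
    - by rewrite -[X in measurable X]setTI; exact: m2.
  apply/seteqP; split => g /=; case: asboolP => Ag Wg; [by left|by right|by case: Wg => -[]|by case: Wg => -[]].
- by move=> g r Ag r01; rewrite asboolT// H1.
- move=> g r Ag r01; rewrite asboolF// H2//; congr curve_at.
  by apply/eqP; rewrite eq_le andbC; exact: (clamp01 r (lexx s)).
Qed.

Lemma mslope_eq (g g' : R -> X) (r v : R) : 0 < r < 1 ->
  (forall u, 0 <= u <= 1 -> g u = g' u) -> mslope g r v -> mslope g' r v.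
Proof.
move=> /andP[r0 r1] gg' H e e0; have [d d0 Hd] := H e e0.
have [d' [d'0 d's d't]] : exists d' : R, [/\ 0 < d', d' <= r & d' <= 1 - r].
  exists (Num.min r (1 - r)); rewrite lt_min r0 subr_gt0 r1.
  by split => //; rewrite ge_min lexx ?orbT.
exists (Num.min d d') => [|u u' ur ru']; first by rewrite lt_min d0.
rewrite lt_min => /andP[h1 h2].
have us : 0 <= u <= 1 by apply/andP; split; slra.
have u's : 0 <= u' <= 1 by apply/andP; split; slra.
by rewrite -!gg'//; exact: Hd.
Qed.

Lemma denergy_eq (g g' : R -> X) n : (forall u, 0 <= u <= 1 -> g u = g' u) ->
  denergy g n = denergy g' n.
Proof.
move=> gg'; apply: eq_bigr => i _; rewrite !gg'//.
  by rewrite divr_ge0//= ler_pdivrMr ?ltr0n ?expn_gt0// mul1r ler_nat.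
by rewrite divr_ge0//= ler_pdivrMr ?ltr0n ?expn_gt0// mul1r ler_nat ltnW.
Qed.

Lemma energy_curve_le (g : curves X) (g' : R -> X) :
  (forall u, 0 <= u <= 1 -> curve_at g u = g' u) -> (energy (curve_at g) 0 1 <= energy g' 0 1)%E.
Proof.
move=> gg'; rewrite energy_sup; apply: ge_ereal_sup => _ [n _ <-].
by rewrite (denergy_eq n gg'); exact: denergy_le.
Qed.

Definition upper (H : borel X -> R) (g : curves X) (s t : R) : \bar R :=
  (\int[leb]_(r in `[s, t]) (H (curve_at g r) * speed (curve_at g) r)%:E)%E.

(** The upper gradient inequality for the frozen curves of [freeze_map]. *)
Lemma wug_localize P w H (s t : R) (A : set (curves X)) : test_plan m P ->
  measurable_fun setT w -> weak_upper_gradient m w H -> 0 <= s -> s <= t -> t <= 1 ->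
  measurable (A : set (borel (curves X))) ->
  (\int[P]_(g in A) (`|w (curve_at g t) - w (curve_at g s)|)%:E <=
   \int[P]_(g in A) upper H g s t)%E.
Proof.
move=> tpP mw [_ H0 HP] s0 st t1 mA; have [C C0 PC] := test_plan_marginal tpP; have [_ Eoo] := tpP.
have [Phi [mPhi PA PnA]] := freeze_map s0 st t1 mA.
have [Q QE] := push_law P mPhi.
have QE' D : measurable D -> Q D = P (Phi @^-1` D) by [].
have i0 : 0 <= (0 : R) <= 1 by rewrite lexx ler01.
have i1 : 0 <= (1 : R) <= 1 by rewrite ler01 lexx.
have c01 r : 0 <= clamp s t r <= 1.
  by have /andP[h1 h2] := clamp01 r st; rewrite (le_trans s0 h1) (le_trans h2).
have s01 : 0 <= s <= 1 by rewrite s0 (le_trans st).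
have t01 : 0 <= t <= 1 by rewrite t1 (le_trans s0).
have tpQ : test_plan m Q.
  split; first exists (C + C); first by rewrite addr_gt0.
    move=> r D r01 mD; have mD1 := measurable_eval (c01 r) measurableT mD.
    have mD2 := measurable_eval s01 measurableT mD; rewrite !setTI in mD1 mD2.
    have mE := measurable_eval r01 measurableT mD; rewrite setTI in mE.
    have mPE := mPhi measurableT _ mE; rewrite setTI in mPE.
    have h1 := PC _ _ (c01 r) mD; have h2 := PC _ _ s01 mD.
    have h3 := measureU2 P mD1 mD2.
    have h4 : (P (Phi @^-1` (eval_at r @^-1` D)) <=
        P (eval_at (clamp s t r) @^-1` D `|` eval_at s @^-1` D))%E.
      apply: le_measure; [exact: mem_set|apply: mem_set; exact: measurableU|].
      move=> g /=; rewrite /eval_at; have [Ag|Ag] := pselect (A g).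
        by rewrite PA//; left.
      by rewrite PnA//; right.
    have h5 : ((C + C)%:E * m D = C%:E * m D + C%:E * m D)%E.
      by rewrite EFinD ge0_muleDl// lee_fin ltW.
    rewrite h5 /pushforward QE; apply: (le_trans h4); apply: (le_trans h3).
    exact: leeD h1 h2.
  apply: le_lt_trans Eoo.
  rewrite (integral_law mPhi QE' (@measurable_energy R X)); last first.
    by move=> g; exact: energy_ge0.
  apply: lower_integral_le => g _; first exact: energy_ge0.
  have [Ag|Ag] := pselect (A g).
    by apply: (le_trans (energy_curve_le (g' := curve_at g \o clamp s t) _)) (energy_clamp _ s0 st t1) => r r01; exact: PA.
  apply: (le_trans (energy_curve_le (g' := curve_at g \o clamp s s) _)) (energy_clamp _ s0 (lexx s) (le_trans st t1)) => r r01.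
  rewrite PnA//=; congr curve_at; apply/esym.
  by apply/eqP; rewrite eq_le andbC; exact: (clamp01 r (lexx s)).
have clamp0 : clamp s t 0 = s by rewrite /clamp max_l// ge_min s0 orbT.
have clamp1 : clamp s t 1 = t by rewrite /clamp min_l// max_r.
have lhsE : (\int[P]_(g in A) (`|w (curve_at g t) - w (curve_at g s)|)%:E =
    \int[Q]_g (`|w (curve_at g 1) - w (curve_at g 0)|)%:E)%E.
  rewrite (integral_law mPhi QE')//; last first.
    apply/measurable_EFinP; apply: measurableT_comp => //; apply: measurable_funB.
      exact: (measurableT_comp mw (measurable_eval i1)).
    exact: (measurableT_comp mw (measurable_eval i0)).
  apply: integral_on => g Ag; first by rewrite !PA// clamp0 clamp1.
  by rewrite !PnA// subrr normr0.
rewrite lhsE; apply: (le_trans (HP Q tpQ)).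
apply: (le_trans (lower_integral_pushforward mPhi QE' _)).
  by move=> g; apply: integral_ge0 => r _; rewrite lee_fin mulr_ge0// speed_ge0.
rewrite [leRHS]integral_mkcond; apply: ae_lower_integral_le_gen => //.
- by move=> g _; apply: integral_ge0 => r _; rewrite lee_fin mulr_ge0// speed_ge0.
- move=> g _; rewrite patchE; case: ifP => // _; apply: integral_ge0 => r _.
  by rewrite lee_fin mulr_ge0// speed_ge0.
apply: aeS (test_plan_ac tpP) => g [ac _] _.
have [v [iv v0 gv sv]] := abs_continuousP ac; rewrite patchE.
have ae01 := ae_neq2 0 1.
have aest := ae_neq2 s t.
have mm : measurable (`[0, 1] : set R) by [].
have [Ag|Ag] := pselect (A g).
  rewrite mem_set// /upper integral_mkcond [leRHS]integral_mkcond.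
  apply: ae_lower_integral_le_gen => //.
  - by move=> r _; rewrite patchE; case: ifP => // _; rewrite lee_fin mulr_ge0// speed_ge0.
  - by move=> r _; rewrite patchE; case: ifP => // _; rewrite lee_fin mulr_ge0// speed_ge0.
  apply: aeS3 sv ae01 aest => r svr [r0 r1] [rs rt] _; rewrite !patchE.
  have zero : (0 <= if r \in `[s, t]%classic then (H (curve_at g r) * speed (curve_at g) r)%:E else point)%E.
    by case: ifP => // _; rewrite lee_fin mulr_ge0// speed_ge0.
  case: ifPn => [/set_mem/=|//]; rewrite in_itv/= => r01.
  have r01' : 0 < r < 1 by move: r01; rewrite !lt_neqAle eq_sym r0 r1.
  have gr : mslope (curve_at g) r (v r) by apply: svr; rewrite in_itv.
  have PAg u : 0 <= u <= 1 -> (curve_at g \o clamp s t) u = curve_at (Phi g) u.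
    by move=> u01; rewrite PA.
  have [rs'|sr] := ltP r s.
    have := mslope_eq r01' PAg (mslope_clamp_out (curve_at g) st (or_introl rs')).
    by move=> /mslope_speed ->; rewrite mulr0.
  have [tr|rt'] := ltP t r.
    have := mslope_eq r01' PAg (mslope_clamp_out (curve_at g) st (or_intror tr)).
    by move=> /mslope_speed ->; rewrite mulr0.
  have srt : s < r < t by rewrite !lt_neqAle sr rt' rt eq_sym rs.
  have := mslope_eq r01' PAg (mslope_clamp srt gr) => /mslope_speed ->.
  rewrite mem_set/= ?in_itv/= ?sr//; rewrite (mslope_speed gr) PA// clamp_id//.
  by rewrite sr.
rewrite memNset//; apply: (@le_trans _ _ (\int[leb]_(r in `[0%R, 1%R]) 0)%E); last by rewrite integral0.
apply: ae_lower_integral_le_gen => //; first by move=> r _; rewrite lee_fin mulr_ge0// speed_ge0.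
apply: aeS ae01 => r [r0 r1] /=; rewrite in_itv/= => r01.
have r01' : 0 < r < 1 by move: r01; rewrite !lt_neqAle eq_sym r0 r1.
have cst0 : mslope (fun=> curve_at g s) r 0.
  move=> e e0; exists 1 => // u u' ur ru' _; rewrite mdistxx mul0r subrr normr0 mulr_ge0 ?(ltW e0)//.
  by rewrite subr_ge0 (le_trans ur).
have := mslope_eq (g' := curve_at (Phi g)) r01' _ cst0 => /(_ _)/mslope_speed -> //.
  by rewrite mulr0.
by move=> u u01; rewrite PnA.
Qed.

End test_plan_curves.

(** * Square integrable functions along test plans *)

Section square_integrable.
Context (R : realType) (X : completeMetricType R) (m : {measure set (borel X) -> \bar R}).
Local Notation leb := (@lebesgue_measure R).
Implicit Types (P : probability (borel (curves X)) R) (w H : borel X -> R).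

Lemma measurable_sup_lfun (H : borel X -> R) : H \in Lfun m 2%:E -> measurable_fun setT H.
Proof. rewrite inE => /andP[mf _]; exact: (@set_mem _ [set f : borel X -> R | measurable_fun setT f] H mf). Qed.

Lemma lfun2_integral (H : borel X -> R) : H \in Lfun m 2%:E ->
  (\int[m]_x ((H x) ^+ 2)%:E < +oo)%E.
Proof.
move=> /Lfun2_integrable_sqr/integrableP[_]; apply: le_lt_trans.
by apply: lower_integral_le => x _; rewrite ?lee_fin ?sqr_ge0//= ger0_norm// sqr_ge0.
Qed.

Lemma test_plan_integral P (C t : R) (f : borel X -> \bar R) : 0 < C -> 0 <= t <= 1 ->
  (forall A, measurable A -> (P (eval_at t @^-1` A) <= C%:E * m A)%E) ->
  measurable_fun setT f -> (forall x, (0 <= f x)%E) ->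
  (\int[P]_g f (eval_at t g) <= C%:E * \int[m]_x f x)%E.
Proof.
move=> C0 t01 PC mf f0; have me := @measurable_eval R X t t01.
have [Q QE] := push_law P me; have QE' D : measurable D -> Q D = P (eval_at t @^-1` D) by [].
rewrite -(integral_law me QE' mf f0); pose c : {nonneg R} := NngNum (ltW C0).
rewrite -[C]/(c%:num) -ge0_integral_mscale//.
by apply: ge0_le_measure_integral => // A mA; have h := PC A mA; rewrite -(QE' A mA) in h; exact: h.
Qed.

(** By Fubini and the bound on the marginals. *)
Lemma test_plan_L2 P H : test_plan m P -> H \in Lfun m 2%:E ->
  (\int[P]_g (\int[leb]_(r in `[0%R, 1%R]) ((H (curve_at g r)) ^+ 2)%:E) < +oo)%E /\
  measurable_fun setT (fun g : borel (curves X) =>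
    \int[leb]_(r in `[0%R, 1%R]) ((H (curve_at g r)) ^+ 2)%:E)%E.
Proof.
move=> tpP HL; have [C C0 PC] := test_plan_marginal tpP; have mH := measurable_sup_lfun HL.
pose h (p : borel (curves X) * R) : \bar R :=
  ((H (eval_at (clamp 0 1 p.2) p.1) ^+ 2) * \1_(`[0, 1]%classic : set R) p.2)%:E.
have mh : measurable_fun setT h.
  have m1 : measurable_fun setT (fun p : borel (curves X) * R => H (eval_at (clamp 0 1 p.2) p.1)).
    exact: (measurableT_comp mH (@measurable_eval_joint R X)).
  have m2 : measurable_fun setT (\1_(`[0, 1]%classic : set R) : R -> R) by exact: measurable_indic.
  have m3 : measurable_fun setT (fun p : borel (curves X) * R => \1_(`[0, 1]%classic : set R) p.2 : R).
    exact: (measurableT_comp m2 measurable_snd).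
  have m4 := measurable_funX 2 m1.
  by apply/measurable_EFinP; exact: (measurable_funM m4 m3).
have h0 p : (0 <= h p)%E by rewrite lee_fin mulr_ge0 ?sqr_ge0.
have E g : (\int[leb]_(r in `[0%R, 1%R]) ((H (curve_at g r)) ^+ 2)%:E = \int[leb]_r h (g, r))%E.
  rewrite integral_mkcond; apply: eq_integral => r _; rewrite patchE /h /= indicE.
  case: ifPn => [rI|]; last by rewrite mulr0.
  rewrite mulr1 clamp_id//; move: rI => /set_mem/=; rewrite in_itv//.
split; last first.
  rewrite (_ : (fun _ => _) = (fun g => \int[leb]_r h (g, r))%E); last by apply/funext => g; exact: E.
  exact: (@measurable_fun_fubini_tonelli_F _ _ _ _ _ leb h mh h0).
under eq_integral do rewrite E.
rewrite (@fubini_tonelli _ _ _ _ _ P leb h mh h0).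
apply: (@le_lt_trans _ _ (\int[leb]_(r in `[0%R, 1%R]) (C%:E * \int[m]_x ((H x) ^+ 2)%:E))%E).
  rewrite [leRHS]integral_mkcond; apply: lower_integral_le => r _; first by apply: integral_ge0.
  rewrite patchE; case: ifPn => [/set_mem/=|rI]; last first.
    by rewrite integral0_eq// => g _; rewrite /h /= indicE (negbTE rI) mulr0.
  rewrite in_itv/= => r01.
  apply: le_trans (test_plan_integral C0 r01 (fun A => PC r A r01) (f := fun x => (H x ^+ 2)%:E) _ _).
  - apply: lower_integral_le => g _; first exact: h0.
    by rewrite /h /= clamp_id// lee_fin ler_piMr ?sqr_ge0// indicE; case: (_ \in _).
  - by apply/measurable_EFinP; exact: measurable_funX.
  - by move=> x; rewrite lee_fin sqr_ge0.
rewrite integral_cst//; apply: lte_mul_pinfty.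
- by rewrite mule_ge0 ?lee_fin ?(ltW C0)//; apply: integral_ge0 => x _; rewrite lee_fin sqr_ge0.
- rewrite fin_numM// ge0_fin_numE; first exact: lfun2_integral.
  by apply: integral_ge0 => x _; rewrite lee_fin sqr_ge0.
have l1 : (leb `[0%R, 1%R] < +oo)%E by rewrite lebesgue_measure_itv/= lte_fin ltr01 -EFinD ltry.
exact: l1.
Qed.

End square_integrable.

(** * Weak upper gradients as bounds on slopes along curves *)

Section sobolev.
Context (R : realType) (X : completeMetricType R) (m : {measure set (borel X) -> \bar R}).
Local Notation leb := (@lebesgue_measure R).
Implicit Types (P : probability (borel (curves X)) R) (w H : borel X -> R).

Definition curve_L2 H (g : curves X) : \bar R :=
  (\int[leb]_(r in `[0%R, 1%R]) ((H (curve_at g r)) ^+ 2)%:E)%E.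

Definition good_curve H (g : curves X) := [/\ abs_continuous (curve_at g) 0 1,
  (energy (curve_at g) 0 1 < +oo)%E & (curve_L2 H g < +oo)%E].

Lemma test_plan_good P H : test_plan m P -> H \in Lfun m 2%:E ->
  {ae P, forall g, good_curve H g}.
Proof.
move=> tpP HL; have [I2 mI2] := test_plan_L2 tpP HL.
have I20 g : (0 <= curve_L2 H g)%E by apply: integral_ge0 => r _; rewrite lee_fin sqr_ge0.
have iI : P.-integrable setT (fun g : borel (curves X) => curve_L2 H g).
  apply/integrableP; split => //; apply: le_lt_trans I2.
  by apply: lower_integral_le => g _ //; rewrite gee0_abs ?I20.
apply: aeS2 (test_plan_ac tpP) (integrable_ae measurableT iI) => g [ac Eoo] /(_ I).
by rewrite ge0_fin_numE.
Qed.

(** Along a good curve the integrand of an upper gradient inequality has an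
    integrable representative. *)
Lemma upper_density H (g : curves X) : measurable_fun setT H -> (forall x, 0 <= H x) ->
  good_curve H g -> exists f : R -> R, [/\ leb.-integrable setT (EFin \o f), forall r, 0 <= f r,
    {ae leb, forall r, 0 <= r <= 1 -> f r = H (curve_at g r) * speed (curve_at g) r},
    forall s t, 0 <= s -> t <= 1 -> upper H g s t = (\int[leb]_(r in `[s, t]) (f r)%:E)%E &
    forall s t, 0 <= s -> t <= 1 -> (upper H g s t <= curve_L2 H g + energy (curve_at g) 0 1)%E].
Proof.
move=> mH H0 [ac Eoo Ioo]; have [v [iv v0 gv sv]] := abs_continuousP ac.
have mv : measurable_fun setT v by have /integrableP[/measurable_EFinP] := iv.
pose h r := H (curve_at g (clamp 0 1 r)).
have mh : measurable_fun setT h.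
  have m1 : measurable_fun setT (fun r : R => eval_at (clamp 0 1 r) (g : borel (curves X))).
    exact: (measurableT_comp (@measurable_eval_joint R X) (measurable_pair1 (g : borel (curves X)))).
  exact: (measurableT_comp mH m1).
have hE r : 0 <= r <= 1 -> h r = H (curve_at g r) by move=> r01; rewrite /h clamp_id.
pose I01 := `[0, 1]%classic : set R.
pose f r := h r * v r * \1_I01 r.
have mI : measurable_fun setT (\1_I01 : R -> R).
  by apply: measurable_indic; exact: measurable_itv.
have mf : measurable_fun setT f by exact: (measurable_funM (measurable_funM mh mv) mI).
have f0 r : 0 <= f r by rewrite !mulr_ge0 ?H0.
have EE : energy (curve_at g) 0 1 = (\int[leb]_(r in `[0%R, 1%R]) ((v r) ^+ 2)%:E)%E.
  rewrite energyE//; apply: ae_eq_lower_integral => //; try by move=> r _; rewrite lee_fin sqr_ge0.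
  by apply: aeS sv => r H1 /H1 /mslope_speed ->.
have IE : curve_L2 H g = (\int[leb]_(r in `[0%R, 1%R]) ((h r) ^+ 2)%:E)%E.
  by apply: eq_integral => r /set_mem/=; rewrite in_itv/= => r01; rewrite hE.
have fle : (\int[leb]_r (f r)%:E <= curve_L2 H g + energy (curve_at g) 0 1)%E.
  rewrite EE IE -ge0_integralD//; last 4 first.
  - by move=> r _; rewrite lee_fin sqr_ge0.
  - by apply/measurable_EFinP; apply: measurable_funTS; exact: measurable_funX.
  - by move=> r _; rewrite lee_fin sqr_ge0.
  - by apply/measurable_EFinP; apply: measurable_funTS; exact: measurable_funX.
  rewrite [leRHS]integral_mkcond; apply: lower_integral_le => r _; first by rewrite lee_fin.
  rewrite patchE /f indicE; case: ifPn => rI; last by rewrite mulr0.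
  rewrite mulr1 -EFinD lee_fin.
  have := sqr_ge0 (h r - v r); have := mulr_ge0 (H0 (curve_at g (clamp 0 1 r))) (v0 r).
  by rewrite -/(h r); nra.
have iF : leb.-integrable setT (EFin \o f).
  apply/integrableP; split; first exact/measurable_EFinP.
  apply: (@le_lt_trans _ _ (\int[leb]_r (f r)%:E)%E).
    by apply: lower_integral_le => r _; rewrite ?lee_fin//= ger0_norm.
  by apply: (le_lt_trans fle); exact: lte_add_pinfty.
have fE : {ae leb, forall r, 0 <= r <= 1 -> f r = H (curve_at g r) * speed (curve_at g) r}.
  apply: aeS sv => r svr r01; have rI : r \in `[0, 1] by rewrite in_itv.
  by rewrite /f indicE mem_set ?mulr1//= hE// (mslope_speed (svr rI)).
have uE s t : 0 <= s -> t <= 1 -> upper H g s t = (\int[leb]_(r in `[s, t]) (f r)%:E)%E.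
  move=> s0 t1; apply: ae_eq_lower_integral => //.
  - by move=> r _; rewrite lee_fin mulr_ge0// speed_ge0.
  - by move=> r _; rewrite lee_fin.
  apply: aeS fE => r fr /=; rewrite in_itv/= => /andP[sr rt]; rewrite fr//.
  by rewrite (le_trans s0 sr) (le_trans rt t1).
exists f; split => // s t s0 t1; rewrite uE//; apply: le_trans fle.
rewrite integral_mkcond; apply: lower_integral_le => r _; rewrite patchE; case: ifP => _ //.
all: by rewrite lee_fin.
Qed.

Section lipschitz_functions.
Variables (w : X -> R) (L : R).
Hypothesis wL : forall x y, `|w x - w y| <= L * mdist x y.

Lemma lip_measurable : measurable_fun setT (w : borel X -> R).
Proof. by apply: continuous_borel; exact: lip_continuous wL. Qed.

Lemma wug_increment P H s t : test_plan m P -> weak_upper_gradient m w H ->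
  0 <= s -> s <= t -> t <= 1 ->
  {ae P, forall g, ((`|w (curve_at g t) - w (curve_at g s)|)%:E <= upper H g s t)%E}.
Proof.
move=> tpP wH s0 st t1; have [HL H0 _] := wH; have mH := measurable_sup_lfun HL.
have s01 : 0 <= s <= 1 by rewrite s0 (le_trans st).
have t01 : 0 <= t <= 1 by rewrite t1 (le_trans s0).
have up0 g : (0 <= upper H g s t)%E.
  by apply: integral_ge0 => r _; rewrite lee_fin mulr_ge0// speed_ge0.
apply: (@ae_le_of_lower_integrals _ _ _ P (fun g => `|w (curve_at g t) - w (curve_at g s)|)
    (fun g => upper H g s t)) => //.
- apply: measurableT_comp => //; apply: measurable_funB.
    exact: (measurableT_comp lip_measurable (measurable_eval t01)).
  exact: (measurableT_comp lip_measurable (measurable_eval s01)).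
- have [I2 mI2] := test_plan_L2 tpP HL; have [_ Eoo] := tpP.
  have c0 g : (0 <= curve_L2 H g)%E by apply: integral_ge0 => r _; rewrite lee_fin sqr_ge0.
  apply: (@le_lt_trans _ _ (\int[P]_g (curve_L2 H g + energy (curve_at g) 0 1))%E).
    apply: ae_lower_integral_le_gen => //; first by move=> g _; rewrite adde_ge0 ?energy_ge0.
    apply: aeS (test_plan_good tpP HL) => g good _.
    by have [f [_ _ _ _]] := upper_density mH H0 good; exact.
  rewrite ge0_integralD//; first exact: lte_add_pinfty.
  - by move=> g _; exact: energy_ge0.
  - exact: measurable_energy.
- by move=> A mA; exact: (wug_localize tpP lip_measurable wH s0 st t1 mA).
Qed.

(** Rational times suffice for the upper gradient inequality on a continuous
    curve; differentiating it in time bounds the slope. *)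
Lemma wug_slope P H : test_plan m P -> weak_upper_gradient m w H ->
  {ae P, forall g, {ae leb, forall t, 0 < t < 1 ->
    slope_le (w \o curve_at g) t (H (curve_at g t) * speed (curve_at g) t)}}.
Proof.
move=> tpP wH; have [HL H0 _] := wH; have mH := measurable_sup_lfun HL.
have Qae : {ae P, forall g, forall n : nat, forall p q : rat, choice.unpickle n = Some (p, q) ->
    0 <= ratr p :> R -> ratr p <= ratr q :> R -> ratr q <= 1 :> R ->
    ((`|w (curve_at g (ratr q)) - w (curve_at g (ratr p))|)%:E <= upper H g (ratr p) (ratr q))%E}.
  apply: ae_foralln => n; case E : (choice.unpickle n) => [[p q]|]; last by apply: ae_all => g p q.
  have [/and3P[p0 pq q1]|npq] := boolP [&& 0 <= ratr p :> R, ratr p <= ratr q :> R & ratr q <= 1 :> R].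
    by apply: aeS (wug_increment tpP wH p0 pq q1) => g Hg p' q' [<- <-].
  by apply: ae_all => g p' q' [<- <-] p0 pq q1; move: npq; rewrite p0 pq q1.
apply: aeS2 Qae (test_plan_good tpP HL) => g Hg good.
have [f [iF f0 fE uE _]] := upper_density mH H0 good.
have L0 : 0 <= `|L| by [].
have wL' x y : `|w x - w y| <= (`|L| + 1) * mdist x y.
  by apply: (le_trans (wL x y)); rewrite ler_wpM2r ?mdist_ge0//; have := ler_norm L; slra.
have incr s t : 0 <= s -> s < t -> t <= 1 ->
    ((`|w (curve_at g t) - w (curve_at g s)|)%:E <= \int[leb]_(r in `[s, t]) (f r)%:E)%E.
  move=> s0 st t1; apply/lee_addgt0Pr => e e0.
  have e2 : 0 < e / (2 * (`|L| + 1)) by rewrite divr_gt0// mulr_gt0//; slra.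
  have s01 : 0 <= s <= 1 by rewrite s0 (le_trans (ltW st)).
  have t01 : 0 <= t <= 1 by rewrite t1 (le_trans s0 (ltW st)).
  have [d1 d10 H1] := @curve_continuous01 _ _ g _ s01 _ e2.
  have [d2 d20 H2] := @curve_continuous01 _ _ g _ t01 _ e2.
  pose md := (s + t) / 2.
  have smd : s < Num.min md (s + d1) by rewrite lt_min ltrDl d10 andbT /md; slra.
  have mdt : Num.max md (t - d2) < t by rewrite gt_max ltrBlDr ltrDl d20 andbT /md; slra.
  have [p] := rat_in_itvoo smd; rewrite in_itv/= lt_min => /andP[sp /andP[pm pd]].
  have [q] := rat_in_itvoo mdt; rewrite in_itv/= gt_max => /andP[/andP[mq dq] qt].
  set p' : R := ratr p in sp pm pd *; set q' : R := ratr q in mq dq qt *.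
  have p0 : 0 <= p' by exact: le_trans s0 (ltW sp).
  have q1 : q' <= 1 by exact: le_trans (ltW qt) t1.
  have pq : p' <= q' by rewrite (le_trans (ltW pm) (ltW mq)).
  have p01 : 0 <= p' <= 1 by rewrite p0 (le_trans pq).
  have q01 : 0 <= q' <= 1 by rewrite q1 (le_trans p0).
  have h1 : mdist (curve_at g p') (curve_at g s) <= e / (2 * (`|L| + 1)).
    by apply: H1 => //; rewrite ger0_norm ?subr_ge0 ?(ltW sp)// ltrBlDl.
  have h2 : mdist (curve_at g q') (curve_at g t) <= e / (2 * (`|L| + 1)).
    by apply: H2 => //; rewrite ler0_norm ?subr_le0 ?(ltW qt)// opprB ltrBlDl -ltrBlDr.
  have := Hg (choice.pickle (p, q)) p q (choice.pickleK _) p0 pq q1.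
  rewrite -/p' -/q' uE// => Hpq.
  have sub : (\int[leb]_(r in `[p', q']) (f r)%:E <= \int[leb]_(r in `[s, t]) (f r)%:E)%E.
    apply: ge0_subset_integral => //.
    - by apply: measurable_funTS; have /integrableP[] := iF.
    - by move=> r _; rewrite lee_fin.
    - by move=> r /=; rewrite !in_itv/= => /andP[/(le_trans (ltW sp))-> /le_trans ->//]; exact: ltW.
  apply: (@le_trans _ _ ((`|w (curve_at g q') - w (curve_at g p')| + e)%:E)%E); last first.
    by rewrite EFinD leeD2r// (le_trans Hpq).
  rewrite lee_fin.
  have k1 := wL' (curve_at g p') (curve_at g s); have k2 := wL' (curve_at g q') (curve_at g t).
  have L1 : 0 < `|L| + 1 by rewrite ltr_wpDl.
  have b1 : `|w (curve_at g p') - w (curve_at g s)| <= e / 2.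
    apply: (le_trans k1); rewrite mulrC -ler_pdivlMr// (le_trans h1)//.
    by rewrite invfM mulrA.
  have b2 : `|w (curve_at g q') - w (curve_at g t)| <= e / 2.
    apply: (le_trans k2); rewrite mulrC -ler_pdivlMr// (le_trans h2)//.
    by rewrite invfM mulrA.
  have := ler_distD (w (curve_at g q')) (w (curve_at g t)) (w (curve_at g s)).
  have := ler_distD (w (curve_at g p')) (w (curve_at g q')) (w (curve_at g s)).
  by move: b1 b2; rewrite (distrC (w (curve_at g q')) (w (curve_at g t))); slra.
pose a t := fine (\int[leb]_(r in `[0%R, t]) (f r)%:E)%E.
have aE s t : 0 <= s -> s <= t -> t <= 1 -> (a t - a s)%:E = (\int[leb]_(r in `[s, t]) (f r)%:E)%E.
  move=> s0 st t1; have mf : measurable_fun setT f by have /integrableP[/measurable_EFinP] := iF.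
  have fin u : (\int[leb]_(r in `[0%R, u]) (f r)%:E)%E \is a fin_num.
    by apply: integrable_fin_num => //; exact: integrableS iF.
  have -> : (a t - a s = \int[leb]_(r in `]s, t]) f r)%R.
    by rewrite -(@Rintegral_itvB _ f (BLeft 0) (BRight t))//= ?bnd_simp//; exact: integrableS iF.
  rewrite -integral_itv_obnd_cbnd; last by apply: measurable_funTS; exact/measurable_EFinP.
  by rewrite /Rintegral fineK// integrable_fin_num//; exact: integrableS iF.
apply: aeS2 (ac_deriv_at iF aE) fE => t Ht fEt t01; move: (t01) => /andP[t0 t1].
rewrite -fEt ?(ltW t0) ?(ltW t1)// => e e0.
have [d d0 Hd] := deriv_slope (Ht t01) e0.
have [d' [d'0 d's d't]] : exists d' : R, [/\ 0 < d', d' <= t & d' <= 1 - t].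
  exists (Num.min t (1 - t)); rewrite lt_min t0 subr_gt0 t1.
  by split => //; rewrite ge_min lexx ?orbT.
exists (Num.min d d') => [|h]; first by rewrite lt_min d0.
rewrite lt_min => /andP[hd]; have := Hd h hd; rewrite (ger0_norm (f0 t)) => Hh hd'.
apply: le_trans Hh; rewrite /=.
move: hd'; rewrite ltr_norml => /andP[h1 h2].
have [h0|h0|->] := ltgtP h 0; last by rewrite addr0 !subrr.
  have hh : t + h < t by slra.
  have h0' : 0 <= t + h by slra.
  rewrite distrC [leRHS]distrC; apply: (le_trans _ (ler_norm _)); rewrite -lee_fin.
  rewrite (aE _ _ h0' (ltW hh) (ltW t1)); exact: incr h0' hh (ltW t1).
have hh : t < t + h by slra.
have h1' : t + h <= 1 by slra.
apply: (le_trans _ (ler_norm _)); rewrite -lee_fin.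
rewrite (aE _ _ (ltW t0) (ltW hh) h1'); exact: incr (ltW t0) hh h1'.
Qed.

(** [w] is absolutely continuous along absolutely continuous curves, so its
    increment is the integral of its derivative. *)
Lemma slope_wug H : H \in Lfun m 2%:E -> (forall x, 0 <= H x) ->
  (forall P, test_plan m P -> {ae P, forall g, {ae leb, forall t, 0 < t < 1 ->
    slope_le (w \o curve_at g) t (H (curve_at g t) * speed (curve_at g) t)}}) ->
  weak_upper_gradient m w H.
Proof.
move=> HL H0 HP; split => // P tpP.
apply: ae_lower_integral_le_gen => //.
  by move=> g _; apply: integral_ge0 => r _; rewrite lee_fin mulr_ge0// speed_ge0.
apply: aeS2 (HP P tpP) (test_plan_ac tpP) => g Hg [ac _] _.
have [v [iv v0 gv sv]] := abs_continuousP ac.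
pose k r := (`|L| * v r)%R.
have ik : leb.-integrable setT (EFin \o k).
  exact: (integrableZl measurableT `|L| iv).
have ik01 : leb.-integrable `[0, 1] (EFin \o k) by exact: integrableS ik.
have [|al ial alE] := @ac_density _ (w \o curve_at g) k 0 1 ik01.
  move=> s t s0 st t1.
  apply: (@le_trans _ _ (`|L|%:E * \int[leb]_(r in `[s, t]) (v r)%:E)%E).
    apply: (@le_trans _ _ (`|L|%:E * (mdist (curve_at g s) (curve_at g t))%:E)%E).
      rewrite -EFinM lee_fin distrC (le_trans (wL _ _))// ler_wpM2r ?mdist_ge0//.
      exact: ler_norm.
    by apply: lee_wpmul2l; [rewrite lee_fin|exact: gv].
  rewrite -ge0_integralZl//; try by move=> r _; rewrite lee_fin.
  by apply: measurable_funTS; have /integrableP[] := iv.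
have dv := ac_deriv_at ial alE.
have i01 := alE 0 1 (lexx 0) ler01 (lexx 1).
have al01 : (`|w (curve_at g 1) - w (curve_at g 0)|%:E <= \int[leb]_(r in `[0%R, 1%R]) (`|al r|)%:E)%E.
  rewrite -abse_EFin i01; apply: le_abse_integral => //.
  by apply: measurable_funTS; have /integrableP[] := ial.
apply: (le_trans al01); apply: ae_lower_integral_le_gen => //.
  by move=> r _; rewrite lee_fin mulr_ge0// speed_ge0.
apply: aeS2 (ae_neq2 0 1)
  (aeS2 (fun r a b => conj a b) Hg dv) => r [r0 r1] [Hr dr] /=; rewrite in_itv/= => r01.
have r01' : 0 < r < 1 by move: r01; rewrite !lt_neqAle eq_sym r0 r1.
by rewrite lee_fin; exact: (deriv_slope_le (dr r01') (Hr r01')).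
Qed.

End lipschitz_functions.

End sobolev.

(** * Minimal weak upper gradients and their locality *)

Section square_integrable_functions.
Context d (T : measurableType d) (R : realType) (m : {measure set T -> \bar R}).
Implicit Types (a b f : T -> R) (O : set T).

Lemma lfun2P f : measurable_fun setT f -> (\int[m]_x ((f x) ^+ 2)%:E < +oo)%E ->
  f \in Lfun m 2%:E.
Proof.
move=> mf foo; rewrite inE; apply/andP; split.
  exact: (@mem_set _ [set f : T -> R | measurable_fun setT f] f mf).
apply: (@mem_set _ [set f : T -> R | finite_norm m 2%:E f] f).
rewrite /finite_norm unlock; apply: poweR_lty; apply: le_lt_trans foo.
apply: lower_integral_le => x _; first exact: poweR_ge0.
by rewrite /= lee_fin powR_mulrn// -normrX ger0_norm ?sqr_ge0.
Qed.

Lemma lfun2_sqr f : f \in Lfun m 2%:E -> ('N[m]_2%:E[EFin \o f] ^+ 2 = \int[m]_x ((f x) ^+ 2)%:E)%E.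
Proof.
move=> _; have := poweR_Lnorm m (EFin \o f) (_ : 2 != 0 :> R) => /(_ _)/=.
rewrite pnatr_eq0 => /(_ isT) E; transitivity (\int[m]_x `|(f x)%:E| `^ 2)%E.
  rewrite -E; have := Lnorm_ge0 m 2%:E (EFin \o f).
  case: ('N[m]_2%:E[_])%E => [r r0| |//].
    by rewrite poweR_EFin powR_mulrn.
  by move=> _; rewrite mulyy /poweR pnatr_eq0.
apply: eq_integral => x _; by rewrite /= powR_mulrn// -normrX ger0_norm ?sqr_ge0.
Qed.

Definition splice O a b : T -> R := fun x => if x \in O then a x else b x.

Lemma splice_in O a b x : O x -> splice O a b x = a x.
Proof. by move=> Ox; rewrite /splice mem_set. Qed.

Lemma splice_out O a b x : ~ O x -> splice O a b x = b x.
Proof. by move=> Ox; rewrite /splice memNset. Qed.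

Lemma measurable_splice O a b : measurable O -> measurable_fun setT a -> measurable_fun setT b ->
  measurable_fun setT (splice O a b).
Proof.
move=> mO ma mb; rewrite (_ : splice _ _ _ = fun x => a x * \1_O x + b x * \1_(~` O) x).
  have m1 : measurable_fun setT (\1_O : T -> R) by exact: measurable_indic.
  have m2 : measurable_fun setT (\1_(~` O) : T -> R) by apply: measurable_indic; exact: measurableC.
  exact: (measurable_funD (measurable_funM ma m1) (measurable_funM mb m2)).
apply/funext => x; rewrite /splice !indicE in_setC; case: (x \in O); by rewrite !(mulr1, mulr0, addr0, add0r).
Qed.

Lemma lfun2_splice O a b : measurable O -> a \in Lfun m 2%:E -> b \in Lfun m 2%:E ->
  measurable_fun setT a -> measurable_fun setT b ->
  (\int[m]_x ((a x) ^+ 2)%:E < +oo)%E -> (\int[m]_x ((b x) ^+ 2)%:E < +oo)%E ->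
  splice O a b \in Lfun m 2%:E.
Proof.
move=> mO aL bL ma mb aoo boo; apply: lfun2P; first exact: measurable_splice.
apply: (@le_lt_trans _ _ (\int[m]_x (((a x) ^+ 2)%:E + ((b x) ^+ 2)%:E))%E).
  apply: lower_integral_le => x _; first by rewrite lee_fin sqr_ge0.
  by rewrite -EFinD lee_fin /splice; case: (x \in O); rewrite ?lerDl ?lerDr sqr_ge0.
rewrite ge0_integralD//; try by move=> x _; rewrite lee_fin sqr_ge0.
- exact: lte_add_pinfty.
- by apply/measurable_EFinP; exact: measurable_funX.
- by apply/measurable_EFinP; exact: measurable_funX.
Qed.

End square_integrable_functions.

Section slopes.
Context (R : realType) (X : completeMetricType R).

Definition local_slope (f : X -> R) (x : X) (c : R) := forall e : R, 0 < e ->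
  exists2 d : R, 0 < d & forall y, mdist x y < d -> `|f y - f x| <= (c + e) * mdist x y.

Lemma local_slope_lip f L x : (forall y z, `|f y - f z| <= L * mdist y z) -> local_slope f x L.
Proof.
move=> fL e e0; exists 1 => // y _; rewrite distrC (le_trans (fL _ _))// ler_wpM2r ?mdist_ge0//.
by rewrite lerDl ltW.
Qed.

Lemma local_slope_near (f f' : X -> R) (U : set X) x c : nbhs x U ->
  (forall y, U y -> f y - f x = f' y - f' x) -> local_slope f x c -> local_slope f' x c.
Proof.
move=> /nbhs_mdistE[r r0 rU] ff' fc e e0; have [d d0 Hd] := fc e e0.
exists (Num.min d r) => [|y]; first by rewrite lt_min d0.
by rewrite lt_min => /andP[yd yr]; rewrite -ff' ?Hd//; exact: rU.
Qed.

(** Along a curve with metric derivative [v], a local Lipschitz bound [c] becomes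
    the slope bound [c * v]. *)
Lemma local_slope_curve (f : X -> R) (g : R -> X) t c v : 0 <= c -> 0 <= v ->
  local_slope f (g t) c -> mslope g t v -> slope_le (f \o g) t (c * v).
Proof.
move=> c0 v0 fc gv e e0.
pose e' := Num.min 1 (e / (c + v + 1)).
have cv : 0 < c + v + 1 by rewrite ltr_wpDl// addr_ge0.
have e'0 : 0 < e' by rewrite lt_min ltr01 divr_gt0.
have e'1 : e' <= 1 by rewrite ge_min lexx.
have e'e : e' * (c + v + 1) <= e by rewrite -ler_pdivlMr// ge_min lexx orbT.
have [d1 d10 H1] := fc e' e'0; have [d2 d20 H2] := gv e' e'0.
have v1 : 0 < v + 1 by rewrite ltr_wpDl.
exists (Num.min d2 (d1 / (v + 1))) => [|h]; first by rewrite lt_min d20 divr_gt0.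
rewrite lt_min => /andP[h2 h1].
have gh : mdist (g t) (g (t + h)) <= (v + e') * `|h|.
  have [h0|h0] := leP 0 h.
    have th : t + h - t = h by rewrite addrC addKr.
    have := H2 t (t + h) (lexx t); rewrite lerDl h0 th => /(_ isT).
    by move: h2; rewrite (ger0_norm h0) => h2 /(_ h2); rewrite ler_norml mulrDl => /andP[_]; slra.
  have th : t - (t + h) = - h by rewrite opprD addrA subrr sub0r.
  have := H2 (t + h) t; rewrite gerDl (ltW h0) lexx th (metric_sym (g (t + h))) => /(_ isT isT).
  by move: h2; rewrite (ltr0_norm h0) => h2 /(_ h2); rewrite ler_norml mulrDl => /andP[_]; slra.
have gd : mdist (g t) (g (t + h)) < d1.
  apply: (le_lt_trans gh); apply: (@le_lt_trans _ _ ((v + 1) * `|h|)).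
    by rewrite ler_wpM2r// lerD2l.
  by rewrite mulrC -ltr_pdivlMr.
apply: (le_trans (H1 _ gd)); apply: (@le_trans _ _ ((c + e') * ((v + e') * `|h|))).
  by apply: ler_wpM2l => //; rewrite addr_ge0// ltW.
rewrite mulrA ler_wpM2r// mulrDl !mulrDr -addrA lerD2l.
apply: le_trans e'e; rewrite (mulrC c) -!mulrDr ler_pM2l//; slra.
Qed.

Lemma slope_leD (a b : R -> R) t K K' : slope_le a t K -> slope_le b t K' ->
  slope_le (a \+ b) t (K + K').
Proof.
move=> aK bK e e0; have e2 : 0 < e / 2 by rewrite divr_gt0.
have [d1 d10 H1] := aK _ e2; have [d2 d20 H2] := bK _ e2.
exists (Num.min d1 d2) => [|h]; first by rewrite lt_min d10.
rewrite lt_min => /andP[h1 h2]; have k1 := H1 _ h1; have k2 := H2 _ h2.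
rewrite /= opprD addrACA (le_trans (ler_normD _ _))// (le_trans (lerD k1 k2))//.
rewrite -mulrDl ler_wpM2r//; slra.
Qed.

End slopes.

Section minimal_gradient.
Context (R : realType) (X : completeMetricType R) (m : {measure set (borel X) -> \bar R}).
Local Notation leb := (@lebesgue_measure R).
Implicit Types (P : probability (borel (curves X)) R) (w G H : borel X -> R).
Local Notation lipschitz L w := (forall x y : X, `|w x - w y| <= L * mdist x y).

(** A function whose slope along curves is controlled at each time by one of a
    family of upper gradients is controlled by any [H] meeting that bound. *)
Lemma wug_inf (w : X -> R) L (Hn : nat -> borel X -> R) H : lipschitz L w ->
  (forall n, weak_upper_gradient m w (Hn n)) -> H \in Lfun m 2%:E -> (forall x, 0 <= H x) ->
  (forall x (e : R), 0 < e -> exists n, Hn n x <= H x + e) -> weak_upper_gradient m w H.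
Proof.
move=> wL wH HL H0 HnH; apply: (slope_wug wL) => // P tpP.
have := ae_foralln (fun n => wug_slope wL tpP (wH n)); apply: aeS => g gn.
have := ae_foralln gn; apply: aeS => t Ht t01 e e0.
have v0 := speed_ge0 (curve_at g) t; set v := speed _ _ in v0 Ht *.
have e' : 0 < e / (2 * (v + 1)) by rewrite divr_gt0// mulr_gt0// ltr_wpDl.
have [n Hne] := HnH (curve_at g t) _ e'.
have [d d0 Hd] := Ht n t01 (e / 2) (divr_gt0 e0 (ltr0Sn R 1)).
exists d => // h hd; apply: (le_trans (Hd h hd)); rewrite ler_wpM2r//.
have : Hn n (curve_at g t) * v <= (H (curve_at g t) + e / (2 * (v + 1))) * v by rewrite ler_wpM2r.
have : e / (2 * (v + 1)) * v <= e / 2.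
  rewrite invfM mulrA -mulrA ler_piMr ?divr_ge0// ?ltW// mulrC ltr_pdivrMr ?mul1r; slra.
rewrite mulrDl; slra.
Qed.

Lemma wug_min (w : X -> R) L H H' : lipschitz L w -> weak_upper_gradient m w H ->
  weak_upper_gradient m w H' -> weak_upper_gradient m w (fun x => Num.min (H x) (H' x)).
Proof.
move=> wL wH wH'; have [HL H0 _] := wH; have [HL' H0' _] := wH'.
have mH := measurable_sup_lfun HL; have mH' := measurable_sup_lfun HL'.
apply: (wug_inf (Hn := fun n => if n is 0 then H else H')) wL _ _ _ _.
- by case.
- apply: lfun2P; first exact: measurable_minr.
  apply: le_lt_trans (lfun2_integral HL); apply: lower_integral_le => x _; rewrite lee_fin ?sqr_ge0//.
  by rewrite ler_sqr ?nnegrE ?H0 ?le_min ?H0 ?H0'// ge_min lexx.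
- by move=> x; rewrite le_min H0 H0'.
- move=> x e e0; rewrite /Num.min; case: ltP => _; [exists 0|exists 1] => //; by rewrite lerDl ltW.
Qed.

(** The minimal gradient minimizes the [L^2] norm; it is below every other upper
    gradient because the minimum of two upper gradients is one. *)
Lemma minimal_gradientP (w : X -> R) L : lipschitz L w -> (exists H, weak_upper_gradient m w H) ->
  weak_upper_gradient m w (minimal_gradient m w) /\
  forall H, weak_upper_gradient m w H -> {ae m, forall x, minimal_gradient m w x <= H x}.
Proof.
move=> wL [H1 wH1].
suff ex : exists G, weak_upper_gradient m w G /\
    forall H, weak_upper_gradient m w H -> {ae m, forall x, G x <= H x}.
  by have := @xgetPex _ (cst 0) _ ex.
pose E H := (\int[m]_x ((H x) ^+ 2)%:E)%E.
pose A := [set E H | H in weak_upper_gradient m w].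
have E0 H : (0 <= E H)%E by apply: integral_ge0 => x _; rewrite lee_fin sqr_ge0.
have A0 : (0 <= ereal_inf A)%E by apply: le_ereal_inf_tmp => _ [H _ <-].
have AE H : weak_upper_gradient m w H -> (ereal_inf A <= E H)%E.
  by move=> wH; apply: ereal_inf_lbound; exists H.
have Afin : ereal_inf A \is a fin_num.
  rewrite ge0_fin_numE// (le_lt_trans (AE _ wH1))//; have [HL _ _] := wH1; exact: lfun2_integral.
have exn (n : nat) : exists H, weak_upper_gradient m w H /\ (E H <= ereal_inf A + (n.+1%:R^-1)%:E)%E.
  have n0 : 0 < n.+1%:R^-1 :> R by rewrite invr_gt0.
  have [_ [H wH <-] /ltW HE] := lb_ereal_inf_adherent n0 Afin.
  by exists H.
have [Hn wHn] := choice exn; have wn n := (wHn n).1; have HnE n := (wHn n).2.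
have H0 n x : 0 <= Hn n x by have [_ h _] := wn n; exact: h.
pose G x := inf (range (fun n => Hn n x)).
have hl x : has_inf (range (fun n => Hn n x)).
  by split; [exists (Hn 0 x), 0%N|exists 0 => _ [n _ <-]].
have GHn n x : G x <= Hn n x by apply: ge_inf; [have [] := hl x|exists n].
have G0 x : 0 <= G x by apply: lb_le_inf; [have [] := hl x|move=> _ [n _ <-]].
have mHn n : measurable_fun setT (Hn n) by have [HL _ _] := wn n; exact: measurable_sup_lfun HL.
have mG : measurable_fun setT G.
  rewrite (_ : G = fun x => infs (fun n => Hn n x) 0%N).
    apply: (@measurable_fun_infs _ _ _ setT (fun n x => Hn n x) 0%N) => [x _|n].
      by have [] := hl x.
    exact: mHn.
  apply/funext => x; rewrite /G /infs/=; congr inf.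
  by apply/seteqP; split=> _ [n _ <-]; exists n.
have EG n : (E G <= E (Hn n))%E.
  apply: lower_integral_le => x _; rewrite lee_fin ?sqr_ge0//.
  by rewrite ler_sqr ?nnegrE.
have GL : G \in Lfun m 2%:E.
  apply: lfun2P => //; apply: le_lt_trans (EG 0%N) _; have [HL _ _] := wn 0%N; exact: lfun2_integral.
have wG : weak_upper_gradient m w G.
  apply: (wug_inf wL wn) => // x e e0.
  by have [_ [n _ <-] /ltW h] := inf_adherent e0 (hl x); exists n.
have EGA : (E G <= ereal_inf A)%E.
  apply/lee_addgt0Pr => e e0; have [n _ /(_ n (leqnn _)) ne] := natSinv_lt e0.
  by apply: (le_trans (EG n)); apply: (le_trans (HnE n)); apply: leeD; rewrite // lee_fin ltW.
exists G; split => // H wH.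
have wM := wug_min wL wG wH; have [ML M0 _] := wM.
have mM := measurable_sup_lfun ML.
have : {ae m, forall x, setT x -> ((G x) ^+ 2)%:E = ((Num.min (G x) (H x)) ^+ 2)%:E}.
  apply: (@ae_eq_of_integral_le _ _ _ m setT (fun x => (Num.min (G x) (H x)) ^+ 2)
    (fun x => ((G x) ^+ 2)%:E)) => //.
  - exact: measurable_funX.
  - by apply/measurable_EFinP; exact: measurable_funX.
  - by move=> x _; rewrite sqr_ge0.
  - move=> x _; rewrite lee_fin ler_sqr ?nnegrE//; by rewrite ge_min lexx.
  - by apply: (le_trans EGA); exact: AE.
  - exact: lfun2_integral.
apply: aeS => x /(_ I) [/eqP]; rewrite eqrXn2//.
by move=> /eqP ->; rewrite ge_min lexx orbT.
Qed.

(** Locality: on [O], where [w1 - w2] has small slope, an upper gradient of [w2]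
    may replace one of [w1]. *)
Lemma wug_splice (w1 w2 : X -> R) L1 L2 H1 H2 (c : borel X -> R) (O : set X) :
  lipschitz L1 w1 -> lipschitz L2 w2 -> weak_upper_gradient m w1 H1 ->
  weak_upper_gradient m w2 H2 -> measurable (O : set (borel X)) -> c \in Lfun m 2%:E ->
  (forall x, 0 <= c x) -> (forall x, O x -> local_slope (w1 \- w2) x (c x)) ->
  weak_upper_gradient m w1 (splice (O : set (borel X)) (H2 \+ c) H1).
Proof.
move=> wL1 wL2 wH1 wH2 mO cL c0 wc.
have [HL1 H10 _] := wH1; have [HL2 H20 _] := wH2.
have mH1 := measurable_sup_lfun HL1; have mH2 := measurable_sup_lfun HL2.
have mc := measurable_sup_lfun cL.
have mH2c : measurable_fun setT (H2 \+ c) by exact: measurable_funD.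
have iH2c : (\int[m]_x (((H2 \+ c) x) ^+ 2)%:E < +oo)%E.
  apply: (@le_lt_trans _ _ (\int[m]_x ((2%:E * ((H2 x) ^+ 2)%:E) + (2%:E * ((c x) ^+ 2)%:E)))%E).
    apply: lower_integral_le => x _; first by rewrite lee_fin sqr_ge0.
    rewrite -!EFinM -EFinD lee_fin /=; have := sqr_ge0 (H2 x - c x); nra.
  have ge x y : (0 <= 2%:E * (((x : R) - y) ^+ 2)%:E)%E by rewrite -EFinM lee_fin mulr_ge0// sqr_ge0.
  have ge' x : (0 <= 2%:E * ((x : R) ^+ 2)%:E)%E by rewrite -(subr0 x).
  have mE (f : borel X -> R) : measurable_fun setT f -> measurable_fun setT (fun x => 2%:E * ((f x) ^+ 2)%:E)%E.
    by move=> mf; under eq_fun do rewrite -EFinM; apply/measurable_EFinP; apply: measurable_funM => //; exact: measurable_funX.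
  rewrite ge0_integralD//; try exact: mE.
  have fin (f : borel X -> R) : f \in Lfun m 2%:E -> (\int[m]_x (2%:E * ((f x) ^+ 2)%:E) < +oo)%E.
    move=> fL; rewrite ge0_integralZl//.
    - by apply: lte_mul_pinfty => //; exact: lfun2_integral.
    - by apply/measurable_EFinP; apply: measurable_funX; exact: measurable_sup_lfun fL.
    - by move=> x _; rewrite lee_fin sqr_ge0.
  by apply: lte_add_pinfty; exact: fin.
have H2c0 x : 0 <= (H2 \+ c) x by rewrite addr_ge0.
apply: (slope_wug wL1).
- apply: lfun2_splice => //; last exact: lfun2_integral.
  exact: lfun2P.
- by move=> x; rewrite /splice; case: (x \in O).
move=> P tpP; apply: aeS3 (wug_slope wL1 tpP wH1) (wug_slope wL2 tpP wH2) (test_plan_ac tpP) => g g1 g2 [ac _].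
have [v [iv v0 gv sv]] := abs_continuousP ac.
apply: aeS3 g1 g2 sv => t t1 t2 svt t01.
have [Ot|nO] := pselect (O (curve_at g t)); last by rewrite splice_out//; exact: t1.
have tI : t \in `[0, 1] by rewrite in_itv/=; move: t01 => /andP[/ltW-> /ltW->].
have sp := svt tI; rewrite splice_in//= mulrDl (mslope_speed sp).
have := slope_leD (t2 t01) (local_slope_curve (c0 _) (v0 t) (wc _ Ot) sp).
rewrite (mslope_speed sp); congr slope_le; apply/funext => r /=.
by rewrite addrC subrK.
Qed.

Lemma wug0 : weak_upper_gradient m (cst 0) (cst 0).
Proof.
apply: (@slope_wug _ _ m (cst 0) 0) => //.
- by move=> x y; rewrite subrr normr0 mul0r.
- apply: lfun2P => //; by rewrite integral0_eq// => x _; rewrite expr0n.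
move=> P tpP; apply: ae_all => g; apply: ae_all => t t01 e e0; exists 1 => // h _.
by rewrite /= subrr normr0 mul0r add0r mulr_ge0// ltW.
Qed.

Lemma wug_local_slope (w : X -> R) L (c : borel X -> R) : lipschitz L w ->
  c \in Lfun m 2%:E -> (forall x, 0 <= c x) -> (forall x, local_slope w x (c x)) ->
  weak_upper_gradient m w c.
Proof.
move=> wL cL c0 wc; apply: (slope_wug wL) => // P tpP.
apply: aeS (test_plan_ac tpP) => g [ac _]; have [v [iv v0 gv sv]] := abs_continuousP ac.
apply: aeS sv => t svt t01.
have tI : t \in `[0, 1] by rewrite in_itv/=; move: t01 => /andP[/ltW-> /ltW->].
have sp := svt tI; rewrite (mslope_speed sp).
exact: local_slope_curve (c0 _) (v0 t) (wc _) sp.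
Qed.

End minimal_gradient.

(** * Lipschitz functions with bounded support *)

Section bounded_support.
Context (R : realType) (X : completeMetricType R) (m : {measure set (borel X) -> \bar R}).
Variables (N : R) (K : nat) (o : X).
Hypothesis radonm : radon m.
Hypothesis cdX : CD0 N m.
Hypothesis K2 : (2 <= K)%N.
Hypothesis NK : N <= K%:R.
Hypothesis So : supp m o.
Implicit Types (w v psi : X -> R) (r L : R).

Definition cball r : set (borel X) := [set x | mdist (x : X) o <= r].

Lemma measurable_cball r : measurable (cball r).
Proof. by apply: closed_borel; exact: closed_mdist_le. Qed.

Lemma cball_fin r : (m (cball r) < +oo)%E.
Proof.
have mS := measurable_supp m; have mB := measurable_sball m o r.
have /le_lt_trans : (m (cball r) <= m (sball m o r) + m (~` supp m))%E.
  rewrite (le_trans _ (measureU2 _ mB (measurableC mS)))//; apply: le_measure.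
  - by apply: mem_set; exact: measurable_cball.
  - by apply: mem_set; apply: measurableU => //; exact: measurableC.
  - by move=> x xr; have [Sx|nSx] := pselect (supp m x); [left|right].
by apply; rewrite (supp_conull radonm) adde0 (sball_finite radonm cdX K2 NK).
Qed.

Definition bounded_support w L r := [/\ 0 <= L, forall x y, `|w x - w y| <= L * mdist x y &
  forall x, r < mdist x o -> w x = 0].

Lemma lfun2_ball (f : borel X -> R) (C r : R) : measurable_fun setT f ->
  (forall x, `|f x| <= C) -> (forall x : X, r < mdist x o -> f x = 0) -> f \in Lfun m 2%:E.
Proof.
move=> mf fC f0; apply: lfun2P => //.
apply: (@le_lt_trans _ _ (\int[m]_(x in cball r) (C ^+ 2)%:E)%E).
  rewrite [leRHS]integral_mkcond; apply: lower_integral_le => x _; first by rewrite lee_fin sqr_ge0.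
  have C0 : 0 <= C by exact: le_trans (normr_ge0 _) (fC x).
  rewrite patchE; case: ifPn => [_|/negP nx].
    by rewrite lee_fin -(ger0_norm (sqr_ge0 (f x))) normrX ler_sqr ?nnegrE.
  rewrite f0 ?expr0n//= ltNge; apply/negP => h; apply: nx; exact: mem_set.
rewrite integral_cst; last exact: measurable_cball.
by apply: lte_mul_pinfty; rewrite ?lee_fin ?sqr_ge0//; exact: cball_fin.
Qed.

Lemma wug_bounded_support w L r : bounded_support w L r ->
  weak_upper_gradient m w (splice (cball r) (cst L) (cst 0)).
Proof.
move=> [L0 wL w0]; apply: (wug_local_slope wL).
- apply: (@lfun2_ball _ L r).
  + by apply: measurable_splice => //; exact: measurable_cball.
  + by move=> x; rewrite /splice; case: (x \in _); rewrite ?normr0// ger0_norm.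
  + move=> x rx; rewrite splice_out// /cball/= => h; by move: rx; rewrite ltNge h.
- by move=> x; rewrite /splice; case: (x \in _).
- move=> x; have [xr|rx] := leP (mdist x o) r.
    by rewrite splice_in//; exact: local_slope_lip.
  rewrite splice_out; last by rewrite /cball/= => h; move: rx; rewrite ltNge h.
  move=> e e0; exists (mdist x o - r) => [|y]; first by rewrite subr_gt0.
  move=> xy; have ro : r < mdist y o.
    by have := metric_triangle x y o; move: xy; slra.
  by rewrite !w0// subrr normr0 mulr_ge0// ?mdist_ge0// add0r ltW.
Qed.

Lemma bounded_support_lfun w L r : bounded_support w L r -> (w : borel X -> R) \in Lfun m 2%:E.
Proof.
move=> [L0 wL w0]; apply: (@lfun2_ball _ (`|w o| + L * `|r|) r).
- exact: lip_measurable wL.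
- move=> x; have [xr|rx] := leP (mdist x o) r; last first.
    by rewrite w0// normr0 addr_ge0// mulr_ge0.
  have := ler_normD (w x - w o) (w o); rewrite subrK => /le_trans; apply.
  rewrite addrC lerD2l (le_trans (wL _ _))// ler_wpM2l// (le_trans xr)// ler_norm//.
- exact: w0.
Qed.

Lemma bounded_support_W12 w L r : bounded_support w L r -> W12 m w.
Proof.
move=> wb; split; first exact: bounded_support_lfun wb.
split; first by have [_ wL _] := wb; exact: lip_measurable wL.
by exists (splice (cball r) (cst L) (cst 0)); exact: wug_bounded_support.
Qed.

Lemma bounded_support_gradient w L r : bounded_support w L r ->
  weak_upper_gradient m w (minimal_gradient m w) /\
  forall H, weak_upper_gradient m w H -> {ae m, forall x, minimal_gradient m w x <= H x}.
Proof.
move=> wb; have [_ wL _] := wb; apply: (minimal_gradientP wL).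
by exists (splice (cball r) (cst L) (cst 0)); exact: wug_bounded_support.
Qed.

Definition grad_energy w : R := fine (\int[m]_x ((minimal_gradient m w x) ^+ 2)%:E)%E.

Lemma grad_energyE w L r : bounded_support w L r ->
  (\int[m]_x ((minimal_gradient m w x) ^+ 2)%:E = (grad_energy w)%:E)%E.
Proof.
move=> wb; have [[GL _ _] _] := bounded_support_gradient wb.
rewrite fineK// ge0_fin_numE; first exact: lfun2_integral.
by apply: integral_ge0 => x _; rewrite lee_fin sqr_ge0.
Qed.

Lemma bounded_supportD v psi L L' r a : bounded_support v L r -> bounded_support psi L' r ->
  bounded_support (fun x => a * psi x + v x) (`|a| * L' + L) r.
Proof.
move=> [L0 vL v0] [L'0 pL p0]; split; first by rewrite addr_ge0// mulr_ge0.
  move=> x y; rewrite opprD addrACA -mulrBr (le_trans (ler_normD _ _))// mulrDl lerD//.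
  by rewrite normrM -mulrA ler_wpM2l.
by move=> x rx; rewrite v0// p0// mulr0 addr0.
Qed.

(** The square of the Sobolev norm is a quadratic form, and so is its [L^2] part;
    hence so is the energy, their difference. *)
Lemma grad_energy_quadratic v psi L L' r : infinitesimally_hilbertian m ->
  bounded_support v L r -> bounded_support psi L' r -> exists e1 : R, forall a : R,
    grad_energy (fun x => a * psi x + v x) = grad_energy v + a * e1 + a ^+ 2 * grad_energy psi.
Proof.
move=> [[B [BC BD BN]] _] vb pb.
have Wv := bounded_support_W12 vb; have Wp := bounded_support_W12 pb.
have vL := bounded_support_lfun vb; have pL := bounded_support_lfun pb.
pose v2 := (\int[m]_x (v x ^+ 2))%R; pose p2 := (\int[m]_x (psi x ^+ 2))%R.
pose vp := (\int[m]_x (v x * psi x))%R.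
have iv : m.-integrable setT (EFin \o (fun x => v x ^+ 2)) by exact: Lfun2_integrable_sqr vL.
have ip : m.-integrable setT (EFin \o (fun x => psi x ^+ 2)) by exact: Lfun2_integrable_sqr pL.
have ivp : m.-integrable setT (EFin \o (fun x => v x * psi x)).
  by apply/Lfun1_integrable; exact: (Lfun2_mul_Lfun1 vL pL).
have Bw w L0 r0 : bounded_support w L0 r0 -> B w w = (\int[m]_x (w x ^+ 2))%R + grad_energy w.
  move=> wb; apply: EFin_inj; have wL := bounded_support_lfun wb.
  rewrite -(BN _ (bounded_support_W12 wb)) /W12norm2 (lfun2_sqr wL).
  have [[GL _ _] _] := bounded_support_gradient wb.
  rewrite (lfun2_sqr GL) (grad_energyE wb) EFinD; congr adde.
  rewrite /Rintegral fineK// ge0_fin_numE; first exact: lfun2_integral.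
  by apply: integral_ge0 => x _; rewrite lee_fin sqr_ge0.
exists (2 * (B psi v - vp)) => a.
have wb := bounded_supportD a vb pb; have Ww := bounded_support_W12 wb.
have E1 := Bw _ _ _ wb.
have BCE f g : W12 m f -> W12 m g -> B f g = B g f by move=> fW gW; apply: BC; exact: mem_set.
have BwE : B (fun x => a * psi x + v x) (fun x => a * psi x + v x) =
    a ^+ 2 * B psi psi + 2 * a * B psi v + B v v.
  rewrite BD// (BCE psi)// (BCE v)// !BD// (BCE v psi)//; ring.
have IE : (\int[m]_x ((a * psi x + v x) ^+ 2))%R = a ^+ 2 * p2 + 2 * a * vp + v2.
  have -> : (\int[m]_x ((a * psi x + v x) ^+ 2))%R =
      (\int[m]_x (a ^+ 2 * psi x ^+ 2 + (2 * a * (v x * psi x) + v x ^+ 2)))%R.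
    by apply: eq_Rintegral => x _; ring.
  have i1 : m.-integrable setT (EFin \o (fun x => a ^+ 2 * psi x ^+ 2)).
    exact: (integrableZl measurableT (a ^+ 2) ip).
  have i2 : m.-integrable setT (EFin \o (fun x => 2 * a * (v x * psi x))).
    exact: (integrableZl measurableT (2 * a) ivp).
  have i3 : m.-integrable setT (EFin \o (fun x => 2 * a * (v x * psi x) + v x ^+ 2)).
    exact: (integrableD measurableT i2 iv).
  rewrite (RintegralD measurableT i1 i3) (RintegralD measurableT i2 iv).
  by rewrite !RintegralZl// addrA.
have E2 := Bw _ _ _ vb; have E3 := Bw _ _ _ pb.
move: E1; rewrite BwE IE E2 E3 -/v2 -/p2 => E1.
move: E1; move: (grad_energy (fun x => a * psi x + v x)) (grad_energy v) (grad_energy psi) (B psi v).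
move: v2 p2 vp {iv ip ivp IE E2 E3 BwE} => q1 q2 q3 g1 g2 g3 g4 E1.
apply: (addrI (a ^+ 2 * q2 + 2 * a * q3 + q1)); rewrite -E1; ring.
Qed.

(** Divide by [a] and let it tend to [0] from both sides. *)
Lemma linear_coefficient (e0 e1 e2 c : R) : 0 <= e2 ->
  (forall a : R, e0 - c * `|a| <= e0 + a * e1 + a ^+ 2 * e2) -> `|e1| <= c.
Proof.
move=> e20 H; apply/ler_addgt0Pr => e e_gt0.
pose t := e / (e2 + 1); have e21 : 0 < e2 + 1 by rewrite ltr_wpDl.
have t0 : 0 < t by rewrite divr_gt0.
have te : t * e2 <= e.
  by rewrite /t -mulrA ler_piMr ?(ltW e_gt0)// mulrC ler_pdivrMr// mul1r lerDl.
have h1 := H t; have h2 := H (- t).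
rewrite normrN !ger0_norm ?(ltW t0)// in h1 h2; rewrite sqrrN in h2.
have k1 : t * (- c) <= t * (e1 + t * e2) by move: h1; rewrite expr2; slra.
have k2 : t * (- c) <= t * (- e1 + t * e2) by move: h2; rewrite expr2; slra.
rewrite !(ler_pM2l t0) in k1 k2.
by rewrite ler_norml; apply/andP; split; slra.
Qed.

End bounded_support.

(** * The Busemann function and its flow *)

Section busemann.
Context (R : realType) (X : completeMetricType R) (m : {measure set (borel X) -> \bar R}).
Variables (N : R) (K : nat) (l : R -> X).
Hypothesis radonm : radon m.
Hypothesis cdX : CD0 N m.
Hypothesis K2 : (2 <= K)%N.
Hypothesis NK : N <= K%:R.
Hypothesis linel : is_line m l.
Local Notation leb := (@lebesgue_measure R).
Local Notation b := (busemann l).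

Let lE t s : mdist (l t) (l s) = `|t - s|.
Proof. by case: linel. Qed.

Lemma busemann_sup x : has_sup (range (fun t => t - mdist x (l t))) /\
  b x = sup (range (fun t => t - mdist x (l t))).
Proof.
have nd : nondecreasing_fun (fun t => t - mdist x (l t)).
  move=> s t st; have := metric_triangle x (l s) (l t); rewrite lE ler0_norm ?subr_le0//; slra.
have ub : ubound (range (fun t => t - mdist x (l t))) (mdist x (l 0)).
  move=> _ [t _ <-]; have := metric_triangle (l 0) x (l t); rewrite lE sub0r normrN metric_sym.
  by have := ler_norm t; slra.
split; first by split; [exists (0 - mdist x (l 0)), 0|exists (mdist x (l 0))].
by apply: cvg_lim => //; apply: nondecreasing_cvgr => //; exists (mdist x (l 0)).
Qed.

Lemma busemann_ge x t : t - mdist x (l t) <= b x.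
Proof. by have [[_ h] ->] := busemann_sup x; apply: ub_le_sup => //; exists t. Qed.

Lemma busemann_approx x (e T : R) : 0 < e -> exists2 t, T <= t & b x - e < t - mdist x (l t).
Proof.
move=> e0; have [hs bE] := busemann_sup x.
have [_ [t _ <-] ht] := sup_adherent e0 hs; exists (Num.max t T); first by rewrite le_max lexx orbT.
rewrite bE (lt_le_trans ht)//; set s := Num.max t T.
have ts : t <= s by rewrite le_max lexx.
by have := metric_triangle x (l t) (l s); rewrite lE ler0_norm ?subr_le0//; slra.
Qed.

Lemma busemann_lip x y : `|b x - b y| <= 1 * mdist x y.
Proof.
have H u v : b u <= b v + mdist u v.
  apply/ler_addgt0Pr => e e0; have [t _ ht] := busemann_approx u 0 e0.
  have := busemann_ge v t; have := metric_triangle v u (l t); rewrite (metric_sym v u); slra.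
rewrite mul1r ler_norml; have := H x y; have := H y x; rewrite (metric_sym y x) => h1 h2.
by apply/andP; split; slra.
Qed.

(** [z] lies between [x] and a far point of the line, so that the supremum that
    defines [b] grows by the distance covered. *)
Lemma busemann_ascent x (r e : R) : supp m x -> 0 < r -> 0 < e ->
  exists2 z, supp m z & mdist x z = r /\ b x + r - e <= b z.
Proof.
move=> Sx r0 e0; have [t Tt ht] := busemann_approx x (r + mdist x (l 0) + 1) e0.
have dl : t <= mdist x (l 0) + mdist x (l t).
  have := metric_triangle (l 0) x (l t); rewrite lE sub0r normrN (metric_sym (l 0)).
  by have := ler_norm t; slra.
have D0 : r < mdist x (l t) by slra.
have Dp : 0 < mdist x (l t) by exact: lt_trans D0.
have th : 0 < r / mdist x (l t) < 1 by rewrite divr_gt0//= ltr_pdivrMr// mul1r.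
have Sl : supp m (l t) by case: linel.
have [z Sz [h1 h2]] := intermediate_point radonm cdX K2 NK Sx Sl th.
have {}h1 : mdist x z = r by rewrite h1 divfK// gt_eqF.
have {}h2 : mdist z (l t) = mdist x (l t) - r by rewrite h2 mulrBl mul1r divfK// gt_eqF.
exists z => //; split => //; have := busemann_ge z t; rewrite h2; slra.
Qed.

Lemma busemann_slope x : supp m x -> (1 <= lip m b x)%E.
Proof.
move=> Sx; rewrite /lip le_max; apply/orP; right.
apply: le_ereal_inf_tmp => _ [V /= FV <-]; apply/lee_addgt0Pr => e e0.
have /nbhs_mdistE[r r0 rV] : nbhs x [set y | y != x -> supp m y -> V y] by exact: FV.
have r2 : 0 < r / 2 by rewrite divr_gt0.
have [z Sz [xz bz]] := busemann_ascent Sx r2 (mulr_gt0 e0 r2).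
have zx : z != x by apply/eqP => zx; move: r2; rewrite -xz zx mdistxx ltxx.
have Vz : V z by apply: rV => //; rewrite xz; slra.
apply: (@le_trans _ _ ((`|b z - b x| / mdist x z)%:E + e%:E)%E).
  rewrite -EFinD lee_fin -lerBlDr ler_pdivlMr ?xz//.
  by have := ler_norm (b z - b x); rewrite mulrBl mul1r; slra.
by rewrite leeD2r//; apply: ereal_sup_ubound; exists z.
Qed.

Variable F : R -> X -> X.
Hypothesis flowF : continuous_gradient_flow m b F.
Hypothesis isoF : isometric_action m F.

Lemma flow_supp t x : supp m x -> supp m (F t x).
Proof. by have [h _ _ _] := flowF; exact: h. Qed.

Lemma flow0 x : supp m x -> F 0 x = x.
Proof. by apply: (isometric_action0 _ isoF) => t y; exact: flow_supp. Qed.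

Lemma flow_iso t x y : supp m x -> supp m y -> mdist (F t x) (F t y) = mdist x y.
Proof. by have [h _] := isoF; exact: h. Qed.

Lemma flowD t s x : supp m x -> F t (F s x) = F (t + s) x.
Proof. by have [_ h] := isoF; exact: h. Qed.

(** On a gradient flow trajectory the energy identity and [lip b >= 1] force the
    equality case of both [|b x - b y| <= d x y] and Cauchy-Schwarz. *)
Lemma trajectory_line g : gradient_flow_trajectory m b setT g -> forall t s : R, t < s ->
  mdist (g t) (g s) = s - t /\ b (g t) - b (g s) = s - t.
Proof.
move=> [Sg gE] t s ts; have H := gE t s I I ts.
have d0 : 0 < s - t by rewrite subr_gt0.
have Lge : ((s - t)%:E <= \int[leb]_(r in `[t, s]) (lip m b (g r)) ^+ 2)%E.
  apply: (@le_trans _ _ (\int[leb]_(r in `[t, s]) (1%R)%:E)%E).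
    by rewrite integral_cst_itv ?mul1r// ltW.
  apply: lower_integral_le => r _; first exact: lee01.
  have h := busemann_slope (Sg r I); rewrite expe2 -[leLHS]mule1.
  by apply: lee_pmul.
have Ege := energy_ge g ts.
set D := mdist (g t) (g s) in Ege *.
have bl : b (g t) - b (g s) <= D.
  by apply: (le_trans (ler_norm _)); rewrite (le_trans (busemann_lip _ _))// mul1r.
have key : D ^+ 2 / (s - t) + (s - t) <= 2 * (b (g t) - b (g s)).
  have two : (0 <= (2^-1)%:E :> \bar R)%E by rewrite lee_fin invr_ge0.
  have : ((b (g s) + 2^-1 * (D ^+ 2 / (s - t)) + 2^-1 * (s - t))%:E <= (b (g t))%:E)%E.
    rewrite H !EFinD !EFinM; apply: leeD; last by apply: lee_wpmul2l.
    by apply: leeD => //; apply: lee_wpmul2l.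
  rewrite lee_fin; set q := D ^+ 2 / (s - t); slra.
have D0 : 0 <= D by exact: mdist_ge0.
have eq : D ^+ 2 / (s - t) * (s - t) = D ^+ 2 by rewrite divfK// gt_eqF.
have k2 : D ^+ 2 + (s - t) ^+ 2 <= 2 * D * (s - t).
  rewrite -eq expr2 -mulrDl; apply: ler_wpM2r; first exact: ltW.
  by apply: (le_trans key); rewrite ler_pM2l.
have DE : D = s - t.
  have : (D - (s - t)) ^+ 2 <= 0 by move: k2; rewrite !expr2; nra.
  by rewrite real_exprn_even_le0 ?num_real//= subr_eq0 => /eqP.
split => //; apply/eqP; rewrite eq_le -{1}DE bl/=.
have q : D ^+ 2 / (s - t) = s - t by rewrite DE expr2 mulfK// gt_eqF.
by move: key; rewrite q; slra.
Qed.

Lemma ae_dense (Q : X -> Prop) x (e : R) : supp m x -> 0 < e -> {ae m, forall y, Q y} ->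
  exists2 y, supp m y & Q y /\ mdist x y < e.
Proof.
move=> Sx e0 /(aeS2 (fun y a c => conj a c) (ae_supp radonm (fun y Sy => Sy))) [Nl [mN N0 QN]].
apply: contrapT => no; have oB := open_mdist_lt x e.
have xB : open_nbhs x [set z | mdist z x < e] by split => //; rewrite /= mdistxx.
have : (0 < m Nl)%E.
  apply: lt_le_trans (Sx _ xB) _; apply: le_measure.
  - by apply: mem_set; exact: open_borel.
  - exact: mem_set.
  - move=> z zx; apply: QN => -[Sz Qz]; apply: no; exists z => //.
    by rewrite metric_sym.
by rewrite N0 ltxx.
Qed.

Lemma flow_line x t s : supp m x -> mdist (F t x) (F s x) = `|t - s| /\ b (F t x) = b x - t.
Proof.
move=> Sx; have [_ _ aeF _] := flowF.
have good y : (supp m y -> gradient_flow_trajectory m b setT (F ^~ y) /\ F 0 y = y) -> supp m y ->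
    (forall u v, mdist (F u y) (F v y) = `|u - v|) /\ forall u, b (F u y) = b y - u.
  move=> h Sy; have [gy y0] := h Sy; have H := trajectory_line gy.
  split=> [u v|u].
    have [uv|uv|->] := ltgtP u v; last by rewrite mdistxx subrr normr0.
      by rewrite (H u v uv).1 ler0_norm ?opprB// subr_le0 ltW.
    by rewrite metric_sym (H v u uv).1 ger0_norm// subr_ge0 ltW.
  have [u0|u0|->] := ltgtP u 0; last by rewrite y0 subr0.
    by have := (H u 0 u0).2; rewrite y0; slra.
  by have := (H 0 u u0).2; rewrite y0; slra.
have near_ (e : R) : 0 < e -> `|mdist (F t x) (F s x) - `|t - s| | <= 2 * e /\ `|b (F t x) - (b x - t)| <= 2 * e.
  move=> e0; have [y Sy [/good/(_ Sy)[Hd Hb] xy]] := ae_dense Sx e0 aeF.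
  have k1 := flow_iso t Sx Sy; have k2 := flow_iso s Sx Sy.
  have k3 := busemann_lip (F t x) (F t y); have k4 := busemann_lip x y.
  rewrite mul1r k1 in k3; rewrite mul1r in k4.
  have t1 := metric_triangle (F t x) (F t y) (F s x); have t2 := metric_triangle (F t y) (F s y) (F s x).
  have t3 := metric_triangle (F t y) (F t x) (F s y); have t4 := metric_triangle (F t x) (F s x) (F s y).
  rewrite (metric_sym (F s y)) in t2; rewrite (metric_sym (F t y) (F t x)) in t3.
  rewrite -Hd; split; rewrite ler_norml; apply/andP; split.
  - slra.
  - slra.
  - move: k3 k4; rewrite !ler_norml Hb => /andP[_ +] /andP[+ +]; move=> ? ? ?.
    move: (busemann_lip (F t x) (F t y)); rewrite mul1r k1 ler_norml Hb => /andP[? ?]; slra.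
  - move: k3 k4; rewrite !ler_norml Hb => /andP[? ?] /andP[? ?]; slra.
have zero (z : R) : (forall e, 0 < e -> `|z| <= 2 * e) -> z = 0.
  move=> h; apply/eqP; rewrite -normr_le0; apply/ler_addgt0Pr => e e0; rewrite add0r.
  by have := h (e / 2) (divr_gt0 e0 (ltr0Sn R 1)); slra.
split; apply/eqP; rewrite -subr_eq0; apply/eqP; apply: zero => e /near_[] //.
Qed.

Lemma orbit_curve : exists c : X -> curves X, measurable_fun setT (c : borel X -> borel (curves X)) /\
  forall x t, supp m x -> 0 <= t <= 1 -> curve_at (c x) t = F t x.
Proof.
have ex (x : X) : exists c : curves X, supp m x -> forall t, 0 <= t <= 1 -> curve_at c t = F t x.
  have [Sx|nSx] := pselect (supp m x); last first.
    by have [c _] := @mk_curve _ X (fun=> x) (fun t _ e e0 => ex_intro2 _ _ 1 ltr01 (fun s _ _ => eq_ind_r (fun v => v <= e) (ltW e0) (mdistxx x))); exists c.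
  have [c Hc] : exists c : curves X, forall t, 0 <= t <= 1 -> curve_at c t = F t x.
    apply: mk_curve => t t01 e e0; exists e => // s s01 st.
    by rewrite (flow_line s t Sx).1 ltW.
  by exists c.
have [c0 Hc0] := choice ex.
pose c x := if `[< supp m x >] then c0 x else point.
exists c; split; last by move=> x t Sx t01; rewrite /c asboolT// Hc0.
apply: measurable_fun_borel => W oW.
pose O' := \bigcup_(xe in [set xe : X * R | [/\ supp m xe.1, 0 < xe.2 &
  forall c', (forall t, 0 <= t <= 1 -> mdist (curve_at (c0 xe.1) t) (curve_at c' t) < xe.2) -> W c']])
  [set y | mdist y xe.1 < xe.2].
have oO : open O' by apply: bigcup_open => xe _; exact: open_mdist_lt.
have mO : measurable (O' : set (borel X)) by exact: open_borel.
have mS := measurable_supp m.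
rewrite (_ : c @^-1` W = (supp m `&` O') `|` (~` supp m `&` (fun=> (point : curves X)) @^-1` W)).
  apply: measurableU; apply: measurableI => //; first exact: measurableC.
  have [Wp|nWp] := pselect (W point).
    by rewrite (_ : _ @^-1` _ = setT)//; apply/seteqP; split.
  by rewrite (_ : _ @^-1` _ = set0)//; apply/seteqP; split.
apply/seteqP; split => y /=.
  rewrite /c; case: asboolP => Sy Wy; last by right.
  left; split => //; have /curves_nbhsP[e e0 eW] : nbhs (c0 y) W by exact: open_nbhs_nbhs.
  by exists (y, e) => //=; rewrite mdistxx.
rewrite /c; case: asboolP => Sy [[_ [[x e] /= [Sx e0 eW] xy]]|[]]//; apply: eW => t t01.
by rewrite !Hc0// flow_iso// metric_sym.
Qed.

Variable o : X.
Hypothesis So : supp m o.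

(** The law of the unit time flow started uniformly in a ball is a test plan:
    its orbits have unit speed and [F t] preserves [m]. *)
Lemma flow_plan (c : X -> curves X) (Om : set (borel X)) (P0 : probability (borel X) R) :
  measurable_fun setT (c : borel X -> borel (curves X)) ->
  (forall x t, supp m x -> 0 <= t <= 1 -> curve_at (c x) t = F t x) ->
  measurable Om -> Om `<=` supp m -> (0 < m Om)%E -> (m Om < +oo)%E ->
  (forall D, measurable D -> P0 D = (m (D `&` Om) * ((fine (m Om))^-1)%:E)%E) ->
  exists2 P : probability (borel (curves X)) R, test_plan m P &
    forall D, P D = P0 (c @^-1` D).
Proof.
move=> mc cF mOm OmS Om0 Omoo P0E; have [P PE] := push_law P0 mc; exists P => //.
have [_ _ _ Fm] := flowF; set k := (fine (m Om))^-1.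
have k0 : 0 < k by rewrite invr_gt0 fine_gt0// Om0.
split.
  exists k => // t A t01 mA.
  have mE := measurable_eval t01 measurableT mA; rewrite setTI in mE.
  have mcE := mc measurableT _ mE; rewrite setTI in mcE.
  rewrite /pushforward PE P0E// muleC; apply: lee_wpmul2l; first by rewrite lee_fin ltW.
  rewrite (_ : (c @^-1` _) `&` Om = (supp m `&` F t @^-1` A) `&` Om); last first.
    apply/seteqP; split => x /= [h Ox].
      by split => //; split; [exact: OmS|move: h; rewrite /eval_at cF//; exact: OmS].
    by split => //; rewrite /eval_at cF//; [case: h|exact: OmS].
  rewrite -(Fm t A mA); apply: le_measure; last by move=> x [].
    rewrite (_ : _ `&` Om = (c @^-1` (eval_at t @^-1` A)) `&` Om).
      by apply: mem_set; exact: measurableI.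
    apply/seteqP; split => x /= [h Ox].
      by split => //; rewrite /eval_at cF//; [case: h|exact: OmS].
    by split => //; split; [exact: OmS|move: h; rewrite /eval_at cF//; exact: OmS].
  apply: mem_set; rewrite (_ : _ `&` _ = supp m `&` (c @^-1` (eval_at t @^-1` A))).
    by apply: measurableI => //; exact: measurable_supp.
  by apply/seteqP; split => x /= [Sx h]; split => //; move: h; rewrite /eval_at cF.
have QE' D : measurable D -> P D = P0 (c @^-1` D) by [].
rewrite (integral_law mc QE' (@measurable_energy R X)); last by move=> g; exact: energy_ge0.
have oneOm : {ae P0, forall x, supp m x}.
  exists (~` supp m); split => //; first by apply: measurableC; exact: measurable_supp.
  rewrite P0E; last by apply: measurableC; exact: measurable_supp.
  by rewrite (_ : _ `&` _ = set0) ?measure0 ?mul0e// -subset0 => x [nS /OmS].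
apply: (@le_lt_trans _ _ (\int[P0]_x ((1 : R) ^+ 2)%:E)%E).
  apply: ae_lower_integral_le_gen => //; first by move=> x _; exact: energy_ge0.
  apply: aeS oneOm => x Sx _; apply: lipschitz_energy => t t' t01 t'01.
  by rewrite !cF// (flow_line _ _ Sx).1 mul1r.
rewrite integral_cst//; apply: (@le_lt_trans _ _ (((1 : R) ^+ 2)%:E * 1)%E); last by rewrite mule1 ltry.
by apply: lee_wpmul2l; [rewrite lee_fin sqr_ge0|exact: probability_le1].
Qed.

Lemma slope_le_eq (u u' : R -> R) t c : 0 < t < 1 -> (forall s, 0 <= s <= 1 -> u s = u' s) ->
  slope_le u t c -> slope_le u' t c.
Proof.
move=> /andP[t0 t1] uu' H e e0; have [d d0 Hd] := H e e0.
exists (Num.min d (Num.min t (1 - t))) => [|h]; first by rewrite !lt_min d0 t0 subr_gt0.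
rewrite !lt_min => /and3P[hd]; rewrite !ltr_norml => /andP[h1 h2] /andP[h3 h4].
rewrite -!uu'; first exact: Hd.
- by rewrite (ltW t0) (ltW t1).
- by apply/andP; split; slra.
Qed.

(** An upper gradient of [w] dominates the rate of change of [w] along the flow.
    That rate is only controlled at almost every time of almost every orbit; the
    invariance of [m] removes the time. *)
Lemma flow_lower_bound (w : X -> R) L (H : borel X -> R) (A : set (borel X)) (c0 : R) :
  (forall x y, `|w x - w y| <= L * mdist x y) -> weak_upper_gradient m w H -> measurable A ->
  (forall (x : X) k, supp m x -> A x -> slope_le (fun s => w (F s x)) 0 k -> c0 <= k) ->
  {ae m, forall x, A x -> c0 <= H x}.
Proof.
move=> wL wH mA Ac; have [HL H0 _] := wH; have mH := measurable_sup_lfun HL.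
have [_ _ _ Fm] := flowF; have [c [mc cF]] := orbit_curve.
have mS := measurable_supp m.
have bad (r : nat) : {ae m, forall x : X, supp m x -> A x -> mdist x o <= r%:R -> c0 <= H x}.
  pose Nr : set (borel X) := [set x | H x < c0] `&` A `&` sball m o r%:R.
  have mN : measurable Nr.
    apply: measurableI; last exact: measurable_sball; apply: measurableI => //.
    by rewrite -[X in measurable X]setTI; exact: measurable_fun_ltr.
  pose Om : set (borel X) := sball m o (r%:R + 1).
  have mOm : measurable Om by exact: measurable_sball.
  have OmS : Om `<=` supp m by move=> x [].
  have Om0 : (0 < m Om)%E by apply: (sball_gt0 radonm So); rewrite ltr_wpDl.
  have Omoo : (m Om < +oo)%E by exact: (sball_finite radonm cdX K2 NK).
  have [P0 P0E] := uniform_probability mOm Om0 Omoo.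
  have [P tpP PE] := flow_plan mc cF mOm OmS Om0 Omoo P0E.
  have Ps := wug_slope wL tpP wH.
  have aeN : {ae P0, forall x, {ae leb, forall t, 0 < t < 1 -> ~ Nr (curve_at (c x) t)}}.
    have : {ae P0, forall x, {ae leb, forall t, 0 < t < 1 ->
        slope_le (w \o curve_at (c x)) t (H (curve_at (c x) t) * speed (curve_at (c x)) t)}}.
      have [Nl [mNl Nl0 NlQ]] := Ps; exists (c @^-1` Nl); split.
      - by have := mc measurableT _ mNl; rewrite setTI.
      - by rewrite -PE.
      - by move=> x /= h; exact: NlQ.
    have oneOm : {ae P0, forall x, supp m x}.
      exists (~` supp m); split => //; first exact: measurableC.
      rewrite P0E; last exact: measurableC.
      by rewrite (_ : _ `&` _ = set0) ?measure0 ?mul0e// -subset0 => x [nS /OmS].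
    apply: aeS2 oneOm => x Sx; apply: aeS => t Ht t01 [[/= Hlt At] [St _]].
    have [t0 t1] := andP t01; have t01' : 0 <= t <= 1 by rewrite !ltW.
    have ms : mslope (curve_at (c x)) t 1.
      apply: (@mslope_eq _ _ (fun s => F s x)) => //; first by move=> u u01; rewrite cF.
      move=> e e0; exists 1 => // u v ut tv _; rewrite (flow_line _ _ Sx).1.
      have -> : `|u - v| = v - u by rewrite distrC ger0_norm// subr_ge0 (le_trans ut).
      rewrite mul1r subrr normr0.
      by rewrite mulr_ge0 ?(ltW e0)// subr_ge0 (le_trans ut).
    have := Ht t01; rewrite (mslope_speed ms) mulr1 => sl.
    move: At Hlt sl; rewrite cF// => At Hlt sl.
    have := slope_le_eq t01 _ sl; move=> /(_ (fun s => w (F s x))) sl'.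
    have {}sl' : slope_le (fun s => w (F s x)) t (H (F t x)).
      by apply: sl' => s s01 /=; rewrite cF.
    have : c0 <= H (F t x).
      apply: (Ac (F t x)) => //; first exact: flow_supp.
      move=> e e0; have [d d0 Hd] := sl' e e0; exists d => // h hd.
      by rewrite add0r !flowD// add0r (addrC h); exact: Hd.
    by rewrite leNgt Hlt.
  pose I01 := `[0, 1]%classic : set R.
  pose h (p : borel X * R) : \bar R := (\1_Nr (eval_at (clamp 0 1 p.2) (c p.1)) * \1_I01 p.2)%:E.
  have mh : measurable_fun setT h.
    have m1 : measurable_fun setT (\1_Nr : borel X -> R) by exact: measurable_indic.
    have m2 : measurable_fun setT (fun p : borel X * R => (c p.1 : borel (curves X), p.2)).
      apply/prod_measurable_funP; split; last exact: measurable_snd.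
      exact: (measurableT_comp mc measurable_fst).
    have m3 : measurable_fun setT (fun p : borel X * R => eval_at (clamp 0 1 p.2) (c p.1)).
      exact: (measurableT_comp (@measurable_eval_joint R X) m2).
    have m4 : measurable_fun setT (fun p : borel X * R => \1_Nr (eval_at (clamp 0 1 p.2) (c p.1)) : R).
      exact: (measurableT_comp m1 m3).
    have m5 : measurable_fun setT (\1_I01 : R -> R) by apply: measurable_indic; exact: measurable_itv.
    have m6 : measurable_fun setT (fun p : borel X * R => \1_I01 p.2 : R).
      exact: (measurableT_comp m5 measurable_snd).
    by apply/measurable_EFinP; exact: (measurable_funM m4 m6).
  have h0 p : (0 <= h p)%E by rewrite lee_fin mulr_ge0.
  have tm (t : R) : 0 <= t <= 1 -> (\int[P0]_x h (x, t) = m Nr * ((fine (m Om))^-1)%:E)%E.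
    move=> t01; have mE := measurable_eval t01 measurableT mN; rewrite setTI in mE.
    have mcE := mc measurableT _ mE; rewrite setTI in mcE.
    have -> : (\int[P0]_x h (x, t) = \int[P0]_x (\1_(c @^-1` (eval_at t @^-1` Nr)) x)%:E)%E.
      apply: eq_integral => x _; rewrite /h /= clamp_id// indicE [in RHS]indicE.
      have -> : \1_I01 t = 1 :> R by rewrite indicE mem_set// /I01/= in_itv.
      rewrite mulr1; have [hx|hx] := pselect (Nr (eval_at t (c x))).
        by rewrite !mem_set.
      by rewrite !memNset.
    rewrite integral_indic// setIT; apply: (etrans (P0E _ mcE)); congr (_ * _)%E; rewrite -(Fm t Nr mN); congr (m _).
    apply/seteqP; split => x /=.
      by move=> [hx [Sx Ox]]; split => //; move: hx; rewrite /eval_at cF.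
    move=> [Sx hx]; split; first by rewrite /eval_at cF.
    split => //; have [_ [_ d1]] := hx; have [d2 _] := flow_line 0 t Sx.
    have := metric_triangle x (F t x) o; rewrite flow0// in d2.
    move: d2 d1; rewrite sub0r normrN (ger0_norm (andP t01).1) => -> d1.
    by have := (andP t01).2; slra.
  have F0 : (\int[P0]_x \int[leb]_t h (x, t) = 0)%E.
    apply/eqP; rewrite eq_le; apply/andP; split; last first.
      by apply: integral_ge0 => x _; apply: integral_ge0.
    apply: (@le_trans _ _ (\int[P0]_x 0)%E); last by rewrite integral0.
    apply: ae_lower_integral_le_gen => //; first by move=> x _; apply: integral_ge0.
    apply: aeS aeN => x Hx _; apply: (@le_trans _ _ (\int[leb]_t 0)%E); last by rewrite integral0.
    apply: ae_lower_integral_le_gen => //; apply: aeS2 Hx (@ae_neq2 R 0 1) => t nN [t0 t1] _.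
    rewrite /h /= lee_fin; have [tI|tI] := boolP (t \in I01); last by rewrite [\1_I01 t]indicE (negbTE tI) mulr0.
    move: tI => /set_mem; rewrite /I01/= in_itv/= => t01; rewrite clamp_id// indicE memNset ?mul0r//.
    by apply: nN; move: t01; rewrite !lt_neqAle (eq_sym 0) t0 t1.
  have mN0 : m Nr = 0%E.
    move: F0; rewrite (@fubini_tonelli _ _ _ _ _ P0 leb h mh h0).
    have -> : (\int[leb]_t \int[P0]_x h (x, t) = \int[leb]_(t in `[0%R, 1%R]) (m Nr * ((fine (m Om))^-1)%:E))%E.
      rewrite [RHS]integral_mkcond; apply: eq_integral => t _; rewrite patchE; case: ifPn => [/set_mem|tI].
        by rewrite /= in_itv/=; exact: tm.
      by rewrite integral0_eq// => x _; rewrite /h /= [\1_I01 t]indicE (negbTE tI) mulr0.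
    rewrite integral_cst//.
    have l1 : leb `[0%R, 1%R] = 1%E by rewrite lebesgue_measure_itv/= lte_fin ltr01 -EFinD subr0.
    move=> /(etrans (congr1 (fun z => (m Nr * ((fine (m Om))^-1)%:E) * z)%E (esym l1))).
    rewrite mule1 => /eqP; rewrite mule_eq0 => /orP[/eqP //|].
    by rewrite eqe invr_eq0 gt_eqF// fine_gt0// Om0.
  exists Nr; split => // x /= nx; apply: contrapT => nN; apply: nx => Sx Ax xr.
  by rewrite leNgt; apply/negP => lt; apply: nN; split; [split|split].
have := ae_foralln bad; apply: aeS2 (ae_supp radonm (fun x Sx => Sx)) => x Sx Hx Ax.
exact: (Hx (Num.truncn (mdist x o)).+1 Sx Ax (ltW (truncnS_gt _))).
Qed.

End busemann.

(** * Energy of perturbations of the Busemann function *)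

Lemma fine_le3 (R : realType) (x y z t : \bar R) (p q : R) : (0 <= x)%E -> (0 <= y)%E ->
  (0 <= z)%E -> t \is a fin_num -> (x + y + z <= p%:E + q%:E * t)%E ->
  fine x + fine y + fine z <= p + q * fine t.
Proof. by case: x y z t => [x| |] [y| |] [z| |] [t| |]. Qed.

Lemma lee_fine (R : realType) (x : \bar R) (p : R) : x \is a fin_num -> fine x <= p -> (x <= p%:E)%E.
Proof. by case: x => [x| |]. Qed.

Lemma energy_balance (R : realType) (IZ mV mZ Ic gw gv gp ge c q : R) :
  IZ + (mV - mZ) + Ic <= gw + 2 * c * mV -> gw = gv + ge + gp -> ge <= 2 * c * mV ->
  gp <= q -> gv <= mV + Ic -> IZ <= mZ + 4 * c * mV + q.
Proof.
move=> h gwE; have -> : 4 * c * mV = 4 * (c * mV) by ring.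
move: h; rewrite gwE -!mulrA; move: (c * mV) => cm; slra.
Qed.

Section energy_step.
Context (R : realType) (X : completeMetricType R) (m : {measure set (borel X) -> \bar R}).
Variables (N : R) (K : nat) (l : R -> X) (F : R -> X -> X) (o : X).
Hypothesis radonm : radon m.
Hypothesis cdX : CD0 N m.
Hypothesis K2 : (2 <= K)%N.
Hypothesis NK : N <= K%:R.
Hypothesis hilbX : infinitesimally_hilbertian m.
Hypothesis linel : is_line m l.
Local Notation b := (busemann l).
Hypothesis flowF : continuous_gradient_flow m b F.
Hypothesis isoF : isometric_action m F.
Hypothesis So : supp m o.
Local Notation bounded_support := (bounded_support o).
Local Notation G w := (minimal_gradient m w).

Variables (R0 r : R) (v : X -> R) (Lv : R).
Hypothesis R0r : R0 <= r.
Hypothesis vb : bounded_support v Lv r.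
Hypothesis vE : forall x, mdist x o < R0 -> v x = b x.

Let U : set (borel X) := [set x | mdist (x : X) o < R0].
Let mU : measurable U. Proof. by apply: open_borel; exact: open_mdist_lt. Qed.
Let nU x : U x -> nbhs (x : X) U.
Proof. by move=> Ux; apply: open_nbhs_nbhs; split => //; exact: open_mdist_lt. Qed.

Let mG w L s : bounded_support w L s -> measurable_fun setT (G w) /\ forall x, 0 <= G w x.
Proof.
move=> /(bounded_support_gradient radonm cdX K2 NK So)[[GL G0 _] _].
by split => //; exact: measurable_sup_lfun GL.
Qed.

Lemma gradient_local w w' L L' s (c : R) (O : set (borel X)) : bounded_support w L s ->
  bounded_support w' L' s -> measurable O -> 0 <= c -> O `<=` cball o s ->
  (forall x, O x -> local_slope (w \- w') x c) -> {ae m, forall x, O x -> G w x <= G w' x + c}.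
Proof.
move=> wb w'b mO c0 Os H; have [_ wL _] := wb; have [_ w'L _] := w'b.
have [wG minG] := bounded_support_gradient radonm cdX K2 NK So wb.
have [wG' _] := bounded_support_gradient radonm cdX K2 NK So w'b.
pose c' : borel X -> R := splice O (cst c) (cst 0).
have c'0 x : 0 <= c' x by rewrite /c' /splice; case: (x \in O).
have c'L : c' \in Lfun m 2%:E.
  apply: (@lfun2_ball _ _ m N K o radonm cdX K2 NK So _ c s).
  - exact: measurable_splice.
  - by move=> x; rewrite ger0_norm//; rewrite /c' /splice; case: (x \in O).
  - by move=> x sx; rewrite /c' splice_out// => /Os; rewrite /cball/= leNgt sx.
have := minG _ (wug_splice wL w'L wG wG' mO c'L c'0 _).
have Hc x : O x -> local_slope (w \- w') x (c' x) by move=> Ox; rewrite /c' splice_in//; exact: H.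
by move=> /(_ Hc); apply: aeS => x + Ox; rewrite splice_in//= /c' splice_in.
Qed.

Let zero_b : bounded_support (cst 0) 0 r.
Proof. by split => // x y; rewrite subrr normr0 mul0r. Qed.

Let G0 : {ae m, forall x, G (cst 0) x <= 0}.
Proof.
have [_ h] := bounded_support_gradient radonm cdX K2 NK So zero_b.
exact: h (wug0 m).
Qed.

Let Ur : U `<=` cball o r.
Proof. by move=> x; rewrite /U /cball/= => /ltW/le_trans; apply. Qed.

Lemma gradient_le w L (c : R) (O : set (borel X)) : bounded_support w L r -> measurable O -> 0 <= c ->
  O `<=` U -> (forall x, O x -> local_slope w x c) -> {ae m, forall x, O x -> G w x <= c}.
Proof.
move=> wb mO c0 OU H; apply: aeS2 G0 (gradient_local wb zero_b mO c0 (subset_trans OU Ur) _) => [x h + Ox|x Ox].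
  by move=> /(_ Ox) h'; slra.
by have := H x Ox; congr local_slope; apply/funext => y; rewrite /= subr0.
Qed.

Variables (h phi : X -> R) (e Lphi mu : R) (V Z : set (borel X)) (sg : borel X -> R) (s : R).
Hypothesis e0 : 0 <= e.
Hypothesis hL : forall x y, `|h x - h y| <= mdist x y.
Hypothesis he : forall x, 0 <= h x <= e.
Hypothesis hF : forall t x, supp m x -> h (F t x) = h x.
Hypothesis Lphi0 : 0 <= Lphi.
Hypothesis phiL : forall x y, `|phi x - phi y| <= Lphi * mdist x y.
Hypothesis phi01 : forall x, 0 <= phi x <= 1.
Hypothesis closedV : closed (V : set X).
Hypothesis VU : V `<=` U.
Hypothesis hV : forall x, ~ V x -> phi x * h x = 0.
Hypothesis msg : measurable_fun setT sg.
Hypothesis sg01 : forall x, 0 <= sg x <= 1.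
Hypothesis hsg : forall x, V x -> local_slope h x (sg x).
Hypothesis sgs : (\int[m]_(x in V) ((sg x) ^+ 2)%:E <= s%:E)%E.
Hypothesis mZ : measurable Z.
Hypothesis ZV : Z `<=` V.

Let psi x := phi x * h x.
Let w (a : R) : X -> R := fun x => a * psi x + v x.
Let eL := e * Lphi.
Let eL0 : 0 <= eL. Proof. exact: mulr_ge0. Qed.
Let mV : measurable V. Proof. exact: closed_borel. Qed.
Let Voo : (m V < +oo)%E.
Proof.
apply: le_lt_trans (cball_fin radonm cdX K2 NK So r); apply: le_measure.
- exact: mem_set.
- by apply: mem_set; exact: measurable_cball.
- exact: subset_trans VU Ur.
Qed.
Let Vfin : m V = (fine (m V))%:E. Proof. by rewrite fineK// ge0_fin_numE. Qed.
Let mV0 : 0 <= fine (m V). Proof. exact: fine_ge0. Qed.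
Let Zoo : (m Z < +oo)%E.
Proof. by apply: le_lt_trans Voo; apply: le_measure => //; exact: mem_set. Qed.

Lemma psi_increment x y : `|psi x - psi y| <= phi x * `|h x - h y| + e * `|phi x - phi y|.
Proof.
have -> : psi x - psi y = phi x * (h x - h y) + (phi x - phi y) * h y by rewrite /psi; ring.
have [p0 _] := andP (phi01 x); have [hy0 hye] := andP (he y).
by rewrite (le_trans (ler_normD _ _))// !normrM (ger0_norm p0) (ger0_norm hy0) lerD2l mulrC ler_wpM2r.
Qed.

Lemma psi_support : bounded_support psi (1 + eL) r.
Proof.
split; first by rewrite addr_ge0.
  move=> x y; apply: (le_trans (psi_increment x y)); rewrite mulrDl mul1r /eL -mulrA lerD//.
    by have [p0 p1] := andP (phi01 x); apply: le_trans (hL x y); rewrite ler_piMl.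
  by apply: ler_wpM2l.
move=> x rx; apply: hV => /VU; rewrite /U/= => xR; move: rx; rewrite ltNge => /negP; apply.
by rewrite (le_trans (ltW xR)).
Qed.

Let wb a := bounded_supportD a vb psi_support.

Let nV x : ~ V x -> nbhs (x : X) (~` V).
Proof. by move=> nVx; apply: open_nbhs_nbhs; split => //; exact: closed_openC. Qed.

(** Along the flow [h] is constant and [b] decreases at unit rate, so [w a] changes
    at least at rate [1 - |a| * eL]. *)
Lemma gradient_ge a : {ae m, forall x, U x -> 1 - `|a| * eL <= G (w a) x}.
Proof.
have [_ wL _] := wb a; have [wG _] := bounded_support_gradient radonm cdX K2 NK So (wb a).
have key := @flow_lower_bound _ _ m N K l radonm cdX K2 NK linel F flowF isoF o So (w a) _ (G (w a)) U
  (1 - `|a| * eL) wL wG mU.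
apply: key => x k Sx Ux sl.
apply/ler_addgt0Pr => t t0; have [d d0 Hd] := sl t t0.
have dU : 0 < R0 - mdist x o by rewrite subr_gt0.
pose z := Num.min d (R0 - mdist x o) / 2.
have z0 : 0 < z by rewrite divr_gt0// lt_min d0.
have zd : z < d by rewrite /z ltr_pdivrMr// (le_lt_trans (_ : _ <= d))// ?ge_min ?lexx//; slra.
have zU : z < R0 - mdist x o.
  by rewrite /z ltr_pdivrMr// (le_lt_trans (_ : _ <= R0 - mdist x o))// ?ge_min ?lexx ?orbT//; slra.
have := Hd z; rewrite ger0_norm ?(ltW z0)// add0r (flow0 flowF isoF)// => /(_ zd) H.
rewrite -(ler_pM2r z0); apply: le_trans H.
have [dF bF] := flow_line radonm cdX K2 NK linel flowF isoF z 0 Sx.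
rewrite (flow0 flowF isoF)// subr0 (ger0_norm (ltW z0)) in dF.
have UF : mdist (F z x) o < R0 by have := metric_triangle (F z x) x o; rewrite dF; slra.
rewrite /w !vE// bF /psi hF//.
have -> : a * (phi (F z x) * h x) + (b x - z) - (a * (phi x * h x) + b x) =
  - (z - a * h x * (phi (F z x) - phi x)) by ring.
rewrite normrN; apply: le_trans (lerB_dist _ _); rewrite (ger0_norm (ltW z0)) mulrBl mul1r lerD2l lerN2.
rewrite normrM normrM -!mulrA ler_wpM2l//; have [h0 h1] := andP (he x).
rewrite (ger0_norm h0) ?/eL -?mulrA; apply: ler_pM => //.
by have := phiL (F z x) x; rewrite dF.
Qed.

Let sqr_G a x : (0 <= ((G (w a) x) ^+ 2)%:E)%E. Proof. by rewrite lee_fin sqr_ge0. Qed.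

Let mG2 u L q : bounded_support u L q -> measurable_fun setT (fun x => ((G u x) ^+ 2)%:E).
Proof. by move=> ub; apply/measurable_EFinP; apply: measurable_funX; have [] := mG ub. Qed.

Let vG1 : {ae m, forall x, V x -> G v x <= 1}.
Proof.
apply: (gradient_le vb mV ler01 VU) => x Vx.
apply: (local_slope_near (nU (VU Vx))) (local_slope_lip x (busemann_lip linel)) => y Uy.
by rewrite !vE//; exact: VU.
Qed.

Let off_V a : {ae m, forall x, ~ V x -> mdist (x : X) o <= r -> G v x <= G (w a) x}.
Proof.
pose O : set (borel X) := (~` V) `&` cball o r.
have mO : measurable O by apply: measurableI; [exact: measurableC|exact: measurable_cball].
have := gradient_local vb (wb a) mO (lexx 0) (@subIsetr _ _ _).
move=> h1; apply: aeS (h1 _) => [x + nVx xr|x [nVx _]].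
  by rewrite addr0; apply; split.
have : local_slope (cst (0 : R)) x (0 : R).
  by apply: local_slope_lip => y z; rewrite subrr normr0 mul0r.
apply: (local_slope_near (nV nVx)) => y nVy.
by rewrite /= subrr /w /psi !hV// mulr0 !add0r !subrr.
Qed.

Let far : {ae m, forall x, r < mdist (x : X) o -> G v x <= 0}.
Proof.
have [_ minG] := bounded_support_gradient radonm cdX K2 NK So vb.
have := minG _ (wug_bounded_support radonm cdX K2 NK So vb).
apply: aeS => x + rx; rewrite splice_out// /cball/= leNgt rx//.
Qed.

Let le_energy a (Y : set (borel X)) : measurable Y -> Y `<=` V ->
  (\int[m]_(x in Y) ((G (w a) x) ^+ 2)%:E + m (V `\` Y) + \int[m]_(x in ~` V) ((G v x) ^+ 2)%:E <=
   \int[m]_x ((G (w a) x) ^+ 2)%:E + (2 * (`|a| * eL))%:E * m V)%E.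
Proof.
move=> mY YV; set c := `|a| * eL; have c0 : 0 <= c by rewrite mulr_ge0.
have mD : measurable (V `\` Y) by exact: measurableD.
have mC : measurable (~` V) by exact: measurableC.
have Ga0 x : 0 <= G (w a) x by have [_] := mG (wb a); exact.
have Gv0 x : 0 <= G v x by have [_] := mG vb; exact.
have mi (A : set (borel X)) : measurable A -> measurable_fun setT (fun x : borel X => (\1_A x : R)%:E).
  by move=> mA; apply/measurable_EFinP; exact: measurable_indic.
have mres (A : set (borel X)) (f : borel X -> \bar R) : measurable A -> measurable_fun setT f -> measurable_fun setT (f \_ A).
  by move=> mA mf; apply/(measurable_restrictT _ mA); exact: measurable_funTS.
have res0 (A : set (borel X)) (f : borel X -> \bar R) x : (forall y, 0 <= f y)%E -> (0 <= (f \_ A) x)%E.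
  by move=> f0; rewrite patchE; case: ifP.
have ind0 (A : set (borel X)) (x : borel X) : (0 <= (\1_A x : R)%:E)%E by rewrite lee_fin.
have mGa := mG2 (wb a); have mGv := mG2 vb.
have Ga2 x : (0 <= ((G (w a) x) ^+ 2)%:E)%E by rewrite lee_fin sqr_ge0.
have Gv2 x : (0 <= ((G v x) ^+ 2)%:E)%E by rewrite lee_fin sqr_ge0.
pose f1 := (fun x => ((G (w a) x) ^+ 2)%:E) \_ Y.
pose f2 (x : borel X) : \bar R := (\1_(V `\` Y) x)%:E.
pose f3 := (fun x => ((G v x) ^+ 2)%:E) \_ (~` V).
have mf1 : measurable_fun setT f1 by exact: mres.
have mf2 : measurable_fun setT f2 by exact: mi.
have mf3 : measurable_fun setT f3 by exact: mres.
have f10 x : (0 <= f1 x)%E by exact: res0.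
have f20 x : (0 <= f2 x)%E by exact: ind0.
have f30 x : (0 <= f3 x)%E by exact: res0.
have f120 x : (0 <= f1 x + f2 x)%E by exact: adde_ge0.
have mf12 : measurable_fun setT (fun x => f1 x + f2 x)%E by exact: emeasurable_funD.
have I2 : (\int[m]_x f2 x = m (V `\` Y))%E by rewrite /f2 integral_indic// setIT.
have I1 : (\int[m]_x f1 x = \int[m]_(x in Y) ((G (w a) x) ^+ 2)%:E)%E by rewrite [RHS]integral_mkcond.
have I3 : (\int[m]_x f3 x = \int[m]_(x in ~` V) ((G v x) ^+ 2)%:E)%E by rewrite [RHS]integral_mkcond.
have I123 : (\int[m]_x (f1 x + f2 x + f3 x) = \int[m]_x f1 x + \int[m]_x f2 x + \int[m]_x f3 x)%E.
  rewrite (ge0_integralD m measurableT (fun x _ => f120 x) mf12 (fun x _ => f30 x) mf3).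
  by rewrite (ge0_integralD m measurableT (fun x _ => f10 x) mf1 (fun x _ => f20 x) mf2).
pose g2 (x : borel X) : \bar R := ((2 * c) * \1_V x)%:E.
have g20 x : (0 <= g2 x)%E by rewrite lee_fin !mulr_ge0.
have mg2 : measurable_fun setT g2.
  have mV1 : measurable_fun setT (\1_V : borel X -> R) by exact: measurable_indic.
  by apply/measurable_EFinP; exact: (measurable_funM (measurable_cst (2 * c)) mV1).
have J2 : (\int[m]_x g2 x = (2 * c)%:E * m V)%E.
  have -> : m V = (\int[m]_x (\1_V x)%:E)%E by rewrite integral_indic// setIT.
  rewrite -ge0_integralZl//; first exact: mi.
  by rewrite lee_fin mulr_ge0.
rewrite -I1 -I2 -I3 -I123 -J2.
rewrite -(ge0_integralD m measurableT (fun x _ => Ga2 x) mGa (fun x _ => g20 x) mg2).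
apply: ae_lower_integral_le_gen => //.
- by move=> x _; apply: adde_ge0.
- by move=> x _; apply: adde_ge0.
apply: aeS3 (gradient_ge a) (off_V a) far => x ge off fx _; rewrite /f1 /f2 /f3 /g2 !patchE.
have [Vx|nVx] := pselect (V x); last first.
  have nYx : ~ Y x by move=> /YV.
  rewrite (memNset nYx) mem_set// !indicE memNset; last by case.
  rewrite (memNset nVx) mulr0 !adde0 !add0e lee_fin.
  have [xr|rx] := leP (mdist (x : X) o) r; first by rewrite ler_sqr ?nnegrE// off.
  have -> : G v x = 0 by apply/eqP; rewrite eq_le fx//= Gv0.
  by rewrite expr0n sqr_ge0.
rewrite [x \in ~` V]memNset; last by move=> /(_ Vx).
rewrite !indicE (mem_set Vx) mulr1 adde0.
have [Yx|nYx] := pselect (Y x).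
  rewrite mem_set// memNset; last by case=> _ /(_ Yx).
  by rewrite adde0 leeDl// lee_fin mulr_ge0.
rewrite memNset// mem_set// add0e -EFinD lee_fin.
have := ge (VU Vx); rewrite -/c => gx; have := Ga0 x; set g := G (w a) x in gx *.
move=> g0; have : 0 <= g ^+ 2 - 2 * g + 1.
  by have := sqr_ge0 (g - 1); rewrite !expr2 (_ : (g - 1) * (g - 1) = g * g - 2 * g + 1)//; ring.
rewrite -[true%:R]/(1 : R); move: (g ^+ 2) gx => g2'; slra.
Qed.

Let fin_energy u L : bounded_support u L r -> (\int[m]_x ((G u x) ^+ 2)%:E = (grad_energy m u)%:E)%E.
Proof. by move=> ub; apply: (grad_energyE radonm cdX K2 NK So ub). Qed.

Let psi_energy : grad_energy m psi <= s + (2 * eL + eL ^+ 2) * fine (m V).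
Proof.
have [_ minG] := bounded_support_gradient radonm cdX K2 NK So psi_support.
have [mGp Gp0] := mG psi_support.
pose q : borel X -> R := splice V (fun x => sg x + eL) (cst 0).
have q0 x : 0 <= q x by rewrite /q /splice; case: (x \in V) => //; rewrite addr_ge0//; have /andP[] := sg01 x.
have mq : measurable_fun setT q by apply: measurable_splice => //; exact: measurable_funD.
have Gq : {ae m, forall x, G psi x <= q x}.
  have [_ pL _] := psi_support; apply: minG; apply: (wug_local_slope pL) => //.
    apply: (@lfun2_ball _ _ m N K o radonm cdX K2 NK So _ (1 + eL) r) => //.
      move=> x; rewrite ger0_norm// /q /splice; case: (x \in V); last by rewrite addr_ge0.
      by rewrite lerD2r; have /andP[] := sg01 x.
    move=> x rx; rewrite /q splice_out// => /VU/Ur; rewrite /cball/= leNgt rx//.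
  move=> x; have [Vx|nVx] := pselect (V x); last first.
    rewrite /q splice_out//; have : local_slope (cst (0 : R)) x (0 : R).
      by apply: local_slope_lip => y z; rewrite subrr normr0 mul0r.
    apply: (local_slope_near (nV nVx)) => y nVy.
    by rewrite /= /psi !hV// subrr.
  rewrite /q splice_in// => t t0; have [d d0 Hd] := hsg Vx t0; exists d => // y xy.
  rewrite distrC (le_trans (psi_increment x y))// addrAC mulrDl lerD//.
    rewrite distrC; apply: le_trans (Hd y xy); have /andP[_ p1] := phi01 x.
    by rewrite ler_piMl.
  by rewrite /eL -mulrA; apply: ler_wpM2l => //; exact: phiL.
rewrite -lee_fin -(fin_energy psi_support).
apply: (@le_trans _ _ (\int[m]_(x in V) (((sg x) ^+ 2)%:E + (2 * eL + eL ^+ 2)%:E))%E).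
  rewrite [leRHS]integral_mkcond; apply: ae_lower_integral_le_gen => //.
  - by move=> x _; rewrite lee_fin sqr_ge0.
  - by move=> x _; rewrite patchE; case: ifP => // _; rewrite -EFinD lee_fin addr_ge0 ?sqr_ge0// addr_ge0 ?sqr_ge0 ?mulr_ge0.
  apply: aeS Gq => x gx _; rewrite patchE.
  have : (G psi x) ^+ 2 <= (q x) ^+ 2 by rewrite ler_sqr ?nnegrE.
  rewrite /q /splice; case: ifPn => _ H; last by rewrite expr0n/= in H; rewrite lee_fin.
  rewrite -EFinD lee_fin (le_trans H)//; have /andP[s0 s1] := sg01 x; rewrite !expr2.
  by have := mulr_ge0 eL0 (_ : 0 <= 1 - sg x); rewrite subr_ge0 => /(_ s1); nra.
rewrite ge0_integralD//; last 3 first.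
- by move=> x _; rewrite lee_fin sqr_ge0.
- by apply: measurable_funTS; apply/measurable_EFinP; exact: measurable_funX.
- by move=> x _; rewrite lee_fin addr_ge0 ?sqr_ge0 ?mulr_ge0.
have VE : (m V <= (fine (m V))%:E)%E by rewrite -Vfin.
rewrite integral_cst// [leRHS]EFinD [X in (_ <= _ + X)%E]EFinM; apply: leeD => //; apply: lee_wpmul2l; last exact: VE.
by rewrite lee_fin addr_ge0 ?sqr_ge0 ?mulr_ge0.
Qed.

(** The energy of [v + a * psi] is at least that of [v] up to an error linear in
    [a]; being quadratic in [a], it has a small linear coefficient. *)
Theorem energy_step wT LT : bounded_support wT LT r ->
  (forall x, Z x -> local_slope (wT \- w mu) x 0) ->
  (\int[m]_(x in Z) ((G wT x) ^+ 2)%:E <=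
    (fine (m Z) + 4 * (`|mu| * eL) * fine (m V) +
     mu ^+ 2 * (s + (2 * eL + eL ^+ 2) * fine (m V)))%:E)%E.
Proof.
move=> wTb HZ.
have ZU : Z `<=` cball o r by move=> x /ZV/VU/Ur.
apply: (@le_trans _ _ (\int[m]_(x in Z) ((G (w mu) x) ^+ 2)%:E)%E).
  rewrite integral_mkcond [leRHS]integral_mkcond; apply: ae_lower_integral_le_gen => //.
  - by move=> x _; rewrite patchE; case: ifP => // _; rewrite lee_fin sqr_ge0.
  - by move=> x _; rewrite patchE; case: ifP.
  apply: aeS (gradient_local wTb (wb mu) mZ (lexx 0) ZU HZ) => x + _; rewrite addr0 !patchE.
  case: ifPn => // /set_mem Zx /(_ Zx) gx; rewrite lee_fin ler_sqr ?nnegrE//.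
    by have [_] := mG wTb; exact.
  by have [_] := mG (wb mu); exact.
have Vfn : m V \is a fin_num by rewrite ge0_fin_numE.
have [e1 Hq] := grad_energy_quadratic radonm cdX K2 NK So hilbX vb psi_support.
pose Ic := (\int[m]_(x in ~` V) ((G v x) ^+ 2)%:E)%E.
have [mGv Gv0] := mG vb.
have Ic0 : (0 <= Ic)%E by apply: integral_ge0 => x _; rewrite lee_fin sqr_ge0.
have Icf : (Ic = (fine Ic)%:E)%E.
  rewrite fineK// ge0_fin_numE//; apply: (@le_lt_trans _ _ (\int[m]_x ((G v x) ^+ 2)%:E)%E).
    apply: ge0_subset_integral => //; first exact: measurableC.
    - exact: mG2 vb.
    - by move=> x _; rewrite lee_fin sqr_ge0.
  by rewrite (fin_energy vb) ltry.
have E0 : grad_energy m v <= fine (m V) + fine Ic.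
  rewrite -lee_fin -(fin_energy vb) EFinD -Vfin -Icf.
  have -> : m V = (\int[m]_(x in V) (1%R)%:E)%E by rewrite integral_cst// mul1e.
  have -> : (\int[m]_x ((G v x) ^+ 2)%:E = \int[m]_(x in V `|` ~` V) ((G v x) ^+ 2)%:E)%E by rewrite setUv.
  rewrite ge0_integral_setU//; last 4 first.
  - exact: measurableC.
  - by rewrite setUv; exact: mG2 vb.
  - by move=> x _; rewrite lee_fin sqr_ge0.
  - by apply/disj_setPCl.
  apply: leeD => //; apply: ae_lower_integral_le_gen => //.
    by move=> x _; rewrite lee_fin sqr_ge0.
  apply: aeS vG1 => x gx Vx; rewrite lee_fin -(expr1n _ 2) ler_sqr ?nnegrE//; exact: gx.
have e1b : `|e1| <= 2 * eL * fine (m V).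
  apply: (@linear_coefficient _ (grad_energy m v) e1 (grad_energy m psi)).
    by apply: fine_ge0; apply: integral_ge0 => x _; rewrite lee_fin; exact: sqr_ge0.
  move=> a; rewrite -Hq.
  have := le_energy a (Y := set0) measurable0 (@sub0set _ _).
  rewrite integral_set0 setD0 (fin_energy (wb a)).
  move=> /(fine_le3 (lexx _) (measure_ge0 _ _) Ic0 Vfn); rewrite -/(fine Ic) add0r.
  move: E0; rewrite -/(w a); move: (grad_energy m v) (grad_energy m (w a)) (fine Ic) => g1 g2 g3.
  move: (fine (m V)) => mV' /=; slra.
have IZ0 : (0 <= \int[m]_(x in Z) ((G (w mu) x) ^+ 2)%:E)%E by apply: integral_ge0.
have IZfn : (\int[m]_(x in Z) ((G (w mu) x) ^+ 2)%:E)%E \is a fin_num.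
  rewrite ge0_fin_numE//; apply: (@le_lt_trans _ _ (\int[m]_x ((G (w mu) x) ^+ 2)%:E)%E).
    by apply: ge0_subset_integral => //; exact: mG2 (wb mu).
  by rewrite (fin_energy (wb mu)) ltry.
have VZ : fine (m (V `\` Z)) = fine (m V) - fine (m Z).
  have -> : m (V `\` Z) = (m V - m Z)%E.
    by rewrite measureD// [V `&` Z]setIC (_ : Z `&` V = Z)//; exact/setIidPl.
  by rewrite fineB// ge0_fin_numE.
have := le_energy mu mZ ZV; rewrite (fin_energy (wb mu)).
move=> /(fine_le3 IZ0 (measure_ge0 _ _) Ic0 Vfn); rewrite VZ => LE.
have h1 : mu * e1 <= 2 * (`|mu| * eL) * fine (m V).
  have -> : 2 * (`|mu| * eL) * fine (m V) = `|mu| * (2 * eL * fine (m V)) by ring.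
  by rewrite (le_trans (ler_norm _))// normrM ler_wpM2l.
have h2 : mu ^+ 2 * grad_energy m psi <= mu ^+ 2 * (s + (2 * eL + eL ^+ 2) * fine (m V)).
  by rewrite ler_wpM2l ?sqr_ge0.
apply: (lee_fine IZfn); exact: (energy_balance LE (Hq mu) h1 h2 E0).
Qed.

End energy_step.

(** * Summation over level sets *)

Section bumps.
Context (R : realType).
Implicit Types (y z e q : R).

(** Slope [1] on [[0, e]], slope [- q] afterwards until it vanishes. *)
Definition bump e q z : R := Num.max 0 (Num.min z (e - (z - e) * q)).

Lemma bump_bounds e q z : 0 <= e -> 0 <= q -> 0 <= bump e q z <= e.
Proof.
move=> e0 q0; rewrite /bump le_max lexx/= ge_max e0/= ge_min.
have [ze|ez] := leP z e => //=.
by rewrite gerBl mulr_ge0// subr_ge0 ltW.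
Qed.

Lemma bump_lip e q z z' : 0 <= q <= 1 -> `|bump e q z - bump e q z'| <= `|z - z'|.
Proof.
move=> /andP[q0 q1]; rewrite /bump.
have : `|(z - e) * q - (z' - e) * q| <= `|z - z'|.
  rewrite -mulrBl opprB addrA subrK normrM (ger0_norm q0).
  by rewrite (le_trans (ler_wpM2l _ q1))// mulr1.
move: ((z - e) * q) ((z' - e) * q) => s s'.
have H1 := ler_norm (z - z'); have H2 := ler_norm (z' - z); rewrite distrC in H2.
rewrite !ler_norml => /andP[h1 h2]; rewrite /Num.max /Num.min; move: `|z - z'| H1 H2 h1 h2 => D H1 H2 h1 h2.
by do !case: ifPn; rewrite -?leNgt => *; apply/andP; split; slra.
Qed.

Lemma bump_slow e q z z' : 0 <= q -> e <= z -> e <= z' -> `|bump e q z - bump e q z'| <= q * `|z - z'|.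
Proof.
move=> q0 ez ez'; rewrite /bump.
have : `|(z - e) * q - (z' - e) * q| = q * `|z - z'|.
  by rewrite -mulrBl opprB addrA subrK normrM (ger0_norm q0) mulrC.
have : 0 <= (z - e) * q by rewrite mulr_ge0// subr_ge0.
have : 0 <= (z' - e) * q by rewrite mulr_ge0// subr_ge0.
have : 0 <= q * `|z - z'| by rewrite mulr_ge0.
move: (q * `|z - z'|) ((z - e) * q) ((z' - e) * q) => D s s' D0 s'0 s0 sD.
have := ler_norm (s - s'); have := ler_norm (s' - s); rewrite distrC sD => h1 h2.
by rewrite ler_norml /Num.max /Num.min; do !case: ifPn; rewrite -?leNgt => *; apply/andP; split; slra.
Qed.

Lemma bump_id e q z : 0 <= q -> 0 <= z <= e -> bump e q z = z.
Proof.
move=> q0 /andP[z0 ze]; rewrite /bump min_l ?max_r//.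
by have : (z - e) * q <= 0; [rewrite mulr_le0_ge0// subr_le0|slra].
Qed.

Lemma bump_neg e q z : z <= 0 -> bump e q z = 0.
Proof. by move=> z0; rewrite /bump max_l// ge_min z0. Qed.

Lemma bump_far e q z : e <= (z - e) * q -> bump e q z = 0.
Proof. by move=> h; rewrite /bump max_l// ge_min subr_le0 h orbT. Qed.

End bumps.

Lemma small_multiple (R : realType) (C ep : R) : 0 < ep -> exists n : nat, C * n.+1%:R^-1 <= ep.
Proof.
move=> ep0; exists (Num.truncn (C / ep)); rewrite ler_pdivrMr// mulrC -ler_pdivrMr//.
exact/ltW/truncnS_gt.
Qed.

Lemma layer_error (R : realType) (a mu e L q p V ep : R) : 0 <= a -> 0 <= e -> e <= 1 -> 0 <= L ->
  0 <= V -> 0 <= p -> q ^+ 2 * p <= 3 * q -> 3 * mu ^+ 2 * V * q <= ep ->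
  (4 * (a * L) + mu ^+ 2 * (2 * L + L ^+ 2)) * p * V * e <= ep ->
  (4 * (a * (e * L)) + mu ^+ 2 * (q ^+ 2 + (2 * (e * L) + (e * L) ^+ 2))) * (p * V) <= 2 * ep.
Proof.
move=> a0 e0 e1 L0 V0 p0 q3 h1 h2.
have -> : (4 * (a * (e * L)) + mu ^+ 2 * (q ^+ 2 + (2 * (e * L) + (e * L) ^+ 2))) * (p * V) =
  mu ^+ 2 * V * (q ^+ 2 * p) +
  (4 * (a * (e * L)) + mu ^+ 2 * (2 * (e * L) + (e * L) ^+ 2)) * (p * V) by ring.
have k1 : mu ^+ 2 * V * (q ^+ 2 * p) <= ep.
  apply: le_trans h1; rewrite (_ : 3 * mu ^+ 2 * V * q = mu ^+ 2 * V * (3 * q)); last by ring.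
  by rewrite ler_wpM2l// mulr_ge0// sqr_ge0.
have k2 : (4 * (a * (e * L)) + mu ^+ 2 * (2 * (e * L) + (e * L) ^+ 2)) * (p * V) <= ep.
  apply: le_trans h2.
  have -> : (4 * (a * L) + mu ^+ 2 * (2 * L + L ^+ 2)) * p * V * e =
    (4 * (a * (e * L)) + mu ^+ 2 * (2 * (e * L) + e * L ^+ 2)) * (p * V) by ring.
  apply: ler_wpM2r; first exact: mulr_ge0.
  rewrite lerD2l; apply: ler_wpM2l; first exact: sqr_ge0.
  rewrite lerD2l exprMn; apply: ler_wpM2r; first exact: sqr_ge0.
  by rewrite expr2; apply: ler_piMr.
slra.
Qed.

Lemma error_budget (R : realType) (mu2 a2 A V D sZ sW sL Q p ep : R) : 0 <= mu2 -> 0 <= A ->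
  sZ <= 1 * Q -> sW <= V + 2 * D -> sL <= p * V -> A * (p * V) <= 2 * (ep / 3) ->
  (2 * mu2 + a2) * D <= ep / 3 -> sZ + mu2 * sW + A * sL + a2 * D <= Q + mu2 * V + ep.
Proof.
move=> m0 A0 hZ hW hL h1 h2; have hW' := ler_wpM2l m0 hW; have hL' := ler_wpM2l A0 hL.
have hD : mu2 * (V + 2 * D) + a2 * D = mu2 * V + (2 * mu2 + a2) * D by ring.
have ep3 : ep = 3 * (ep / 3) by rewrite mulrCA divff ?mulr1.
move: (ep / 3) h1 h2 ep3 => ep' h1 h2 ->; rewrite mul1r in hZ.
move: ((2 * mu2 + a2) * D) h2 hD => x2 h2 hD; move: (mu2 * V) hD => x4 hD.
move: (mu2 * sW) (A * sL) (A * (p * V)) (mu2 * (V + 2 * D)) (a2 * D) hW' hL' h1 hD => x1 x3 x5 x6 x7; slra.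
Qed.

Section counting.
Context d (T : measurableType d) (R : realType) (m : {measure set T -> \bar R}).

Lemma sum_indic_le1 (J : nat) (P : nat -> Prop) : (forall k k', P k -> P k' -> k = k') ->
  \sum_(k < J) (`[< P k >] : nat)%:R <= (1 : R).
Proof.
move=> uP; have [[k Pk]|nP] := pselect (exists k : 'I_J, P k).
  rewrite (bigD1 k)//= asboolT// big1 ?addr0// => i ik; rewrite asboolF// => Pi.
  by move: ik; rewrite -val_eqE/= (uP _ _ Pi Pk) eqxx.
by rewrite big1 ?ler01// => k _; rewrite asboolF// => Pk; apply: nP; exists k.
Qed.

Lemma count_near (J M : nat) (t : R) : 0 <= t ->
  \sum_(k < J) (`[< k%:R <= t <= k%:R + M%:R >] : nat)%:R <= (M.+1%:R : R).
Proof.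
move=> t0; apply: (@le_trans _ _ (\sum_(k < J) \sum_(i < M.+1) (`[< (k + i)%N = Num.truncn t >] : nat)%:R)).
  apply: ler_sum => k _; case: asboolP => [/andP[kt tk]|_]; last by apply: sumr_ge0.
  have /andP[n1 n2] := truncn_itv t0.
  have kn : (k <= Num.truncn t)%N by rewrite -ltnS -(ltr_nat R) (le_lt_trans kt).
  have nM : (Num.truncn t - k < M.+1)%N.
    by rewrite ltnS leq_subLR -(ler_nat R) natrD (le_trans n1).
  rewrite (bigD1 (Ordinal nM))//= asboolT ?subnKC// lerDl; exact: sumr_ge0.
rewrite exchange_big/=; apply: (@le_trans _ _ (\sum_(i < M.+1) 1)).
  by apply: ler_sum => i _; apply: (@sum_indic_le1 J (fun k => (k + i)%N = Num.truncn t)) => k k' <- /addIn.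
by rewrite sumr_const card_ord.
Qed.

Lemma sum_measure_le (J : nat) (A : nat -> set T) (V : set T) (C : R) : 0 <= C ->
  (forall k, measurable (A k)) -> measurable V -> (m V < +oo)%E -> (forall k, A k `<=` V) ->
  (forall x, V x -> \sum_(k < J) (`[< A k x >] : nat)%:R <= C) ->
  \sum_(k < J) fine (m (A k)) <= C * fine (m V).
Proof.
move=> C0 mA mV Voo AV H.
have Afin k : m (A k) \is a fin_num.
  rewrite ge0_fin_numE//; apply: le_lt_trans Voo; apply: le_measure => //; exact: mem_set.
have Vfin : m V \is a fin_num by rewrite ge0_fin_numE.
rewrite -lee_fin EFinM fineK// -sumEFin.
have -> : (\sum_(k < J) (fine (m (A k)))%:E = \int[m]_x \sum_(k < J) (\1_(A k) x)%:E)%E.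
  rewrite ge0_integral_sum//; last first.
    by move=> k; apply/measurable_EFinP; exact: measurable_indic.
  by apply: eq_bigr => k _; rewrite fineK// integral_indic// setIT.
have -> : (C%:E * m V = \int[m]_(x in V) C%:E)%E by rewrite integral_cst.
rewrite [leRHS]integral_mkcond; apply: lower_integral_le => x _.
  by apply: sume_ge0 => k _; rewrite lee_fin.
rewrite sumEFin patchE; case: ifPn => [/set_mem Vx|/negP nV].
  rewrite lee_fin; apply: le_trans (H x Vx); apply: ler_sum => k _.
  by rewrite indicE; case: asboolP => Ak; [rewrite mem_set|rewrite memNset].
rewrite big1 => [//|k _]; rewrite indicE memNset// => /AV Vx.
by apply: nV; exact: mem_set.
Qed.

End counting.

Section energy_bound.
Context (R : realType) (X : completeMetricType R) (m : {measure set (borel X) -> \bar R}).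
Variables (N : R) (K : nat) (l : R -> X) (F : R -> X -> X) (o : X).
Hypothesis radonm : radon m.
Hypothesis cdX : CD0 N m.
Hypothesis K2 : (2 <= K)%N.
Hypothesis NK : N <= K%:R.
Hypothesis hilbX : infinitesimally_hilbertian m.
Hypothesis linel : is_line m l.
Local Notation b := (busemann l).
Hypothesis flowF : continuous_gradient_flow m b F.
Hypothesis isoF : isometric_action m F.
Hypothesis So : supp m o.
Local Notation bounded_support := (bounded_support o).
Local Notation G w := (minimal_gradient m w).

Variables (R0 r mu : R) (v wT f : X -> R) (Lv LT : R).
Hypothesis R0r : R0 <= r.
Hypothesis vb : bounded_support v Lv r.
Hypothesis vE : forall x, mdist x o < R0 -> v x = b x.
Hypothesis wTb : bounded_support wT LT r.
Hypothesis wTE : forall x, mdist x o < R0 -> wT x = b x + mu * f x.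
Hypothesis f0 : forall x, 0 <= f x.
Hypothesis fL : forall x y, `|f x - f y| <= mdist x y.
Hypothesis fF : forall t x, supp m x -> f (F t x) = f x.

Let U : set (borel X) := [set x | mdist (x : X) o < R0].

Variables (Q V : set (borel X)) (phi : X -> R) (Lphi : R).
Hypothesis mQ : measurable Q.
Hypothesis QV : Q `<=` V.
Hypothesis closedV : closed (V : set X).
Hypothesis VU : V `<=` U.
Hypothesis Lphi0 : 0 <= Lphi.
Hypothesis phiL : forall x y, `|phi x - phi y| <= Lphi * mdist x y.
Hypothesis phi01 : forall x, 0 <= phi x <= 1.
Hypothesis phiV : forall x, ~ V x -> phi x = 0.
Hypothesis phiQ : forall x, Q x -> nbhs (x : X) [set y | phi y = 1].

Let mV : measurable V. Proof. exact: closed_borel. Qed.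
Let Voo : (m V < +oo)%E.
Proof.
apply: le_lt_trans (cball_fin radonm cdX K2 NK So r); apply: le_measure.
- exact: mem_set.
- by apply: mem_set; exact: measurable_cball.
- by move=> x /VU; rewrite /U /cball/= => /ltW/le_trans; apply.
Qed.
Let mr (A : set (borel X)) : R := fine (m A).
Let subV (A : set (borel X)) : measurable A -> A `<=` V -> (m A = (mr A)%:E)%E /\ mr A <= mr V.
Proof.
move=> mA AV; have Aoo : (m A <= m V)%E by apply: le_measure => //; exact: mem_set.
have Af : m A \is a fin_num by rewrite ge0_fin_numE// (le_lt_trans Aoo).
have Vf : m V \is a fin_num by rewrite ge0_fin_numE.
by rewrite /mr fineK//; split => //; rewrite fine_le.
Qed.
Let mf : measurable_fun setT (f : borel X -> R).
Proof. by apply: (@lip_measurable _ _ f 1) => x y; rewrite mul1r. Qed.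

Section one_bump.
Variables (e th : R) (P k : nat).
Hypothesis e0 : 0 < e.
Let q : R := P.+1%:R^-1.
Let q0 : 0 < q. Proof. by rewrite invr_gt0. Qed.
Let q1 : q <= 1. Proof. by rewrite invf_le1// ler1n. Qed.
Let y x : R := f x + th.
Let c : R := k%:R * e.
Definition layer : set (borel X) := V `&` [set x | c <= y x <= c + e * (1 + P.+1%:R)].
Definition window : set (borel X) := V `&` [set x | c <= y x <= c + e].
Definition window_in : set (borel X) := Q `&` [set x | c < y x < c + e].

Let yL x x' : `|y x - y x'| <= mdist x x'.
Proof.
have -> : y x - y x' = f x - f x' by rewrite /y; ring.
exact: fL.
Qed.

Let my : measurable_fun setT (y : borel X -> R).
Proof. by apply: measurable_funD. Qed.

Lemma measurable_window_in : measurable window_in.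
Proof.
apply: measurableI => //; rewrite (_ : [set x | _] = [set x | c < y x] `&` [set x | y x < c + e]).
  by apply: measurableI; rewrite -[X in measurable X]setTI; exact: measurable_fun_ltr.
by apply/seteqP; split => x /=; [move=> /andP[]|move=> [-> ->]].
Qed.

Lemma closed_strip (a a' : R) : closed [set x : X | a <= y x <= a'].
Proof.
have cy : continuous y by apply: (@lip_continuous _ _ y 1) => x x'; rewrite mul1r; exact: yL.
rewrite (_ : [set x | _] = y @^-1` [set z | a <= z] `&` y @^-1` [set z | z <= a']).
  by apply: closedI; apply: (continuous_closedP _).1.
by apply/seteqP; split => x /=; [move=> /andP[]|move=> [-> ->]].
Qed.

Lemma closed_layer : closed (layer : set X).
Proof. by apply: closedI => //; exact: closed_strip. Qed.

Lemma measurable_window : measurable window.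
Proof. by apply: closed_borel; apply: closedI => //; exact: closed_strip. Qed.

(** On [window_in] the bump has slope exactly [1], so that [wT] and [v + mu * psi]
    differ there by a constant; elsewhere its slope is at most [q]. *)
Lemma bump_step : (\int[m]_(x in window_in) ((G wT x) ^+ 2)%:E <=
  (mr window_in + mu ^+ 2 * mr window + (4 * (`|mu| * (e * Lphi)) +
     mu ^+ 2 * (q ^+ 2 + (2 * (e * Lphi) + (e * Lphi) ^+ 2))) * mr layer)%:E)%E.
Proof.
have e0' := ltW e0; have q0' := ltW q0.
pose h x := bump e q (y x - c).
have q01 : 0 <= q <= 1 by rewrite q0' q1.
have hL x x' : `|h x - h x'| <= mdist x x'.
  apply: (le_trans (bump_lip _ _ _ q01)).
  have -> : y x - c - (y x' - c) = y x - y x' by ring.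
  exact: yL.
have he x : 0 <= h x <= e by exact: bump_bounds.
have hF t x : supp m x -> h (F t x) = h x by move=> Sx; rewrite /h /y fF.
have layerV : layer `<=` V by move=> x [].
have qP : e * (1 + P.+1%:R) * q - e * q = e.
  by rewrite mulrDr mulr1 mulrDl addrAC subrr add0r -mulrA /q divff ?mulr1// pnatr_eq0.
have hV x : ~ layer x -> phi x * h x = 0.
  move=> nl; have [Vx|nVx] := pselect (V x); last by rewrite phiV// mul0r.
  have [yc|cy] := leP (y x) c; first by rewrite /h bump_neg ?mulr0// subr_le0.
  rewrite /h bump_far ?mulr0//; rewrite mulrBl -{1}qP lerD2r ler_wpM2r//.
  rewrite leNgt; apply/negP => lt; apply: nl; split => //=; rewrite (ltW cy)/=.
  by rewrite -lerBlDl ltW.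
have mW := measurable_window.
pose sg : borel X -> R := splice window (cst 1) (cst q).
have msg : measurable_fun setT sg by exact: measurable_splice.
have sg01 x : 0 <= sg x <= 1 by rewrite /sg /splice; case: (x \in _); rewrite /cst ?ler01 ?lexx ?q0'.
have hsg x : layer x -> local_slope h x (sg x).
  move=> [Vx /= /andP[cy ye]].
  have [yce|cey] := leP (y x) (c + e).
    rewrite /sg splice_in; last by split => //=; rewrite cy.
    by apply: local_slope_lip => x1 x2; rewrite mul1r.
  rewrite /sg splice_out; last by move=> [_ /= /andP[_]]; rewrite leNgt cey.
  move=> t t0; exists (y x - (c + e)) => [|z xz]; first by rewrite subr_gt0.
  have := yL x z; rewrite ler_norml => /andP[_ xyz].
  have h1 : e <= y x - c by rewrite lerBrDl ltW.
  have h2 : e <= y z - c by slra.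
  have := bump_slow q0' h2 h1; rewrite -/(h z) -/(h x) => /le_trans; apply.
  have -> : y z - c - (y x - c) = y z - y x by ring.
  apply: (@le_trans _ _ (q * mdist x z)); first by rewrite ler_wpM2l// metric_sym.
  by rewrite ler_wpM2r ?mdist_ge0// /cst lerDl ltW.
have mL : measurable layer by apply: closed_borel; exact: closed_layer.
have [Lf LV] := subV mL layerV.
have [Wf WV] := subV mW (fun x (Wx : window x) => Wx.1).
have sgs : (\int[m]_(x in layer) ((sg x) ^+ 2)%:E <= (mr window + q ^+ 2 * mr layer)%:E)%E.
  have cW0 x : (0 <= (\1_window x : R)%:E)%E by rewrite lee_fin.
  have miW : measurable_fun layer (fun x : borel X => (\1_window x : R)%:E).
    by apply/measurable_EFinP; apply: measurable_funTS; exact: measurable_indic.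
  apply: (@le_trans _ _ (\int[m]_(x in layer) ((\1_window x)%:E + (q ^+ 2)%:E))%E).
    apply: lower_integral_le => x _; first by rewrite lee_fin sqr_ge0.
    rewrite -EFinD lee_fin /sg /splice indicE; case: (x \in window); rewrite /cst ?expr1n ?lerDl ?sqr_ge0// add0r//.
  rewrite ge0_integralD//; last by move=> x _; rewrite lee_fin sqr_ge0.
  have Lle : (m layer <= (mr layer)%:E)%E by rewrite {1}Lf.
  have Wle : (m window <= (mr window)%:E)%E by rewrite {1}Wf.
  rewrite integral_indic// integral_cst// [leRHS]EFinD; apply: leeD.
    apply: le_trans Wle; apply: le_measure; [apply: mem_set; exact: measurableI|exact: mem_set|by move=> x []].
  by rewrite [leRHS]EFinM; apply: lee_wpmul2l; rewrite ?lee_fin ?sqr_ge0.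
have mZ := measurable_window_in.
have ZL : window_in `<=` layer.
  move=> x [Qx /= /andP[h1 h2]]; split; first exact: QV.
  rewrite /= (ltW h1)/= (le_trans (ltW h2))// lerD2l ler_peMr// lerDl//.
have HZ x : window_in x -> local_slope (wT \- (fun z => mu * (phi z * h z) + v z)) x 0.
  move=> [Qx /= /andP[h1 h2]].
  have nU : nbhs (x : X) U by apply: open_nbhs_nbhs; split; [exact: open_mdist_lt|exact: VU (QV Qx)].
  pose dd := Num.min (y x - c) (c + e - y x).
  have d0 : 0 < dd by rewrite lt_min !subr_gt0 h1 h2.
  have nB : nbhs x [set z | mdist x z < dd] by apply/nbhs_mdistE; exists dd.
  have : local_slope (cst (0 : R)) x (0 : R).
    by apply: local_slope_lip => z z'; rewrite subrr normr0 mul0r.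
  apply: (local_slope_near (filterI (filterI nU (phiQ Qx)) nB)) => z [[Uz pz] /= dz].
  have px : phi x = 1 by have /nbhs_mdistE[t t0 Ht] := phiQ Qx; apply: Ht; rewrite mdistxx.
  have hE z' : mdist x z' < dd -> h z' = y z' - c.
    move=> xz'; apply: bump_id => //; move: xz'; rewrite lt_min => /andP[k1 k2].
    have := yL x z'; rewrite ler_norml => /andP[k3 k4]; apply/andP; split; slra.
  have Ux : U x by exact: VU (QV Qx).
  rewrite /= !wTE// !vE// px pz !hE ?mdistxx// /y; ring.
have VLU : layer `<=` [set x : borel X | mdist (x : X) o < R0] by move=> x [/VU].
have := energy_step radonm cdX K2 NK hilbX linel flowF isoF So R0r vb vE e0' hL he hF Lphi0 phiL phi01
  closed_layer VLU hV msg sg01 hsg sgs mZ ZL wTb HZ.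
move=> /le_trans; apply; rewrite lee_fin -/(mr layer) -/(mr window_in).
have -> : mr window_in + 4 * (`|mu| * (e * Lphi)) * mr layer +
   mu ^+ 2 * (mr window + q ^+ 2 * mr layer + (2 * (e * Lphi) + (e * Lphi) ^+ 2) * mr layer) =
  mr window_in + mu ^+ 2 * mr window +
   (4 * (`|mu| * (e * Lphi)) + mu ^+ 2 * (q ^+ 2 + (2 * (e * Lphi) + (e * Lphi) ^+ 2))) * mr layer by ring.
by [].
Qed.

End one_bump.

(** Summing over the bumps starting at the multiples of [e] recovers the full
    slope of [f]; a generic shift of the levels makes their boundary negligible. *)
Theorem energy_bound : (\int[m]_(x in Q) ((G wT x) ^+ 2)%:E <= (mr Q + mu ^+ 2 * mr V)%:E)%E.
Proof.
apply/lee_addgt0Pr => ep ep0; have mV0 : 0 <= mr V by exact: fine_ge0.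
have ep3 : 0 < ep / 3 by rewrite divr_gt0.
have [P HP] := small_multiple (3 * mu ^+ 2 * mr V) ep3.
pose B1 := (4 * (`|mu| * Lphi) + mu ^+ 2 * (2 * Lphi + Lphi ^+ 2)) * P.+3%:R * mr V.
have [n Hn] := small_multiple B1 ep3.
pose B2 := (2 * mu ^+ 2 + (1 + `|mu|) ^+ 2) * mr V.
have [n2 Hn2] := small_multiple B2 ep3.
pose q : R := P.+1%:R^-1; pose e : R := n.+1%:R^-1; pose L := n2.+1.
have e0 : 0 < e by rewrite invr_gt0.
have e1 : e <= 1 by rewrite invf_le1// ler1n.
have Lr0 : 0 < L%:R :> R by rewrite ltr0n.
pose th (i : nat) := i%:R * e / L%:R.
pose D (i : nat) : set (borel X) := V `&` [set x | exists j : nat, f x + th i = j%:R * e].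
have mD i : measurable (D i).
  apply: measurableI => //; rewrite (_ : [set x | _] = \bigcup_j [set x | j%:R * e <= f x + th i <= j%:R * e]).
    by apply: bigcupT_measurable => j; apply: closed_borel; exact: closed_strip.
  apply/seteqP; split => x /=; first by move=> [j xj]; exists j => //=; rewrite xj lexx.
  by move=> [j _ /= xj]; exists j; apply/eqP; rewrite eq_le andbC.
have DV i : D i `<=` V by move=> x [].
have [i [iL Di]] : exists i : nat, (i < L)%N /\ mr (D i) <= mr V * L%:R^-1.
  apply: contrapT => nex.
  have big i : (i < L)%N -> mr V * L%:R^-1 < mr (D i).
    by move=> iL; rewrite ltNge; apply/negP => h; apply: nex; exists i.
  have := @sum_measure_le _ _ R m L (fun i => D i `&` [set x | (i < L)%N]) V 1 ler01.
  have mDi k : measurable (D k `&` [set x : borel X | (k < L)%N]).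
    case: (k < L)%N; first by rewrite (_ : [set x | _] = setT) ?setIT//; apply/seteqP; split.
    by rewrite (_ : [set x | _] = set0) ?setI0//; apply/seteqP; split.
  move=> /(_ mDi mV Voo (fun k x h => h.1.1)) H.
  have {}H : \sum_(k < L) mr (D k) <= 1 * mr V.
    apply: le_trans (H _); last first.
      move=> x Vx; apply: (@sum_indic_le1 R L (fun k => (D k `&` [set _ | (k < L)%N]) x)) => k k' [[_ /= [j kj]] /= kL] [[_ /= [j' kj']] /= k'L].
      have E : (k + j' * L)%N = (k' + j * L)%N.
        apply/eqP; rewrite -(eqr_nat R) !natrD !natrM; apply/eqP.
        have E2 : (th k - th k') = (j%:R - j'%:R) * e by rewrite mulrBl -kj -kj'; ring.
        have E3 : k%:R - k'%:R = (j%:R - j'%:R) * L%:R :> R.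
          have ne : e / L%:R != 0 by rewrite mulf_neq0 ?invr_eq0 ?gt_eqF.
          apply: (mulIf ne); rewrite mulrBl !mulrA -/(th k) -/(th k') E2 mulrAC -mulrA.
          by rewrite [RHS]mulrA mulfK ?gt_eqF.
        by move: E3; rewrite mulrBl; slra.
      by have := congr1 (modn^~ L) E; rewrite (addnC k) (addnC k') !modnMDl !modn_small.
    apply: ler_sum => k _; rewrite /mr (_ : _ `&` _ = D k)// setIidl// => x _; exact: ltn_ord.
  have : \sum_(k < L) mr V * L%:R^-1 < \sum_(k < L) mr (D k).
    by apply: ltr_sum => [|k _]; [apply/hasP; exists ord0; rewrite ?mem_index_enum|exact: big].
  have -> : \sum_(k < L) mr V * L%:R^-1 = mr V.
    by rewrite sumr_const card_ord -[LHS]mulr_natr divfK// gt_eqF.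
  move=> /lt_le_trans/(_ H).
  by rewrite mul1r ltxx.
set t := th i; pose y x := f x + t; pose Di' := D i; have mDi := mD i.
have t0 : 0 <= t by rewrite !mulr_ge0// ?invr_ge0 ltW.
have y0 x : 0 <= y x by rewrite addr_ge0.
have ye0 x : 0 <= y x / e by rewrite divr_ge0// ltW.
pose J := (Num.truncn ((f o + R0 + t) / e)).+1.
have yJ x : V x -> (Num.truncn (y x / e) < J)%N.
  move=> /VU; rewrite /U/= => xR; rewrite ltnS; apply: le_truncn.
  rewrite ler_pM2r ?invr_gt0// /y lerD2r.
  by have := fL x o; rewrite ler_norml => /andP[_]; slra.
pose Z k := window_in e t k; pose W k := window e t k; pose Ly k := layer e t P k.
have mZ k : measurable (Z k) by exact: measurable_window_in.
have mW k : measurable (W k) by exact: measurable_window.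
have mLy k : measurable (Ly k) by apply: closed_borel; exact: closed_layer.
have mc (A : set (borel X)) : measurable A -> measurable_fun setT (fun x : borel X => (\1_A x : R)%:E).
  by move=> mA; apply/measurable_EFinP; exact: measurable_indic.
have [GLf G0 _] : weak_upper_gradient m wT (G wT).
  by have [] := bounded_support_gradient radonm cdX K2 NK So wTb.
have mG2 : measurable_fun setT (fun x => ((G wT x) ^+ 2)%:E).
  by apply/measurable_EFinP; apply: measurable_funX; exact: measurable_sup_lfun GLf.
have G20 x : (0 <= ((G wT x) ^+ 2)%:E)%E by rewrite lee_fin sqr_ge0.
have mU : measurable U by apply: open_borel; exact: open_mdist_lt.
have GU : {ae m, forall x, U x -> G wT x <= 1 + `|mu|}.
  apply: (gradient_le radonm cdX K2 NK So R0r wTb mU (addr_ge0 ler01 (normr_ge0 _)) (@subset_refl _ _)) => x Ux.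
  have nU : nbhs (x : X) U by apply: open_nbhs_nbhs; split; [exact: open_mdist_lt|].
  have : local_slope (fun z => b z + mu * f z) x (1 + `|mu|).
    apply: local_slope_lip => z z'; have -> : b z + mu * f z - (b z' + mu * f z') = (b z - b z') + mu * (f z - f z') by ring.
    rewrite (le_trans (ler_normD _ _))// mulrDl lerD ?(busemann_lip linel)// normrM ler_wpM2l//.
  by apply: (local_slope_near nU) => z Uz; rewrite !wTE.
have cover : (\int[m]_(x in Q) ((G wT x) ^+ 2)%:E <=
    \sum_(k < J) \int[m]_(x in Z k) ((G wT x) ^+ 2)%:E + ((1 + `|mu|) ^+ 2)%:E * m (D i))%E.
  have r0 k x : (0 <= ((fun z => ((G wT z) ^+ 2)%:E) \_ (Z k)) x)%E by rewrite patchE; case: ifP.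
  have mr' k : measurable_fun setT ((fun z => ((G wT z) ^+ 2)%:E) \_ (Z k)).
    by apply/(measurable_restrictT _ (mZ k)); exact: measurable_funTS.
  have -> : (((1 + `|mu|) ^+ 2)%:E * m (D i) = \int[m]_x (((1 + `|mu|) ^+ 2)%:E * (\1_(D i) x)%:E))%E.
    by rewrite ge0_integralZl//; first [exact: mc|rewrite lee_fin; exact: sqr_ge0|rewrite integral_indic// setIT].
  have -> : (\sum_(k < J) \int[m]_(x in Z k) ((G wT x) ^+ 2)%:E =
      \int[m]_x \sum_(k < J) ((fun z => ((G wT z) ^+ 2)%:E) \_ (Z k)) x)%E.
    by rewrite ge0_integral_sum//; apply: eq_bigr => k _; rewrite [LHS]integral_mkcond.
  have s0 x : (0 <= \sum_(k < J) ((fun z => ((G wT z) ^+ 2)%:E) \_ (Z k)) x)%E by apply: sume_ge0.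
  have d0 x : (0 <= ((1 + `|mu|) ^+ 2)%:E * (\1_(D i) x : R)%:E)%E by rewrite -EFinM lee_fin mulr_ge0// sqr_ge0.
  have ms : measurable_fun setT (fun x => \sum_(k < J) ((fun z => ((G wT z) ^+ 2)%:E) \_ (Z k)) x)%E.
    exact: emeasurable_sum.
  have md : measurable_fun setT (fun x : borel X => ((1 + `|mu|) ^+ 2)%:E * (\1_(D i) x : R)%:E)%E.
    by apply: measurable_funeM; exact: mc.
  rewrite -(ge0_integralD m measurableT (fun x _ => s0 x) ms (fun x _ => d0 x) md).
  rewrite [leLHS]integral_mkcond; apply: ae_lower_integral_le_gen => //.
  - by move=> x _; rewrite patchE; case: ifP.
  - by move=> x _; rewrite adde_ge0.
  apply: aeS GU => x gx _; rewrite patchE; case: ifPn => [/set_mem Qx|_]; last by rewrite adde_ge0.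
  have Vx := QV Qx; have [Dx|nDx] := pselect (D i x).
    rewrite indicE mem_set// mule1; apply: (@le_trans _ _ ((1 + `|mu|) ^+ 2)%:E); last by rewrite leeDr.
    by rewrite lee_fin ler_sqr ?nnegrE ?addr_ge0// gx//; exact: VU.
  have /andP[k1 k2] := truncn_itv (ye0 x); pose k := Num.truncn (y x / e).
  have Zk : Z k x.
    split => //=; rewrite -/(y x) lt_neqAle; apply/andP; split.
      rewrite -ler_pdivlMr// k1 andbT; apply/eqP => E; apply: nDx; split => //=.
      by exists k; rewrite -/t -/(y x) E.
    by rewrite -[X in _ < _ + X]mul1r -mulrDl -ltr_pdivrMr// natr1.
  rewrite (bigD1 (Ordinal (yJ x Vx)))//= patchE mem_set// -addeA leeDl//.
  by rewrite adde_ge0//; apply: sume_ge0.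
have step k := @bump_step e t P k e0.
have [Df DVr] := subV mDi (DV i).
apply: (le_trans cover).
have ZQ : \sum_(k < J) mr (Z k) <= 1 * mr Q.
  have Qoo : (m Q < +oo)%E by apply: le_lt_trans Voo; apply: le_measure => //; exact: mem_set.
  apply: (sum_measure_le ler01 mZ mQ Qoo) => [k x []//|x Qx].
  apply: (@sum_indic_le1 R J (fun k => Z k x)) => k k' [_ /= /andP[h1 h2]] [_ /= /andP[h3 h4]].
  have lt a c : a%:R * e < y x -> y x < c%:R * e + e -> (a <= c)%N.
    move=> u1 u2; rewrite -ltnS -(ltr_nat R) -(ltr_pM2r e0) -natr1 mulrDl mul1r.
    exact: lt_trans u1 u2.
  by apply/eqP; rewrite eqn_leq !(lt _ _ h1 h4, lt _ _ h3 h2).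
have LyV : \sum_(k < J) mr (Ly k) <= P.+3%:R * mr V.
  apply: sum_measure_le => //; first by move=> k x [].
  move=> x Vx; apply: le_trans (count_near J P.+2 (ye0 x)); apply: ler_sum => k _.
  case: asboolP => [[_ /= /andP[h1 h2]]|_]; last by [].
  rewrite asboolT// ler_pdivlMr// h1/= ler_pdivrMr// (le_trans h2)// mulrDl lerD2l.
  by have -> : e * (1 + P.+1%:R) = P.+2%:R * e by rewrite -[P.+2%:R]natr1 addrC mulrC.
have WV : \sum_(k < J) mr (W k) <= mr V + 2 * mr (D i).
  have Wf k : measurable (W k `\` D i) by exact: measurableD.
  have Wg k : measurable (W k `&` D i) by exact: measurableI.
  have Doo : (m (D i) < +oo)%E by rewrite Df ltry.
  have S1 : \sum_(k < J) mr (W k `\` D i) <= 1 * mr V.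
    apply: (sum_measure_le ler01 Wf mV Voo) => [k x [[]]//|x Vx]; apply: (@sum_indic_le1 R J (fun k => (W k `\` D i) x)) => k k' [[_ /= /andP[h1 h2]] nD] [[_ /= /andP[h3 h4]] _].
    have lt a c : a%:R * e <= y x -> y x <= c%:R * e + e -> (a <= c)%N.
      move=> u1 u2; rewrite -ltnS -(ltr_nat R) -(ltr_pM2r e0) -natr1 mulrDl mul1r.
      rewrite lt_neqAle (le_trans u1 u2) andbT; apply/eqP => E; apply: nD; split => //=.
      by exists a; apply/eqP; rewrite -/t -/(y x) eq_le u1 andbT E.
    by apply/eqP; rewrite eqn_leq !(lt _ _ h1 h4, lt _ _ h3 h2).
  have S2 : \sum_(k < J) mr (W k `&` D i) <= 2 * mr (D i).
    apply: (sum_measure_le (ler0n R 2) Wg mDi Doo) => [k x []//|x Dx]; apply: le_trans (count_near J 1 (ye0 x)); apply: ler_sum => k _.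
    case: asboolP => [[[_ /= /andP[h1 h2]] _]|_]; last by [].
    by rewrite asboolT// ler_pdivlMr// h1/= ler_pdivrMr// mulrDl mul1r.
  rewrite mul1r in S1; apply: le_trans (lerD S1 S2); rewrite -big_split/=; apply: ler_sum => k _.
  have [E1 _] := subV (Wf k) (fun x h => h.1.1); have [E2 _] := subV (Wg k) (fun x h => h.1.1).
  have [E3 _] := subV (mW k) (fun x h => h.1).
  rewrite -lee_fin EFinD -E1 -E2 -E3 -{1}(setDUK (@subIsetl _ (W k) (D i))).
  have -> : W k `\` (W k `&` D i) = W k `\` D i by rewrite setDIr setDv set0U.
  by rewrite addeC measureU2.
pose A := 4 * (`|mu| * (e * Lphi)) + mu ^+ 2 * (q ^+ 2 + (2 * (e * Lphi) + (e * Lphi) ^+ 2)).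
have eL0 : 0 <= e * Lphi by rewrite mulr_ge0// ltW.
have A0 : 0 <= A.
  apply: addr_ge0; first by rewrite mulr_ge0// mulr_ge0.
  apply: mulr_ge0; first exact: sqr_ge0.
  apply: addr_ge0; first exact: sqr_ge0.
  by apply: addr_ge0; [rewrite mulr_ge0|exact: sqr_ge0].
apply: (@le_trans _ _ ((\sum_(k < J) (mr (Z k) + mu ^+ 2 * mr (W k) + A * mr (Ly k)) +
   (1 + `|mu|) ^+ 2 * mr (D i))%:E)).
  rewrite EFinD -sumEFin [X in (_ <= _ + X)%E]EFinM; apply: leeD; first by apply: lee_sum => k _; exact: step.
  by apply: lee_wpmul2l; rewrite ?lee_fin ?sqr_ge0// {1}Df.
rewrite -EFinD lee_fin !big_split/= -!mulr_sumr.
have Q1 : q ^+ 2 * P.+3%:R <= 3 * q.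
  rewrite expr2 -mulrA mulrC ler_wpM2r ?invr_ge0// /q mulrC ler_pdivrMr//.
  by rewrite -natrM ler_nat mulnS !addSn add0n !ltnS leq_pmull.
have T1 := layer_error (normr_ge0 mu) (ltW e0) e1 Lphi0 mV0 (ler0n R P.+3) Q1 HP Hn.
have T2 : (2 * mu ^+ 2 + (1 + `|mu|) ^+ 2) * mr (D i) <= ep / 3.
  apply: le_trans Hn2; rewrite /B2 -mulrA; apply: ler_wpM2l Di.
  by apply: addr_ge0; [apply: mulr_ge0 => //; exact: sqr_ge0|exact: sqr_ge0].
exact: (error_budget (sqr_ge0 mu) A0 ZQ WV LyV T1 T2).
Qed.

End energy_bound.

(** * The gradient of the Busemann function plus an invariant function *)

Section gradient_bound.
Context (R : realType) (X : completeMetricType R) (m : {measure set (borel X) -> \bar R}).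
Variables (N : R) (K : nat) (l : R -> X) (F : R -> X -> X) (o : X).
Hypothesis radonm : radon m.
Hypothesis cdX : CD0 N m.
Hypothesis K2 : (2 <= K)%N.
Hypothesis NK : N <= K%:R.
Hypothesis hilbX : infinitesimally_hilbertian m.
Hypothesis linel : is_line m l.
Local Notation b := (busemann l).
Hypothesis flowF : continuous_gradient_flow m b F.
Hypothesis isoF : isometric_action m F.
Hypothesis So : supp m o.
Local Notation G w := (minimal_gradient m w).

Lemma clamp_one (x : R) : 1 <= x -> clamp 0 1 x = 1.
Proof. by move=> x1; rewrite /clamp min_l// max_r. Qed.

Lemma clamp_zero (x : R) : x <= 0 -> clamp 0 1 x = 0.
Proof. by move=> x0; rewrite /clamp max_l// ge_min x0 orbT. Qed.

Lemma cutoff_support (g : X -> R) (Lg R0 : R) : 0 < R0 -> 0 <= Lg ->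
  (forall x y, `|g x - g y| <= Lg * mdist x y) ->
  bounded_support o (fun x => clamp 0 1 (2 - mdist x o / R0) * g x)
    (Lg + R0^-1 * (`|g o| + Lg * (2 * R0))) (2 * R0).
Proof.
move=> R00 Lg0 gL; set chi := fun x => clamp 0 1 (2 - mdist x o / R0).
have c01 x : 0 <= chi x <= 1 by exact: clamp01.
have cL x y : `|chi x - chi y| <= R0^-1 * mdist x y.
  apply: (le_trans (clamp_lip _ _ _ _)).
  have -> : 2 - mdist x o / R0 - (2 - mdist y o / R0) = - ((mdist x o - mdist y o) * R0^-1) by ring.
  have i0 : 0 <= R0^-1 by rewrite invr_ge0 ltW.
  rewrite normrN normrM (ger0_norm i0) mulrC ler_wpM2l//.
  exact: mdist_lip.
have cz x : 2 * R0 < mdist x o -> chi x = 0.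
  move=> h; apply: clamp_zero; rewrite subr_le0 ler_pdivlMr//; exact: ltW.
have gB x : mdist x o <= 2 * R0 -> `|g x| <= `|g o| + Lg * (2 * R0).
  move=> h; have := ler_normD (g x - g o) (g o); rewrite subrK => /le_trans; apply.
  by rewrite addrC lerD2l (le_trans (gL _ _))// ler_wpM2l.
have B0 : 0 <= `|g o| + Lg * (2 * R0) by rewrite addr_ge0// !mulr_ge0// ltW.
have near_ x y : mdist x o <= 2 * R0 ->
    `|chi x * g x - chi y * g y| <= (Lg + R0^-1 * (`|g o| + Lg * (2 * R0))) * mdist x y.
  move=> h; have -> : chi x * g x - chi y * g y = chi y * (g x - g y) + (chi x - chi y) * g x by ring.
  rewrite (le_trans (ler_normD _ _))// !normrM mulrDl; have /andP[c0 c1] := c01 y; apply: lerD.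
    by rewrite ger0_norm//; apply: le_trans (gL x y); rewrite ler_piMl.
  rewrite mulrAC; apply: ler_pM => //; exact: gB.
have C0 : 0 <= Lg + R0^-1 * (`|g o| + Lg * (2 * R0)) by rewrite addr_ge0// mulr_ge0// invr_ge0 ltW.
have lip x y : `|chi x * g x - chi y * g y| <= (Lg + R0^-1 * (`|g o| + Lg * (2 * R0))) * mdist x y.
  have [xh|hx] := leP (mdist x o) (2 * R0); first exact: near_.
  have [yh|hy] := leP (mdist y o) (2 * R0); first by rewrite distrC metric_sym; exact: near_.
  by rewrite (cz x hx) (cz y hy) !mul0r subrr normr0; apply: mulr_ge0 => //; exact: mdist_ge0.
by split => // x h; have := cz x h; rewrite /chi => ->; rewrite mul0r.
Qed.

Variables (R1 R0 mu : R) (f : X -> R).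
Hypothesis R10 : R1 < R0.
Hypothesis R00 : 0 < R0.
Hypothesis f0 : forall x, 0 <= f x.
Hypothesis fL : forall x y, `|f x - f y| <= mdist x y.
Hypothesis fF : forall t x, supp m x -> f (F t x) = f x.

Let u x := b x + mu * f x.
Let chi x := clamp 0 1 (2 - mdist x o / R0).
Let wT x := chi x * u x.

Lemma linear_lip x y : `|u x - u y| <= (1 + `|mu|) * mdist x y.
Proof.
have -> : u x - u y = (b x - b y) + mu * (f x - f y) by rewrite /u; ring.
rewrite (le_trans (ler_normD _ _))// mulrDl lerD ?(busemann_lip linel)//.
by rewrite normrM ler_wpM2l.
Qed.

Let chi1 x : mdist x o < R0 -> chi x = 1.
Proof.
move=> h; apply: clamp_one; rewrite lerBrDl -lerBrDr.
by rewrite (_ : 2 - 1 = 1 :> R) ?ler_pdivrMr ?mul1r ?ltW//; ring.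
Qed.

Let wTb := cutoff_support R00 (addr_ge0 ler01 (normr_ge0 mu)) linear_lip.
Let vb := cutoff_support R00 ler01 (busemann_lip linel).

(** [energy_bound] with cutoffs [phi] and [V] shrinking to [C]. *)
Lemma compact_bound (C : set X) : compact C -> (forall x, C x -> mdist x o <= R1) ->
  (\int[m]_(x in C) ((G wT x) ^+ 2)%:E <= ((1 + mu ^+ 2) * fine (m C))%:E)%E.
Proof.
move=> cC CR; have clC : closed C by apply: compact_closed => //; exact: metric_hausdorff.
have mC : measurable (C : set (borel X)) by exact: closed_borel.
have [C0|/set0P C0] := eqVneq C set0.
  by rewrite C0 integral_set0 measure0 mulr0.
pose dl (n : nat) : R := (R0 - R1) / 4 * n.+1%:R^-1.
have R4 : 0 < (R0 - R1) / 4 by rewrite divr_gt0// subr_gt0.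
have dl0 n : 0 < dl n by rewrite mulr_gt0// invr_gt0.
have dl4 n : 2 * dl n < R0 - R1.
  have : dl n <= (R0 - R1) / 4 by rewrite ger_pMr// invf_le1// ler1n.
  slra.
pose V n : set (borel X) := [set x | setdist C x <= 2 * dl n].
have clV n : closed (V n : set X).
  have cs : continuous (setdist C) by apply: (@lip_continuous _ _ _ 1) => x y; rewrite mul1r; exact: setdist_lip.
  rewrite (_ : (V n : set X) = setdist C @^-1` [set z | z <= 2 * dl n])//.
  by apply: (continuous_closedP _).1.
have mV n : measurable (V n) by exact: closed_borel.
have VU n : V n `<=` [set x : borel X | mdist (x : X) o < R0].
  move=> x /= Vx; have e0 : 0 < R0 - R1 - 2 * dl n by rewrite subr_gt0.
  have [y Cy xy] := setdist_lt x C0 e0; have := CR y Cy; have := metric_triangle x y o.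
  by move: Vx xy; rewrite /V/=; slra.
have CV n : C `<=` V n.
  by move=> x Cx; rewrite /V/= (le_trans (setdist_le x Cx))// mdistxx mulr_ge0// ltW.
have bound n : (\int[m]_(x in C) ((G wT x) ^+ 2)%:E <= (fine (m C) + mu ^+ 2 * fine (m (V n)))%:E)%E.
  pose phi x := clamp 0 1 (2 - setdist C x / dl n).
  have i0 : 0 <= (dl n)^-1 by rewrite invr_ge0 ltW.
  have phiL x y : `|phi x - phi y| <= (dl n)^-1 * mdist x y.
    apply: (le_trans (clamp_lip _ _ _ _)).
    have -> : 2 - setdist C x / dl n - (2 - setdist C y / dl n) = - ((setdist C x - setdist C y) * (dl n)^-1) by ring.
    by rewrite normrN normrM (ger0_norm i0) mulrC ler_wpM2l//; exact: setdist_lip.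
  have phi01 x : 0 <= phi x <= 1 by exact: clamp01.
  have phiV x : ~ V n x -> phi x = 0.
    move=> nV; apply: clamp_zero; rewrite subr_le0 ler_pdivlMr// leNgt; apply/negP => /ltW h.
    exact: nV.
  have phiQ x : C x -> nbhs x [set y | phi y = 1].
    move=> Cx; apply/nbhs_mdistE; exists (dl n) => // y xy; apply: clamp_one.
    have : setdist C y / dl n <= 1.
      by rewrite ler_pdivrMr// mul1r (le_trans (setdist_le y Cx))// metric_sym ltW.
    slra.
  have Rr : R0 <= 2 * R0 by rewrite ler_peMl ?ler1n// ltW.
  apply: (@energy_bound _ _ m N K l F o radonm cdX K2 NK hilbX linel flowF isoF So R0 (2 * R0) mu
    (fun x => chi x * b x) wT f _ _ Rr vb _ wTb _ f0 fL fF C (V n) phi (dl n)^-1 mC (CV n) (clV n) (VU n)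
    i0 phiL phi01 phiV phiQ).
  - by move=> x /chi1 ->; rewrite mul1r.
  - by move=> x /chi1 E; rewrite /wT E mul1r.
have Voo n : (m (V n) < +oo)%E.
  apply: le_lt_trans (cball_fin radonm cdX K2 NK So R0); apply: le_measure.
  - exact: mem_set.
  - by apply: mem_set; exact: measurable_cball.
  - by move=> x /VU/ltW.
have Vcap : \bigcap_n V n = C.
  apply/seteqP; split => [x Vx|x Cx n _]; last exact: CV.
  apply: contrapT => nC; have s0 := setdist_gt0 clC C0 nC.
  have [n Hn] := small_multiple ((R0 - R1) / 4) (divr_gt0 s0 (ltr0Sn R 2)).
  have := Vx n I; rewrite /V/= -/(dl n); move: Hn; rewrite -/(dl n); slra.
have cvgV : (fine \o (m \o V)) n @[n --> \oo] --> fine (m C).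
  apply: fine_cvg; rewrite fineK; last first.
    by rewrite ge0_fin_numE// (le_lt_trans _ (Voo 0%N))//; apply: le_measure; [exact: mem_set|exact: mem_set|exact: CV].
  rewrite -Vcap; apply: nonincreasing_cvg_mu => //; first by rewrite Vcap.
  apply/nonincreasing_seqP => n; apply/subsetPset => x; rewrite /V/= => /le_trans; apply.
  rewrite ler_pM2l// ler_pM2l// lef_pV2 ?posrE// ler_nat//.
apply/lee_addgt0Pr => ep ep0.
have ep' : 0 < ep / (mu ^+ 2 + 1) by rewrite divr_gt0// ltr_wpDl// sqr_ge0.
have /cvgrPdist_lt/(_ _ ep')[n _ /(_ n (leqnn n))] := cvgV.
rewrite /= distrC => /ltW hn; apply: (le_trans (bound n)); rewrite -EFinD lee_fin.
have h1 : fine (m (V n)) <= fine (m C) + ep / (mu ^+ 2 + 1).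
  by have := ler_norm (fine (m (V n)) - fine (m C)); slra.
have h2 : mu ^+ 2 * fine (m (V n)) <= mu ^+ 2 * (fine (m C) + ep / (mu ^+ 2 + 1)) by rewrite ler_wpM2l// sqr_ge0.
have h3 : mu ^+ 2 * (ep / (mu ^+ 2 + 1)) <= ep.
  by rewrite mulrCA ler_piMr ?(ltW ep0)// ler_pdivrMr ?ltr_wpDl ?sqr_ge0// mul1r lerDl.
move: h2; rewrite mulrDr mulrDl mul1r; move: (mu ^+ 2 * fine (m C)) (mu ^+ 2 * (ep / _)) h3 => q1 q2.
slra.
Qed.

(** Otherwise, by inner regularity, a compact set of positive measure would
    contradict [compact_bound]. *)
Theorem gradient_bound : {ae m, forall x : X, mdist x o <= R1 -> G wT x <= Num.sqrt (1 + mu ^+ 2)}.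
Proof.
have mu1 : 0 <= 1 + mu ^+ 2 by rewrite addr_ge0// sqr_ge0.
have [[GLf G0 _] _] := bounded_support_gradient radonm cdX K2 NK So wTb.
have mG := measurable_sup_lfun GLf.
pose A : set (borel X) := [set x | Num.sqrt (1 + mu ^+ 2) < G wT x] `&` cball o R1.
have mA : measurable A.
  apply: measurableI; last exact: measurable_cball.
  by rewrite -[X in measurable X]setTI; exact: measurable_fun_ltr.
have A0 : m A = 0%E.
  apply/eqP; rewrite eq_le measure_ge0 andbT; have [_ ->//] := radonm.
  apply: ge_ereal_sup => _ [C [cC CA] <-].
  have clC : closed C by apply: compact_closed => //; exact: metric_hausdorff.
  have mC : measurable (C : set (borel X)) by exact: closed_borel.
  have Cf : m C \is a fin_num by rewrite ge0_fin_numE// compact_finite.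
  have H := compact_bound cC (fun x Cx => (CA x Cx).2).
  have big x : C x -> 1 + mu ^+ 2 < (G wT x) ^+ 2.
    by move=> /CA[/= h _]; rewrite -(sqr_sqrtr mu1) ltr_sqr ?nnegrE ?sqrtr_ge0.
  have I1 : (\int[m]_(x in C) (1 + mu ^+ 2)%:E = ((1 + mu ^+ 2) * fine (m C))%:E)%E.
    by rewrite integral_cst// EFinM fineK.
  have ae0 : {ae m, forall x, C x -> ((G wT x) ^+ 2)%:E = (1 + mu ^+ 2)%:E}.
    apply: (@ae_eq_of_integral_le _ _ _ m C (fun=> 1 + mu ^+ 2)) => //.
    - by apply: measurable_funTS; apply/measurable_EFinP; exact: measurable_funX.
    - by move=> x Cx; rewrite lee_fin ltW// big.
    - by rewrite [leRHS]I1.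
    - by rewrite [ltLHS]I1 ltry.
  have [Nl [mNl N0 CN]] := ae0; rewrite -N0; apply: le_measure; [exact: mem_set|exact: mem_set|].
  move=> x Cx; apply: CN => /(_ Cx) [E]; have := big x Cx; by rewrite E ltxx.
exists A; split => // x /= nx; apply: contrapT => nA; apply: nx => xR.
by rewrite leNgt; apply/negP => h; apply: nA; split.
Qed.

End gradient_bound.

(** * The orbit distance *)

Section splitting.
Context (R : realType) (X : completeMetricType R) (m : {measure set (borel X) -> \bar R}).
Variables (N : R) (K : nat) (l : R -> X) (F : R -> X -> X).
Hypothesis radonm : radon m.
Hypothesis cdX : CD0 N m.
Hypothesis K2 : (2 <= K)%N.
Hypothesis NK : N <= K%:R.
Hypothesis hilbX : infinitesimally_hilbertian m.
Hypothesis linel : is_line m l.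
Local Notation b := (busemann l).
Hypothesis flowF : continuous_gradient_flow m b F.
Hypothesis isoF : isometric_action m F.
Local Notation leb := (@lebesgue_measure R).

Lemma lipschitz_speed (g : R -> X) (L v t : R) : 0 < t < 1 ->
  (forall s s', 0 <= s <= 1 -> 0 <= s' <= 1 -> mdist (g s) (g s') <= L * `|s - s'|) ->
  mslope g t v -> v <= L.
Proof.
move=> /andP[t0 t1] gL gv; apply/ler_addgt0Pr => e e0; have [d d0 Hd] := gv e e0.
pose h := Num.min d (1 - t) / 2.
have m0 : 0 < Num.min d (1 - t) by rewrite lt_min d0 subr_gt0.
have h0 : 0 < h by rewrite divr_gt0.
have [hd h1] : h < d /\ h < 1 - t.
  have : h < Num.min d (1 - t) by rewrite /h ltr_pdivrMr// ltr_pMr// ltr1n.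
  by rewrite lt_min => /andP[].
have th : t + h - t = h by rewrite addrC addKr.
have := Hd t (t + h) (lexx t); rewrite lerDl (ltW h0) th => /(_ isT hd).
have := gL t (t + h); rewrite (ltW t0) (ltW t1) => /(_ isT).
have -> : 0 <= t + h <= 1 by apply/andP; split; slra.
move=> /(_ isT); rewrite distrC th (ger0_norm (ltW h0)) => k1; rewrite ler_norml => /andP[k2 _].
by rewrite -(ler_pM2r h0) mulrDl; slra.
Qed.

Section lipschitz_combination.
Variables (mu : R) (f : X -> R).
Hypothesis f0 : forall x, 0 <= f x.
Hypothesis fL : forall x y, `|f x - f y| <= mdist x y.
Hypothesis fF : forall t x, supp m x -> f (F t x) = f x.
Let u x := b x + mu * f x.

(** Integrate [|D u| <= sqrt (1 + mu ^ 2)] along a test plan concentrated near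
    the geodesics from [a] to [w]. *)
Lemma near_geodesic_bound (a w : X) (t : R) : supp m a -> supp m w -> 0 < t -> t < 1 / 2 ->
  `|u a - u w| <= Num.sqrt (1 + mu ^+ 2) * (mdist a w + t) +
    2 * (1 + `|mu|) * (t + t * (mdist a w + t)).
Proof.
move=> Sa Sw t0 t2; pose D := mdist a w + t; pose M := Num.sqrt (1 + mu ^+ 2).
have D0 : 0 < D by rewrite ltr_wpDl// mdist_ge0.
have tT : 0 < t < 1 - t by apply/andP; split; slra.
have T1 : 1 - t < 1 by rewrite gtrDl oppr_lt0.
have [P tpP Pg] := geodesic_plan radonm cdX K2 NK Sw Sa t0 tT T1.
have R10 : D < D + 1 by rewrite ltrDl.
have R00 : 0 < D + 1 by rewrite addr_gt0.
pose wT x := clamp 0 1 (2 - mdist x w / (D + 1)) * u x.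
have wTb : bounded_support w wT _ (2 * (D + 1)) :=
  cutoff_support w R00 (addr_ge0 ler01 (normr_ge0 mu)) (linear_lip linel mu fL).
have Gb := gradient_bound radonm cdX K2 NK hilbX linel flowF isoF Sw mu R10 R00 f0 fL fF.
have [[GL G0 GP] _] := bounded_support_gradient radonm cdX K2 NK Sw wTb.
have wTE x : mdist x w <= D -> wT x = u x.
  move=> h; rewrite /wT clamp_one ?mul1r//.
  rewrite lerBrDl -lerBrDr (_ : 2 - 1 = 1 :> R); last by ring.
  by rewrite ler_pdivrMr// mul1r (le_trans h)// ltW.
have i0 : 0 <= (0 : R) <= 1 by rewrite lexx ler01.
have i1 : 0 <= (1 : R) <= 1 by rewrite ler01 lexx.
pose er := 2 * (1 + `|mu|) * (t + t * D).
have upper_ : (\int[P]_g \int[leb]_(s in `[0%R, 1%R])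
    (minimal_gradient m wT (curve_at g s) * speed (curve_at g) s)%:E <= (M * D)%:E)%E.
  apply: (@le_trans _ _ (\int[P]_g (M * D)%:E)%E).
    apply: ae_lower_integral_le_gen => //.
    - by move=> g _; apply: integral_ge0 => s _; rewrite lee_fin mulr_ge0// speed_ge0.
    - by move=> g _; rewrite lee_fin mulr_ge0 ?sqrtr_ge0// ltW.
    apply: aeS3 Pg (test_plan_ae tpP Gb) (test_plan_ac tpP) => g [gB gLip _ _] gG [ac _] _.
    have [v [iv v0 gv sv]] := abs_continuousP ac.
    apply: (@le_trans _ _ (\int[leb]_(s in `[0%R, 1%R]) (M * D)%:E)%E); last first.
      by rewrite (integral_cst_itv _ (@ler01 R)) subr0 mulr1.
    apply: ae_lower_integral_le_gen => //.
    - by move=> s _; rewrite lee_fin mulr_ge0// speed_ge0.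
    - by move=> s _; rewrite lee_fin mulr_ge0 ?sqrtr_ge0// ltW.
    apply: aeS3 gG sv (@ae_neq2 R 0 1) => s Gs svs [s0 s1] /= sI.
    have s01 : 0 <= s <= 1 by move: sI; rewrite in_itv.
    have s01' : 0 < s < 1 by move: s01; rewrite !lt_neqAle (eq_sym 0) s0 s1.
    rewrite lee_fin; apply: ler_pM => //; first exact: speed_ge0.
      by apply: Gs => //; have [_] := gB s s01.
    by rewrite (mslope_speed (svs sI)); exact: lipschitz_speed s01' gLip (svs sI).
  rewrite integral_cst//; apply: (@le_trans _ _ ((M * D)%:E * 1)%E); last by rewrite mule1.
  apply: lee_wpmul2l; last exact: probability_le1.
  by rewrite lee_fin mulr_ge0 ?sqrtr_ge0// ltW.
have lower_ : ((`|u a - u w| - er)%:E <=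
    \int[P]_g (`|wT (curve_at g 1) - wT (curve_at g 0)|)%:E)%E.
  have [h|h] := leP (`|u a - u w| - er) 0.
    by apply: (@le_trans _ _ 0%E); [rewrite lee_fin|apply: integral_ge0].
  apply: (@le_trans _ _ (\int[P]_g (`|u a - u w| - er)%:E)%E).
    rewrite integral_cst//; have P1 : P setT = 1%E by exact: probability_setT.
    by apply: le_trans (_ : ((`|u a - u w| - er)%:E * 1 <= _)%E); [rewrite mule1|rewrite -P1].
  apply: ae_lower_integral_le_gen => //; first by move=> g _; rewrite lee_fin ltW.
  apply: aeS Pg => g [gB gLip ga gw] _; rewrite lee_fin.
  have [_ d0] := gB 0 i0; have [_ d1] := gB 1 i1; rewrite !wTE//.
  have k0 := linear_lip linel mu fL (curve_at g 0) a; have k1 := linear_lip linel mu fL (curve_at g 1) w.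
  rewrite -/(u _) -/(u a) in k0; rewrite -/(u _) -/(u w) in k1.
  have ga' : mdist (curve_at g 0) a <= t + t * D by exact: ga.
  have gw' : mdist (curve_at g 1) w <= t + t * D.
    apply: (le_trans gw); rewrite (_ : 1 - (1 - t) = t); last by ring.
    by rewrite lerDr ltW.
  have c0 : 0 <= 1 + `|mu| by rewrite addr_ge0.
  have {}k0 := le_trans k0 (ler_wpM2l c0 ga'); have {}k1 := le_trans k1 (ler_wpM2l c0 gw').
  have t1 := ler_distD (u (curve_at g 0)) (u a) (u w).
  have t2' := ler_distD (u (curve_at g 1)) (u (curve_at g 0)) (u w).
  rewrite (distrC (u a) (u (curve_at g 0))) in t1; rewrite (distrC (u (curve_at g 0)) (u (curve_at g 1))) in t2'.
  rewrite /er -mulrA; move: ((1 + `|mu|) * (t + t * D)) k0 k1 => q k0 k1; slra.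
have tot := le_trans lower_ (le_trans (GP P tpP) upper_).
by move: tot; rewrite lee_fin lerBlDr.
Qed.

Lemma lipschitz_combination (a w : X) : supp m a -> supp m w ->
  `|u a - u w| <= Num.sqrt (1 + mu ^+ 2) * mdist a w.
Proof.
move=> Sa Sw; apply/ler_addgt0Pr => e e0; set M := Num.sqrt _; set d := mdist a w.
have M0 : 0 <= M by exact: sqrtr_ge0.
have d0 : 0 <= d by exact: mdist_ge0.
pose c := M + 2 * (1 + `|mu|) * (2 + d).
have c0 : 0 < c + 1 by rewrite ltr_wpDl// addr_ge0// !mulr_ge0// addr_ge0.
pose t := Num.min (1 / 4) (e / (c + 1)).
have t0 : 0 < t by rewrite lt_min !divr_gt0.
have t4 : t <= 1 / 4 by rewrite ge_min lexx.
have te : t * c <= e.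
  have : t <= e / (c + 1) by rewrite ge_min lexx orbT.
  rewrite ler_pdivlMr// mulrDr mulr1 => h; move: (t * c) h => q h; slra.
have t2 : t < 1 / 2 by slra.
apply: (le_trans (near_geodesic_bound Sa Sw t0 t2)); rewrite -/M -/d.
rewrite mulrDr -addrA lerD2l; apply: le_trans te.
have -> : t * c = M * t + 2 * (1 + `|mu|) * (t * (2 + d)) by rewrite /c; ring.
rewrite lerD2l; apply: ler_wpM2l; first by rewrite mulr_ge0// addr_ge0.
rewrite [leRHS]mulrDr [leLHS]addrC -(mulr1 t) -!mulrA !mul1r -!mulrDr ler_pM2l//; slra.
Qed.

End lipschitz_combination.

(** With [w] on the orbit of [q] almost nearest to [p], the choice [mu = f p / s]
    gives Pythagoras' inequality [s ^ 2 + f p ^ 2 <= d (p, w) ^ 2], where [s] is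
    the difference of [b]; so the nearest point has the same value of [b]. *)
Theorem level_set_distance (p q : X) t : supp m p -> supp m q -> b p = b q ->
  mdist p q <= mdist p (F t q).
Proof.
move=> Sp Sq bpq; pose O := [set F s q | s in setT]; pose f := setdist O.
have O0 : O !=set0 by exists (F 0 q); exists 0.
have f0 x : 0 <= f x by exact: setdist_ge0.
have fL x y : `|f x - f y| <= mdist x y by exact: setdist_lip.
have fF s x : supp m x -> f (F s x) = f x.
  move=> Sx; apply/eqP; rewrite eq_le; apply/andP; split; apply/ler_addgt0Pr => e e0.
    have [_ [r _ <-] h] := setdist_lt x O0 e0; apply: le_trans (ltW h).
    rewrite -(flow_iso isoF s Sx (flow_supp flowF (t := r) Sq)); apply: setdist_le.
    by exists (s + r) => //; rewrite (flowD isoF).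
  have [_ [r _ <-] h] := setdist_lt (F s x) O0 e0; apply: le_trans (ltW h).
  have Sy : supp m (F (- s + r) q) by exact: (flow_supp flowF).
  have -> : mdist (F s x) (F r q) = mdist x (F (- s + r) q).
    by rewrite -(flow_iso isoF s Sx Sy) (flowD isoF)// addrA subrr add0r.
  by apply: setdist_le; exists (- s + r).
have fO s : f (F s q) = 0.
  apply/eqP; rewrite eq_le f0 andbT -(mdistxx (F s q)); apply: setdist_le.
  by exists s.
apply: (@le_trans _ _ (f p)); last by apply: setdist_le; exists t.
apply/ler_addgt0Pr => e e0; set fp := f p.
have fp0 : 0 <= fp by exact: f0.
pose eta := Num.min (e / 2) (Num.min 1 ((e / 2) ^+ 2 / (2 * fp + 1))).
have e2 : 0 < e / 2 by rewrite divr_gt0.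
have den : 0 < 2 * fp + 1 by rewrite ltr_wpDl// mulr_ge0.
have eta0 : 0 < eta by rewrite !lt_min e2 ltr01 divr_gt0// exprn_gt0.
have eta1 : eta <= e / 2 by rewrite ge_min lexx.
have eta2 : eta <= 1 by rewrite !ge_min lexx orbT.
have eta3 : eta * (2 * fp + 1) <= (e / 2) ^+ 2.
  by rewrite -ler_pdivlMr// !ge_min lexx !orbT.
have [_ [s _ <-] hs] := setdist_lt p O0 eta0; rewrite -/f -/fp in hs.
have Sw : supp m (F s q) by exact: (flow_supp flowF).
have [dq bq] := flow_line radonm cdX K2 NK linel flowF isoF s 0 Sq.
rewrite (flow0 flowF isoF)// subr0 in dq.
set d := mdist p (F s q) in hs.
have d0 : 0 <= d by exact: mdist_ge0.
have pyth : s ^+ 2 + fp ^+ 2 <= d ^+ 2.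
  have [->|sn0] := eqVneq s 0.
    rewrite expr0n add0r ler_sqr ?nnegrE// /d /fp; apply: setdist_le; by exists s.
  pose mu := fp / s; have := lipschitz_combination mu f0 fL fF Sp Sw.
  rewrite fO bq bpq mulr0 addr0 -/fp -/d => H.
  have h1 : b q + mu * fp - (b q - s) = s + mu * fp by ring.
  have m0 : 0 <= 1 + mu ^+ 2 by rewrite addr_ge0// sqr_ge0.
  have : (s + mu * fp) ^+ 2 <= (1 + mu ^+ 2) * d ^+ 2.
    rewrite -(sqr_sqrtr m0) -exprMn -h1 -[leLHS]ger0_norm ?sqr_ge0// normrX ler_sqr ?nnegrE//.
    by rewrite mulr_ge0 ?sqrtr_ge0.
  have s2 : 0 < s ^+ 2 by rewrite exprn_even_gt0.
  have -> : s + mu * fp = (s ^+ 2 + fp ^+ 2) / s by rewrite /mu; field.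
  have -> : 1 + mu ^+ 2 = (s ^+ 2 + fp ^+ 2) / s ^+ 2 by rewrite /mu; field.
  have A0 : 0 < s ^+ 2 + fp ^+ 2 by rewrite ltr_wpDr// sqr_ge0.
  set A := s ^+ 2 + fp ^+ 2 in A0 *; move=> /(ler_wpM2r (ltW s2)).
  have -> : (A / s) ^+ 2 * s ^+ 2 = A * A by field.
  have -> : A / s ^+ 2 * d ^+ 2 * s ^+ 2 = A * d ^+ 2 by field.
  by rewrite (ler_pM2l A0).
have s_small : `|s| <= e / 2.
  rewrite -ler_sqr ?nnegrE ?(ltW e2)// -normrX ger0_norm ?sqr_ge0//.
  have h1 : d ^+ 2 <= (fp + eta) ^+ 2 by rewrite ler_sqr ?nnegrE ?addr_ge0 ?(ltW eta0)// ltW.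
  have h2 : (fp + eta) ^+ 2 = fp ^+ 2 + eta * (2 * fp + eta) by ring.
  have h3 : eta * (2 * fp + eta) <= eta * (2 * fp + 1) by rewrite ler_pM2l// lerD2l.
  move: pyth h1; rewrite h2; move: (s ^+ 2) (fp ^+ 2) (d ^+ 2) ((e / 2) ^+ 2) eta3 h3 => a1 a2 a3 a4.
  by move: (eta * _) (eta * (2 * fp + eta)) => a5 a6; slra.
have tri := metric_triangle p (F s q) q; rewrite dq -/d in tri.
by move: hs tri s_small eta1; slra.
Qed.

End splitting.

Theorem theorem5p23 (R : realType) (X : completeMetricType R)
    (m : {measure set (borel X) -> \bar R}) (N : R)
    (l : R -> X) (F : R -> X -> X)
    (sepX : separable X) (radonm : radon m)
    (N_ge1 : 1 <= N) (cdX : CD0 N m) (hilbX : infinitesimally_hilbertian m)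
    (linel : is_line m l)
    (flowF : continuous_gradient_flow m (busemann l) F)
    (isoF : isometric_action m F) :
  isometric_embedding (orbit_space m F) (orbit_dist m F)
    (zero_section m (busemann l) F).
Proof.
pose K := (Num.truncn N).+2; have K2 : (2 <= K)%N by [].
have NK : N <= K%:R.
  by apply/ltW/(lt_trans (truncnS_gt N)); rewrite ltr_nat.
have Fsupp t x : supp m x -> supp m (F t x) by exact: (flow_supp flowF).
have bF x t : supp m x -> busemann l (F t x) = busemann l x - t.
  by move=> Sx; have [] := flow_line radonm cdX K2 NK linel flowF isoF t 0 Sx.
have F0 x : supp m x -> F 0 x = x by exact: (isometric_action0 Fsupp isoF).
have FD t s x : supp m x -> F t (F s x) = F (t + s) x by exact: (flowD isoF).
have sec x : supp m x -> exists p, [/\ supp m p, orbit_class m F p = orbit_class m F x,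
    busemann l p = 0 & zero_section m (busemann l) F (orbit_class m F x) = p].
  move=> Sx; have [|Sp cp bp] := @xgetPex _ point [set p | [/\ supp m p, orbit_class m F p = orbit_class m F x &
      busemann l p = 0]].
    exists (F (busemann l x) x); split; [exact: Fsupp| |by rewrite bF// subrr].
    apply/seteqP; split=> y [Sy [t yt]]; split => //.
      exists (- busemann l x + t); rewrite -FD// -yt FD// addNr F0//.
    by exists (busemann l x + t); rewrite yt FD.
  by exists (zero_section m (busemann l) F (orbit_class m F x)).
move=> _ _ [x Sx <-] [y Sy <-].
have [p [Sp <- bp ->]] := sec x Sx; have [q [Sq <- bq ->]] := sec y Sy.
rewrite (orbit_distE Fsupp isoF Sp Sq).
have bpq : busemann l p = busemann l q by rewrite bp bq.
have H t := level_set_distance radonm cdX K2 NK hilbX linel flowF isoF t Sp Sq bpq.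
apply/eqP; rewrite eq_le; apply/andP; split.
  by apply: lb_le_inf; [exists (mdist p (F 0 q)), 0|move=> _ [t _ <-]; exact: H].
have -> : mdist p q = mdist p (F 0 q) by rewrite F0.
by apply: ge_inf; [exists 0 => _ [t _ <-]; exact: mdist_ge0|exists 0].
Qed.
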